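(* There are constants $c_0,c_1>0$ and $\varepsilon_0>0$ such that for every $0<\varepsilon<\varepsilon_0$, every $(1+\varepsilon)$-quasiconformal mapping $\phi:\mathbb C\to\mathbb C$ and every $E\subset\partial\mathbb D$, $$\dim(E)\ge1-c_0\varepsilon^2\ \Longrightarrow\ \dim(\phi(E))\ge1-c_1\varepsilon^2.$$
   Context: A homeomorphism $\phi$ of $\mathbb C$ is $K$-quasiconformal if $\phi\in W^{1,2}_{loc}$ and $\max_\alpha|\partial_\alpha\phi|\le K\min_\alpha|\partial_\alpha\phi|$ a.e. $\dim$ denotes Hausdorff dimension; $\mathbb D$ is the unit disk. *)

(* Defs.v *)
(* The complex plane C is modelled as R * R
   (R : realType), with the Euclidean metric and the product Lebesgue measure. *)
From HB Require Import structures.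
From mathcomp Require Import all_boot all_order all_algebra.
From mathcomp Require Import all_classical all_reals all_analysis.
Set Implicit Arguments. Unset Strict Implicit. Unset Printing Implicit Defensive.
Import Order.TTheory GRing.Theory Num.Theory.
Import numFieldNormedType.Exports.
Local Open Scope classical_set_scope.
Local Open Scope ring_scope.

Section Defs.
Variable R : realType.
Local Notation P := (R * R)%type.

Definition edist (p q : P) : R :=
  Num.sqrt ((p.1 - q.1) ^+ 2 + (p.2 - q.2) ^+ 2).

Definition unit_circle : set P := [set p | p.1 ^+ 2 + p.2 ^+ 2 = 1].

(* diameter (diam of the empty set is 0) *)
Definition ediam (U : set P) : \bar R :=
  ereal_sup ([set 0%E] `|` [set (edist p q)%:E | p in U & q in U]).

Definition diam_pow (s : R) (U : set P) : \bar R :=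
  if ediam U is r%:E then (r `^ s)%:E else +oo%E.

Definition hausdorff_pre (s d : R) (E : set P) : \bar R :=
  ereal_inf [set (\sum_(0 <= i <oo) diam_pow s (U i))%E |
     U in [set U : nat -> set P |
            E `<=` \bigcup_i U i /\ forall i, (ediam (U i) <= d%:E)%E]].

Definition hausdorff_measure (s : R) (E : set P) : \bar R :=
  ereal_sup [set hausdorff_pre s d E | d in [set d : R | 0 < d]].

Definition hausdorff_dim (E : set P) : \bar R :=
  ereal_inf [set s%:E | s in [set s : R | 0 < s /\ hausdorff_measure s E = 0%E]].

Definition leb2 := (@lebesgue_measure R \x @lebesgue_measure R)%E.

Inductive dir := DX | DY.

Definition slice (d : dir) (f : P -> R) (p : P) : R -> R :=
  match d with DX => fun t => f (t, p.2) | DY => fun t => f (p.1, t) end.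

Definition coord (d : dir) (p : P) : R :=
  match d with DX => p.1 | DY => p.2 end.

Definition pd (d : dir) (f : P -> R) : P -> R :=
  fun p => derive1 (slice d f p) (coord d p).

Fixpoint iter_pd (s : seq dir) (f : P -> R) : P -> R :=
  if s is d :: s' then pd d (iter_pd s' f) else f.

Definition smooth (f : P -> R) : Prop :=
  forall s : seq dir, continuous (iter_pd s f) /\
    forall (d : dir) (p : P), derivable (slice d (iter_pd s f) p) (coord d p) 1.

Definition test_function (psi : P -> R) : Prop :=
  smooth psi /\ compact (closure [set p | psi p != 0]).

Definition L2loc (f : P -> R) : Prop :=
  measurable_fun setT f /\
  forall K : set P, compact K ->
    (\int[leb2]_(x in K) ((f x) ^+ 2)%:E < +oo)%E.

Definition weak_pd (d : dir) (f g : P -> R) : Prop :=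
  forall psi, test_function psi ->
    (\int[leb2]_x ((f x * pd d psi x)%:E) = - \int[leb2]_x ((g x * psi x)%:E))%E.

Definition W12loc_with (f fx fy : P -> R) : Prop :=
  L2loc f /\ L2loc fx /\ L2loc fy /\ weak_pd DX f fx /\ weak_pd DY f fy.

Definition homeomorphism (phi : P -> P) : Prop :=
  exists psi : P -> P,
    cancel phi psi /\ cancel psi phi /\ continuous phi /\ continuous psi.

(* |d_alpha phi| (p) where phi = (u, v) with weak partials ux uy vx vy:
   d_alpha phi = cos a * d_x phi + sin a * d_y phi *)
Definition dir_deriv_norm (ux uy vx vy : P -> R) (a : R) (p : P) : R :=
  Num.sqrt ((cos a * ux p + sin a * uy p) ^+ 2 +
            (cos a * vx p + sin a * vy p) ^+ 2).

Definition quasiconformal (K : R) (phi : P -> P) : Prop :=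
  homeomorphism phi /\
  exists ux uy vx vy : P -> R,
    W12loc_with (fun p => (phi p).1) ux uy /\
    W12loc_with (fun p => (phi p).2) vx vy /\
    {ae leb2, forall p, forall a b : R,
        dir_deriv_norm ux uy vx vy a p <= K * dir_deriv_norm ux uy vx vy b p}.

End Defs.

(* Main.v *)
(* On squares where the derivative of f is L^2-close to a constant matrix, f is close to an
   affine map; injectivity forces the same orientation for all those matrices, so after a
   reflection f is sense preserving and the area of f(U) bounds the integral of the Jacobian
   over U. The length-area method with logarithmic weights then gives weak quasisymmetry, and
   hole filling the growth of the energy on concentric squares. Integrating the Cauchy-Riemann
   defect of f, which is O(k) in L^2, against 1/(z-a-h) + 1/(z-a+h) - 2/(z-a) gives
   |f(a+h) + f(a-h) - 2f(a)| <= C k |f(a+h) - f(a)|. So the image chords c of dyadic arcs split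
   almost evenly, and c^(-t) length^(2s) is a supermartingale as soon as 2s - t - 1 >= C' k^2.
   As length^s is at most the mean of l c^t and of that mass divided by l, covers of f(E) with
   small t-sum yield covers of E with small s-sum. *)
Require Import Defs.
From HB Require Import structures.
From mathcomp Require Import all_boot all_order all_algebra.
From mathcomp Require Import all_classical all_reals all_analysis.
From mathcomp Require Import measurable_realfun lebesgue_integral_fubini zify ring lra.
Set Implicit Arguments. Unset Strict Implicit. Unset Printing Implicit Defensive.
Import Order.TTheory GRing.Theory Num.Theory.
Import numFieldNormedType.Exports.
Local Open Scope classical_set_scope.
Local Open Scope ring_scope.

(** The analytic definition provides a homeomorphism with Sobolev coordinates: neither
    differentiability almost everywhere, nor a change of variables, nor a degree is at hand. Three
    substitutes carry the proof: absolute continuity on almost every line, the fact that a ray from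
    an image point leaves the image of a rectangle through the image of its boundary, and inscribed
    discs that bound areas of images from below. The loss must be of order [eps ^+ 2], while a
    single splitting of a chord deviates by order [eps]. The first order deviations of the two
    halves have a sum of known sign, by the triangle inequality, so that only squares remain. The
    kernel of the second difference decays like |h|^2 / |z|^3, hence its boundary term vanishes in
    the limit as soon as f grows with an exponent below 2. This is the place where constants matter:
    area is lost by a factor 3/2 and by using squares for discs, and the resulting exponent, about
    12 / (2 pi), still lies below 2. Elsewhere the constants are generous. *)

Lemma pair_ext (T1 T2 : Type) (z w : T1 * T2) : z.1 = w.1 -> z.2 = w.2 -> z = w.
Proof. by case: z w => ? ? [? ?] /= -> ->. Qed.

Lemma le_of_eq (R : numDomainType) (x y : R) : x = y -> x <= y.
Proof. by move->. Qed.

(** * Lebesgue measure on the plane, exchange of coordinates, Fubini for real integrals *)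

Section plane_measure.
Variable R : realType.
Local Notation P := (R * R)%type.

(* [lebesgue_measure] lives on [measurableTypeR R], whose canonical measurable
  structure differs from that of [R]; the copy [lbm] lives on [R] itself. *)
Definition lbm (A : set R) : \bar R := @lebesgue_measure R A.

Let lbm0 : lbm set0 = 0%E. Proof. exact: measure0. Qed.

Let lbm_ge0 A : (0 <= lbm A)%E. Proof. exact: measure_ge0. Qed.

Let lbm_semi_sigma_additive : semi_sigma_additive lbm.
Proof.
move=> F mF tF mUF.
by apply: (@measure_semi_sigma_additive _ _ _ (@lebesgue_measure R)); [exact: mF|exact: tF|exact: mUF].
Qed.

HB.instance Definition _ := isMeasure.Build _ R R lbm lbm0 lbm_ge0 lbm_semi_sigma_additive.

Let lbm_sigma_finite : sigma_finite setT lbm.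
Proof.
have [F FT Ff] := @sigma_finiteT _ _ _ (@lebesgue_measure R).
by exists F; [exact: FT|move=> i; exact: Ff].
Qed.

HB.instance Definition _ := @Measure_isSigmaFinite.Build _ R R lbm lbm_sigma_finite.

Local Notation mu1 := lbm.
Local Notation mu2 := (lbm \x lbm)%E.

Lemma aeS d (T : measurableType d) (mu : {measure set T -> \bar R}) (A B : T -> Prop) :
 (forall x, A x -> B x) -> {ae mu, forall x, A x} -> {ae mu, forall x, B x}.
Proof. by move=> AB [N [mN N0 sN]]; exists N; split => // x /= nB; apply: sN => /= /AB. Qed.

Lemma aeI d (T : measurableType d) (mu : {measure set T -> \bar R}) (A B : T -> Prop) :
 {ae mu, forall x, A x} -> {ae mu, forall x, B x} -> {ae mu, forall x, A x /\ B x}.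
Proof.
move=> [N [mN N0 sN]] [M [mM M0 sM]]; exists (N `|` M); split.
- exact: measurableU.
- by rewrite null_set_setU.
- move=> x /= nAB; have [Nx|nN] := pselect (N x); [by left|right].
 apply: sM => /= Bx; apply: nAB; split=> //.
 by apply: contrapT => nA; apply: nN; apply: sN.
Qed.

Lemma aeA d (T : measurableType d) (mu : {measure set T -> \bar R}) (A : T -> Prop) :
 (forall x, A x) -> {ae mu, forall x, A x}.
Proof. by move=> h; exists set0; split => //; move=> x /=; case; exact: h. Qed.

Lemma norm_le2 (z : P) (r : R) : (`|z| <= r) = (`|z.1| <= r) && (`|z.2| <= r).
Proof. by rewrite prod_normE ge_max. Qed.

Lemma norm1_le (z : P) : `|z.1| <= `|z|.
Proof. by rewrite prod_normE le_max lexx. Qed.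

Lemma norm2_le (z : P) : `|z.2| <= `|z|.
Proof. by rewrite prod_normE le_max lexx orbT. Qed.

Lemma open_measurable2 (U : set P) : open U -> measurable U.
Proof.
move=> oU.
pose V (i : rat * rat * nat) : set P :=
 `]ratr i.1.1 - i.2.+1%:R^-1, ratr i.1.1 + i.2.+1%:R^-1[ `*`
 `]ratr i.1.2 - i.2.+1%:R^-1, ratr i.1.2 + i.2.+1%:R^-1[.
have mV i : measurable (V i) by exact: measurableX.
pose W i := if `[< V i `<=` U >] then V i else set0.
suff -> : U = \bigcup_i W i.
 apply: countable_bigcupT_measurable => [|i]; first exact: countableP.
 by rewrite /W; case: ifPn.
apply/seteqP; split=> [z Uz|z [i _]]; last first.
 by rewrite /W; case: ifPn => [/asboolP|//]; exact.
have /nbhs_ballP[e /= e0 eU] := open_nbhs_nbhs (conj oU Uz).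
have [n ne] : exists n : nat, n.+1%:R^-1 < e / 2.
 have := near_infty_natSinv_lt (PosNum (divr_gt0 e0 (ltr0n _ 2))).
 by case=> n _ /(_ n (leqnn _)) /=; exists n.
set d := n.+1%:R^-1 in ne *.
have d0 : 0 < d by rewrite invr_gt0.
have h1 : z.1 - d < z.1 + d by lra.
have h2 : z.2 - d < z.2 + d by lra.
have [q1] := rat_in_itvoo h1.
rewrite in_itv /= => /andP[q1a q1b].
have [q2] := rat_in_itvoo h2.
rewrite in_itv /= => /andP[q2a q2b].
exists (q1, q2, n) => //; rewrite /W ifT; last first.
 apply/asboolP => w [] /=; rewrite !in_itv /= -/d => /andP[w1 w2] /andP[w3 w4].
 apply: eU; split; rewrite -ball_normE /=; rewrite ltr_norml; apply/andP; split; lra.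
by split; rewrite /= in_itv /= -/d; apply/andP; split; lra.
Qed.

Lemma cont_meas2 (f : P -> R) : continuous f -> measurable_fun setT f.
Proof.
move=> cf; apply: (measurability _ (RGenOpens.measurableE R)).
move=> _ [_ [a [b ->] <-]]; rewrite setTI; apply: open_measurable2.
by apply: open_comp; [move=> x _; exact: cf|exact: interval_open].
Qed.

Definition cbox (a b c d : R) : set P := `[a, b] `*` `[c, d].

Lemma mcbox a b c d : measurable (cbox a b c d).
Proof. exact: measurableX. Qed.

Lemma mu_itvcc (a b : R) : a <= b -> mu1 `[a, b] = (b - a)%:E.
Proof.
move=> ab; rewrite /lbm lebesgue_measure_itv /= lte_fin.
by case: ltP => // ba; rewrite (le_anti (introT andP (conj ab ba))) subrr.
Qed.

Lemma mu_cbox a b c d : a <= b -> c <= d ->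
 mu2 (cbox a b c d) = ((b - a) * (d - c))%:E.
Proof. by move=> ab cd; rewrite product_measure1E//= (mu_itvcc ab) (mu_itvcc cd) EFinM. Qed.

Lemma compact_cbox a b c d : compact (cbox a b c d).
Proof. by apply: compact_setX; exact: segment_compact. Qed.

Definition sqr_at (c : P) (r : R) : set P := cbox (c.1 - r) (c.1 + r) (c.2 - r) (c.2 + r).

Lemma sqr_atP (c : P) r z : sqr_at c r z <-> `|z - c| <= r.
Proof.
rewrite norm_le2 /= !ler_distl /sqr_at /cbox /= !in_itv /=.
by split=> [[-> ->]//|/andP[]].
Qed.

Lemma mu_sqr_at c r : 0 <= r -> mu2 (sqr_at c r) = (4 * r ^+ 2)%:E.
Proof. by move=> r0; rewrite mu_cbox; [congr (_%:E); ring|lra|lra]. Qed.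

Lemma msqr_at c r : measurable (sqr_at c r).
Proof. exact: mcbox. Qed.

Lemma bounded_on_compact (K : set P) (f : P -> R) : continuous f -> compact K ->
 exists M, 0 < M /\ forall z, K z -> `|f z| <= M.
Proof.
move=> cf cK.
have /compact_bounded : compact (f @` K).
 by apply: continuous_compact => //; exact: continuous_subspaceT.
case=> M [_ HM]; exists (`|M| + 1); split; first by rewrite ltr_wpDl.
move=> z Kz; apply: (HM (`|M| + 1)); last by exists z.
by rewrite ltr_pwDr// ler_norm.
Qed.

Lemma cont_int2 (D : set P) (f : P -> R) a b c d : measurable D ->
 D `<=` cbox a b c d -> a <= b -> c <= d ->
 continuous f -> mu2.-integrable D (EFin \o f).
Proof.
move=> mD DK ab cd cf.
apply: measurable_bounded_integrable => //.
- apply: le_lt_trans (_ : (mu2 (cbox a b c d) < +oo)%E).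
  by apply: le_measure; rewrite ?inE//; exact: mcbox.
 by rewrite mu_cbox// ltry.
- by apply: measurable_funTS; exact: cont_meas2.
- have [M [M0 HM]] := bounded_on_compact cf (@compact_cbox a b c d).
 exists M; split; first exact: num_real.
 move=> x Mx z Dz; apply: le_trans (ltW Mx); apply: HM; exact: DK.
Qed.

Definition swap (z : P) : P := (z.2, z.1).

Lemma measurable_swap : measurable_fun setT swap.
Proof. by apply: measurable_fun_pair; [exact: measurable_snd|exact: measurable_fst]. Qed.

Definition swap_measure (A : set P) : \bar R := mu2 (swap @^-1` A).

Let measurable_preswap (A : set P) : measurable A -> measurable (swap @^-1` A).
Proof. by move=> mA; rewrite -[X in measurable X]setTI; exact: measurable_swap. Qed.

Let swap_measure0 : swap_measure set0 = 0%E.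
Proof. by rewrite /swap_measure preimage_set0 measure0. Qed.

Let swap_measure_ge0 A : (0 <= swap_measure A)%E. Proof. exact: measure_ge0. Qed.

Let swap_measure_sa : semi_sigma_additive swap_measure.
Proof.
move=> F mF tF mUF; rewrite /swap_measure preimage_bigcup.
apply: measure_semi_sigma_additive.
- by move=> i; exact: measurable_preswap.
- apply/trivIsetP => i j _ _ ij; rewrite -preimage_setI.
 by move/trivIsetP : tF => /(_ i j I I ij) ->; rewrite preimage_set0.
- by rewrite -preimage_bigcup; exact: measurable_preswap.
Qed.

HB.instance Definition _ := isMeasure.Build _ P R swap_measure
 swap_measure0 swap_measure_ge0 swap_measure_sa.

(** Uniqueness of the product measure: the image measure under [swap] has the same values on
    measurable rectangles. Statements about vertical lines are deduced from those about horizontal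
    lines through this. *)
Lemma swap_measureE (A : set P) : measurable A -> mu2 (swap @^-1` A) = mu2 A.
Proof.
move=> mA; rewrite -/(swap_measure A); symmetry.
apply: product_measure_unique => // B C mB mC; rewrite /= /swap_measure.
rewrite (_ : swap @^-1` (B `*` C) = C `*` B); last first.
 by apply/seteqP; split=> -[x y] [].
by rewrite product_measure1E// muleC.
Qed.

Lemma integral_swap (D : set P) (f : P -> \bar R) : measurable D ->
 measurable_fun D f ->
 (forall z, D z -> 0 <= f z)%E ->
 (\int[mu2]_(z in D) f z = \int[mu2]_(z in swap @^-1` D) f (swap z))%E.
Proof.
move=> mD mf f0.
apply: (etrans _ (@ge0_integral_pushforward _ _ _ _ R _ measurable_swap mu2 D f mD mf _)).
 symmetry.
 exact: (@eq_measure_integral _ _ _ D mu2 swap_measure f (fun A mA _ => swap_measureE mA)).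
by move=> z /set_mem; exact: f0.
Qed.

Definition leb2_copy (A : set P) : \bar R := @leb2 R A.

Let leb2_copy0 : leb2_copy set0 = 0%E.
Proof. by rewrite /leb2_copy /leb2 measure0. Qed.

Let leb2_copy_ge0 A : (0 <= leb2_copy A)%E.
Proof. by rewrite /leb2_copy /leb2; exact: measure_ge0. Qed.

Let leb2_copy_sa : semi_sigma_additive leb2_copy.
Proof.
move=> F mF tF mUF; rewrite /leb2_copy /leb2.
by apply: (@measure_semi_sigma_additive _ _ _ (@lebesgue_measure R \x @lebesgue_measure R)%E); [exact: mF|exact: tF|exact: mUF].
Qed.

HB.instance Definition _ := isMeasure.Build _ P R leb2_copy
 leb2_copy0 leb2_copy_ge0 leb2_copy_sa.

(** The bridge between the measure of the definitions and the copy [lbm \x lbm]: both agree on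
    rectangles, so uniqueness of the product measure applies. *)
Lemma leb2E (A : set P) : measurable A -> @leb2 R A = mu2 A.
Proof.
move=> mA; rewrite -/(leb2_copy A); symmetry.
apply: product_measure_unique => // B C mB mC; rewrite /= /leb2_copy /leb2.
by apply: product_measure1E; [exact: mB|exact: mC].
Qed.

Lemma leb2_ge0_integral (D : set P) (f : P -> \bar R) : measurable D ->
 measurable_fun D f -> (forall z, D z -> 0 <= f z)%E ->
 (\int[@leb2 R]_(z in D) f z = \int[mu2]_(z in D) f z)%E.
Proof.
move=> mD mf f0.
pose T := (measurableTypeR R * measurableTypeR R)%type.
have mi : measurable_fun setT (id : T -> P) by move=> _ Y mY; rewrite setTI.
have := @ge0_integral_pushforward _ _ T P R id mi (@lebesgue_measure R \x @lebesgue_measure R)%E D f mD mf.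
move=> <-; last by move=> z /set_mem; exact: f0.
by apply: (eq_measure_integral mu2) => A mA _; exact: leb2E.
Qed.

Lemma leb2_integral (f : P -> \bar R) : measurable_fun setT f ->
 (\int[@leb2 R]_z f z = \int[mu2]_z f z)%E.
Proof.
move=> mf; rewrite [LHS]integralE [RHS]integralE; congr (_ - _)%E.
 by apply: leb2_ge0_integral => //; exact: measurable_funepos.
by apply: leb2_ge0_integral => //; exact: measurable_funeneg.
Qed.

Lemma lebesgue_ge0_integral (D : set R) (f : R -> \bar R) : measurable D ->
 measurable_fun D f -> (forall z, D z -> 0 <= f z)%E ->
 (\int[@lebesgue_measure R]_(z in D) f z = \int[lbm]_(z in D) f z)%E.
Proof.
move=> mD mf f0.
have mi : measurable_fun setT (id : measurableTypeR R -> R) by move=> _ Y mY; rewrite setTI.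
have := @ge0_integral_pushforward _ _ (measurableTypeR R) R R id mi (@lebesgue_measure R) D f mD mf.
move=> <-; last by move=> z /set_mem; exact: f0.
by apply: (eq_measure_integral lbm) => A mA _.
Qed.

Lemma lebesgue_integral (D : set R) (f : R -> \bar R) : measurable D ->
 measurable_fun D f ->
 (\int[@lebesgue_measure R]_(z in D) f z = \int[lbm]_(z in D) f z)%E.
Proof.
move=> mD mf; rewrite [LHS]integralE [RHS]integralE; congr (_ - _)%E.
 by apply: lebesgue_ge0_integral => //; exact: measurable_funepos.
by apply: lebesgue_ge0_integral => //; exact: measurable_funeneg.
Qed.

Section fubini.
Variables (A B : set R) (mA : measurable A) (mB : measurable B).

Variable (f : P -> R) (fi : mu2.-integrable (A `*` B) (EFin \o f)).

Let F : P -> \bar R := (EFin \o f) \_ (A `*` B).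

Let Fi : mu2.-integrable setT F.
Proof. exact/(integrable_mkcond _ (measurableX mA mB)). Qed.

Let F_in y : B y -> (fun x => F (x, y)) = (EFin \o (fun x => f (x, y))) \_ A.
Proof.
move=> By; apply/funext => x; rewrite /F !patchE; congr (if _ then _ else _).
by apply/idP/idP; rewrite !inE /=; [case|].
Qed.

Let F_out y : ~ B y -> (fun x => F (x, y)) = cst 0%E.
Proof.
move=> By; apply/funext => x; rewrite /F !patchE ifF//; apply/negbTE/negP.
by rewrite !inE => -[].
Qed.

(** Fubini is available on the whole product space, hence the extension [F] of [f] by zero; its row
    at height y is a row of [f] or identically zero, according to whether y lies in [B]. *)
Lemma ae_integrable_row :
 {ae mu1, forall y, B y -> mu1.-integrable A (EFin \o (fun x => f (x, y)))}.
Proof.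
apply: aeS (ae_integrable2 Fi) => y iy By.
by apply/integrable_mkcond => //; rewrite -F_in.
Qed.

Let inner := fun y => \int[mu1]_(x in A) f (x, y).

Let innerE : {ae mu1, forall y, setT y -> ((EFin \o inner) \_ B) y = fubini_G mu1 F y}.
Proof.
apply: aeS ae_integrable_row => y iy _.
rewrite patchE /fubini_G; case: ifPn => yB.
 rewrite F_in; last exact: set_mem.
 rewrite -integral_mkcond /= /inner /Rintegral fineK//.
 by apply: integrable_fin_num => //; apply: iy; exact: set_mem.
rewrite F_out; last by move=> By; rewrite mem_set in yB.
by rewrite integral0.
Qed.

Let Gi : mu1.-integrable setT (fubini_G mu1 F).
Proof.
have mF : measurable_fun setT F by exact: measurable_int Fi.
have mG : measurable_fun setT (fubini_G mu1 F) by exact: (measurable_fubini_G Fi).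
apply/integrableP; split=> //.
apply: le_lt_trans ((integrable21ltyP mu1 mu1 mF).1 Fi).
apply: ge0_le_integral => //; first exact: measurableT_comp.
- by apply: (@measurable_fun_fubini_tonelli_G _ _ _ _ R mu1 (fun z => `|F z|%E)) => //; exact: measurableT_comp.
- move=> y _; apply: le_abse_integral => //.
 by apply: measurableT_comp mF _; exact: measurable_pair2.
Qed.

Lemma integrable_rows : mu1.-integrable B (EFin \o inner).
Proof.
apply/integrable_mkcond => //.
have mG := Gi.
have mI : measurable_fun setT ((EFin \o inner) \_ B).
 apply/(measurable_restrictT _ _).1 => //.
 apply: (@eq_measurable_fun _ _ _ _ _ (EFin \o (fine \o fubini_G mu1 F))).
  move=> y /set_mem By /=; rewrite /fubini_G F_in// -integral_mkcond.
  by [].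
 apply/measurable_EFinP; apply: measurableT_comp; first exact: fine_measurable.
 by apply: measurable_funTS; exact: measurable_int mG.
move/integrableP : (mG) => [_ G_oo]; apply/integrableP; split => //.
rewrite (_ : (\int[_]_(x in _) `|_ x| = \int[mu1]_x `|fubini_G mu1 F x|)%E)//.
apply: ae_eq_integral => //; first exact: measurableT_comp.
 by apply: measurableT_comp => //; exact: measurable_int mG.
by apply: aeS innerE => y H _; rewrite H.
Qed.

(** On the null set of rows that are not integrable, [inner] is a default value of [fine]; almost
    everywhere it agrees with the extended-valued inner integral, which is enough. *)
Lemma Rfubini : \int[mu2]_(z in A `*` B) f z = \int[mu1]_(y in B) inner y.
Proof.
congr fine; rewrite integral_mkcond -(integral21_prod_meas1 Fi).
rewrite [RHS]integral_mkcond; apply: ae_eq_integral => //.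
- by apply: measurable_int Gi.
- by apply/(measurable_restrictT _ _).1 => //; exact: measurable_int integrable_rows.
- by apply: aeS innerE => y H _; rewrite H.
Qed.

End fubini.

End plane_measure.

Arguments swap {R} z /.

(** * Smooth functions of one variable and product test functions *)

Section smooth_functions.
Variable R : realType.
Implicit Types f g : R -> R.

(** Derivatives are carried as existential witnesses, so that closure under sums, products and
    inverses is a plain induction on n, without computing [derive1]. *)
Fixpoint Cder (n : nat) (f : R -> R) : Prop :=
 if n is m.+1 then exists2 f', (forall x : R, is_derive x (1 : R) f (f' x)) & Cder m f' else True.

Lemma der_comp f g (x a b d : R) : is_derive (g x) (1 : R) f a ->
 is_derive x (1 : R) g b -> a * b = d -> is_derive x (1 : R) (fun y => f (g y)) d.
Proof. by move=> df dg <-; exact: is_derive1_comp. Qed.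

Lemma der_inv f (x a d : R) : f x != 0 -> is_derive x (1 : R) f a ->
 - a / (f x) ^+ 2 = d -> is_derive x (1 : R) (fun y => (f y)^-1) d.
Proof.
move=> fx df <-; have := @is_deriveV R f x a 1 fx df.
by rewrite /GRing.scale /= (_ : - f x ^- 2 * a = - a / f x ^+ 2)//; ring.
Qed.

Lemma CderS n f : Cder n.+1 f -> Cder n f.
Proof. by elim: n f => // n IH f [f' df cf]; exists f' => //; exact: IH. Qed.

Lemma Cder_cst n (c : R) : Cder n (fun=> c).
Proof. by elim: n c => //= n IH c; exists (fun=> 0) => // x; exact: is_derive_cst. Qed.

Lemma CderD n f g : Cder n f -> Cder n g -> Cder n (fun x => f x + g x).
Proof.
elim: n f g => //= n IH f g [f' df cf] [g' dg cg].
by exists (fun x => f' x + g' x); [move=> x; exact: is_deriveD|exact: IH].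
Qed.

Lemma CderM n f g : Cder n f -> Cder n g -> Cder n (fun x => f x * g x).
Proof.
elim: n f g => //= n IH f g [f' df cf] [g' dg cg].
exists (fun x => f x * g' x + g x * f' x).
 by move=> x; apply: is_derive_eq.
apply: CderD; apply: IH => //; apply: CderS.
 by exists f'.
by exists g'.
Qed.

Lemma CderN n f : Cder n f -> Cder n (fun x => - f x).
Proof.
elim: n f => //= n IH f [f' df cf].
by exists (fun x => - f' x); [move=> x; exact: is_deriveN|exact: IH].
Qed.

Lemma Cder_affine n f (a b : R) : Cder n f -> Cder n (fun x => f (a * x + b)).
Proof.
elim: n f => //= n IH f [f' df cf].
exists (fun x => a * f' (a * x + b)); last by apply: CderM; [exact: Cder_cst|exact: IH].
move=> x.
have h : is_derive x (1 : R) (fun x : R => a * x + b) a.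
 by apply: is_derive_eq; rewrite ?scaler0 /GRing.scale /=; ring.
by apply: (der_comp (df _) h); ring.
Qed.

Lemma CderV n f : (forall x, f x != 0) -> Cder n f -> Cder n (fun x => (f x)^-1).
Proof.
move=> f0; elim: n f f0 => //= n IH f f0 [f' df cf].
exists (fun x => (- f' x) * ((f x)^-1 * (f x)^-1)).
 move=> x; apply: (der_inv (f0 x) (df x)).
 by rewrite -exprVn; ring.
have cf1 : Cder n f by apply: CderS; exists f'.
by apply: CderM; [exact: CderN|apply: CderM; exact: IH].
Qed.

Definition smooth1 f := forall n, Cder n f.

Lemma smooth1_der f : smooth1 f ->
 (forall x : R, is_derive x (1 : R) f (derive1 f x)) /\ smooth1 (derive1 f).
Proof.
move=> sf; have [f' df _] := sf 1%N.
have E : derive1 f = f' by apply/funext => x; rewrite derive1E; exact: derive_val.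
split; first by move=> x; rewrite E.
move=> n; have [f'' df'' cf''] := sf n.+1.
suff -> : derive1 f = f'' by [].
by apply/funext => x; rewrite derive1E; exact: derive_val.
Qed.

Lemma smooth1_cont f : smooth1 f -> continuous f.
Proof.
move=> sf x; apply/differentiable_continuous/derivable1_diffP.
exact: (ex_derive (is_derive := (smooth1_der sf).1 x)).
Qed.

(** Meant for [flat_exp] at points t <= 0, where the function is zero up to a quadratic error. *)
Lemma is_derive_of_quad f x (C : R) : (forall h, `|f (x + h) - f x| <= C * h ^+ 2) ->
 is_derive x (1 : R) f 0.
Proof.
move=> H.
have C0 : 0 <= C by have := le_trans (normr_ge0 _) (H 1); rewrite expr1n mulr1.
have K : h^-1 *: ((f \o shift x) (h *: (1 : R)) - f x) @[h --> 0^'] --> (0 : R).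
 apply/cvgrPdist_le => e e0; near=> h; rewrite sub0r normrN /= /GRing.scale /= mulr1 normrM.
 have h0 : h != 0 by near: h; exact: nbhs_dnbhs_neq.
 rewrite normfV mulrC ler_pdivrMr ?normr_gt0// (addrC h); apply: le_trans (H h) _.
 rewrite -real_normK ?num_real// expr2 mulrA ler_wpM2r//.
 apply: (@le_trans _ _ ((C + 1) * `|h|)); first by rewrite ler_wpM2r// lerDl.
 rewrite mulrC -ler_pdivlMr; last by rewrite ltr_wpDl.
 near: h; apply: dnbhs0_le; rewrite divr_gt0// ltr_wpDl//.
have D : derivable f x 1 by apply/cvg_ex; exists 0.
by apply: (DeriveDef D); exact/cvg_lim.
Unshelve. all: by end_near. Qed.

(** The flat function exp(-1/t) with a polynomial in 1/t in front, because this family is closed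
    under differentiation: with s = 1/t the derivative turns p into s^2 (p - p'). *)
Definition flat_exp (p : {poly R}) (t : R) : R :=
 if 0 < t then p.[t^-1] * expR (- t^-1) else 0.

Lemma poly_exp_bound (p : {poly R}) (k : nat) :
 exists C, forall s, 0 < s -> `|p.[s]| * s ^+ k * expR (- s) <= C.
Proof.
elim/poly_ind: p k => [|p c IH] k.
 by exists 0 => s s0; rewrite horner0 normr0 !mul0r.
have [C HC] := IH k.+1; exists (C + `|c| * k.+1`!%:R + `|c|) => s s0.
rewrite hornerMXaddC.
have h : s ^+ k * expR (- s) <= k.+1`!%:R + 1.
 rewrite expRN ler_pdivrMr ?expR_gt0//.
 case: k {IH HC} => [|k].
  rewrite expr0 (_ : 1%N`!%:R = 1)// -[leLHS]mulr1 ler_pM// ?lerDl//.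
  by apply: le_trans (expR_ge1Dx s); rewrite lerDl ltW.
 have := expR_ge1Dxn k (ltW s0) => e1.
 have e2 : s ^+ k.+1 / k.+1`!%:R <= expR s by apply: le_trans e1; rewrite lerDr.
 move: e2; rewrite ler_pdivrMr ?ltr0n ?fact_gt0// => e2.
 apply: (le_trans e2); rewrite mulrC ler_wpM2r// ?expR_ge0//.
 by rewrite (@le_trans _ _ (k.+2)`!%:R)// ?lerDl// ler_nat factS leq_pmull.
have h0 : 0 <= s ^+ k * expR (- s) by rewrite mulr_ge0// ?expR_ge0// exprn_ge0// ltW.
have := HC s s0; rewrite exprS => HCs.
have tri : `|p.[s] * s + c| <= `|p.[s]| * s + `|c|.
 by apply: le_trans (ler_normD _ _) _; rewrite normrM (gtr0_norm s0).
rewrite -mulrA; apply: (le_trans (ler_wpM2r h0 tri)).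
rewrite mulrDl -!addrA lerD//; first by move: HCs; rewrite !mulrA.
by apply: le_trans (ler_wpM2l (normr_ge0 c) h) _; rewrite mulrDr mulr1.
Qed.

Lemma flat_exp_der (p : {poly R}) (t : R) :
 is_derive t (1 : R) (flat_exp p) (flat_exp ('X^2 * (p - p^`())) t).
Proof.
have [t0|t0] := ltP 0 t.
 have t_neq0 : t != 0 by rewrite gt_eqF.
 rewrite {2}/flat_exp t0.
 apply: (near_eq_is_derive (f := fun t : R => p.[t^-1] * expR (- t^-1))).
  near=> s; rewrite /flat_exp ifT//; near: s; exact: lt_nbhsr.
 have dV : is_derive t (1 : R) (fun x : R => x^-1) (- t ^- 2).
  by apply: (der_inv t_neq0 (is_derive_id _ _)); rewrite mulN1r.
 have dp : is_derive t (1 : R) (fun t : R => p.[t^-1]) (- t ^- 2 * p^`().[t^-1]).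
  by apply: (der_comp (f := fun x => p.[x]) (is_derive_poly _ _) dV); rewrite mulrC.
 have dN : is_derive t (1 : R) (fun x : R => - x^-1) (t ^- 2).
  by apply: is_derive_eq; rewrite opprK.
 have de : is_derive t (1 : R) (fun t : R => expR (- t^-1)) (t ^- 2 * expR (- t^-1)).
  by apply: (der_comp (is_derive_expR _) dN); rewrite mulrC.
 apply: (is_derive_eq (is_deriveM dp de)); rewrite /GRing.scale /= !hornerE /= -!exprVn; ring.
have [C HC] := poly_exp_bound p 2.
have -> : flat_exp ('X^2 * (p - p^`())) t = 0 by rewrite /flat_exp ltNge t0.
have C0 : 0 <= C.
 apply: le_trans (HC 1 ltr01); rewrite !mulr_ge0// ?expR_ge0//.
apply: (@is_derive_of_quad _ _ C) => h.
rewrite {2}/flat_exp ltNge t0 /= subr0 /flat_exp; case: ifPn => th; last first.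
 by rewrite normr0 mulr_ge0// sqr_ge0.
rewrite normrM (ger0_norm (expR_ge0 _)).
have := HC (t + h)^-1; rewrite invr_gt0 => /(_ th); rewrite mulrAC exprVn.
rewrite ler_pdivrMr ?exprn_gt0// => /le_trans; apply; rewrite ler_wpM2l//.
by rewrite ler_sqr ?nnegrE//; lra.
Unshelve. all: by end_near. Qed.

Lemma flat_exp_smooth (p : {poly R}) : smooth1 (flat_exp p).
Proof.
move=> n; elim: n p => //= n IH p.
by exists (flat_exp ('X^2 * (p - p^`()))) => // x; exact: flat_exp_der.
Qed.

Definition smooth_step (t : R) : R :=
 flat_exp 1 t / (flat_exp 1 t + flat_exp 1 (1 - t)).

Lemma flat_exp1_ge0 t : 0 <= flat_exp 1 t.
Proof. by rewrite /flat_exp; case: ifPn => // _; rewrite hornerE mul1r expR_ge0. Qed.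

Lemma flat_exp1_gt0 t : 0 < t -> 0 < flat_exp 1 t.
Proof. by move=> t0; rewrite /flat_exp t0 hornerE mul1r expR_gt0. Qed.

Lemma smooth_step_den t : 0 < flat_exp 1 t + flat_exp 1 (1 - t).
Proof.
have [t0|t0] := ltP 0 t.
 by rewrite ltr_pwDl// ?flat_exp1_gt0// flat_exp1_ge0.
by rewrite ltr_wpDl// ?flat_exp1_ge0// flat_exp1_gt0//; lra.
Qed.

Lemma smooth_step_smooth : smooth1 smooth_step.
Proof.
move=> n; apply: CderM; first exact: flat_exp_smooth.
apply: CderV; first by move=> x; rewrite gt_eqF// smooth_step_den.
apply: CderD; first exact: flat_exp_smooth.
have -> : (fun x => flat_exp 1 (1 - x)) = (fun x => flat_exp 1 (-1 * x + 1)).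
 by apply/funext => x; congr flat_exp; ring.
by apply: Cder_affine; exact: flat_exp_smooth.
Qed.

Lemma smooth_step_le0 t : t <= 0 -> smooth_step t = 0.
Proof. by move=> t0; rewrite /smooth_step /flat_exp ltNge t0 /= mul0r. Qed.

Lemma smooth_step_ge1 t : 1 <= t -> smooth_step t = 1.
Proof.
move=> t1; rewrite /smooth_step [X in _ / (_ + X)](_ : _ = 0); last first.
 by rewrite /flat_exp ifF//; apply/negbTE; rewrite -leNgt; lra.
by rewrite addr0 divff// gt_eqF// flat_exp1_gt0//; lra.
Qed.

Lemma smooth_step_itv t : 0 <= smooth_step t <= 1.
Proof.
have h := smooth_step_den t.
rewrite /smooth_step divr_ge0 ?flat_exp1_ge0 ?(ltW h)//=.
by rewrite ler_pdivrMr; [rewrite mul1r lerDl flat_exp1_ge0|exact: smooth_step_den].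
Qed.

(** The product form survives every partial derivative, which reduces the smoothness required of a
    test function to one variable. *)
Lemma iter_pd_prod (s : seq dir) (al be : R -> R) : smooth1 al -> smooth1 be ->
 exists al' be', [/\ smooth1 al', smooth1 be' &
  iter_pd s (fun p : R * R => al p.1 * be p.2) = (fun p : R * R => al' p.1 * be' p.2)].
Proof.
move=> sa sb; elim: s => [|d s [a' [b' [sa' sb' E]]]]; first by exists al, be.
rewrite /= E; case: d.
 exists (derive1 a'), b'; split => //; first exact: (smooth1_der sa').2.
 apply/funext => -[x y]; rewrite /pd /= derive1E.
 have h := (smooth1_der sa').1 x.
 by apply: derive_val; apply: is_derive_eq; rewrite /GRing.scale /=; ring.
exists a', (derive1 b'); split => //; first exact: (smooth1_der sb').2.
apply/funext => -[x y]; rewrite /pd /= derive1E.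
have h := (smooth1_der sb').1 y.
by apply: derive_val; apply: is_derive_eq; rewrite /GRing.scale /=; ring.
Qed.

Lemma smooth_prod (al be : R -> R) : smooth1 al -> smooth1 be ->
 smooth (fun p : R * R => al p.1 * be p.2).
Proof.
move=> sa sb s; have [a' [b' [sa' sb' ->]]] := iter_pd_prod s sa sb.
split.
 move=> z; apply: (@continuousM _ _ (fun p : R * R => a' p.1) (fun p => b' p.2)).
  apply: continuous_comp; first exact: cvg_fst.
  exact: smooth1_cont.
 apply: continuous_comp; first exact: cvg_snd.
 exact: smooth1_cont.
case=> -[x y] /=.
 have h := (smooth1_der sa').1 x.
 by apply: ex_derive.
have h := (smooth1_der sb').1 y.
by apply: ex_derive.
Qed.

Lemma test_function_prod (al be : R -> R) (a b c d : R) : smooth1 al -> smooth1 be ->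
 (forall x, ~~ (a <= x <= b) -> al x = 0) -> (forall y, ~~ (c <= y <= d) -> be y = 0) ->
 test_function (fun p : R * R => al p.1 * be p.2).
Proof.
move=> sa sb Ha Hb; split; first exact: smooth_prod.
have cl : closed (cbox a b c d).
 by apply: compact_closed; [exact: norm_hausdorff|exact: compact_cbox].
apply: (subclosed_compact _ (@compact_cbox _ a b c d)); first exact: closed_closure.
rewrite ((closure_id (cbox a b c d)).1 cl); apply: closure_subset => -[x y] /= h.
split; rewrite /= in_itv /=; apply: contraNT h => hx; first by rewrite Ha ?mul0r.
by rewrite Hb ?mulr0.
Qed.

End smooth_functions.

(** * Weak derivatives tested against mollified rectangles *)

Section rectangle_identity.
Variable R : realType.
Local Notation P := (R * R)%type.
Local Notation mu1 := (@lbm R).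
Local Notation mu2 := (@lbm R \x @lbm R)%E.

Lemma Rdominated_cvg d (T : measurableType d) (mu : {measure set T -> \bar R})
 (D : set T) (f_ : nat -> T -> R) (f g : T -> R) : measurable D ->
 (forall n, measurable_fun D (f_ n)) -> measurable_fun D f ->
 (forall x, D x -> f_ n x @[n --> \oo] --> f x) ->
 mu.-integrable D (EFin \o g) -> (forall n x, D x -> `|f_ n x| <= g x) ->
 (\int[mu]_(x in D) f_ n x)%R @[n --> \oo] --> (\int[mu]_(x in D) f x)%R.
Proof.
move=> mD mf_ mf cf ig fg.
have [] := @dominated_convergence _ _ _ mu D mD (fun n => EFin \o f_ n) (EFin \o f) (EFin \o g).
- by move=> n; exact/measurable_EFinP.
- exact/measurable_EFinP.
- by apply: aeA => x Dx; apply: cvg_EFin; [exact: nearW|exact: cf].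
- exact: ig.
- by apply: aeA => x n Dx; rewrite /= lee_fin fg.
- move=> fi _ H; apply: fine_cvg; rewrite fineK//; exact: integrable_fin_num fi.
Qed.

Lemma lbm_set1 (a : R) : lbm [set a] = 0%E.
Proof. exact: lebesgue_measure_set1. Qed.

Lemma L2loc_sq_lty (g : P -> R) a b c d : L2loc g ->
 (\int[mu2]_(z in cbox a b c d) ((g z) ^+ 2)%:E < +oo)%E.
Proof.
move=> [mg gK]; rewrite -leb2_ge0_integral; first exact/gK/compact_cbox.
- exact: mcbox.
- apply/measurable_EFinP; apply: measurable_funTS; exact: measurable_funX.
- by move=> z _; rewrite lee_fin sqr_ge0.
Qed.

Lemma L2loc_sq_integrable (g : P -> R) a b c d : L2loc g ->
 mu2.-integrable (cbox a b c d) (EFin \o (fun z => g z ^+ 2)).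
Proof.
move=> Lg; apply/integrableP; split.
 by apply/measurable_EFinP; apply: measurable_funTS; apply: measurable_funX; exact: Lg.1.
under eq_integral => z _ do rewrite /= ger0_norm ?sqr_ge0//.
exact: L2loc_sq_lty.
Qed.

Lemma L2loc_integrable (g : P -> R) a b c d : a <= b -> c <= d -> L2loc g ->
 mu2.-integrable (cbox a b c d) (EFin \o g).
Proof.
move=> ab cd Lg; have mg := Lg.1.
apply: (le_integrable _ (g := EFin \o (fun z => 1 + g z ^+ 2))).
- exact: mcbox.
- by apply/measurable_EFinP; exact: measurable_funTS.
- move=> z _ /=; rewrite lee_fin (ger0_norm (_ : 0 <= 1 + g z ^+ 2)); last first.
  by rewrite addr_ge0// sqr_ge0.
 have := sqr_ge0 (`|g z| - 1); rewrite -(real_normK (num_real (g z))); nra.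
- apply: (@integrableD _ _ _ _ _ _ (EFin \o cst 1) (EFin \o (fun z => g z ^+ 2))).
 + exact: mcbox.
 + apply: (@cont_int2 _ _ (cst 1) a b c d) => //; first exact: mcbox.
  by move=> x; exact: cvg_cst.
 + exact: L2loc_sq_integrable.
Qed.

Lemma integral_swapT (f : P -> \bar R) : measurable_fun setT f ->
 (\int[mu2]_z f z = \int[mu2]_z f (swap z))%E.
Proof.
move=> mf; rewrite [LHS]integralE [RHS]integralE; congr (_ - _)%E.
 rewrite integral_swap//; last exact: measurable_funepos.
 by rewrite preimage_setT; apply: eq_integral => z _; rewrite !funeposE.
rewrite integral_swap//; last exact: measurable_funeneg.
by rewrite preimage_setT; apply: eq_integral => z _; rewrite !funenegE.
Qed.

Definition itv_supp (f : R -> R) (a b : R) := forall x, ~~ (a <= x <= b) -> f x = 0.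

(** Only product test functions are retained from [weak_pd]: they approximate indicators of
    rectangles. The derivative in y is expressed by the same definition after composition with
    [swap]. *)
Definition weak_x (f g : P -> R) := forall (al be : R -> R) (a b c d : R),
 smooth1 al -> smooth1 be -> itv_supp al a b -> itv_supp be c d ->
 (\int[mu2]_z (f z * (derive1 al z.1 * be z.2))%:E =
  - \int[mu2]_z (g z * (al z.1 * be z.2))%:E)%E.

Lemma msmooth_fst (al : R -> R) : smooth1 al -> measurable_fun setT (fun z : P => al z.1).
Proof.
move=> sa; apply: (measurableT_comp (f := al)); last exact: measurable_fst.
by apply: continuous_measurable_fun; exact: smooth1_cont.
Qed.

Lemma msmooth_snd (al : R -> R) : smooth1 al -> measurable_fun setT (fun z : P => al z.2).
Proof.
move=> sa; apply: (measurableT_comp (f := al)); last exact: measurable_snd.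
by apply: continuous_measurable_fun; exact: smooth1_cont.
Qed.

Lemma weak_pd_x (f g : P -> R) : continuous f -> measurable_fun setT g ->
 weak_pd DX f g -> weak_x f g.
Proof.
move=> cf mg W al be a b c d sa sb Ha Hb.
have [da sda] := smooth1_der sa.
have := W _ (test_function_prod sa sb Ha Hb).
have -> : pd DX (fun p : P => al p.1 * be p.2) = (fun p => derive1 al p.1 * be p.2).
 apply/funext => -[x y]; rewrite /pd /= derive1E.
 have h := da x; apply: derive_val; apply: is_derive_eq; rewrite /GRing.scale /=; ring.
rewrite !leb2_integral//.
- apply/measurable_EFinP; apply: measurable_funM => //; apply: measurable_funM.
  exact: msmooth_fst.
 exact: msmooth_snd.
- apply/measurable_EFinP; apply: measurable_funM; first exact: cont_meas2.
 apply: measurable_funM; first exact: msmooth_fst.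
 exact: msmooth_snd.
Qed.

Lemma weak_pd_y (f g : P -> R) : continuous f -> measurable_fun setT g ->
 weak_pd DY f g -> weak_x (f \o swap) (g \o swap).
Proof.
move=> cf mg W al be a b c d sa sb Ha Hb.
have [da sda] := smooth1_der sa.
have := W _ (test_function_prod sb sa Hb Ha).
have -> : pd DY (fun p : P => be p.1 * al p.2) = (fun p => be p.1 * derive1 al p.2).
 apply/funext => -[x y]; rewrite /pd /= derive1E.
 have h := da y; apply: derive_val; apply: is_derive_eq; rewrite /GRing.scale /=; ring.
have m1 : measurable_fun setT (fun z : P => ((g z) * (be z.1 * al z.2))%:E).
 apply/measurable_EFinP; apply: measurable_funM => //; apply: measurable_funM.
  exact: msmooth_fst.
 exact: msmooth_snd.
have m2 : measurable_fun setT (fun z : P => ((f z) * (be z.1 * derive1 al z.2))%:E).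
 apply/measurable_EFinP; apply: measurable_funM; first exact: cont_meas2.
 apply: measurable_funM; first exact: msmooth_fst.
 exact: msmooth_snd.
rewrite !leb2_integral// (integral_swapT m1) (integral_swapT m2) /= => H.
under eq_integral do rewrite (mulrC _ (be _)).
by rewrite H; congr (- _)%E; apply: eq_integral => z _; rewrite (mulrC (al _)).
Qed.

Local Notation step := (@smooth_step R).
Local Notation bump := (derive1 (@smooth_step R)).

Let dstep := (smooth1_der (@smooth_step_smooth R)).1.
Let sbump : smooth1 bump := (smooth1_der (@smooth_step_smooth R)).2.

Lemma bump_out t : ~~ (0 <= t <= 1) -> bump t = 0.
Proof.
rewrite negb_and -!ltNge => /orP[t0|t1]; rewrite derive1E; apply: derive_val.
 apply: (near_eq_is_derive (f := cst (0 : R))).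
 by near=> s; rewrite smooth_step_le0// ltW//; near: s; exact: lt_nbhsl.
apply: (near_eq_is_derive (f := cst (1 : R))).
by near=> s; rewrite smooth_step_ge1// ltW//; near: s; exact: lt_nbhsr.
Unshelve. all: by end_near. Qed.

Lemma bump_bound : exists B, 0 < B /\ forall t, `|bump t| <= B.
Proof.
have /compact_bounded [M [_ HM]] : compact (bump @` `[0, 1]).
 apply: continuous_compact; last exact: segment_compact.
 by apply: continuous_subspaceT; exact: smooth1_cont.
exists (`|M| + 1); split; first by rewrite ltr_wpDl.
move=> t; have [t01|/bump_out ->] := boolP (0 <= t <= 1).
 by apply: (HM (`|M| + 1)); [rewrite ltr_pwDr// ler_norm|exists t => //=; rewrite in_itv].
by rewrite normr0 addr_ge0.
Qed.

Let r (n : nat) : R := n.+1%:R.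
Let r0 n : 0 < r n. Proof. by rewrite ltr0n. Qed.
Let rV0 n : 0 < (r n)^-1. Proof. by rewrite invr_gt0. Qed.

(** The derivative of the rescaled [smooth_step]: an approximate identity carried by
    [a, a + 1/(n+1)], on the right of a only. *)
Definition mollifier (n : nat) (a x : R) : R := r n * bump (r n * (x - a)).

Lemma mollifier_cont n a : continuous (mollifier n a).
Proof.
move=> x; apply: cvgM; first exact: cvg_cst.
apply: (@continuous_comp _ _ _ (fun x => r n * (x - a)) bump).
 by apply: cvgM; [exact: cvg_cst|apply: cvgB; [exact: cvg_id|exact: cvg_cst]].
exact: smooth1_cont.
Qed.

Lemma mollifier_out n a x : ~~ (a <= x <= a + (r n)^-1) -> mollifier n a x = 0.
Proof.
move=> h; rewrite /mollifier bump_out ?mulr0//; apply: contra h => /andP[h1 h2].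
rewrite pmulr_rge0 ?r0// in h1; rewrite -ler_pdivlMl ?r0// mulr1 in h2.
by rewrite -lerBlDl h2 -subr_ge0 h1.
Qed.

Lemma Rint_lebesgue (f : R -> R) (D : set R) : measurable D -> measurable_fun D f ->
 (\int[lebesgue_measure]_(x in D) f x)%R = (\int[mu1]_(x in D) f x)%R.
Proof. by move=> mD mf; rewrite /Rintegral lebesgue_integral//; exact/measurable_EFinP. Qed.

Lemma Rint_FTC2 (f F : R -> R) a b : a < b -> continuous f ->
 (forall x : R, is_derive x (1 : R) F (f x)) ->
 \int[mu1]_(x in `[a, b]) f x = F b - F a.
Proof.
move=> ab cf dF; rewrite -Rint_lebesgue//; last first.
 by apply: measurable_funTS; exact: continuous_measurable_fun.
rewrite /Rintegral (@continuous_FTC2 _ f F)//.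
- exact: continuous_subspaceT.
- have cF : continuous F.
  by move=> x; apply/differentiable_continuous/derivable1_diffP; exact: ex_derive.
 split; [by move=> x _; exact: ex_derive|apply: cvg_at_right_filter; exact: cF|apply: cvg_at_left_filter; exact: cF].
- by move=> x _; rewrite derive1E derive_val.
Qed.

Lemma cont_int1 (f : R -> R) a b : continuous f ->
 mu1.-integrable `[a, b] (EFin \o f).
Proof.
move=> cf.
have /compact_bounded [M [_ HM]] : compact (f @` `[a, b]).
 apply: continuous_compact; last exact: segment_compact.
 exact: continuous_subspaceT.
apply: measurable_bounded_integrable => //.
- by rewrite /= /lbm lebesgue_measure_itv /=; case: ifP => // _; rewrite -EFinB ltry.
- by apply: measurable_funTS; exact: continuous_measurable_fun.
- exists M; split; first exact: num_real.
 by move=> x Mx z Dz; apply: HM => //; exists z.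
Qed.

Lemma mollifier_int n a : \int[mu1]_(x in `[a, a + (r n)^-1]) mollifier n a x = 1.
Proof.
have dF (x : R) : is_derive x (1 : R) (fun x => step (r n * (x - a))) (mollifier n a x).
 apply: (der_comp (dstep _) (b := r n)); last by rewrite mulrC.
 by apply: is_derive_eq; rewrite /GRing.scale /=; ring.
rewrite (Rint_FTC2 _ (@mollifier_cont n a) dF) ?ltrDl//.
by rewrite addrAC subrr add0r mulfV ?gt_eqF ?r0// smooth_step_ge1// mulr0 smooth_step_le0// subr0.
Qed.

Lemma mu1_itvcc (a b : R) : a <= b -> fine (mu1 `[a, b]) = b - a.
Proof. by move=> ab; rewrite mu_itvcc. Qed.

Lemma le_Rint_cst (f : R -> R) a b M : a <= b -> continuous f ->
 (forall x, a <= x <= b -> `|f x| <= M) -> `|\int[mu1]_(x in `[a, b]) f x| <= M * (b - a).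
Proof.
move=> ab cf fM; have h : `|\int[mu1]_(x in `[a, b]) f x| <= \int[mu1]_(x in `[a, b]) `|f x|.
 by apply: le_normr_Rintegral => //; exact: cont_int1.
apply: (le_trans h).
rewrite -(mu1_itvcc ab) -Rintegral_cst//; apply: le_Rintegral => //.
- apply: (@cont_int1 (fun x => `|f x|)) => x.
 by apply: cvg_norm; exact: cf.
- by apply: (@cont_int1 (cst M)) => x; exact: cvg_cst.
Qed.

Definition mollify (n : nat) (F : R -> R) (a : R) : R :=
 \int[mu1]_(x in `[a, a + (r n)^-1]) (F x * mollifier n a x).

Lemma mollify_dist (B : R) : (forall t, `|bump t| <= B) ->
 forall n (F : R -> R) a e, continuous F ->
 (forall x, a <= x <= a + (r n)^-1 -> `|F x - F a| <= e) ->
 `|mollify n F a - F a| <= B * e.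
Proof.
move=> HB n F a e cF Fe.
have cm := @mollifier_cont n a.
have i1 : mu1.-integrable `[a, a + (r n)^-1] (EFin \o (fun x => F x * mollifier n a x)).
 by apply: cont_int1 => x; apply: cvgM; [exact: cF|exact: cm].
have i2 : mu1.-integrable `[a, a + (r n)^-1] (EFin \o mollifier n a).
 exact: cont_int1.
have -> : F a = \int[mu1]_(x in `[a, a + (r n)^-1]) (F a * mollifier n a x).
 by rewrite RintegralZl// mollifier_int mulr1.
rewrite /mollify -RintegralB//; last first.
 by apply: cont_int1 => x; apply: cvgM; [exact: cvg_cst|exact: cm].
have le_a : a <= a + (r n)^-1 by rewrite lerDl ltW.
have -> : B * e = e * (B * r n) * (a + (r n)^-1 - a).
 by rewrite addrAC subrr add0r -!mulrA mulfV ?gt_eqF// mulr1 mulrC.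
apply: le_Rint_cst => //.
 by move=> x; apply: cvgB; apply: cvgM; [exact: cF|exact: cm|exact: cvg_cst|exact: cm].
move=> x ax; rewrite -mulrBl normrM; apply: ler_pM => //; first exact: Fe.
by rewrite /mollifier normrM (gtr0_norm (r0 n)) mulrC ler_wpM2r// ltW.
Qed.

Lemma Rint_supp d (T : measurableType d) (mu : {measure set T -> \bar R})
 (A D : set T) (f g : T -> R) : A `<=` D -> {in A, f =1 g} ->
 (forall x, D x -> ~ A x -> f x = 0) ->
 (\int[mu]_(x in D) f x)%R = (\int[mu]_(x in A) g x)%R.
Proof.
move=> AD fg f0; rewrite [LHS]Rintegral_mkcond [RHS]Rintegral_mkcond.
congr Rintegral; apply/funext => x; rewrite !patchE.
have [xA|xA] := boolP (x \in A).
 by rewrite ifT; [exact: fg|rewrite inE; apply: AD; exact: set_mem].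
by case: ifPn => // xD; apply: f0; [exact: set_mem|move: xA; rewrite notin_setE].
Qed.

Lemma Rint_negl d (T : measurableType d) (mu : {measure set T -> \bar R})
 (D N : set T) (f : T -> R) : measurable D -> measurable N -> mu N = 0%E ->
 mu.-integrable D (EFin \o f) ->
 (\int[mu]_(x in D) f x)%R = (\int[mu]_(x in D `\` N) f x)%R.
Proof. by move=> mD mN N0 fi; rewrite /Rintegral (negligible_integral mN). Qed.

(** Half-open on the left because it is the exact pointwise limit of [plateau], endpoints included:
    at a the first step is still 0, at b the second one is. *)
Definition itv_ind (a b x : R) : R := if a < x <= b then 1 else 0.

Lemma Rint_itv_ind (f : R -> R) (a b e : R) : b <= e ->
 mu1.-integrable `[a, b] (EFin \o f) ->
 \int[mu1]_(x in `[a, e]) (f x * itv_ind a b x) = \int[mu1]_(x in `[a, b]) f x.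
Proof.
move=> be fi; rewrite (Rint_negl (N := [set a]) _ _ _ fi)//; last exact: lbm_set1.
apply: Rint_supp => [x [/=]|x|x _ /=].
- by rewrite !in_itv /= => /andP[-> xb] _; exact: le_trans xb be.
- rewrite inE /= in_itv /= => -[/andP[ax xb] /eqP xa].
 by rewrite /itv_ind xb andbT ifT ?mulr1// lt_neqAle eq_sym xa.
- move=> h; rewrite /itv_ind ifF ?mulr0//; apply/negP => /andP[ax xb]; apply: h.
 by rewrite in_itv /= (ltW ax) xb; split => //; apply/eqP; rewrite gt_eqF.
Qed.

Lemma mu2_vline (a : R) : mu2 ([set a] `*` setT) = 0%E.
Proof. by rewrite product_measure1E//= lbm_set1 mul0e. Qed.

Lemma mu2_hline (a : R) : mu2 (setT `*` [set a]) = 0%E.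
Proof. by rewrite product_measure1E//= lbm_set1 mule0. Qed.

Lemma Rint_box_ind (g : P -> R) (a b c d e h : R) : b <= e -> d <= h ->
 mu2.-integrable (cbox a b c d) (EFin \o g) ->
 \int[mu2]_(z in cbox a e c h) (g z * (itv_ind a b z.1 * itv_ind c d z.2)) =
 \int[mu2]_(z in cbox a b c d) g z.
Proof.
move=> be dh gi; rewrite (Rint_negl (N := ([set a] `*` setT) `|` (setT `*` [set c])) _ _ _ gi)//; last 3 first.
- exact: mcbox.
- by apply: measurableU; apply: measurableX.
- rewrite null_set_setU//=; [by apply: measurableX|by apply: measurableX|exact: mu2_vline|exact: mu2_hline].
apply: Rint_supp => [[x y] [[/=]]|[x y]|[x y] _ /=].
- rewrite !in_itv /= => /andP[ax xb] /andP[cy yd] _; split; rewrite /= in_itv /= ?ax ?cy /=.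
  exact: le_trans xb be.
 exact: le_trans yd dh.
- rewrite inE /= => -[[]] /=; rewrite !in_itv /= => /andP[ax xb] /andP[cy yd] /not_orP[h1 h2].
 rewrite /itv_ind /= xb yd !andbT !ifT ?mulr1//; rewrite lt_neqAle ?ax ?cy andbT eq_sym; apply/eqP => E.
  by apply: h2; split.
 by apply: h1; split.
- move=> H; rewrite /itv_ind /=; case: ifPn => [/andP[ax xb]|_]; last by rewrite mul0r mulr0.
 case: ifPn => [/andP[cy yd]|_]; last by rewrite !mulr0.
 exfalso; apply: H; split; first by split; rewrite /= in_itv /= ?xb ?yd ltW.
 by case=> -[/= E1 E2]; [rewrite E1 ltxx in ax|rewrite E2 ltxx in cy].
Qed.

Definition plateau (n : nat) (a b x : R) : R := step (r n * (x - a)) - step (r n * (x - b)).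

Let step_shift n a : smooth1 (fun x => step (r n * (x - a))).
Proof.
have -> : (fun x => step (r n * (x - a))) = (fun x => step (r n * x + - (r n * a))).
 by apply/funext => x; congr smooth_step; ring.
by move=> m; apply: Cder_affine; exact: smooth_step_smooth.
Qed.

Lemma plateau_smooth n a b : smooth1 (plateau n a b).
Proof. by move=> m; apply: CderD; [exact: step_shift|apply: CderN; exact: step_shift]. Qed.

Lemma plateau_der n a b x : derive1 (plateau n a b) x = mollifier n a x - mollifier n b x.
Proof.
have dF (e : R) : is_derive x (1 : R) (fun x => step (r n * (x - e))) (mollifier n e x).
 apply: (der_comp (dstep _) (b := r n)); last by rewrite mulrC.
 by apply: is_derive_eq; rewrite /GRing.scale /=; ring.
by rewrite derive1E; apply: derive_val; apply: is_deriveB.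
Qed.

Lemma plateau_supp n a b : a <= b -> itv_supp (plateau n a b) a (b + 1).
Proof.
move=> ab x; rewrite negb_and -!ltNge => /orP[xa|bx].
 rewrite /plateau !smooth_step_le0 ?subr0// pmulr_rle0// subr_le0; first lra.
 lra.
have rn1 : 1 <= r n by rewrite /r ler1n.
by rewrite /plateau !smooth_step_ge1 ?subrr//; nra.
Qed.

Lemma plateau_le n a b x : `|plateau n a b x| <= 1.
Proof.
have /andP[h1 h2] := smooth_step_itv (r n * (x - a)).
have /andP[h3 h4] := smooth_step_itv (r n * (x - b)).
by rewrite /plateau ler_norml; apply/andP; split; lra.
Qed.

Let step_cvg (t : R) : 0 < t -> \forall n \near \oo, step (r n * t) = 1.
Proof.
move=> t0; near=> n; apply: smooth_step_ge1; rewrite -ler_pdivrMr// div1r.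
apply: le_trans (_ : n%:R <= _); last by rewrite ler_nat.
near: n; exact: nbhs_infty_ger.
Unshelve. all: by end_near. Qed.

Lemma plateau_cvg a b x : a <= b -> plateau n a b x @[n --> \oo] --> itv_ind a b x.
Proof.
move=> ab; apply: cvg_near_cst; rewrite /itv_ind.
have [xa|ax] := leP x a.
 near=> n; rewrite /plateau !smooth_step_le0 ?subr0//= pmulr_rle0// subr_le0//.
 exact: le_trans ab.
have [xb|bx] := leP x b.
 have h : 0 < x - a by lra.
 near=> n; rewrite /plateau [X in _ - X]smooth_step_le0 ?pmulr_rle0 ?subr_le0// subr0.
 near: n; exact: step_cvg.
have h1 : 0 < x - a by lra.
have h2 : 0 < x - b by lra.
near=> n; rewrite /plateau /= (_ : step (r n * (x - a)) = 1); last by near: n; exact: step_cvg.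
rewrite (_ : step (r n * (x - b)) = 1) ?subrr//; near: n; exact: step_cvg.
Unshelve. all: by end_near. Qed.

Lemma mollify_wide n (F : R -> R) (a a' b' : R) : a' <= a -> a + 1 <= b' ->
 \int[mu1]_(x in `[a', b']) (F x * mollifier n a x) = mollify n F a.
Proof.
move=> aa' ab'; apply: Rint_supp => [x /=|x _ //|x _ /=].
 rewrite !in_itv /= => /andP[h1 h2]; apply/andP; split; first exact: le_trans aa' h1.
 apply: (le_trans h2); apply: le_trans ab'; rewrite lerD2l invf_le1 ?ltr0n//.
 by rewrite /r ler1n.
rewrite in_itv /= => /negP h; by rewrite mollifier_out ?mulr0.
Qed.

Lemma mollify_cvg (F : R -> R) a : continuous F -> mollify n F a @[n --> \oo] --> F a.
Proof.
move=> cF; have [B [B0 HB]] := bump_bound.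
apply/cvgrPdist_le => e e0.
have eB : 0 < e / B by rewrite divr_gt0.
have /cvgrPdist_le /(_ _ eB) [del /= del0 Hdel] := cF a.
near=> n; rewrite distrC (_ : e = B * (e / B)); last by rewrite mulrC divfK// gt_eqF.
apply: mollify_dist => // x /andP[ax xa]; rewrite distrC; apply: Hdel => /=.
rewrite ltr_distlC; apply/andP; split; first lra.
apply: (le_lt_trans xa); rewrite ltrD2l -[ltRHS]invrK ltf_pV2 ?posrE ?invr_gt0//.
apply: lt_le_trans (_ : n%:R <= _); last by rewrite ler_nat.
near: n; exact: nbhs_infty_gtr.
Unshelve. all: by end_near. Qed.

End rectangle_identity.

(** * The rectangle identity for weak derivatives *)

Section weak_rectangle.
Variable R : realType.
Local Notation P := (R * R)%type.
Local Notation mu1 := (@lbm R).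
Local Notation mu2 := (@lbm R \x @lbm R)%E.

Lemma continuous_row (f : P -> R) y : continuous f -> continuous (fun x => f (x, y)).
Proof.
move=> cf x; apply: (@continuous_comp _ _ _ (fun x : R => (x, y)) f); last exact: cf.
apply/cvg_ballP => e e0; near=> t; split => /=; last exact: ballxx.
by near: t; apply/nbhs_ballP; exists e.
Unshelve. all: by end_near. Qed.

Lemma continuous_col (f : P -> R) x : continuous f -> continuous (fun y => f (x, y)).
Proof.
move=> cf y; apply: (@continuous_comp _ _ _ (fun y : R => (x, y)) f); last exact: cf.
apply/cvg_ballP => e e0; near=> t; split => /=; first exact: ballxx.
by near: t; apply/nbhs_ballP; exists e.
Unshelve. all: by end_near. Qed.

Definition locint (g : P -> R) := measurable_fun setT g /\
 forall a b c d, a <= b -> c <= d -> mu2.-integrable (cbox a b c d) (EFin \o g).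

(** Test with a product of two plateaus. The derivative of a plateau is a difference of mollifiers
    at a and b, so one side tends to an integral over the vertical sides and the other to the
    integral over the box, both by dominated convergence. *)
Lemma weak_rect (f g : P -> R) a b c d : continuous f -> locint g ->
 weak_x f g -> a <= b -> c <= d ->
 \int[mu1]_(y in `[c, d]) (f (b, y) - f (a, y)) = \int[mu2]_(z in cbox a b c d) g z.
Proof.
move=> cf [mg gi] W ab cd.
have be : b <= b + 1 by rewrite lerDl.
have de : d <= d + 1 by rewrite lerDl.
have ae : a <= b + 1 by lra.
have ce : c <= d + 1 by lra.
(* A plateau spills over its right end by at most 1/(n+1), so all the test functions live in the box
   enlarged by 1. *)
set B' := cbox a (b + 1) c (d + 1).
have mB' : measurable B' by exact: mcbox.
have cfy y := @continuous_row f y cf.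
have cfx x := @continuous_col f x cf.
pose al n := plateau n a b; pose be_ n := plateau n c d.
have sal n : smooth1 (al n) by exact: plateau_smooth.
have sbe n : smooth1 (be_ n) by exact: plateau_smooth.
have ms n (h : R -> R) : smooth1 h -> measurable_fun setT (fun z : P => h z.1) by move=> *; exact: msmooth_fst.
have E n : \int[mu2]_(z in B') (f z * (derive1 (al n) z.1 * be_ n z.2)) =
  - \int[mu2]_(z in B') (g z * (al n z.1 * be_ n z.2)).
 have := W (al n) (be_ n) _ _ _ _ (sal n) (sbe n) (plateau_supp n ab) (plateau_supp n cd).
 move=> /(congr1 fine); rewrite fineN.
 have out (h : P -> R) z : ~ B' z ->
   h z * (derive1 (al n) z.1 * be_ n z.2) = 0 /\ h z * (al n z.1 * be_ n z.2) = 0.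
  move=> nB; have [y_in|y_out] := boolP (c <= z.2 <= d + 1); last first.
   by rewrite /be_ (plateau_supp n cd y_out) !mulr0.
  have x_out : ~~ (a <= z.1 <= b + 1).
   by apply/negP => x_in; apply: nB; split; rewrite /= in_itv.
  rewrite /al (plateau_supp n ab x_out) plateau_der !mollifier_out ?subr0 ?mul0r ?mulr0//.
   apply: contra x_out => /andP[h1 h2].
   have rn : n.+1%:R^-1 <= 1 :> R by rewrite invf_le1 ?ltr0n// ler1n.
   by rewrite (le_trans ab h1) (le_trans h2)// lerD2l.
  apply: contra x_out => /andP[h1 h2].
  have rn : n.+1%:R^-1 <= 1 :> R by rewrite invf_le1 ?ltr0n// ler1n.
  by rewrite h1 (le_trans h2)// lerD.
 have S1 := @Rint_supp R _ _ mu2 B' setT (fun z => f z * (derive1 (al n) z.1 * be_ n z.2)) _ (subsetT _) (fun z _ => erefl) (fun z _ nB => (out f z nB).1).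
 have S2 := @Rint_supp R _ _ mu2 B' setT (fun z => g z * (al n z.1 * be_ n z.2)) _ (subsetT _) (fun z _ => erefl) (fun z _ nB => (out g z nB).2).
 by rewrite -S1 -S2.
have ci (h : P -> R) : continuous h -> mu2.-integrable B' (EFin \o h).
 by move=> ch; apply: (@cont_int2 _ _ _ a (b + 1) c (d + 1)).
have igB : mu2.-integrable B' (EFin \o g) by exact: gi.
have cbe n : continuous (be_ n) by exact: smooth1_cont.
have c1 (h : R -> R) : continuous h -> continuous (fun z : P => h z.1).
 by move=> ch z; apply: (@continuous_comp _ _ _ fst h); [exact: cvg_fst|exact: ch].
have c2 (h : R -> R) : continuous h -> continuous (fun z : P => h z.2).
 by move=> ch z; apply: (@continuous_comp _ _ _ snd h); [exact: cvg_snd|exact: ch].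
have Y : \int[mu2]_(z in B') (g z * (al n z.1 * be_ n z.2)) @[n --> \oo] -->
  \int[mu2]_(z in cbox a b c d) g z.
 rewrite -(@Rint_box_ind _ g a b c d (b + 1) (d + 1))//; last exact: gi.
 apply: (@Rdominated_cvg _ _ _ _ _ _ _ (fun z => `|g z|)) => //.
 - move=> n; apply: measurable_funTS; apply: measurable_funM => //.
  by apply: measurable_funM; [exact: msmooth_fst|exact: msmooth_snd].
 - have mi (p q : R) : measurable_fun setT (itv_ind p q).
   have -> : itv_ind p q = \1_(`]p, q]) :> (R -> R).
    by apply/funext => x; rewrite indicE /itv_ind mem_setE in_itv /=; case: ifP.
   by apply: measurable_indic.
  apply: measurable_funTS; apply: measurable_funM => //.
  apply: measurable_funM.
   by apply: (measurableT_comp (mi _ _)); exact: measurable_fst.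
  by apply: (measurableT_comp (mi _ _)); exact: measurable_snd.
 - move=> z _; apply: cvgM; first exact: cvg_cst.
  by apply: cvgM; exact: plateau_cvg.
 - exact: integrable_norm.
 - move=> n z _; rewrite !normrM -[leRHS]mulr1 ler_wpM2l// -[leRHS]mulr1.
  by apply: ler_pM => //; exact: plateau_le.
have [B [B0 HB]] := bump_bound R.
have [M [M0 HM]] := bounded_on_compact cf (@compact_cbox _ a (b + 1) c (d + 1)).
have hE n y : \int[mu1]_(x in `[a, b + 1]) (f (x, y) * (derive1 (al n) x * be_ n y)) =
  be_ n y * (mollify n (fun x => f (x, y)) a - mollify n (fun x => f (x, y)) b).
 rewrite -(@mollify_wide _ n _ a a (b + 1))//; last lra.
 rewrite -(@mollify_wide _ n _ b a (b + 1))//.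
 have im e : mu1.-integrable `[a, b + 1] (EFin \o (fun x => f (x, y) * mollifier n e x)).
  apply: cont_int1 => x.
  by apply: cvgM; [exact: cfy|exact: mollifier_cont].
 rewrite -RintegralB// -RintegralZl//.
  by apply: eq_Rintegral => x _; rewrite plateau_der; move: (mollifier _ _ _) (mollifier _ _ _) => A A'; ring.
 apply: cont_int1 => x.
 by apply: cvgB; apply: cvgM; [exact: cfy|exact: mollifier_cont|exact: cfy|exact: mollifier_cont].
have X : \int[mu2]_(z in B') (f z * (derive1 (al n) z.1 * be_ n z.2)) @[n --> \oo] -->
  \int[mu1]_(y in `[c, d]) (f (a, y) - f (b, y)).
 have cab : continuous (fun y => f (a, y) - f (b, y)).
  by move=> y; apply: cvgB; exact: cfx.
 rewrite -(@Rint_itv_ind _ _ c d (d + 1))//; last exact: cont_int1.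
 have fub n : \int[mu2]_(z in B') (f z * (derive1 (al n) z.1 * be_ n z.2)) =
   \int[mu1]_(y in `[c, d + 1]) (be_ n y * (mollify n (fun x => f (x, y)) a - mollify n (fun x => f (x, y)) b)).
  rewrite /B' /cbox Rfubini//; last first.
   apply: (ci (fun z => f z * (derive1 (al n) z.1 * be_ n z.2))) => z.
   apply: cvgM; first exact: cf.
   by apply: cvgM; [exact: (c1 _ (smooth1_cont (smooth1_der (sal n)).2))|exact: (c2 _ (cbe n))].
  by apply: eq_Rintegral => y _; rewrite -hE.
 under eq_fun do rewrite fub.
 apply: (@Rdominated_cvg _ _ _ _ _ _ _ (cst (2 * (M + B * (2 * M))))) => //.
 - move=> n; have := @integrable_rows _ _ _ (measurable_itv `[a, b + 1]) (measurable_itv `[c, d + 1]) (fun z => f z * (derive1 (al n) z.1 * be_ n z.2)).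
  have ciz : mu2.-integrable (`[a, b + 1]%classic `*` `[c, d + 1]%classic) (EFin \o (fun z => f z * (derive1 (al n) z.1 * be_ n z.2))).
   apply: (ci (fun z => f z * (derive1 (al n) z.1 * be_ n z.2))) => z.
   apply: cvgM; first exact: cf.
   by apply: cvgM; [exact: (c1 _ (smooth1_cont (smooth1_der (sal n)).2))|exact: (c2 _ (cbe n))].
  move=> /(_ ciz) /(measurable_int _) /measurable_EFinP.
  by apply: eq_measurable_fun => y _; exact: hE.
 - apply: measurable_funTS; apply: measurable_funM; first exact: continuous_measurable_fun.
  have -> : itv_ind c d = \1_(`]c, d]) :> (R -> R).
   by apply/funext => x; rewrite indicE /itv_ind mem_setE in_itv /=; case: ifP.
  by apply: measurable_indic.
 - move=> y _; rewrite mulrC; apply: cvgM; first exact: plateau_cvg.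
  by apply: cvgB; apply: (mollify_cvg (F := fun x => f (x, y))).
 - by apply: cont_int1 => x; exact: cvg_cst.
 - move=> n y ycd.
  have ml e : a <= e <= b -> `|mollify n (fun x => f (x, y)) e| <= M + B * (2 * M).
   move=> /andP[ae' eb'].
   have le1 : n.+1%:R^-1 <= 1 :> R by rewrite invf_le1 ?ltr0n// ler1n.
   have fe x : e <= x <= e + n.+1%:R^-1 -> `|f (x, y)| <= M.
    move=> /andP[h1 h2]; apply: HM; split => //=; rewrite in_itv /=.
    by rewrite (le_trans ae' h1) (le_trans h2)// lerD.
   have := @mollify_dist _ B HB n (fun x => f (x, y)) e (2 * M) (cfy y).
   move=> /(_ _)/wrap[|H].
    move=> x hx; apply: le_trans (ler_normB _ _) _; rewrite mulr2n mulrDl mul1r; apply: lerD; apply: fe => //.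
    by rewrite lexx lerDl invr_ge0 ler0n.
   have h1 : `|f (e, y)| <= M by apply: fe; rewrite lexx lerDl invr_ge0 ler0n.
   rewrite -[mollify _ _ _](subrK (f (e, y))) addrC.
   by apply: le_trans (ler_normD _ _) _; apply: lerD.
  rewrite normrM -[leRHS]mul1r; apply: ler_pM => //; first exact: plateau_le.
  apply: le_trans (ler_normB _ _) _.
  by rewrite /cst /= mulr_natl mulr2n; apply: lerD; apply: ml; rewrite ?lexx ?ab.
have X' : \int[mu2]_(z in B') (f z * (derive1 (al n) z.1 * be_ n z.2)) @[n --> \oo] -->
  - \int[mu2]_(z in cbox a b c d) g z.
 by under eq_fun do rewrite E; apply: cvgN.
have := cvg_unique _ X X' => /(_ (@norm_hausdorff _ _)) H.
have -> : \int[mu1]_(y in `[c, d]) (f (b, y) - f (a, y)) = - \int[mu1]_(y in `[c, d]) (f (a, y) - f (b, y)).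
 rewrite -mulN1r -RintegralZl//; last first.
  by apply: cont_int1 => y; apply: cvgB; exact: cfx.
 by apply: eq_Rintegral => y _; ring.
by rewrite H opprK.
Qed.

End weak_rectangle.

(** * Absolute continuity on almost every line *)

Section absolutely_continuous_rows.
Variable R : realType.
Local Notation P := (R * R)%type.
Local Notation mu1 := (@lbm R).
Local Notation mu2 := (@lbm R \x @lbm R)%E.

Lemma ae_countable d (T : measurableType d) (mu : {measure set T -> \bar R})
 (I : countType) (A : I -> T -> Prop) :
 (forall i, {ae mu, forall x, A i x}) -> {ae mu, forall x, forall i, A i x}.
Proof.
move=> H; have : {ae mu, forall x, forall n : nat, forall i, unpickle n = Some i -> A i x}.
 apply/ae_foralln => n; case E : (@unpickle I n) => [i|]; last exact: aeA.
 by apply: aeS (H i) => x Ax j [<-].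
by apply: aeS => x h i; apply: (h (pickle i)); exact: pickleK.
Qed.

(** Lebesgue differentiation of a primitive that vanishes identically, after extension of the
    integrand by zero. *)
Lemma zero_integrals_ae (h : R -> R) (p q : R) : mu1.-integrable `[p, q] (EFin \o h) ->
 (forall x, p <= x <= q -> \int[mu1]_(y in `[p, x]) h y = 0) ->
 {ae mu1, forall y, p < y < q -> h y = 0}.
Proof.
move=> hi h0.
have [qp|pq] := ltP q p.
 by apply: aeA => y /andP[py yq]; have := lt_trans py yq; rewrite ltNge (ltW qp).
pose lm := @lebesgue_measure R.
have hi' : lm.-integrable `[p, q] (EFin \o h).
 have /integrableP[mh hoo] := hi; apply/integrableP; split; first exact: mh.
 rewrite lebesgue_integral//; exact: measurableT_comp mh.
pose k := h \_ `[p, q].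
have kl : locally_integrable [set: R] k by exact: integrable_locally.
have mk : measurable_fun setT k by case: kl.
have ki (D : set R) : measurable D -> lm.-integrable D (EFin \o k).
 move=> mD; apply: (integrableS measurableT) => //.
 by have := (integrable_mkcond (mu := lm) (EFin \o h) (measurable_itv `[p, q])).1 hi'; rewrite restrict_EFin.
have kint x : p < x < q -> (\int[lm]_(t in `[p, x]) k t)%R = 0.
 move=> /andP[px xq]; rewrite -[RHS](h0 x) ?(ltW px) ?(ltW xq)//.
 rewrite Rint_lebesgue//; last exact: measurable_funTS.
 apply: eq_Rintegral => t /set_mem /=; rewrite in_itv /= => /andP[pt tx].
 by rewrite /k patchE ifT// inE /= in_itv /= pt (le_trans tx (ltW xq)).
have := @FTC1 _ k (BLeft p) (fun y => ki _ (measurable_itv _)) kl.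
apply: aeS => y /= H /andP[py yq].
have [|_ E] := H; first by rewrite lte_fin.
have -> : h y = k y by rewrite /k patchE ifT// inE /= in_itv /= !ltW.
rewrite -E derive1E; apply: derive_val.
apply: (near_eq_is_derive (f := cst (0 : R))).
near=> t; rewrite /cst kint//; apply/andP; split; near: t; [exact: lt_nbhsr|exact: lt_nbhsl].
Unshelve. all: by end_near. Qed.

(** Absolute continuity in integrated form: the derivative g is a datum, not a pointwise limit. *)
Definition row_ac (f g : R -> R) := forall a b, a <= b ->
 mu1.-integrable `[a, b] (EFin \o g) /\ f b - f a = \int[mu1]_(x in `[a, b]) g x.

Lemma Rint_cat (g : R -> R) a b c : a <= b -> b <= c ->
 mu1.-integrable `[a, c] (EFin \o g) ->
 \int[mu1]_(x in `[a, c]) g x = \int[mu1]_(x in `[a, b]) g x + \int[mu1]_(x in `[b, c]) g x.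
Proof.
move=> ab bc gi.
have E : `[a, c]%classic = `[a, b]%classic `|` `]b, c]%classic :> set R.
 by rewrite -itv_bndbnd_setU// bnd_simp.
have gi2 : mu1.-integrable `[b, c] (EFin \o g).
 apply: integrableS gi => //; apply: subset_itvr; by rewrite bnd_simp.
rewrite E Rintegral_setU//; last 2 first.
- by rewrite -E.
- rewrite disj_set2E; apply/eqP/seteqP; split => // x [] /=; rewrite !in_itv /=.
 by move=> /andP[_ xb] /andP[bx _]; have := le_lt_trans xb bx; rewrite ltxx.
congr (_ + _); rewrite (Rint_negl (N := [set b]) _ _ _ gi2)//; last exact: lbm_set1.
congr Rintegral; apply/seteqP; split=> x /=; rewrite !in_itv /=.
 by move=> /andP[bx xc]; rewrite (ltW bx) xc; split=> //; apply/eqP; rewrite gt_eqF.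
by move=> [/andP[bx xc]] /eqP xb; rewrite xc andbT lt_neqAle eq_sym xb.
Qed.

Lemma Rint_continuous (g : R -> R) a b : a <= b -> mu1.-integrable `[a, b] (EFin \o g) ->
 {within `[a, b], continuous (fun x => \int[mu1]_(t in `[a, x]) g t)}.
Proof.
move=> ab gi; have /integrableP[mg goo] := gi.
have mg' : measurable_fun `[a, b] g by exact/measurable_EFinP.
have gi' : (@lebesgue_measure R).-integrable `[a, b] (EFin \o g).
 apply/integrableP; split; first exact: mg.
 rewrite lebesgue_integral//; exact: measurableT_comp mg.
have := parameterized_integral_continuous ab gi'.
apply: subspace_eq_continuous => x /set_mem /=; rewrite in_itv /= => /andP[ax xb].
rewrite /from_subspace /= /parameterized_integral Rint_lebesgue//.
by apply: measurable_funS mg' => //; apply: subset_itvl; rewrite bnd_simp.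
Qed.

(** [f] and the primitive of [g] are continuous, so their difference [k], equal at all rationals of
    a bounded interval, is constant there. *)
Lemma row_ac_rat (f g : R -> R) : continuous f ->
 (forall n : nat, mu1.-integrable `[- n%:R, n%:R] (EFin \o g)) ->
 (forall p q : rat, (p < q)%R -> f (ratr q) - f (ratr p) = \int[mu1]_(x in `[ratr p, ratr q]) g x) ->
 row_ac f g.
Proof.
move=> cf gi H a b ab.
have [n na nb] : exists2 n : nat, - n%:R + 1 < a & b < n%:R - 1 :> R.
 exists (Num.bound (`|a| + `|b| + 1)); have h := archi_boundP (_ : 0 <= `|a| + `|b| + 1).
  have := ler_norm (- a); rewrite normrN => h1.
  have := h _ => /(_ _)/wrap[|h2]; first by rewrite !addr_ge0.
  by have := normr_ge0 b; lra.
 have := ler_norm b => h1.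
 have := h _ => /(_ _)/wrap[|h2]; first by rewrite !addr_ge0.
 by have := normr_ge0 a; lra.
have sub (p q : R) : - n%:R <= p -> q <= n%:R -> mu1.-integrable `[p, q] (EFin \o g).
 move=> hp hq; apply: integrableS (gi n) => // x /=; rewrite !in_itv /= => /andP[h1 h2].
 by rewrite (le_trans hp h1) (le_trans h2 hq).
split; first by apply: sub; lra.
pose F x := \int[mu1]_(t in `[- n%:R, x]) g t.
have FE p q : - n%:R <= p -> p <= q -> q <= n%:R -> \int[mu1]_(x in `[p, q]) g x = F q - F p.
 move=> hp pq hq; rewrite /F (@Rint_cat _ (- n%:R) p q)//; first by rewrite addrAC subrr add0r.
 exact: sub.
rewrite FE; [|lra|lra|lra].
have nn : - n%:R <= n%:R :> R by lra.
have cF : {in `]- n%:R, n%:R[, continuous F}.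
 have := Rint_continuous nn (gi n); rewrite continuous_within_itvP; last lra.
 by case.
pose k x := f x - F x.
have ck x : - n%:R < x -> x < n%:R -> {for x, continuous k}.
 by move=> h1 h2; apply: cvgB; [exact: cf|apply: cF; rewrite in_itv /= h1 h2].
have kr (p q : rat) : - n%:R <= ratr p :> R -> ratr q <= n%:R :> R -> p < q -> k (ratr p) = k (ratr q).
 move=> hp hq pq; have := H p q pq; rewrite FE//; last by rewrite ler_rat ltW.
 by rewrite /k; lra.
suff : k a = k b by rewrite /k; lra.
have kc x (r0 : rat) : - n%:R + 1 < x -> x < n%:R - 1 -> ratr r0 < x - 1 / 2 -> - n%:R < ratr r0 :> R -> k x = k (ratr r0).
 move=> h1 h2 h3 h4; apply/eqP; rewrite -subr_eq0 -normr_le0; apply/ler_addgt0Pr => e e0; rewrite add0r.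
 have /cvgrPdist_le /(_ _ e0) [d /= d0 Hd] : {for x, continuous k} by apply: ck; lra.
 have hd : x - Num.min d (1 / 2) < x by rewrite ltrBlDr ltrDl lt_min d0 /=; lra.
 have [q] := rat_in_itvoo hd; rewrite in_itv /= => /andP[q1 q2].
 have [m1 m2] : Num.min d (1 / 2) <= d /\ Num.min d (1 / 2) <= 1 / 2 by rewrite !ge_min !lexx orbT.
 rewrite (kr r0 q); [|exact: ltW h4|move: q2 h2; clear; lra|by rewrite -(ltr_rat R); lra].
 by apply: Hd => /=; rewrite ltr_norml; apply/andP; split; lra.
have h : - n%:R < Num.min (a - 1 / 2) (- n%:R + 1) :> R by rewrite lt_min; apply/andP; split; lra.
have [r0] := rat_in_itvoo h; rewrite in_itv /= lt_min => /andP[r1 /andP[r2 r3]].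
by rewrite (kc a r0) ?(kc b r0)//; lra.
Qed.

(** For fixed rational abscissas the rectangle identity holds over every range of heights, hence the
    row identity holds at almost every height. Only countably many null sets are discarded, and
    continuity then reaches all abscissas. *)
Lemma ae_row_ac (f g : P -> R) : continuous f -> locint g -> weak_x f g ->
 {ae mu1, forall y, row_ac (fun x => f (x, y)) (fun x => g (x, y))}.
Proof.
move=> cf [mg gi] W.
have nn (n : nat) : - n%:R <= n%:R :> R by apply: (@le_trans _ _ 0); rewrite ?oppr_le0.
have G (i : nat * rat * rat) : {ae mu1, forall y : R, i.1.2 < i.2 -> - i.1.1%:R < y < i.1.1%:R ->
  f (ratr i.2, y) - f (ratr i.1.2, y) = \int[mu1]_(x in `[ratr i.1.2, ratr i.2]) g (x, y)}.
 case: i => [[n p] q] /=.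
 have [pq|qp] := ltP p q; last by apply: aeA.
 have pq' : ratr p <= ratr q :> R by rewrite ler_rat ltW.
 set I := `[ratr p, ratr q]%classic.
 have gI e : e <= n%:R -> - n%:R <= e -> mu2.-integrable (I `*` `[- n%:R, e]%classic) (EFin \o g).
  by move=> en ne; exact: gi.
 have i1 : mu1.-integrable `[- n%:R, n%:R] (EFin \o (fun y => f (ratr q, y) - f (ratr p, y))).
  by apply: cont_int1 => y; apply: cvgB; exact: continuous_col.
 have i2 := @integrable_rows _ _ _ (measurable_itv _) (measurable_itv _) g (gI _ (lexx _) (nn n)).
 have Z := @zero_integrals_ae (fun y => (f (ratr q, y) - f (ratr p, y)) - \int[mu1]_(x in I) g (x, y)) (- n%:R) n%:R.
 apply: aeS (Z (integrableB _ i1 i2) _) => //.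
  by move=> y H _ yn; apply/eqP; rewrite -subr_eq0; apply/eqP; exact: H.
 move=> x /andP[nx xn].
 rewrite RintegralB//; last 2 first.
 - apply: (integrableS _ _ _ i1) => //; by apply: subset_itvl; rewrite bnd_simp.
 - apply: (integrableS _ _ _ i2) => //; by apply: subset_itvl; rewrite bnd_simp.
 rewrite (weak_rect cf (conj mg gi) W)// -(Rfubini (measurable_itv _) (measurable_itv _) (gI _ xn nx)).
 by rewrite subrr.
have I n : {ae mu1, forall y : R, `[- n%:R, n%:R]%classic y -> mu1.-integrable `[- n%:R, n%:R] (EFin \o (fun x => g (x, y)))}.
 apply: ae_integrable_row => //; exact: gi.
apply: aeS (aeI (ae_countable G) (ae_countable I)) => y [Gy Iy].
have ylt (m : nat) : (Num.bound `|y| <= m)%N -> - m%:R < y < m%:R.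
 move=> h; rewrite -ltr_norml; apply: lt_le_trans (archi_boundP _) _ => //.
 by rewrite ler_nat.
apply: row_ac_rat.
- exact: continuous_row.
- move=> n; pose m := maxn (Num.bound `|y|) n.
 have := ylt m (leq_maxl _ _) => /andP[h1 h2].
 have nm : n%:R <= m%:R :> R by rewrite ler_nat leq_maxr.
 apply: integrableS (Iy m _) => //; last by rewrite /= in_itv /= !ltW.
 by move=> x /=; rewrite !in_itv /= => /andP[h3 h4]; apply/andP; split; lra.
- by move=> p q pq; apply: (Gy (Num.bound `|y|, p, q)) => //; exact: ylt.
Qed.

End absolutely_continuous_rows.

(** * Integrability and elementary bounds for real-valued functions *)

Section real_integrable.
Context d (T : measurableType d) (R : realType) (mu : {measure set T -> \bar R}).
Variables (D : set T) (mD : measurable D).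
Implicit Types f g : T -> R.
Local Notation intg f := (mu.-integrable D (EFin \o f)).

Lemma RiD f g : intg f -> intg g -> intg (fun x => f x + g x).
Proof. by move=> fi gi; exact: (integrableD mD fi gi). Qed.

Lemma RiB f g : intg f -> intg g -> intg (fun x => f x - g x).
Proof. by move=> fi gi; exact: (integrableB mD fi gi). Qed.

Lemma RiZ (k : R) f : intg f -> intg (fun x => k * f x).
Proof. by move=> fi; exact: (integrableZl mD k fi). Qed.

Lemma RiN f : intg f -> intg (fun x => `|f x|).
Proof. exact: integrable_norm. Qed.

Lemma Rile f g : measurable_fun D f -> (forall x, D x -> `|f x| <= g x) -> intg g -> intg f.
Proof.
move=> mf fg gi; apply: (le_integrable mD _ _ gi); first exact/measurable_EFinP.
by move=> x Dx /=; rewrite lee_fin; apply: le_trans (fg x Dx) (ler_norm _).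
Qed.

Lemma Rim f : intg f -> measurable_fun D f.
Proof. by move=> fi; apply/measurable_EFinP; exact: measurable_int fi. Qed.

Lemma Ris f (E : set T) : measurable E -> E `<=` D -> intg f -> mu.-integrable E (EFin \o f).
Proof. by move=> mE ED; exact: integrableS. Qed.

Lemma RiMb (h g : T -> R) (M : R) : measurable_fun D h -> (forall x, D x -> `|h x| <= M) ->
 intg g -> intg (fun x => h x * g x).
Proof.
move=> mh hM gi; apply: (@Rile _ (fun x => M * `|g x|)); last exact/RiZ/RiN.
 by apply: measurable_funM => //; exact: Rim.
by move=> x Dx; rewrite normrM ler_wpM2r// hM.
Qed.

Lemma Rint_le_norm f g : intg f -> intg g -> (forall x, D x -> `|f x| <= g x) ->
 `|(\int[mu]_(x in D) f x)%R| <= (\int[mu]_(x in D) g x)%R.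
Proof.
move=> fi gi fg; apply: le_trans (le_normr_Rintegral mD fi) _.
by apply: le_Rintegral => //; exact: RiN.
Qed.

End real_integrable.

(** * Product and chain rules along a line *)

Section absolutely_continuous_calculus.
Variable R : realType.
Local Notation mu1 := (@lbm R).

Lemma unif_compact (V : normedModType R) (K : set V) (f : V -> R) (e : R) :
 0 < e -> compact K -> continuous f ->
 exists2 d, 0 < d & forall x y, K x -> `|y - x| < d -> `|f y - f x| <= e.
Proof.
move=> e0 /compact_near_coveringP cK cf.
have := cK _ (0 : R)^'+ (fun d x => forall y, `|y - x| < d -> `|f y - f x| <= e).
have FF : Filter (0 : R)^'+ by typeclasses eauto.
move=> /(_ FF)/(_ _)/wrap[x Kx|].
 have e20 : 0 < e / 2 by rewrite divr_gt0.
 have /cvgrPdist_le /(_ _ e20) /nbhs_ballP [d /= d0 Hd] := cf x.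
 exists (ball x (d / 2), [set i : R | i < d / 2]) => /=.
  split; first by apply/nbhs_ballP; exists (d / 2) => //=; rewrite divr_gt0.
  by apply: nbhs_right_lt; rewrite divr_gt0.
 case=> z i [/=]; rewrite -ball_normE /= => zx id y yz.
 have h (t : V) : `|x - t| < d -> `|f x - f t| <= e / 2.
  by move=> h; apply: Hd; rewrite -ball_normE.
 have h1 : `|f x - f z| <= e / 2 by apply: h; lra.
 have h2 : `|f x - f y| <= e / 2.
  apply: h; rewrite -[x - y](subrKA z); apply: le_lt_trans (ler_normD _ _) _.
  by rewrite distrC in yz; lra.
 rewrite -[f y - f z](subrKA (f x)); apply: le_trans (ler_normD _ _) _.
 by rewrite (distrC (f y)); lra.
move=> H; have : \forall d \near (0 : R)^'+, 0 < d by exact: nbhs_right_gt.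
move=> H0; have /filter_ex [d [Hd d0]] := @filterI _ _ FF _ _ H H0.
by exists d => // x y Kx; apply: Hd.
Qed.

(** Pieces of length d/2 are cut off one after the other and subadditivity adds them up; the
    induction is on the number of pieces. *)
Lemma short_intervals_le (F : R -> R -> R) (a b d : R) : 0 < d -> a <= b ->
 (forall s t u, a <= s -> s <= t -> t <= u -> u <= b -> F s u <= F s t + F t u) ->
 (forall s t, a <= s -> s <= t -> t <= b -> t - s < d -> F s t <= 0) -> F a b <= 0.
Proof.
move=> d0 ab Fadd Fs.
have d20 : 0 < d / 2 by rewrite divr_gt0.
suff H (n : nat) s : a <= s -> s <= b -> b - s <= n%:R * (d / 2) -> F s b <= 0.
 apply: (H (Num.bound ((b - a) / (d / 2))) a) => //.
 by rewrite -ler_pdivrMr// ltW// archi_boundP// divr_ge0 ?subr_ge0// ltW.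
elim: n s => [|n IH] s as_ sb.
 by rewrite mul0r => h; apply: Fs => //; lra.
rewrite -natr1 mulrDl mul1r => h.
have [le|lt] := leP (b - s) (d / 2); first by apply: Fs => //; lra.
have h1 := IH (s + d / 2) _ _ _; have h2 := Fs s (s + d / 2).
apply: le_trans (Fadd s (s + d / 2) b _ _ _ _) _; [lra|lra|lra|lra|].
by rewrite -[leRHS]addr0 lerD// ?h2 ?h1//; lra.
Qed.

Section row_calculus.
Variables (F f K k : R -> R).
Hypotheses (cF : continuous F) (cK : continuous K) (Ff : row_ac F f) (Kk : row_ac K k).

Let unif a b (G : R -> R) (e : R) : 0 < e -> continuous G ->
 exists2 d, 0 < d & forall s t x, a <= s -> s <= t -> t <= b -> t - s < d -> s <= x <= t ->
  [/\ `|G s - G x| <= e, `|G t - G x| <= e & `|G s - G t| <= e].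
Proof.
move=> e0 cG.
have [d d0 Hd] := unif_compact e0 (@segment_compact R a b) cG.
exists d => // s t x as_ st tb tsd /andP[sx xt].
split; apply: Hd; rewrite /= ?in_itv /= ?ltr_norml; apply/andP; split; lra.
Qed.

Let integrableMc (G h : R -> R) a b : continuous G -> mu1.-integrable `[a, b] (EFin \o h) ->
 mu1.-integrable `[a, b] (EFin \o (fun x => G x * h x)).
Proof.
move=> cG hi.
have /compact_bounded [M [_ HM]] : compact (G @` `[a, b]).
 by apply: continuous_compact; [exact: continuous_subspaceT|exact: segment_compact].
apply: (@RiMb _ _ _ _ _ _ _ _ (`|M| + 1)) => //.
 by apply: measurable_funTS; exact: continuous_measurable_fun.
by move=> x Dx; apply: (HM (`|M| + 1)); [rewrite ltr_pwDr// ler_norm|exists x].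
Qed.

(** An additive interval function that is o(1) times one fixed finite integral on short intervals
    must vanish. The product and the chain rule are both obtained this way, without differentiating
    at points. *)
Lemma row_ac_error (A : R -> R -> R) (m w : R -> R) a b :
 (forall s t u, a <= s -> s <= t -> t <= u -> u <= b -> A s u = A s t + A t u) ->
 mu1.-integrable `[a, b] (EFin \o m) -> (forall x, 0 <= m x) -> a <= b ->
 (forall e, 0 < e -> exists2 d, 0 < d & forall s t, a <= s -> s <= t -> t <= b -> t - s < d ->
  `|A s t| <= e * \int[mu1]_(x in `[s, t]) m x) -> A a b = 0.
Proof.
move=> Aadd mi m0 ab H.
have msub s t : a <= s -> t <= b -> mu1.-integrable `[s, t] (EFin \o m).
 move=> h1 h2; apply: integrableS mi => // x /=; rewrite !in_itv /= => /andP[h3 h4].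
 by rewrite (le_trans h1 h3) (le_trans h4 h2).
suff h e : 0 < e -> `|A a b| <= e * \int[mu1]_(x in `[a, b]) m x.
 apply/eqP; rewrite -normr_le0; apply/ler_addgt0Pr => e e0; rewrite add0r.
 set I := \int[mu1]_(x in `[a, b]) m x in h *.
 have I0 : 0 <= I by apply: Rintegral_ge0.
 have e'0 : 0 < e / (I + 1) by rewrite divr_gt0// ltr_wpDl.
 apply: le_trans (h _ e'0) _; rewrite mulrAC ler_pdivrMr ?ltr_wpDl// ler_wpM2l//; first exact: ltW.
 by rewrite lerDl ler01.
move=> e0; have [d d0 Hd] := H e e0.
rewrite -subr_le0.
apply: (@short_intervals_le (fun s t => `|A s t| - e * \int[mu1]_(x in `[s, t]) m x) a b d) => //.
 move=> s t u as_ st tu ub; rewrite (Aadd s t u)// (@Rint_cat _ _ s t u)//; last exact: msub.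
 by have := ler_normD (A s t) (A t u); lra.
by move=> s t as_ st tb tsd; rewrite subr_le0; exact: Hd.
Qed.

Lemma row_acM : row_ac (fun x => F x * K x) (fun x => K x * f x + F x * k x).
Proof.
move=> a b ab; have [fi fE] := Ff ab; have [ki kE] := Kk ab.
have i12 : mu1.-integrable `[a, b] (EFin \o (fun x => K x * f x + F x * k x)).
 by apply: RiD => //; exact: integrableMc.
split => //.
pose A s t := (F t * K t - F s * K s) - \int[mu1]_(x in `[s, t]) (K x * f x + F x * k x).
apply/eqP; rewrite -subr_eq0; apply/eqP.
have mi : mu1.-integrable `[a, b] (EFin \o (fun x => `|f x| + `|k x|)).
 by apply: RiD => //; exact: RiN.
apply: (@row_ac_error A (fun x => `|f x| + `|k x|) 0 a b _ mi) => //.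
- move=> s t u as_ st tu ub; rewrite /A (@Rint_cat _ _ s t u)//; first ring.
 apply: Ris i12 => // x /=; rewrite !in_itv /= => /andP[h3 h4].
 by rewrite (le_trans as_ h3) (le_trans h4 ub).
move=> e e0.
have [d1 d10 H1] := unif a b e0 cF; have [d2 d20 H2] := unif a b e0 cK.
exists (Num.min d1 d2); first by rewrite lt_min d10.
move=> s t as_ st tb; rewrite lt_min => /andP[ts1 ts2].
have [fi' fE'] := Ff st; have [ki' kE'] := Kk st.
have j12 : mu1.-integrable `[s, t] (EFin \o (fun x => K x * f x + F x * k x)).
 by apply: RiD => //; exact: integrableMc.
have l1 : mu1.-integrable `[s, t] (EFin \o (fun x => K t * f x)) by exact: RiZ.
have l2 : mu1.-integrable `[s, t] (EFin \o (fun x => F s * k x)) by exact: RiZ.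
have -> : A s t = \int[mu1]_(x in `[s, t]) ((K t * f x + F s * k x) - (K x * f x + F x * k x)).
 rewrite RintegralB//; last exact: RiD.
 by rewrite /A [in RHS]RintegralD// !RintegralZl// -fE' -kE'; congr (_ - _); ring.
rewrite -RintegralZl//; last by apply: RiD => //; exact: RiN.
apply: Rint_le_norm => //.
- by apply: RiB => //; exact: RiD.
- by apply: RiZ => //; apply: RiD => //; exact: RiN.
move=> x; rewrite /= in_itv /= => sxt.
have [_ h2 _] := H2 s t x as_ st tb ts2 sxt.
have [h1 _ _] := H1 s t x as_ st tb ts1 sxt.
rewrite (_ : _ - _ = (K t - K x) * f x + (F s - F x) * k x); last ring.
apply: le_trans (ler_normD _ _) _; rewrite !normrM mulrDr.
by apply: lerD; apply: ler_wpM2r.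
Qed.

Lemma row_ac_comp (p p' : R -> R) : continuous p' -> (forall x : R, is_derive x (1 : R) p (p' x)) ->
 row_ac (fun x => p (F x)) (fun x => p' (F x) * f x).
Proof.
move=> cp' dp.
have cpF : continuous (fun x => p' (F x)).
 by move=> x; apply: (@continuous_comp _ _ _ F p'); [exact: cF|exact: cp'].
move=> a b ab; have [fi fE] := Ff ab.
have i1 := integrableMc cpF fi.
split => //.
pose A s t := (p (F t) - p (F s)) - \int[mu1]_(x in `[s, t]) (p' (F x) * f x).
apply/eqP; rewrite -subr_eq0; apply/eqP.
have mi := RiN fi.
apply: (@row_ac_error A (fun x => `|f x|) 0 a b _ mi) => //.
- move=> s t u as_ st tu ub; rewrite /A (@Rint_cat _ _ s t u)//; first ring.
 apply: Ris i1 => // x /=; rewrite !in_itv /= => /andP[h3 h4].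
 by rewrite (le_trans as_ h3) (le_trans h4 ub).
move=> e e0.
have /compact_bounded [M [_ HM]] : compact (F @` `[a, b]).
 by apply: continuous_compact; [exact: continuous_subspaceT|exact: segment_compact].
pose N := `|M| + 1.
have HN x : a <= x <= b -> - N <= F x <= N.
 move=> h; rewrite -ler_norml; apply: (HM N); first by rewrite /N ltr_pwDr// ler_norm.
 by exists x => //=; rewrite in_itv.
have [d0 d00 H0] := unif_compact e0 (@segment_compact R (- N) N) cp'.
have d020 : 0 < d0 / 3 by rewrite divr_gt0.
have [d1 d10 H1] := unif a b d020 cF.
exists d1 => // s t as_ st tb ts.
have [fi' fE'] := Ff st.
have j1 := integrableMc cpF fi'.
(* Mean value theorem between F s and F t, in whichever order they lie; the uniform continuity of p'
   then compares xi with every F x. *)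
have [xi [xiE xid]] : exists xi, p (F t) - p (F s) = p' xi * (F t - F s) /\ `|xi - F s| <= `|F t - F s|.
 have cp : continuous p.
  by move=> y; apply/differentiable_continuous/derivable1_diffP; exact: ex_derive.
 have mvt q r : q <= r -> exists2 c, p r - p q = p' c * (r - q) & q <= c <= r.
  move=> qr; have [|c] := @MVT_segment R p p' q r qr (fun x _ => dp x).
   exact: continuous_subspaceT.
  by rewrite in_itv /=; exists c.
 have [st'|ts'] := leP (F s) (F t).
  have [c cE /andP[h1 h2]] := mvt _ _ st'; exists c; split => //.
  by rewrite !ger0_norm ?subr_ge0// lerD2r.
 have [c cE /andP[h1 h2]] := mvt _ _ (ltW ts'); exists c; split; first by rewrite -[LHS]opprB cE -mulrN opprB.
 by rewrite !ler0_norm ?subr_le0 ?(ltW ts') ?lerN2 ?lerD2r.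
have -> : A s t = \int[mu1]_(x in `[s, t]) (p' xi * f x - p' (F x) * f x).
 rewrite RintegralB//; last exact: RiZ.
 by rewrite /A RintegralZl// -fE' xiE.
rewrite -RintegralZl//; last exact: RiN.
apply: Rint_le_norm => //.
- by apply: RiB => //; exact: RiZ.
- by apply: RiZ => //; exact: RiN.
move=> x; rewrite /= in_itv /= => sxt.
rewrite -mulrBl normrM; apply: ler_wpM2r => //.
have [h1 _ h3] := H1 s t x as_ st tb ts sxt.
apply: H0; first by rewrite /= in_itv /=; apply: HN; case/andP: sxt => sx xt; rewrite (le_trans as_ sx) (le_trans xt tb).
rewrite -(subrKA (F s)); apply: le_lt_trans (ler_normD _ _) _.
by rewrite (distrC (F t)) in xid; lra.
Qed.

End row_calculus.
End absolutely_continuous_calculus.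

(** * Functions absolutely continuous on almost all horizontal lines *)

Section plane_calculus.
Variable R : realType.
Local Notation P := (R * R)%type.
Local Notation mu1 := (@lbm R).
Local Notation mu2 := (@lbm R \x @lbm R)%E.

Lemma locintMc (g : P -> R) (h : P -> R) : continuous h -> locint g ->
 locint (fun z => h z * g z).
Proof.
move=> ch [mg gi]; split.
 by apply: measurable_funM => //; exact: cont_meas2.
move=> a b c d ab cd.
have [M [M0 HM]] := bounded_on_compact ch (@compact_cbox _ a b c d).
apply: (@RiMb _ _ _ _ _ _ _ _ M) => //; first exact: mcbox.
 by apply: measurable_funTS; exact: cont_meas2.
exact: gi.
Qed.

Lemma locint_cont (h : P -> R) : continuous h -> locint h.
Proof.
move=> ch; split; first exact: cont_meas2.
move=> a b c d ab cd; apply: (@cont_int2 _ _ _ a b c d) => //.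
exact: mcbox.
Qed.

Lemma locintD (g h : P -> R) : locint g -> locint h ->
 locint (fun z => g z + h z).
Proof.
move=> [mg gi] [mh hi]; split; first exact: measurable_funD.
by move=> a b c d ab cd; apply: RiD; [exact: mcbox|exact: gi|exact: hi].
Qed.

Lemma locintZ (k : R) (g : P -> R) : locint g -> locint (fun z => k * g z).
Proof.
by move=> gi; apply: (locintMc (h := cst k)) => //; move=> x; exact: cvg_cst.
Qed.

(** The working form of a weak derivative: line by line it is stable under products and under
    composition with C^1 functions, which identities against test functions do not show directly. *)
Record xac (f g : P -> R) : Prop := Xac {
 xac_cont : continuous f;
 xac_box : locint g;
 xac_row : {ae mu1, forall y, row_ac (fun x => f (x, y)) (fun x => g (x, y))} }.

Lemma xac_weak (f g : P -> R) : continuous f -> locint g -> weak_x f g -> xac f g.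
Proof. by move=> *; split => //; exact: ae_row_ac. Qed.

Lemma xac_smooth (f g : P -> R) : continuous f -> continuous g ->
 (forall x y, is_derive x (1 : R) (fun x => f (x, y)) (g (x, y))) -> xac f g.
Proof.
move=> cf cg df; split => //; first exact: locint_cont.
apply: aeA => y a b ab; have cgy := @continuous_row _ g y cg.
split; first exact: cont_int1.
move: ab; rewrite le_eqVlt => /predU1P[->|ab].
 by rewrite subrr set_itv1 Rintegral_mkcond -(Rintegral_set1 (fun x => g (x, y)) b) Rint_lebesgue//= -?Rintegral_mkcond// ; apply: measurable_funTS; exact: continuous_measurable_fun.
by rewrite (Rint_FTC2 ab cgy (fun x => df x y)).
Qed.

Lemma xacM (f g h k : P -> R) : xac f g -> xac h k ->
 xac (fun z => f z * h z) (fun z => h z * g z + f z * k z).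
Proof.
move=> [cf gi fg] [ch ki hk]; split.
- by move=> z; apply: cvgM; [exact: cf|exact: ch].
- by apply: locintD; exact: locintMc.
- apply: aeS (aeI fg hk) => y [h1 h2]; apply: row_acM => //; exact: continuous_row.
Qed.

Lemma xacD (f g h k : P -> R) : xac f g -> xac h k ->
 xac (fun z => f z + h z) (fun z => g z + k z).
Proof.
move=> [cf gi fg] [ch ki hk]; split.
- by move=> z; apply: cvgD; [exact: cf|exact: ch].
- exact: locintD.
- apply: aeS (aeI fg hk) => y [h1 h2] a b ab.
 have [i1 e1] := h1 a b ab; have [i2 e2] := h2 a b ab.
 split; first exact: RiD.
 by rewrite RintegralD// -e1 -e2; ring.
Qed.

Lemma xac_cst (k : R) : xac (cst k) (cst 0).
Proof.
apply: xac_smooth; [by move=> x; exact: cvg_cst|by move=> x; exact: cvg_cst|].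
by move=> x y; exact: is_derive_cst.
Qed.

Lemma xacDc (f g : P -> R) (k : R) : xac f g -> xac (fun z => f z + k) g.
Proof.
move=> fg; have := xacD fg (xac_cst k).
by rewrite (_ : (fun z => g z + cst 0 z) = g)//; apply/funext => z; rewrite /= addr0.
Qed.

Lemma xacZ (f g : P -> R) (k : R) : xac f g -> xac (fun z => k * f z) (fun z => k * g z).
Proof.
move=> fg; have := xacM (xac_cst k) fg.
by rewrite (_ : (fun z => f z * cst 0 z + cst k z * g z) = (fun z => k * g z))//; apply/funext => z; rewrite /= mulr0 add0r.
Qed.

Lemma xac_comp (p p' : R -> R) (f g : P -> R) : continuous p' ->
 (forall x : R, is_derive x (1 : R) p (p' x)) -> xac f g ->
 xac (fun z => p (f z)) (fun z => p' (f z) * g z).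
Proof.
move=> cp' dp [cf gi fg].
have cp : continuous p.
 by move=> y; apply/differentiable_continuous/derivable1_diffP; exact: ex_derive.
split.
- by move=> z; apply: (@continuous_comp _ _ _ f p); [exact: cf|exact: cp].
- apply: locintMc => // z.
 by apply: (@continuous_comp _ _ _ f p'); [exact: cf|exact: cp'].
- by apply: aeS fg => y h; apply: row_ac_comp => //; exact: continuous_row.
Qed.

Lemma ae_Rintegral (D : set R) (f g : R -> R) : measurable D ->
 mu1.-integrable D (EFin \o f) -> mu1.-integrable D (EFin \o g) ->
 {ae mu1, forall x, D x -> f x = g x} ->
 \int[mu1]_(x in D) f x = \int[mu1]_(x in D) g x.
Proof.
move=> mD fi gi fg; congr fine; apply: ae_eq_integral => //; [exact: measurable_int fi|exact: measurable_int gi|].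
by apply: aeS fg => x h Dx /=; rewrite h.
Qed.

Lemma xac_int (f g : P -> R) a b c d : a <= b -> c <= d -> xac f g ->
 \int[mu2]_(z in cbox a b c d) g z = \int[mu1]_(y in `[c, d]) (f (b, y) - f (a, y)).
Proof.
move=> ab cd [cf [mg gi] fg].
rewrite /cbox Rfubini//; last exact: gi.
apply: ae_Rintegral => //.
- apply: integrable_rows => //; exact: gi.
- by apply: cont_int1 => y; apply: cvgB; exact: continuous_col.
- by apply: aeS fg => y h _; have [_ ->] := h a b ab.
Qed.

Lemma Rint_swap (g : P -> R) a b c d : a <= b -> c <= d ->
 mu2.-integrable (cbox a b c d) (EFin \o g) ->
 \int[mu2]_(z in cbox c d a b) g (swap z) = \int[mu2]_(z in cbox a b c d) g z.
Proof.
move=> ab cd gi; have mg := Rim gi.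
have E : swap @^-1` (cbox a b c d) = cbox c d a b.
 by apply/seteqP; split=> -[x y] [].
have mE : measurable (cbox a b c d) by exact: mcbox.
congr fine; rewrite [LHS]integralE [RHS]integralE; congr (_ - _)%E.
 rewrite [RHS]integral_swap//; last by apply: measurable_funepos; exact/measurable_EFinP.
 by rewrite E; apply: eq_integral => z _; rewrite !funeposE.
rewrite [RHS]integral_swap//; last by apply: measurable_funeneg; exact/measurable_EFinP.
by rewrite E; apply: eq_integral => z _; rewrite !funenegE.
Qed.

Lemma locint_swap (g : P -> R) : locint g -> locint (g \o swap).
Proof.
move=> [mg gi]; split; first by apply: measurableT_comp => //; exact: measurable_swap.
move=> a b c d ab cd; have := gi c d a b cd ab => /integrableP[_ goo].
apply/integrableP; split.
 by apply/measurable_EFinP; apply: measurable_funTS; apply: measurableT_comp => //; exact: measurable_swap.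
apply: le_lt_trans goo; rewrite [leRHS]integral_swap//.
- by rewrite (_ : swap @^-1` _ = cbox a b c d)//; apply/seteqP; split=> -[x y] [].
- exact: mcbox.
- by apply/measurable_EFinP; apply: measurableT_comp => //; exact: measurable_funTS.
Qed.

Definition yac (f g : P -> R) := xac (f \o swap) (g \o swap).

Lemma yac_box f g : yac f g -> locint g.
Proof.
move=> [_ /locint_swap + _].
by rewrite (_ : (g \o swap) \o swap = g)//; apply/funext => -[x y].
Qed.

Lemma yac_int (f g : P -> R) a b c d : a <= b -> c <= d -> yac f g ->
 \int[mu2]_(z in cbox a b c d) g z = \int[mu1]_(x in `[a, b]) (f (x, d) - f (x, c)).
Proof.
move=> ab cd fg; rewrite -Rint_swap//; last exact: (yac_box fg).2.
exact: (xac_int cd ab fg).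
Qed.

(** Averaging over the height: if every row with property Q exceeded the mean by the margin,
    integration would give [I + e <= I]. *)
Lemma good_row (h : P -> R) (Q : R -> Prop) a b c d e : a <= b -> c < d -> 0 < e ->
 mu2.-integrable (cbox a b c d) (EFin \o h) -> {ae mu1, forall y, Q y} ->
 exists y, [/\ c <= y <= d, Q y &
  (d - c) * \int[mu1]_(x in `[a, b]) h (x, y) <= \int[mu2]_(z in cbox a b c d) h z + e].
Proof.
move=> ab cd e0 hi aQ; apply: contrapT => H.
set I := \int[mu2]_(z in cbox a b c d) h z in H.
have dc : 0 < d - c by rewrite subr_gt0.
have cdW := ltW cd.
have i1 := @integrable_rows _ _ _ (measurable_itv `[a, b]) (measurable_itv `[c, d]) h hi.
have i2 : mu1.-integrable `[c, d] (EFin \o (cst ((I + e) / (d - c)))).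
 by apply: cont_int1 => x; exact: cvg_cst.
(* The maximum with the threshold turns a lower bound valid almost everywhere into one valid at
   every height. *)
have i3 : mu1.-integrable `[c, d] (EFin \o (fun y => Num.max (\int[mu1]_(x in `[a, b]) h (x, y)) ((I + e) / (d - c)))).
 apply: (@Rile _ _ _ _ _ _ _ (fun y => `|\int[mu1]_(x in `[a, b]) h (x, y)| + `|(I + e) / (d - c)|)) => //.
 - by apply: measurable_maxr; [exact: Rim i1|exact: measurable_cst].
 - move=> y _; rewrite /Num.max; case: ifP => _; [by rewrite lerDr|by rewrite lerDl].
 - by apply: RiD => //; apply: RiN.
have : I + e <= I; last by rewrite gerDl leNgt e0.
rewrite {2}/I Rfubini//.
rewrite (@ae_Rintegral _ _ (fun y => Num.max (\int[mu1]_(x in `[a, b]) h (x, y)) ((I + e) / (d - c))))//; last first.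
 apply: aeS aQ => y Qy; rewrite /= in_itv /= => ycd.
 apply/esym/max_idPl; rewrite leNgt; apply/negP => h1; apply: H; exists y; split => //.
 by rewrite mulrC -ler_pdivlMr// ltW.
apply: (@le_trans _ _ (\int[mu1]_(y in `[c, d]) (cst ((I + e) / (d - c)) y))).
 by rewrite Rintegral_cst// mu1_itvcc// divfK// gt_eqF.
by apply: le_Rintegral => // y _; rewrite le_max lexx orbT.
Qed.

End plane_calculus.

(** * Additivity over boxes, Cauchy inequality, variation along a line *)

Section box_additivity.
Variable R : realType.
Local Notation P := (R * R)%type.
Local Notation mu1 := (@lbm R).
Local Notation mu2 := (@lbm R \x @lbm R)%E.
Implicit Types (h : P -> R) (a b c d : R).

Lemma box_splity h a b c m d : a <= b -> c <= m -> m <= d -> locint h ->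
 \int[mu2]_(z in cbox a b c d) h z =
 \int[mu2]_(z in cbox a b c m) h z + \int[mu2]_(z in cbox a b m d) h z.
Proof.
move=> ab cm md [_ hi]; rewrite /cbox !Rfubini//; [|exact: hi|exact: hi|by apply: hi => //; exact: le_trans md].
apply: Rint_cat => //; apply: integrable_rows => //; apply: hi => //; exact: le_trans md.
Qed.

Lemma box_mono h (D : set P) a b c d : a <= b -> c <= d -> locint h ->
 (forall z, 0 <= h z) -> measurable D -> D `<=` cbox a b c d ->
 \int[mu2]_(z in D) h z <= \int[mu2]_(z in cbox a b c d) h z.
Proof.
move=> ab cd [mh hi] h0 mD DB.
have hB := hi a b c d ab cd; have hD := integrableS (@mcbox _ a b c d) mD DB hB.
apply: fine_le; [exact: (integrable_fin_num mD hD)|exact: (integrable_fin_num (@mcbox _ a b c d) hB)|].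
apply: ge0_subset_integral => //; first exact: mcbox.
 by apply/measurable_EFinP; exact: measurable_funTS.
by move=> z _; rewrite lee_fin.
Qed.

Lemma box_ge0 h (D : set P) : (forall z, 0 <= h z) -> 0 <= \int[mu2]_(z in D) h z.
Proof. by move=> h0; apply: Rintegral_ge0. Qed.

(** Only the bottom and top strips of the annulus are counted, at full width: these are the strips
    where rows are chosen. The vertical strips come from the same lemma after [swap]. *)
Lemma box_annulus h a a' b' b c c' d' d : a <= a' -> a' <= b' -> b' <= b ->
 c <= c' -> c' <= d' -> d' <= d -> locint h -> (forall z, 0 <= h z) ->
 \int[mu2]_(z in cbox a b c c') h z + \int[mu2]_(z in cbox a b d' d) h z +
 \int[mu2]_(z in cbox a' b' c' d') h z <= \int[mu2]_(z in cbox a b c d) h z.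
Proof.
move=> h1 h2 h3 h4 h5 h6 hi h0.
have ab : a <= b by lra.
rewrite (@box_splity h a b c c' d)//; last lra.
rewrite (@box_splity h a b c' d' d)//.
rewrite -!addrA lerD2l addrC lerD2r; apply: box_mono => //; first exact: mcbox.
move=> z []; rewrite /= !in_itv /= => /andP[z1 z2] /andP[z3 z4].
by split; rewrite /= in_itv /=; apply/andP; split; lra.
Qed.

Lemma good_col h (Q : R -> Prop) a b c d e : a < b -> c <= d -> 0 < e ->
 locint h -> {ae mu1, forall x, Q x} ->
 exists x, [/\ a <= x <= b, Q x &
  (b - a) * \int[mu1]_(y in `[c, d]) h (x, y) <= \int[mu2]_(z in cbox a b c d) h z + e].
Proof.
move=> ab cd e0 hi aQ; have hs := locint_swap hi.
have [x [xab Qx H]] := @good_row _ (h \o swap) Q c d a b e cd ab e0 (hs.2 c d a b cd (ltW ab)) aQ.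
by exists x; split => //; rewrite -(Rint_swap (ltW ab) cd (hi.2 _ _ _ _ (ltW ab) cd)).
Qed.

(** Cauchy-Schwarz in the form 2 |h| <= l + h^2 / l with a weight l chosen at each use, so that no
    square root of an integral appears. *)
Lemma box_cauchy h a b c d l : a <= b -> c <= d -> 0 < l -> locint h ->
 locint (fun z => h z ^+ 2) ->
 \int[mu2]_(z in cbox a b c d) `|h z| <=
  (l * ((b - a) * (d - c)) + l^-1 * \int[mu2]_(z in cbox a b c d) h z ^+ 2) / 2.
Proof.
move=> ab cd l0 [_ hi] [_ h2i].
have i1 := hi a b c d ab cd; have i2 := h2i a b c d ab cd.
have mB : measurable (cbox a b c d) by exact: mcbox.
have i0 : mu2.-integrable (cbox a b c d) (EFin \o (cst l : P -> R)).
 by apply: (@cont_int2 _ _ _ a b c d) => // x; exact: cvg_cst.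
have -> : (l * ((b - a) * (d - c)) + l^-1 * \int[mu2]_(z in cbox a b c d) h z ^+ 2) / 2 =
 \int[mu2]_(z in cbox a b c d) (2^-1 * (cst l z + l^-1 * h z ^+ 2)).
 have i3 := RiZ mB l^-1 i2.
 rewrite RintegralZl//; last exact: RiD.
 rewrite RintegralD// RintegralZl// (_ : \int[mu2]_(z in cbox a b c d) cst l z = l * ((b - a) * (d - c))).
  by rewrite mulrC.
 by rewrite Rintegral_cst//= mu_cbox.
apply: le_Rintegral => //; first exact: RiN.
 by apply: RiZ => //; apply: RiD => //; exact: RiZ.
move=> z _ /=; rewrite -(real_normK (num_real (h z))).
rewrite ler_pdivlMl// -subr_ge0.
have -> : l + l^-1 * `|h z| ^+ 2 - 2 * `|h z| = l^-1 * (`|h z| - l) ^+ 2.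
 by field; rewrite gt_eqF.
by rewrite mulr_ge0 ?sqr_ge0// invr_ge0 ltW.
Qed.

Lemma row_bound (f g : R -> R) a b x x' : row_ac f g -> a <= x -> x <= b -> a <= x' -> x' <= b ->
 `|f x - f x'| <= \int[mu1]_(t in `[a, b]) `|g t|.
Proof.
move=> fg ax xb ax' xb'.
have [gi _] := fg a b (le_trans ax xb).
have H p q : a <= p -> p <= q -> q <= b -> `|f q - f p| <= \int[mu1]_(t in `[a, b]) `|g t|.
 move=> ap pq qb; have [gi' ->] := fg p q pq.
 apply: le_trans (le_normr_Rintegral _ gi') _ => //.
 have sub : `[p, q]%classic `<=` (`[a, b]%classic : set R).
  by move=> y; rewrite /= !in_itv /= => /andP[y1 y2]; apply/andP; split; lra.
 apply: fine_le; [exact: (integrable_fin_num (measurable_itv _) (RiN gi'))|exact: (integrable_fin_num (measurable_itv _) (RiN gi))|].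
 apply: ge0_subset_integral => //; first by apply/measurable_EFinP; apply: Rim; exact: RiN gi.
by have [h|h] := leP x x'; [rewrite distrC|]; apply: H => //; exact: ltW.
Qed.

End box_additivity.

(** * Segments and rays in the image cross images of rectangle boundaries *)

Section homeomorphism_hits.
Variable R : realType.
Local Notation P := (R * R)%type.

Definition rect (x1 x2 y1 y2 : R) (z : P) := (x1 <= z.1 <= x2) && (y1 <= z.2 <= y2).
Definition rect_bd (x1 x2 y1 y2 : R) (z : P) := rect x1 x2 y1 y2 z /\
 (z.1 = x1 \/ z.1 = x2 \/ z.2 = y1 \/ z.2 = y2).

(** Its sign separates the rectangle from the outside and its zeros lie on the boundary, so the
    intermediate value theorem detects a crossing. *)
Definition gauge (x1 x2 y1 y2 : R) (z : P) : R :=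
 Num.max (Num.max (x1 - z.1) (z.1 - x2)) (Num.max (y1 - z.2) (z.2 - y2)).

Lemma continuous_maxr (f g : P -> R) : continuous f -> continuous g ->
 continuous (fun z => Num.max (f z) (g z)).
Proof. by move=> cf cg z; apply: continuous_max; [exact: cf|exact: cg]. Qed.

Lemma gauge_continuous x1 x2 y1 y2 : continuous (gauge x1 x2 y1 y2).
Proof.
have c1 : continuous (fun z : P => z.1) by move=> z; exact: cvg_fst.
have c2 : continuous (fun z : P => z.2) by move=> z; exact: cvg_snd.
by apply: continuous_maxr; apply: continuous_maxr => z;
 apply: cvgB; try exact: cvg_cst; try exact: c1; exact: c2.
Qed.

Lemma gauge_le0 x1 x2 y1 y2 z : (gauge x1 x2 y1 y2 z <= 0) = rect x1 x2 y1 y2 z.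
Proof. by rewrite /gauge /rect !ge_max !subr_le0. Qed.

Lemma gauge_eq0 x1 x2 y1 y2 z : gauge x1 x2 y1 y2 z = 0 -> rect_bd x1 x2 y1 y2 z.
Proof.
move=> E; split; first by rewrite -gauge_le0 E.
move: E; rewrite /gauge /Num.max; do 3?[case: ifP => _]; move=> /eqP; rewrite subr_eq0 => /eqP E;
 [do 3 right|do 2 right; left|right; left|left]; by rewrite E.
Qed.

Variables (f g : P -> P).
Hypotheses (fK : cancel f g) (gK : cancel g f) (cf : continuous f) (cg : continuous g).

Definition seg (w0 w1 : P) (t : R) : P := (w0.1 + t * (w1.1 - w0.1), w0.2 + t * (w1.2 - w0.2)).

Lemma seg_continuous w0 w1 : continuous (seg w0 w1).
Proof.
have c (p q : R) : continuous (fun t : R => p + t * q).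
 by move=> t; apply: cvgD; [exact: cvg_cst|apply: cvgM; [exact: cvg_id|exact: cvg_cst]].
move=> t; apply/cvg_ballP => e e0; near=> s; split => /=; near: s.
 by have /cvg_ballP := c w0.1 (w1.1 - w0.1) t; apply.
by have /cvg_ballP := c w0.2 (w1.2 - w0.2) t; apply.
Unshelve. all: by end_near. Qed.

Lemma seg_hit (G : P -> R) (w0 w1 : P) : continuous G -> G (g w0) <= 0 -> 0 <= G (g w1) ->
 exists t z, [/\ 0 <= t <= 1, G z = 0 & f z = seg w0 w1 t].
Proof.
move=> cG h0 h1.
pose k t := G (g (seg w0 w1 t)).
have ck : continuous k.
 move=> t; apply: (@continuous_comp _ _ _ (fun t => g (seg w0 w1 t)) G); last exact: cG.
 by apply: (@continuous_comp _ _ _ (seg w0 w1) g); [exact: seg_continuous|exact: cg].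
have k0 : k 0 = G (g w0).
 by rewrite /k /seg !mul0r !addr0; case: (w0).
have k1 : k 1 = G (g w1).
 by rewrite /k /seg !mul1r (addrC w0.1) (addrC w0.2) !subrK; case: (w1).
have [|t t01 kt] := @IVT R k 0 1 0 ler01 (continuous_subspaceT ck).
 by rewrite k0 k1 ge_min le_max h0 h1 orbT.
exists t, (g (seg w0 w1 t)); split; [by rewrite in_itv in t01|exact: kt|exact: gK].
Qed.

Lemma rect_hit x1 x2 y1 y2 z0 w : rect x1 x2 y1 y2 z0 -> ~~ rect x1 x2 y1 y2 (g w) ->
 exists t z, [/\ 0 <= t <= 1, rect_bd x1 x2 y1 y2 z & f z = seg (f z0) w t].
Proof.
move=> h0 h1.
have [||t [z [t01 Gz fz]]] := @seg_hit (gauge x1 x2 y1 y2) (f z0) w (@gauge_continuous _ _ _ _).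
- by rewrite fK gauge_le0.
- by apply: ltW; rewrite ltNge gauge_le0.
by exists t, z; split => //; exact: gauge_eq0.
Qed.

Lemma bounded_on_box a b c d : exists2 M, 0 < M & forall z, cbox a b c d z -> `|f z| <= M.
Proof.
have c1 : continuous (fun z => (f z).1).
 by move=> z; apply: (@continuous_comp _ _ _ f fst); [exact: cf|exact: cvg_fst].
have c2 : continuous (fun z => (f z).2).
 by move=> z; apply: (@continuous_comp _ _ _ f snd); [exact: cf|exact: cvg_snd].
have [M1 [M10 H1]] := bounded_on_compact c1 (@compact_cbox _ a b c d).
have [M2 [M20 H2]] := bounded_on_compact c2 (@compact_cbox _ a b c d).
exists (M1 + M2); first by rewrite addr_gt0.
move=> z Bz; rewrite norm_le2; apply/andP; split.
 by apply: le_trans (H1 _ Bz) _; lra.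
by apply: le_trans (H2 _ Bz) _; lra.
Qed.

(** The image of the rectangle is bounded, so the ray, pulled back by [g], must leave the rectangle.
    This is the topological input of the whole proof, standing in for invariance of domain. *)
Lemma ray_hit x1 x2 y1 y2 z0 (e : P) : rect x1 x2 y1 y2 z0 -> e != 0 ->
 exists t z, [/\ 0 <= t, rect_bd x1 x2 y1 y2 z & f z = ((f z0).1 + t * e.1, (f z0).2 + t * e.2)].
Proof.
move=> h0 e0.
have [M M0 HM] := bounded_on_box x1 x2 y1 y2.
have en0 : 0 < `|e| by rewrite normr_gt0.
pose T := (2 * M + 1) / `|e|.
have T0 : 0 < T by rewrite divr_gt0//; lra.
pose w : P := ((f z0).1 + T * e.1, (f z0).2 + T * e.2).
have inB z : rect x1 x2 y1 y2 z -> cbox x1 x2 y1 y2 z.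
 by move=> /andP[? ?]; split; rewrite /= in_itv.
have wout : ~~ rect x1 x2 y1 y2 (g w).
 apply/negP => /inB /HM; rewrite gK => wM.
 have fz0M := HM _ (inB _ h0).
 have : `|T *: e| <= 2 * M.
  have -> : T *: e = w - f z0 by apply/pair_equal_spec; split => /=; rewrite addrAC subrr add0r.
  by apply: le_trans (ler_normB _ _) _; lra.
 by rewrite normrZ (gtr0_norm T0) /T divfK ?gt_eqF//; lra.
have [t [z [/andP[t0 t1] bz fz]]] := rect_hit h0 wout.
exists (t * T), z; split => //; first by rewrite mulr_ge0// ltW.
by rewrite fz /seg /w /=; congr (_, _); ring.
Qed.

End homeomorphism_hits.

(** * Length-area estimate on square annuli *)

Section oscillation.
Variable R : realType.
Local Notation P := (R * R)%type.
Local Notation mu1 := (@lbm R).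
Local Notation mu2 := (@lbm R \x @lbm R)%E.

Record grad2 (p px py : P -> R) : Prop := Grad2 {
 grad2_x : xac p px;
 grad2_y : yac p py;
 grad2_xx : locint (fun z => px z ^+ 2);
 grad2_yy : locint (fun z => py z ^+ 2) }.

Definition energy (px py : P -> R) (D : set P) : R :=
 \int[mu2]_(z in D) (px z ^+ 2 + py z ^+ 2).

Lemma energy_locint p px py : grad2 p px py ->
 locint (fun z => px z ^+ 2 + py z ^+ 2).
Proof. by case=> *; exact: locintD. Qed.

(** Rectangles instead of concentric squares, since the four sides will be chosen independently
    among good rows and good columns. *)
Definition varies_around (p : P -> R) (c : P) (r w : R) :=
 forall x1 x2 y1 y2, c.1 - r <= x1 <= c.1 - r / 2 -> c.1 + r / 2 <= x2 <= c.1 + r ->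
   c.2 - r <= y1 <= c.2 - r / 2 -> c.2 + r / 2 <= y2 <= c.2 + r ->
   exists z z', [/\ rect_bd x1 x2 y1 y2 z, rect_bd x1 x2 y1 y2 z' & w <= `|p z - p z'|].

(** A good row in each horizontal strip and a good column in each vertical strip bound a rectangle.
    The variation of [p] on its boundary is controlled by four line integrals, each at most the
    average over its strip up to e. *)
Lemma annulus_sides (p px py : P -> R) (c : P) (r w : R) : grad2 p px py -> 0 < r -> 0 <= w ->
 varies_around p c r w ->
 w * (r / 2) <= 2 * (
  \int[mu2]_(z in cbox (c.1 - r) (c.1 + r) (c.2 - r) (c.2 - r / 2)) `|px z| +
  \int[mu2]_(z in cbox (c.1 - r) (c.1 + r) (c.2 + r / 2) (c.2 + r)) `|px z| +
  \int[mu2]_(z in cbox (c.1 - r) (c.1 - r / 2) (c.2 - r) (c.2 + r)) `|py z| +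
  \int[mu2]_(z in cbox (c.1 + r / 2) (c.1 + r) (c.2 - r) (c.2 + r)) `|py z|).
Proof.
move=> [px_ac py_ac pxx pyy] r0 w0 H.
have px_bi := xac_box px_ac; have py_bi := yac_box py_ac.
have r20 : 0 < r / 2 by rewrite divr_gt0.
have nx : locint (fun z => `|px z|).
 split; first by apply: measurableT_comp => //; exact: px_bi.1.
 by move=> *; apply: RiN; exact: px_bi.2.
have ny : locint (fun z => `|py z|).
 split; first by apply: measurableT_comp => //; exact: py_bi.1.
 by move=> *; apply: RiN; exact: py_bi.2.
set c1 := c.1; set c2 := c.2.
pose IB h := \int[mu2]_(z in cbox (c1 - r) (c1 + r) (c2 - r) (c2 - r / 2)) h z.
pose IT h := \int[mu2]_(z in cbox (c1 - r) (c1 + r) (c2 + r / 2) (c2 + r)) h z.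
pose IL h := \int[mu2]_(z in cbox (c1 - r) (c1 - r / 2) (c2 - r) (c2 + r)) h z.
pose IR h := \int[mu2]_(z in cbox (c1 + r / 2) (c1 + r) (c2 - r) (c2 + r)) h z.
have step e : 0 < e -> w * (r / 2) <= 2 * (IB (fun z => `|px z|) + IT (fun z => `|px z|) + IL (fun z => `|py z|) + IR (fun z => `|py z|) + 4 * e).
 move=> e0.
 have l1 : c1 - r <= c1 + r by lra.
 have l2 : c2 - r <= c2 + r by lra.
 have l3 : c2 - r < c2 - r / 2 by lra.
 have l4 : c2 + r / 2 < c2 + r by lra.
 have l5 : c1 - r < c1 - r / 2 by lra.
 have l6 : c1 + r / 2 < c1 + r by lra.
 have [y1 [y1in Q1 B1]] := good_row l1 l3 e0 (nx.2 _ _ _ _ l1 (ltW l3)) (xac_row px_ac).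
 have [y2 [y2in Q2 B2]] := good_row l1 l4 e0 (nx.2 _ _ _ _ l1 (ltW l4)) (xac_row px_ac).
 have [x1 [x1in Q3 B3]] := good_col l5 l2 e0 ny (xac_row py_ac).
 have [x2 [x2in Q4 B4]] := good_col l6 l2 e0 ny (xac_row py_ac).
 rewrite -/(IB _) in B1; rewrite -/(IT _) in B2; rewrite -/(IL _) in B3; rewrite -/(IR _) in B4.
 have [z [z' [bz bz' wz]]] := H x1 x2 y1 y2 x1in x2in y1in y2in.
 set sB := \int[mu1]_(x in `[c1 - r, c1 + r]) `|px (x, y1)| in B1.
 set sT := \int[mu1]_(x in `[c1 - r, c1 + r]) `|px (x, y2)| in B2.
 set sL := \int[mu1]_(y in `[c2 - r, c2 + r]) `|py (x1, y)| in B3.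
 set sR := \int[mu1]_(y in `[c2 - r, c2 + r]) `|py (x2, y)| in B4.
 have sB0 : 0 <= sB by apply: Rintegral_ge0.
 have sT0 : 0 <= sT by apply: Rintegral_ge0.
 have sL0 : 0 <= sL by apply: Rintegral_ge0.
 have sR0 : 0 <= sR by apply: Rintegral_ge0.
 move: (x1in) (x2in) (y1in) (y2in) => /andP[a1 a2] /andP[a3 a4] /andP[a5 a6] /andP[a7 a8].
 have rb1 x x' : x1 <= x <= x2 -> x1 <= x' <= x2 -> `|p (x, y1) - p (x', y1)| <= sB.
  move=> /andP[u1 u2] /andP[u3 u4].
  by apply: (row_bound (a := c1 - r) (b := c1 + r) Q1); move: a1 a4 u1 u2 u3 u4; clear; lra.
 have rb2 x x' : x1 <= x <= x2 -> x1 <= x' <= x2 -> `|p (x, y2) - p (x', y2)| <= sT.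
  move=> /andP[u1 u2] /andP[u3 u4].
  by apply: (row_bound (a := c1 - r) (b := c1 + r) Q2); move: a1 a4 u1 u2 u3 u4; clear; lra.
 have rb3 y y' : y1 <= y <= y2 -> y1 <= y' <= y2 -> `|p (x1, y) - p (x1, y')| <= sL.
  move=> /andP[u1 u2] /andP[u3 u4].
  by apply: (row_bound (a := c2 - r) (b := c2 + r) Q3); move: a5 a8 u1 u2 u3 u4; clear; lra.
 have rb4 y y' : y1 <= y <= y2 -> y1 <= y' <= y2 -> `|p (x2, y) - p (x2, y')| <= sR.
  move=> /andP[u1 u2] /andP[u3 u4].
  by apply: (row_bound (a := c2 - r) (b := c2 + r) Q4); move: a5 a8 u1 u2 u3 u4; clear; lra.
 have x12 : x1 <= x2 by move: a2 a3 r20; clear; lra.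
 have y12 : y1 <= y2 by move: a6 a7 r20; clear; lra.
 (* Every boundary point is joined to the corner (x2, y2) along at most two sides. *)
 have corner q : rect_bd x1 x2 y1 y2 q -> `|p q - p (x2, y2)| <= sB + sT + sL + sR.
  case: q => x y [/= /andP[/= xx yy]] [->|[->|[->|->]]].
  - have h1 := rb3 y y2 yy; have h2 := rb2 x1 x2.
   rewrite !lexx y12 x12 in h1 h2.
   rewrite -(subrKA (p (x1, y2))); apply: le_trans (ler_normD _ _) _.
   by move: (h1 isT) (h2 isT isT) sB0 sT0 sL0 sR0; clear; lra.
  - have := rb4 y y2 yy; rewrite lexx y12 => /(_ isT); move: sB0 sT0 sL0; clear; lra.
  - have h1 := rb1 x x2 xx; have h2 := rb4 y1 y2.
   rewrite !lexx y12 x12 in h1 h2.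
   rewrite -(subrKA (p (x2, y1))); apply: le_trans (ler_normD _ _) _.
   by move: (h1 isT) (h2 isT isT) sB0 sT0 sL0 sR0; clear; lra.
  - have := rb2 x x2 xx; rewrite lexx x12 => /(_ isT); move: sB0 sR0 sL0; clear; lra.
 have wS : w <= 2 * (sB + sT + sL + sR).
  apply: (le_trans wz); rewrite -(subrKA (p (x2, y2))); apply: le_trans (ler_normD _ _) _.
  by move: (corner _ bz) (corner _ bz'); rewrite (distrC (p z')); clear; lra.
 have e1 : c2 - r / 2 - (c2 - r) = r / 2 by field.
 have e2 : c2 + r - (c2 + r / 2) = r / 2 by field.
 have e3 : c1 - r / 2 - (c1 - r) = r / 2 by field.
 have e4 : c1 + r - (c1 + r / 2) = r / 2 by field.
 rewrite e1 in B1; rewrite e2 in B2; rewrite e3 in B3; rewrite e4 in B4.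
 apply: le_trans (ler_wpM2r (ltW r20) wS) _.
 by rewrite mulrAC -mulrA ler_pM2l//; move: B1 B2 B3 B4; clear; lra.
apply/ler_addgt0Pr => e e0; have e80 : 0 < e / 8 by rewrite divr_gt0.
by apply: le_trans (step _ e80) _; rewrite -/(IB _) -/(IT _) -/(IL _) -/(IR _); lra.
Qed.

(** Rows only see [px] and columns only [py], so the corner squares, which lie in two strips, are
    not counted twice for the same derivative. *)
Lemma annulus_energy (p px py : P -> R) (c : P) (r : R) : grad2 p px py -> 0 < r ->
  \int[mu2]_(z in cbox (c.1 - r) (c.1 + r) (c.2 - r) (c.2 - r / 2)) px z ^+ 2 +
  \int[mu2]_(z in cbox (c.1 - r) (c.1 + r) (c.2 + r / 2) (c.2 + r)) px z ^+ 2 +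
  \int[mu2]_(z in cbox (c.1 - r) (c.1 - r / 2) (c.2 - r) (c.2 + r)) py z ^+ 2 +
  \int[mu2]_(z in cbox (c.1 + r / 2) (c.1 + r) (c.2 - r) (c.2 + r)) py z ^+ 2 <=
 energy px py (sqr_at c r) - energy px py (sqr_at c (r / 2)).
Proof.
move=> [_ _ pxx pyy] r0; rewrite /energy /sqr_at.
have l1 : c.1 - r <= c.1 + r by lra.
have l2 : c.2 - r <= c.2 + r by lra.
have l3 : c.1 - r <= c.1 - r / 2 by lra.
have l4 : c.1 + r / 2 <= c.1 + r by lra.
have l5 : c.1 - r / 2 <= c.1 + r / 2 by lra.
have l6 : c.2 - r / 2 <= c.2 + r / 2 by lra.
have l7 : c.2 - r <= c.2 - r / 2 by lra.
have l8 : c.2 + r / 2 <= c.2 + r by lra.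
have E2 a b c' d : a <= b -> c' <= d -> \int[mu2]_(z in cbox a b c' d) (px z ^+ 2 + py z ^+ 2) =
  \int[mu2]_(z in cbox a b c' d) (px z ^+ 2) + \int[mu2]_(z in cbox a b c' d) (py z ^+ 2).
 by move=> ab cd; rewrite RintegralD//; [exact: mcbox|exact: pxx.2|exact: pyy.2].
rewrite !E2//.
have sq0 (h : P -> R) z : 0 <= h z ^+ 2 by exact: sqr_ge0.
have A1 : _ := @box_annulus _ (fun z => px z ^+ 2) (c.1 - r) (c.1 - r / 2) (c.1 + r / 2) (c.1 + r) (c.2 - r) (c.2 - r / 2) (c.2 + r / 2) (c.2 + r) _ _ _ _ _ _ pxx (sq0 px).
have A2 : _ := @box_annulus _ ((fun z => py z ^+ 2) \o swap) (c.2 - r) (c.2 - r / 2) (c.2 + r / 2) (c.2 + r) (c.1 - r) (c.1 - r / 2) (c.1 + r / 2) (c.1 + r) _ _ _ _ _ _ (locint_swap pyy) (fun z => sq0 py (swap z)).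
have S a b c' d : a <= b -> c' <= d -> \int[mu2]_(z in cbox c' d a b) ((fun z => py z ^+ 2) \o swap) z =
  \int[mu2]_(z in cbox a b c' d) py z ^+ 2.
 by move=> ab cd; exact: (Rint_swap ab cd (pyy.2 _ _ _ _ ab cd)).
have {}A1 := A1 l3 l5 l4 l7 l6 l8; have {}A2 := A2 l7 l6 l8 l3 l5 l4.
rewrite (S _ _ _ _ l3 l2) (S _ _ _ _ l4 l2) (S _ _ _ _ l5 l6) (S _ _ _ _ l1 l2) in A2.
move: A1 A2; clear; lra.
Qed.

Lemma annulus_osc (p px py : P -> R) (c : P) (r w : R) : grad2 p px py -> 0 < r -> 0 <= w ->
 varies_around p c r w ->
 w ^+ 2 <= 64 * (energy px py (sqr_at c r) - energy px py (sqr_at c (r / 2))).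
Proof.
move=> G r0 w0 H; have := annulus_sides G r0 w0 H; have := annulus_energy c G r0.
set c1 := c.1; set c2 := c.2; set EX := energy _ _ _ - _; clearbody EX.
have [px_bi py_bi pxx pyy] : [/\ locint px, locint py, locint (fun z => px z ^+ 2) & locint (fun z => py z ^+ 2)].
 by case: G => gx gy *; split => //; [exact: xac_box gx|exact: yac_box gy].
have l1 : c1 - r <= c1 + r by lra.
have l2 : c2 - r <= c2 + r by lra.
have l3 : c2 - r <= c2 - r / 2 by lra.
have l4 : c2 + r / 2 <= c2 + r by lra.
have l5 : c1 - r <= c1 - r / 2 by lra.
have l6 : c1 + r / 2 <= c1 + r by lra.
have sq0 (h : P -> R) D : 0 <= \int[mu2]_(z in D) h z ^+ 2 by apply: box_ge0 => z; exact: sqr_ge0.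
have ar : (c1 + r - (c1 - r)) * (c2 - r / 2 - (c2 - r)) = r ^+ 2 by field.
have ar2 : (c1 + r - (c1 - r)) * (c2 + r - (c2 + r / 2)) = r ^+ 2 by field.
have ar3 : (c1 - r / 2 - (c1 - r)) * (c2 + r - (c2 - r)) = r ^+ 2 by field.
have ar4 : (c1 + r - (c1 + r / 2)) * (c2 + r - (c2 - r)) = r ^+ 2 by field.
move=> EXe S0.
have [->|wn0] := eqVneq w 0.
 rewrite expr0n /= mulr_ge0//; apply: le_trans EXe.
 by rewrite !addr_ge0.
have wp : 0 < w by rewrite lt_neqAle eq_sym wn0.
(* With this weight the area term equals w r / 4, half of the left-hand side; the other half gives
   the constant 64. *)
pose l := w / (16 * r).
have l0 : 0 < l by rewrite divr_gt0// mulr_gt0.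
have C1 := box_cauchy l1 l3 l0 px_bi pxx.
have C2 := box_cauchy l1 l4 l0 px_bi pxx.
have C3 := box_cauchy l5 l2 l0 py_bi pyy.
have C4 := box_cauchy l6 l2 l0 py_bi pyy.
rewrite ar in C1; rewrite ar2 in C2; rewrite ar3 in C3; rewrite ar4 in C4.
have lV0 : 0 <= l^-1 by rewrite invr_ge0 ltW.
have lE := ler_wpM2l lV0 EXe; rewrite !mulrDr in lE.
have S : w * (r / 2) <= 4 * (l * r ^+ 2) + l^-1 * EX.
 by move: C1 C2 C3 C4 S0 lE; clear; lra.
have lr : l * r ^+ 2 = w * r / 16 by rewrite /l; field; rewrite gt_eqF.
have lV : l^-1 = 16 * r / w by rewrite /l; field; rewrite wn0 gt_eqF.
rewrite lr lV in S.
have {}S : w * r / 4 <= 16 * r / w * EX by move: S; clear; lra.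
have : w * r / 4 * w <= 16 * r / w * EX * w by rewrite ler_pM2r.
rewrite (_ : 16 * r / w * EX * w = 16 * r * EX); last by field.
rewrite (_ : w * r / 4 * w = r * (w ^+ 2 / 4)); last by field.
rewrite (_ : 16 * r * EX = r * (16 * EX)); last by ring.
by rewrite ler_pM2l// => {}S; move: S; clear; lra.
Qed.

End oscillation.

(** * Almost affine behaviour where the derivative is almost constant *)

Section linearization.
Variable R : realType.
Local Notation P := (R * R)%type.
Local Notation mu1 := (@lbm R).
Local Notation mu2 := (@lbm R \x @lbm R)%E.

(** Monotonicity in the sense of Lebesgue: every rectangle around two points sees on its boundary at
    least their difference, which is what [annulus_osc] asks for. *)
Definition rect_mono (p : P -> R) := forall x1 x2 y1 y2 z1 z2,
 rect x1 x2 y1 y2 z1 -> rect x1 x2 y1 y2 z2 ->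
 exists q q', [/\ rect_bd x1 x2 y1 y2 q, rect_bd x1 x2 y1 y2 q' & `|p z1 - p z2| <= `|p q - p q'|].

(** From the image with the larger coordinate runs a ray that increases it, from the other image a
    ray that decreases it; both meet the image of the boundary. *)
Lemma homeo_monotone (f g : P -> P) : cancel f g -> cancel g f -> continuous f -> continuous g ->
 rect_mono (fun z => (f z).1) /\ rect_mono (fun z => (f z).2).
Proof.
move=> fK gK cf cg.
have e1 : ((1, 0) : P) != 0 by rewrite xpair_eqE negb_and oner_eq0.
have e2 : ((0, 1) : P) != 0 by rewrite xpair_eqE negb_and oner_eq0 orbT.
have e3 : ((-1, 0) : P) != 0 by rewrite xpair_eqE negb_and oppr_eq0 oner_eq0.
have e4 : ((0, -1) : P) != 0 by rewrite xpair_eqE negb_and oppr_eq0 oner_eq0 orbT.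
split=> x1 x2 y1 y2 z1 z2.
 wlog le : z1 z2 / (f z2).1 <= (f z1).1.
  move=> W h1 h2; have [le|/ltW le] := leP (f z2).1 (f z1).1; first exact: W.
  by have [q [q' [bq bq' h]]] := W _ _ le h2 h1; exists q, q'; rewrite distrC.
 move=> h1 h2.
 have [t [q [t0 bq fq]]] := ray_hit fK gK cf cg h1 e1.
 have [t' [q' [t0' bq' fq']]] := ray_hit fK gK cf cg h2 e3.
 exists q, q'; split => //; rewrite fq fq' /= !ger0_norm; lra.
wlog le : z1 z2 / (f z2).2 <= (f z1).2.
 move=> W h1 h2; have [le|/ltW le] := leP (f z2).2 (f z1).2; first exact: W.
 by have [q [q' [bq bq' h]]] := W _ _ le h2 h1; exists q, q'; rewrite distrC.
move=> h1 h2.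
have [t [q [t0 bq fq]]] := ray_hit fK gK cf cg h1 e2.
have [t' [q' [t0' bq' fq']]] := ray_hit fK gK cf cg h2 e4.
by exists q, q'; split => //; rewrite fq fq' /= !ger0_norm; lra.
Qed.

Lemma energy_ge0 px py (D : set P) : 0 <= energy px py D.
Proof. by apply: box_ge0 => z; rewrite addr_ge0// sqr_ge0. Qed.

Lemma energy_mono p px py (D : set P) c r : grad2 p px py -> 0 <= r -> measurable D ->
 D `<=` sqr_at c r -> energy px py D <= energy px py (sqr_at c r).
Proof.
move=> G r0 mD DB; apply: box_mono => //; [lra|lra|exact: energy_locint G|].
by move=> z; rewrite addr_ge0// sqr_ge0.
Qed.

(** The Courant-Lebesgue argument: each of n dyadic annuli sees the same difference and their
    energies telescope. The result is a logarithmic modulus of continuity. *)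
Lemma small_osc (p px py : P -> R) c r n z1 z2 : grad2 p px py -> rect_mono p ->
 0 < r -> sqr_at c (r / 2 ^+ n) z1 -> sqr_at c (r / 2 ^+ n) z2 ->
 n%:R * (p z1 - p z2) ^+ 2 <= 64 * energy px py (sqr_at c r).
Proof.
move=> G M r0 h1 h2.
suff H m : (m <= n)%N -> m%:R * (p z1 - p z2) ^+ 2 <=
  64 * (energy px py (sqr_at c r) - energy px py (sqr_at c (r / 2 ^+ m))).
 by apply: (le_trans (H n (leqnn n))); rewrite ler_pM2l// gerBl energy_ge0.
elim: m => [|m IH] mn; first by rewrite mul0r expr0 divr1 subrr mulr0.
have {}IH := IH (ltnW mn).
set s := r / 2 ^+ m in IH *.
have s0 : 0 < s by rewrite divr_gt0// exprn_gt0.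
have sE : r / 2 ^+ m.+1 = s / 2 by rewrite /s exprSr invfM mulrA.
rewrite sE -natr1 mulrDl mul1r.
have sn : r / 2 ^+ n <= s / 2.
 rewrite -sE ler_wpM2l ?(ltW r0)// lef_pV2 ?posrE ?exprn_gt0//.
 by rewrite ler_eXn2l// ltr1n.
have in_sq z : sqr_at c (r / 2 ^+ n) z -> `|z.1 - c.1| <= s / 2 /\ `|z.2 - c.2| <= s / 2.
 move=> /sqr_atP; rewrite norm_le2 /= => /andP[u1 u2].
 by split; [exact: le_trans u1 sn|exact: le_trans u2 sn].
have := @annulus_osc _ p px py c s `|p z1 - p z2| G s0 (normr_ge0 _).
rewrite real_normK ?num_real// => /(_ _)/wrap[|K]; last by move: IH K; clear; lra.
move=> x1 x2 y1 y2 /andP[a1 a2] /andP[a3 a4] /andP[a5 a6] /andP[a7 a8].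
have [u1 u2] := in_sq _ h1; have [u3 u4] := in_sq _ h2.
by apply: M; apply/andP; split; apply/andP; split;
 move: u1 u2 u3 u4; rewrite !ler_distl => /andP[v1 v2] /andP[v3 v4] /andP[v5 v6] /andP[v7 v8];
  move: a1 a2 a3 a4 a5 a6 a7 a8 v1 v2 v3 v4 v5 v6 v7 v8; clear; lra.
Qed.

Lemma grad2_affine (p px py : P -> R) a b : grad2 p px py ->
 grad2 (fun z => p z - (a * z.1 + b * z.2)) (fun z => px z - a) (fun z => py z - b).
Proof.
move=> [gx gy gxx gyy].
have c1 : continuous (fun z : P => z.1) by move=> z; exact: cvg_fst.
have c2 : continuous (fun z : P => z.2) by move=> z; exact: cvg_snd.
have ck (k : R) : continuous (cst k : P -> R) by move=> x; exact: cvg_cst.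
have sq (q : P -> R) (k : R) : locint q -> locint (fun z => q z ^+ 2) ->
  locint (fun z => (q z - k) ^+ 2).
 move=> bq bqq.
 have -> : (fun z => (q z - k) ^+ 2) = (fun z => q z ^+ 2 + (((- 2 * k) * q z) + k ^+ 2)).
  by apply/funext => z; ring.
 apply: locintD => //; apply: locintD; first exact: locintZ.
 by apply: locint_cont => x; exact: cvg_cst.
have lin (a' b' : R) : xac (fun z => - (a' * z.1 + b' * z.2)) (cst (- a')).
 apply: xac_smooth; [|by move=> z; exact: cvg_cst|].
  by move=> z; apply: cvgN; apply: cvgD; apply: cvgM; [exact: cvg_cst|exact: c1|exact: cvg_cst|exact: c2].
 move=> x y /=; apply: is_derive_eq; rewrite /GRing.scale /=; ring.
split.
- exact: (xacD gx (lin a b)).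
- have := xacD gy (lin b a).
 rewrite /yac (_ : (fun z : P => _ + _) = (fun z => p z - (a * z.1 + b * z.2)) \o swap)//.
 by apply/funext => z /=; rewrite (addrC (b * _)).
- by apply: sq => //; exact: xac_box gx.
- by apply: sq => //; exact: yac_box gy.
Qed.

(** First n is taken large, to make the logarithmic modulus small; then [del] is taken small against
    2^n / tau, because rows are sought in strips of relative height tau / 2^n. *)
Lemma near_linear_params (N eta tau : R) : 0 <= N -> 0 < eta -> 0 < tau -> exists n (del : R),
 [/\ (0 < n)%N, 0 < del & [/\ N / n%:R <= (eta / 16) ^+ 2, (2 ^+ n)^-1 <= eta / 16 &
  Num.sqrt del * (2 ^+ n / tau) <= eta / 64 /\ Num.sqrt del <= eta / 64]].
Proof.
move=> N0 e0 t0.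
have p1 : 0 <= N / (eta / 16) ^+ 2 by rewrite divr_ge0// sqr_ge0.
have p2 : 0 <= 16 / eta by rewrite divr_ge0// ltW.
have B1 := archi_boundP p1; have B2 := archi_boundP p2.
set n1 := Num.bound _ in B1; set n2 := Num.bound _ in B2.
clearbody n1 n2; pose n := (n1 + n2).+1.
have nb1 : N / (eta / 16) ^+ 2 <= n%:R.
 by apply/ltW/(lt_le_trans B1); rewrite ler_nat /n -addnS leq_addr.
have nb2 : 16 / eta <= n%:R.
 by apply/ltW/(lt_le_trans B2); rewrite ler_nat /n -addSn leq_addl.
clearbody n.
have n0 : 0 < n%:R :> R by apply: lt_le_trans nb2; rewrite divr_gt0.
have e16 : 0 < eta / 16 by rewrite divr_gt0.
pose q := eta / 64 / (1 + 2 ^+ n / tau).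
have d0 : 0 < 1 + 2 ^+ n / tau by rewrite ltr_wpDr// divr_ge0 ?exprn_ge0// ltW.
have q0 : 0 < q by rewrite !divr_gt0.
have t20 : 0 <= 2 ^+ n / tau by rewrite divr_ge0 ?exprn_ge0// ltW.
exists n, (q ^+ 2); split; [by rewrite -(ltr0n R)|by rewrite exprn_gt0|].
rewrite sqrtr_sqr gtr0_norm//; split.
- by rewrite ler_pdivrMr// mulrC -ler_pdivrMr// exprn_gt0.
- have n2n : n%:R <= 2 ^+ n :> R by rewrite -natrX ler_nat ltnW// ltn_expl.
 rewrite invf_ple ?posrE ?exprn_gt0//; apply: le_trans n2n.
 by rewrite invfM invrK mulrC.
- split; rewrite /q.
  rewrite mulrAC ler_pdivrMr// ler_wpM2l//; first by rewrite divr_ge0// ltW.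
  by rewrite lerDr.
 by rewrite ler_pdivrMr// ler_peMr// ?divr_ge0 ?lerDl// ltW.
Qed.

(** From px^2 <= 2 (px - a)^2 + 2 a^2: the deviation contributes 2, and the linear part, over a
    square of area 4 r^2, contributes 16. *)
Lemma energy_affine_le (p px py : P -> R) c r a b m : grad2 p px py ->
 0 < r -> `|a| <= m -> `|b| <= m ->
 energy (fun z => px z - a) (fun z => py z - b) (sqr_at c r) <= (r * m) ^+ 2 ->
 energy px py (sqr_at c r) <= 18 * (r * m) ^+ 2.
Proof.
move=> G r0 am bm En.
have Ga := grad2_affine a b G.
have l1 : c.1 - r <= c.1 + r by lra.
have l2 : c.2 - r <= c.2 + r by lra.
have mQ : measurable (sqr_at c r) by exact: msqr_at.
have cK : locint (cst (2 * (a ^+ 2 + b ^+ 2)) : P -> R).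
 by apply: locint_cont => x; exact: cvg_cst.
have gb := energy_locint Ga.
have gb2 := locintZ 2 gb.
have g2 := locintD gb2 cK.
have m0 : 0 <= m by exact: le_trans am.
have a2 : a ^+ 2 <= m ^+ 2 by rewrite -(real_normK (num_real a)) ler_sqr ?nnegrE.
have b2 : b ^+ 2 <= m ^+ 2 by rewrite -(real_normK (num_real b)) ler_sqr ?nnegrE.
apply: (@le_trans _ _ (\int[mu2]_(z in sqr_at c r) (2 * ((px z - a) ^+ 2 + (py z - b) ^+ 2) + cst (2 * (a ^+ 2 + b ^+ 2)) z))).
 apply: le_Rintegral => //; [exact: (energy_locint G).2|exact: g2.2|].
 move=> t _ /=; rewrite -subr_ge0.
 rewrite (_ : _ - _ = (px t - 2 * a) ^+ 2 + (py t - 2 * b) ^+ 2); last by ring.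
 by rewrite addr_ge0 ?sqr_ge0.
rewrite RintegralD//; last 2 first.
- exact: gb2.2.
- exact: cK.2.
rewrite RintegralZl//; last exact: gb.2.
rewrite Rintegral_cst//= mu_sqr_at ?(ltW r0)//=.
have r2 : 0 <= r ^+ 2 by exact: sqr_ge0.
have := ler_wpM2r r2 a2; have := ler_wpM2r r2 b2; move: En; rewrite /energy exprMn; clear; lra.
Qed.

Lemma box_cauchy_le (h : P -> R) c r q m : 0 < r -> 0 < q -> 0 < m ->
 locint h -> locint (fun z => h z ^+ 2) ->
 \int[mu2]_(z in sqr_at c r) h z ^+ 2 <= q ^+ 2 * (r * m) ^+ 2 ->
 \int[mu2]_(z in sqr_at c r) `|h z| <= 3 * (q * m) * r ^+ 2.
Proof.
move=> r0 q0 m0 hb hhb hE.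
have l1 : c.1 - r <= c.1 + r by lra.
have l2 : c.2 - r <= c.2 + r by lra.
have qm0 : 0 < q * m by rewrite mulr_gt0.
have ar : (c.1 + r - (c.1 - r)) * (c.2 + r - (c.2 - r)) = 4 * r ^+ 2 by ring.
apply: (le_trans (box_cauchy l1 l2 qm0 hb hhb)); rewrite ar.
have qmV : 0 <= (q * m)^-1 by rewrite invr_ge0 ltW.
have := ler_wpM2l qmV hE.
rewrite (_ : (q * m)^-1 * (q ^+ 2 * (r * m) ^+ 2) = q * m * r ^+ 2); last first.
 by field; rewrite !gt_eqF.
have : 0 <= q * m * r ^+ 2 by rewrite mulr_ge0 ?sqr_ge0// ltW.
by clear; rewrite -/(sqr_at c r); lra.
Qed.

Lemma locint_norm (h : P -> R) : locint h -> locint (fun z => `|h z|).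
Proof.
move=> hb; split; first by apply: measurableT_comp => //; exact: hb.1.
by move=> *; apply: RiN; exact: hb.2.
Qed.

(* A good vertical line and a dense set of good rows control [p] minus its linear
  part; the modulus of continuity of the monotone function [p] does the rest. *)
Lemma near_linear (eta tau : R) : 0 < eta -> 0 < tau < 1 -> exists2 del, 0 < del &
 forall (p px py : P -> R) c r a b m, grad2 p px py -> rect_mono p ->
 0 < r -> 0 < m -> `|a| <= m -> `|b| <= m ->
 energy (fun z => px z - a) (fun z => py z - b) (sqr_at c r) <= del * (r * m) ^+ 2 ->
 forall z z', sqr_at c ((1 - tau) * r) z -> sqr_at c ((1 - tau) * r) z' ->
 `|p z - p z' - (a * (z.1 - z'.1) + b * (z.2 - z'.2))| <= eta * (r * m).
Proof.
move=> e0 /andP[t0 t1].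
(* 1152 = 64 * 18, the product of the constants of [small_osc] and [energy_affine_le]. *)
have [n [del0 [n0 d0 [np1 np2 [np3 np4]]]]] := near_linear_params (ler0n R 1152) e0 t0.
pose del := Num.min del0 1.
have dd : 0 < del by rewrite lt_min d0 ltr01.
exists del => // p px py c r a b m G M r0 m0 am bm En.
set q := Num.sqrt del0 in np3 np4.
have q0 : 0 < q by rewrite sqrtr_gt0.
have qq : del0 = q ^+ 2 by rewrite sqr_sqrtr// ltW.
have rm0 : 0 < r * m by rewrite mulr_gt0.
have Ga := grad2_affine a b G.
set w := fun z => p z - (a * z.1 + b * z.2) in Ga.
have wxb := xac_box (grad2_x Ga); have wyb := yac_box (grad2_y Ga).
have wxx := grad2_xx Ga; have wyy := grad2_yy Ga.
have En1 : energy (fun z => px z - a) (fun z => py z - b) (sqr_at c r) <= q ^+ 2 * (r * m) ^+ 2.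
 by apply: (le_trans En); rewrite -qq ler_wpM2r ?sqr_ge0// ge_min lexx.
have En2 : energy (fun z => px z - a) (fun z => py z - b) (sqr_at c r) <= (r * m) ^+ 2.
 apply: (le_trans En); rewrite -[leRHS]mul1r ler_wpM2r ?sqr_ge0//.
 by rewrite ge_min lexx orbT.
have E3 := energy_affine_le G r0 am bm En2.
have l1 : c.1 - r <= c.1 + r by move: r0; clear; lra.
have l2 : c.2 - r <= c.2 + r by move: r0; clear; lra.
have l1' : c.1 - r < c.1 + r by move: r0; clear; lra.
have mQ : measurable (sqr_at c r) by exact: msqr_at.
have ESx : \int[mu2]_(z in sqr_at c r) (px z - a) ^+ 2 <= q ^+ 2 * (r * m) ^+ 2.
 apply: le_trans En1; apply: le_Rintegral => //; [exact: wxx.2|exact: (energy_locint Ga).2|].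
 by move=> z _; rewrite lerDl sqr_ge0.
have ESy : \int[mu2]_(z in sqr_at c r) (py z - b) ^+ 2 <= q ^+ 2 * (r * m) ^+ 2.
 apply: le_trans En1; apply: le_Rintegral => //; [exact: wyy.2|exact: (energy_locint Ga).2|].
 by move=> z _; rewrite lerDr sqr_ge0.
have Ix := box_cauchy_le r0 q0 m0 wxb wxx ESx.
have Iy := box_cauchy_le r0 q0 m0 wyb wyy ESy.
clear En ESx ESy En1 En2 wxx wyy.
have e1 : 0 < q * m * r ^+ 2 by rewrite !mulr_gt0// exprn_gt0.
have [x0 [x0in Qx0 Bx0]] := good_col l1' l2 e1 (locint_norm wyb) (xac_row (grad2_y Ga)).
rewrite -/(sqr_at c r) in Bx0.
set V := \int[mu1]_(y in `[c.2 - r, c.2 + r]) `|py (x0, y) - b| in Bx0.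
have VE : V <= 2 * (q * m) * r.
 have : 2 * r * V <= 2 * r * (2 * (q * m) * r).
  rewrite (_ : c.1 + r - (c.1 - r) = 2 * r) in Bx0; last by ring.
  by move: Bx0 Iy; clear; lra.
 by rewrite ler_pM2l// mulr_gt0.
(* Every height in the smaller square has a good row within s above it, and on this scale
   [small_osc] makes [p] almost constant. *)
pose s := tau * r / 2 ^+ n.
have s0 : 0 < s by rewrite divr_gt0 ?exprn_gt0// mulr_gt0.
have tr0 : 0 < tau * r by rewrite mulr_gt0.
have str : s <= tau * r by rewrite /s ler_pdivrMr ?exprn_gt0// ler_peMr ?(ltW tr0)// exprn_ege1// ler1n.
have srn : s <= r / 2 ^+ n.
 by rewrite /s ler_wpM2r ?invr_ge0 ?exprn_ge0// ger_pMl// ltW.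
have bs : `|b| * s <= eta / 16 * (r * m).
 apply: (@le_trans _ _ (m * (r / 2 ^+ n))).
  by apply: ler_pM => //; exact: ltW.
 have := ler_wpM2l (ltW rm0) np2; rewrite [m * _]mulrC mulrAC; clear; lra.
have key z : sqr_at c ((1 - tau) * r) z -> exists y, [/\ c.2 - r <= y <= c.2 + r,
  `|w z - w (z.1, y)| <= eta / 8 * (r * m) & `|w (z.1, y) - w (x0, y)| <= eta / 8 * (r * m)].
 move=> /sqr_atP; rewrite norm_le2 /= !ler_distl => /andP[/andP[z1 z2] /andP[z3 z4]].
 have t1r : (1 - tau) * r = r - tau * r by ring.
 rewrite t1r in z1 z2 z3 z4.
 have zs : z.2 < z.2 + s by rewrite ltrDl.
 have y1 : c.2 - r <= z.2 by move: z3 tr0; clear; lra.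
 have y2 : z.2 + s <= c.2 + r by move: z4 str; clear; lra.
 have [y [yin Qy By]] := good_row l1 zs e1 ((locint_norm wxb).2 _ _ _ _ l1 (ltW zs)) (xac_row (grad2_x Ga)).
 have yI : c.2 - r <= y <= c.2 + r.
  by move: yin y1 y2; clear => /andP[? ?] ? ?; apply/andP; split; lra.
 exists y; split => //.
  have h1 : sqr_at z (tau * r / 2 ^+ n) z by apply/sqr_atP; rewrite subrr normr0 ltW.
  have ys : `|y - z.2| <= s.
   by move: yin; clear => /andP[? ?]; rewrite ler_distl; apply/andP; split; lra.
  have h2 : sqr_at z (tau * r / 2 ^+ n) (z.1, y).
   by apply/sqr_atP; rewrite norm_le2 /= subrr normr0 (ltW s0) /=.
  have sm := small_osc G M tr0 h1 h2.
  have sub : sqr_at z (tau * r) `<=` sqr_at c r.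
   move=> t /sqr_atP; rewrite norm_le2 /= !ler_distl => /andP[/andP[t2 t3] /andP[t4 t5]].
   by apply/sqr_atP; rewrite norm_le2 /= !ler_distl; move: z1 z2 z3 z4 t2 t3 t4 t5; clear => *; apply/andP; split; apply/andP; split; lra.
  have E1 := energy_mono G (ltW r0) (@msqr_at _ z (tau * r)) sub.
  have pz : `|p z - p (z.1, y)| <= eta / 16 * (r * m).
   rewrite -ler_sqr ?nnegrE// ?mulr_ge0 ?divr_ge0 ?(ltW e0) ?(ltW r0) ?(ltW m0)//.
   rewrite real_normK ?num_real// exprMn.
   apply: le_trans (ler_wpM2r (sqr_ge0 _) np1).
   rewrite mulrAC ler_pdivlMr ?ltr0n// mulrC.
   by move: sm E1 E3; clear; lra.
  have -> : w z - w (z.1, y) = (p z - p (z.1, y)) + b * (y - z.2) by rewrite /w /=; ring.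
  apply: (le_trans (ler_normD _ _)); rewrite normrM.
  have := ler_wpM2l (normr_ge0 b) ys.
  by move: pz bs; clear; lra.
 have [xI1 xI2] := andP x0in.
 have zI1 : c.1 - r <= z.1 by move: z1 tr0; clear; lra.
 have zI2 : z.1 <= c.1 + r by move: z2 tr0; clear; lra.
 apply: (le_trans (row_bound Qy zI1 zI2 xI1 xI2)).
 have : s * (\int[mu1]_(x in `[c.1 - r, c.1 + r]) `|px (x, y) - a|) <= s * (eta / 8 * (r * m)).
  rewrite (_ : z.2 + s - z.2 = s) in By; last by ring.
  apply: (le_trans By).
  have subB : cbox (c.1 - r) (c.1 + r) z.2 (z.2 + s) `<=` sqr_at c r.
   move=> t [/= t1' t2']; split => //=; move: t2'; rewrite /= !in_itv /= => /andP[t3 t4].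
   by apply/andP; split; [exact: le_trans y1 t3|exact: le_trans t4 y2].
  have := box_mono l1 l2 (locint_norm wxb) (fun _ => normr_ge0 _) (mcbox _ _ _ _) subB.
  rewrite -/(sqr_at c r) => bm'.
  have sE : s * (eta / 8 * (r * m)) = eta / 8 * m * tau / 2 ^+ n * r ^+ 2 by rewrite /s; ring.
  have : 4 * (q * m) * r ^+ 2 <= s * (eta / 8 * (r * m)).
   rewrite sE ler_wpM2r ?sqr_ge0//.
   have np3' := np3; rewrite mulrA ler_pdivrMr// in np3'.
   rewrite ler_pdivlMr ?exprn_gt0//.
   have := ler_wpM2l (ltW m0) np3'; set T := 2 ^+ n; clearbody T.
   have := mulr_ge0 (ltW m0) (mulr_ge0 (ltW e0) (ltW t0)); clear; lra.
  by move: bm' Ix; clear; lra.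
 by rewrite ler_pM2l.
have keyV y y' : c.2 - r <= y <= c.2 + r -> c.2 - r <= y' <= c.2 + r ->
  `|w (x0, y) - w (x0, y')| <= eta / 8 * (r * m).
 move=> /andP[u1 u2] /andP[u3 u4].
 apply: (le_trans (row_bound Qx0 u1 u2 u3 u4)); apply: (le_trans VE).
 by have := ler_wpM2l (ltW rm0) np4; clear -e0 rm0; have := mulr_gt0 e0 rm0; lra.
move=> z z' /key[y [yI A1 A2]] /key[y' [yI' B1 B2]].
have C1 := keyV _ _ yI yI'.
have -> : p z - p z' - (a * (z.1 - z'.1) + b * (z.2 - z'.2)) =
  (w z - w (z.1, y)) + (w (z.1, y) - w (x0, y)) + (w (x0, y) - w (x0, y')) -
  (w (z'.1, y') - w (x0, y')) - (w z' - w (z'.1, y')) by rewrite /w /=; ring.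
move: A1 A2 B1 B2 C1; rewrite !ler_norml.
have : 0 < eta * (r * m) by rewrite mulr_gt0.
clear => e /andP[? ?] /andP[? ?] /andP[? ?] /andP[? ?] /andP[? ?].
apply/andP; split; lra.
Qed.

End linearization.

Import HBNNSimple.

(** * Density of dyadic step functions in L^2 *)

Section step_approximation.
Variable R : realType.
Local Notation P := (R * R)%type.
Local Notation mu2 := (@lbm R \x @lbm R)%E.
Variable D : set P.
Hypotheses (mD : measurable D) (Dfin : (mu2 D < +oo)%E).
Implicit Types f g s : P -> R.

Definition sq_int f := measurable_fun setT f /\ mu2.-integrable D (EFin \o (fun z => f z ^+ 2)).

Lemma sq_int_le f g : measurable_fun setT f -> (forall z, D z -> `|f z| <= g z) -> sq_int g -> sq_int f.
Proof.
move=> mf fg [mg gi]; split => //; apply: (@Rile _ _ _ mu2 D mD _ (fun z => g z ^+ 2)) => //.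
 by apply: measurable_funX; exact: measurable_funTS.
move=> z /fg h; rewrite normrX ler_sqr ?nnegrE//; exact: le_trans h.
Qed.

Lemma sq_intD f g : sq_int f -> sq_int g -> sq_int (fun z => f z + g z).
Proof.
move=> [mf fi] [mg gi]; split; first exact: measurable_funD.
apply: (@Rile _ _ _ mu2 D mD _ (fun z => 2 * f z ^+ 2 + 2 * g z ^+ 2)).
- by apply: measurable_funX; apply: measurable_funTS; exact: measurable_funD.
- move=> z _; rewrite ger0_norm ?sqr_ge0// -subr_ge0.
 by rewrite (_ : _ - _ = (f z - g z) ^+ 2) ?sqr_ge0//; ring.
- by apply: RiD => //; exact: RiZ.
Qed.

Lemma sq_intZ k f : sq_int f -> sq_int (fun z => k * f z).
Proof.
move=> [mf fi]; split; first by apply: measurable_funM.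
by under eq_fun do rewrite exprMn; exact: RiZ.
Qed.

Lemma sq_intB f g : sq_int f -> sq_int g -> sq_int (fun z => f z - g z).
Proof.
move=> hf hg; have := sq_intD hf (sq_intZ (-1) hg).
by under eq_fun do rewrite mulN1r.
Qed.

Lemma sq_int_cst k : sq_int (cst k).
Proof.
split; first exact: measurable_cst.
apply/integrableP; split; first by apply/measurable_EFinP; apply: measurable_funX; exact: measurable_cst.
by rewrite /= integral_cst//= lte_mul_pinfty// ?lee_fin.
Qed.

Lemma Rint_sqD f g : sq_int f -> sq_int g ->
 \int[mu2]_(z in D) (f z + g z) ^+ 2 <=
 2 * \int[mu2]_(z in D) f z ^+ 2 + 2 * \int[mu2]_(z in D) g z ^+ 2.
Proof.
move=> hf hg; have [mf fi] := hf; have [mg gi] := hg.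
rewrite -!RintegralZl// -RintegralD//; [|exact: RiZ|exact: RiZ].
apply: le_Rintegral => //; [exact: (sq_intD hf hg).2|by apply: RiD => //; exact: RiZ|].
move=> z _; rewrite -subr_ge0.
by rewrite (_ : _ - _ = (f z - g z) ^+ 2) ?sqr_ge0//; ring.
Qed.

Lemma sq_int_norm f : sq_int f -> sq_int (fun z => `|f z|).
Proof.
move=> [mf fi]; split; first exact: measurableT_comp.
rewrite (_ : (fun z => `|f z| ^+ 2) = (fun z => f z ^+ 2))//.
by apply/funext => z; rewrite real_normK ?num_real.
Qed.

(** Agreement of all comparisons with the lines i / 2^n: both points lie in one half-open dyadic
    square, without naming it. *)
Definition same_cell n (z z' : P) := forall i : int,
 (i%:~R / 2 ^+ n <= z.1) = (i%:~R / 2 ^+ n <= z'.1) /\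
 (i%:~R / 2 ^+ n <= z.2) = (i%:~R / 2 ^+ n <= z'.2).

Lemma same_cellS n m z z' : (n <= m)%N -> same_cell m z z' -> same_cell n z z'.
Proof.
move=> nm h i; have := h (i * 2 ^+ (m - n)).
suff -> : (i * 2 ^+ (m - n))%:~R / 2 ^+ m = i%:~R / 2 ^+ n :> R by [].
have -> : 2 ^+ m = 2 ^+ (m - n) * 2 ^+ n :> R by rewrite -exprD subnK.
by rewrite intrM rmorphXn /=; field; rewrite !expf_neq0.
Qed.

Definition step n s := sq_int s /\ forall z z', same_cell n z z' -> s z = s z'.

Definition near_step f := sq_int f /\ forall e : R, 0 < e -> exists n s,
 step n s /\ \int[mu2]_(z in D) (f z - s z) ^+ 2 <= e.

Lemma near_stepD f g : near_step f -> near_step g -> near_step (fun z => f z + g z).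
Proof.
move=> [hf Hf] [hg Hg]; split; first exact: sq_intD.
move=> e e0; have e4 : 0 < e / 4 by rewrite divr_gt0.
have [n [s [[hs Hs] es]]] := Hf _ e4; have [m [t [[ht Ht] et]]] := Hg _ e4.
exists (maxn n m), (fun z => s z + t z); split.
 split; first exact: sq_intD.
 move=> z z' h; congr (_ + _); [apply: Hs|apply: Ht]; apply: same_cellS h; first exact: leq_maxl.
 exact: leq_maxr.
under eq_Rintegral do rewrite opprD addrACA.
apply: le_trans (Rint_sqD (sq_intB hf hs) (sq_intB hg ht)) _.
by move: es et; clear; lra.
Qed.

Lemma near_stepZ k f : near_step f -> near_step (fun z => k * f z).
Proof.
move=> [hf Hf]; split; first exact: sq_intZ.
move=> e e0; have k0 : 0 < k ^+ 2 + 1 by rewrite ltr_wpDl ?sqr_ge0.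
have [n [s [[hs Hs] es]]] := Hf (e / (k ^+ 2 + 1)) (divr_gt0 e0 k0).
exists n, (fun z => k * s z); split; first by split; [exact: sq_intZ|move=> z z' /Hs ->].
under eq_Rintegral do rewrite -mulrBr exprMn.
have hfs := sq_intB hf hs.
rewrite RintegralZl//; last exact: hfs.2.
rewrite ler_pdivlMr// in es; apply: le_trans es; rewrite mulrC ler_wpM2l// ?lerDl//.
by apply: Rintegral_ge0 => z _; rewrite sqr_ge0.
Qed.

Lemma near_step_step n s : step n s -> near_step s.
Proof.
move=> hs; split; first exact: hs.1.
move=> e e0; exists n, s; split => //; rewrite (_ : \int[_]_(_ in _) _ = 0) ?ltW//.
by under eq_Rintegral do rewrite subrr expr0n; rewrite Rintegral_cst// mul0r.
Qed.

Lemma near_step_cvg (f_ : nat -> P -> R) f g : (forall n, near_step (f_ n)) ->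
 measurable_fun setT f -> (forall z, D z -> f_ n z @[n --> \oo] --> f z) ->
 (forall n z, D z -> `|f_ n z| <= g z) -> sq_int g -> near_step f.
Proof.
move=> hf_ mf cf fg hg.
have fg' z : D z -> `|f z| <= g z.
 move=> Dz; have cn : `|f_ n z| @[n --> \oo] --> `|f z| by apply: cvg_norm; exact: cf.
 rewrite -(cvg_lim _ cn)//; apply: limr_le; first by apply/cvg_ex; exists `|f z|.
 by apply: nearW => n; exact: fg.
have hf := sq_int_le mf fg' hg.
split => // e e0.
have hfn n := sq_intB hf (hf_ n).1.
have H : (\int[mu2]_(z in D) (f z - f_ n z) ^+ 2) @[n --> \oo] --> \int[mu2]_(z in D) (cst 0 z : R).
 apply: (@Rdominated_cvg _ _ _ mu2 D _ _ (fun z => 4 * g z ^+ 2)) => //.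
 - by move=> n; apply: measurable_funTS; apply: measurable_funX; exact: (hfn n).1.
 - move=> z Dz; rewrite (_ : cst 0 z = (f z - f z) ^+ 2); last by rewrite subrr expr0n.
  rewrite expr2; under eq_fun do rewrite expr2.
  by apply: cvgM; (apply: cvgB; [exact: cvg_cst|exact: cf]).
 - by apply: RiZ => //; exact: hg.2.
 - move=> n z Dz; have h1 := fg' z Dz; have h2 := fg n z Dz.
  rewrite ger0_norm ?sqr_ge0// (_ : 4 * g z ^+ 2 = (2 * g z) ^+ 2); last by ring.
  rewrite -(real_normK (num_real (f z - _))) ler_sqr ?nnegrE//.
   by apply: (le_trans (ler_normB _ _)); lra.
  by rewrite mulr_ge0//; exact: le_trans h1.
rewrite Rintegral_cst// mul0r in H.
have e2 : 0 < e / 4 by rewrite divr_gt0.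
have /cvgrPdist_lt/(_ _ e2)[N _ /(_ N (leqnn N))] := H; rewrite sub0r normrN => hN.
have [n [s [hs es]]] := (hf_ N).2 _ e2.
exists n, s; split => //.
have -> : (fun z => (f z - s z) ^+ 2) = (fun z => ((f z - f_ N z) + (f_ N z - s z)) ^+ 2).
 by apply/funext => z; congr (_ ^+ 2); ring.
apply: (le_trans (Rint_sqD (hfn N) (sq_intB (hf_ N).1 hs.1))).
by have := ltW (le_lt_trans (ler_norm _) hN); move: es; clear; lra.
Qed.

Lemma near_step_max f g : near_step f -> near_step g -> near_step (fun z => Num.max (f z) (g z)).
Proof.
move=> [hf Hf] [hg Hg].
have mx f' g' : sq_int f' -> sq_int g' -> sq_int (fun z => Num.max (f' z) (g' z)).
 move=> hf' hg'.
 apply: (@sq_int_le _ (fun z => `|f' z| + `|g' z|)).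
 - by apply: measurable_maxr; [exact: hf'.1|exact: hg'.1].
 - by move=> z _; rewrite maxEle; case: ifP => _; rewrite ?lerDl ?lerDr.
 - by apply: sq_intD; exact: sq_int_norm.
split; first exact: mx.
move=> e e0; have e4 : 0 < e / 2 by rewrite divr_gt0.
have [n [s [[hs Hs] es]]] := Hf _ e4; have [m [t [[ht Ht] et]]] := Hg _ e4.
exists (maxn n m), (fun z => Num.max (s z) (t z)); split.
 split; first exact: mx.
 move=> z z' h; congr Num.max; [apply: Hs|apply: Ht]; apply: same_cellS h; first exact: leq_maxl.
 exact: leq_maxr.
have i1 := (sq_intB hf hs).2; have i2 := (sq_intB hg ht).2.
apply: (@le_trans _ _ (\int[mu2]_(z in D) ((f z - s z) ^+ 2 + (g z - t z) ^+ 2))).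
 apply: le_Rintegral => //; [exact: (sq_intB (mx _ _ hf hg) (mx _ _ hs ht)).2|exact: RiD|].
 move=> z _.
 have sq (a b c : R) : a <= b -> b <= c -> b ^+ 2 <= a ^+ 2 + c ^+ 2.
  move=> ab bc; have := sqr_ge0 a; have := sqr_ge0 c; have [b0|/ltW b0] := leP 0 b; nra.
 have := sqr_ge0 (f z - s z); have := sqr_ge0 (g z - t z).
 have [fg|gf] := leP (f z) (g z); have [st|ts] := leP (s z) (t z) => h1 h2; try lra.
 - by apply: sq; lra.
 - by rewrite [leRHS]addrC; apply: sq; lra.
rewrite RintegralD//; move: es et; lra.
Qed.

Definition near_grid (A : set P) := measurable A /\ near_step (\1_A : P -> R).

(** Complements are affine in the indicator; finite unions are maxima, which preserve step
    functions; countable unions follow by dominated convergence. *)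
Lemma near_grid_sigma : sigma_algebra setT near_grid.
Proof.
split.
- split => //; apply: (@near_step_step 0); rewrite indic0; split => //; exact: sq_int_cst.
- move=> A [mA hA]; split; first exact: measurableD.
 rewrite (_ : \1_(_) = (fun z => cst 1 z + (-1) * \1_A z)); last first.
  apply/funext => z; rewrite setTD !indicE; have [zA|zA] := boolP (z \in A).
   by rewrite memNset /=; [ring|move=> h; apply: h; exact: set_mem zA].
  by rewrite mem_set /=; [ring|move=> h; move: zA; rewrite mem_set].
 apply: near_stepD; last exact: near_stepZ.
 by apply: (@near_step_step 0); split => //; exact: sq_int_cst.
- move=> A hA; have mA k := (hA k).1; split; first exact: bigcup_measurable.
 pose B n := \big[setU/set0]_(k < n) A k.
 have hB n : near_grid (B n).
  elim: n => [|n [mB hB]].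
   rewrite /B big_ord0; split => //.
   by apply: (@near_step_step 0); rewrite indic0; split => //; exact: sq_int_cst.
  rewrite /B big_ord_recr /=; split; first exact: measurableU.
  have -> : \1_(\big[setU/set0]_(i < n) A i `|` A n) = (fun z => Num.max (\1_(B n) z) (\1_(A n) z : R)).
   apply/funext => z; rewrite !indicE in_setU -/(B n).
   by case: (z \in B n); case: (z \in A n) => /=; rewrite ?maxxx // ?(max_l (@ler01 R)) ?(max_r (@ler01 R)).
  by apply: near_step_max => //; exact: (hA n).2.
 have ind01 (S : set P) z : `|\1_S z : R| <= 1 by rewrite indicE; case: (z \in S); rewrite ?normr1 ?normr0.
 apply: (@near_step_cvg (fun n => \1_(B n)) _ (cst 1)) => //.
 - by move=> n; exact: (hB n).2.
 - by apply: measurable_indic; exact: bigcup_measurable.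
 - move=> z _; have [[k _ Ak]|nz] := pselect ((\bigcup_k A k) z).
   apply: cvg_near_cst; exists k.+1 => // n /= kn.
   rewrite !indicE !mem_set//; first by exists k.
   by rewrite /B -bigcup_mkord; exists k.
  apply: cvg_near_cst; apply: nearW => n; rewrite !indicE !memNset//.
  by rewrite /B -bigcup_mkord => -[k _ Ak]; apply: nz; exists k.
 - exact: sq_int_cst.
Qed.

Lemma near_grid_halfplane (p : P -> R) x : p = fst \/ p = snd -> near_grid [set z | x < p z].
Proof.
move=> hp; have mp : measurable_fun setT p by case: hp => ->; [exact: measurable_fst|exact: measurable_snd].
have mS (y : R) : measurable [set z | y <= p z].
 have := mp measurableT `[y, +oo[%classic (measurable_itv _); rewrite setTI.
 by rewrite (_ : p @^-1` _ = [set z | y <= p z])//; apply/seteqP; split => z /=; rewrite in_itv /= andbT.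
have mH : measurable [set z | x < p z].
 have := mp measurableT `]x, +oo[%classic (measurable_itv _); rewrite setTI.
 by rewrite (_ : p @^-1` _ = [set z | x < p z])//; apply/seteqP; split => z /=; rewrite in_itv /= andbT.
split => //.
(* The grid value just above x: strictly larger than x, so that points with [p z = x] are excluded
   at every n, and within 2^-n of x. *)
pose i n := Num.floor (2 ^+ n * x) + 1.
have p2 n : 0 < 2 ^+ n :> R by rewrite exprn_gt0.
have ix n : x < (i n)%:~R / 2 ^+ n.
 by rewrite ltr_pdivlMr// mulrC; apply: lt_le_trans (floorD1_gt _) _.
have xi n : (i n)%:~R / 2 ^+ n <= x + (2 ^+ n)^-1.
 rewrite ler_pdivrMr// mulrDl mulVf ?gt_eqF// rmorphD /= lerD2r mulrC; exact: floor_le_tmp.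
pose S n := [set z : P | (i n)%:~R / 2 ^+ n <= p z].
have ind01 (S' : set P) z : `|\1_S' z : R| <= 1 by rewrite indicE; case: (z \in S'); rewrite ?normr1 ?normr0.
apply: (@near_step_cvg (fun n => \1_(S n)) _ (cst 1)) => //.
- move=> n; apply: (@near_step_step n); split.
  apply: (@sq_int_le _ (cst 1)) => //; last exact: sq_int_cst.
  by apply: measurable_indic; exact: mS.
 move=> z z' /(_ (i n))[e1 e2]; rewrite !indicE; congr (_%:R); congr nat_of_bool.
 apply/idP/idP => /set_mem h; apply/mem_set; move: h; rewrite /S /=;
  by case: hp => ->; rewrite ?e1 ?e2.
- move=> z _; have [xz|zx] := ltP x (p z); last first.
  apply: cvg_near_cst; apply: nearW => n; rewrite !indicE !memNset//= /S /=.
   by apply/negP; rewrite -leNgt.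
  by apply/negP; rewrite -ltNge; exact: le_lt_trans (ix n).
 have d0 : 0 < p z - x by rewrite subr_gt0.
 have := archi_boundP (ltW (divr_gt0 (@ltr01 R) d0)); set N := Num.bound _ => hN.
 apply: cvg_near_cst; exists N => // n /= Nn; rewrite !indicE !mem_set//= /S /=.
 apply: (le_trans (xi n)); rewrite -lerBrDl -[leRHS]invrK lef_pV2 ?posrE ?invr_gt0//.
 rewrite -div1r; apply: (le_trans (ltW hN)); rewrite -natrX ler_nat.
 by apply: (leq_trans Nn); rewrite ltnW// ltn_expl.
- exact: sq_int_cst.
Qed.

Lemma near_grid_measurable (A : set P) : measurable A -> near_grid A.
Proof.
have [g0 gC gU] := near_grid_sigma.
have line (p : P -> R) (B : set R) : p = fst \/ p = snd -> measurable B -> near_grid (p @^-1` B).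
 move=> hp mB.
 have : (@RGenOInfty.G R).-sigma.-measurable B by rewrite -RGenOInfty.measurableE.
 apply: (@smallest_sub _ _ _ (fun B => near_grid (p @^-1` B))) => //.
 - split.
  + by rewrite preimage_set0.
  + by move=> C hC; rewrite setTD preimage_setC -setTD; exact: gC.
  + by move=> C hC; rewrite preimage_bigcup; exact: gU.
 - move=> _ [x ->]; have := near_grid_halfplane x hp.
  by rewrite (_ : p @^-1` _ = [set z | x < p z])//; apply/seteqP; split => z /=; rewrite in_itv /= andbT.
have gI C C' : near_grid C -> near_grid C' -> near_grid (C `&` C').
 move=> hC hC'; rewrite -[C]setCK -[C']setCK -setCU -!setTD; apply: (gC).
 rewrite -bigcup2E; apply: (gU) => -[|[|k]] /=; [exact: gC|exact: gC|exact: g0].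
rewrite measurable_prod_measurableType; apply: smallest_sub; first exact: near_grid_sigma.
move=> _ [B mB [C mC <-]].
by apply: (gI (fst @^-1` B) (snd @^-1` C)); apply: line => //; [left|right].
Qed.

(** Nonnegative functions are limits of simple functions with measurable level sets; the general
    case writes f as (f + |f|) - |f|. *)
Lemma near_step_sq_int f : sq_int f -> near_step f.
Proof.
wlog f0 : f / forall z, 0 <= f z.
 move=> W hf; have mn : measurable_fun setT (fun z => `|f z|) by apply: measurableT_comp => //; exact: hf.1.
 have hn := sq_int_norm hf.
 have := near_stepD (W _ _ (sq_intD hf hn)) (near_stepZ (-1) (W _ _ hn)).
 rewrite (_ : (fun z => _ + _) = f); last by apply/funext => z; ring.
 apply => // z; rewrite -lerBlDr sub0r; exact: lerNnormlW.
move=> hf; have [mf fi] := hf.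
have mf' : measurable_fun setT (EFin \o f) by exact/measurable_EFinP.
have [z|g [ndg cg]] := approximation measurableT mf'; first by rewrite /= lee_fin.
have cgf z : (g n z : R) @[n --> \oo] --> f z by have /fine_cvgP[_] := cg z I.
have gf n z : g n z <= f z.
 rewrite -(cvg_lim _ (cgf z))//; apply: nondecreasing_cvgn_le; last by apply/cvg_ex; exists (f z).
 by move=> a b ab; exact/lefP/ndg.
apply: (@near_step_cvg (fun n => g n) _ f) => //.
- move=> n.
 have E : (g n : P -> R) = _ := funext (fimfunEord (g n)).
 rewrite E; move: (finmap.enum_fset _) => F.
 suff H m : near_step (fun x => \sum_(i < m) F`_i * \1_(g n @^-1` [set F`_i]) x) by exact: H.
 elim: m => [|m IH].
  under eq_fun do rewrite big_ord0.
  by apply: (@near_step_step 0); split => //; exact: sq_int_cst.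
 under eq_fun do rewrite big_ord_recr /=.
 apply: near_stepD => //; apply: near_stepZ.
 by apply: (near_grid_measurable _).2; exact: measurable_sfunP.
- by move=> n z _; rewrite ger0_norm.
Qed.

End step_approximation.

(** * From estimates on small squares to open sets *)

Section grid.
Variable R : realType.
Local Notation P := (R * R)%type.
Local Notation mu2 := (@lbm R \x @lbm R)%E.

Lemma additive_ge0 (I : choiceType) (D : set P) (L : set P -> R) (F : I -> set P) (s : seq I) :
 L set0 = 0 ->
 (forall A B, measurable A -> measurable B -> A `<=` D -> B `<=` D -> A `&` B = set0 ->
  L (A `|` B) = L A + L B) ->
 uniq s -> (forall i, measurable (F i)) -> (forall i, i \in s -> F i `<=` D /\ 0 <= L (F i)) ->
 (forall i j, i != j -> F i `&` F j = set0) ->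
 0 <= L (\big[setU/set0]_(i <- s) F i).
Proof.
move=> L0 LU us mF hF dF; elim: s us hF => [|i s IH] /=; first by rewrite big_nil L0.
move=> /andP[ni us] hF; rewrite big_cons.
have hs j : j \in s -> F j `<=` D /\ 0 <= L (F j) by move=> js; apply: hF; rewrite inE js orbT.
rewrite LU//; last 4 first.
- by apply: bigsetU_measurable => j _; exact: mF.
- by apply: (hF i _).1; rewrite inE eqxx.
- by rewrite -bigcup_seq => z [j /= js Fz]; exact: (hs j js).1 Fz.
- rewrite -bigcup_seq setI_bigcupr; apply: bigcup0 => j /= js; apply: dF.
 by apply: contraNneq ni => ->.
by rewrite addr_ge0 ?IH//; apply: (hF i _).2; rewrite inE eqxx.
Qed.

(** Half-open in both directions, so that dyadic cells are such squares and tile the plane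
    exactly. *)
Definition hsq (c : P) (r : R) : set P :=
 [set z | (c.1 - r <= z.1 < c.1 + r) && (c.2 - r <= z.2 < c.2 + r)].

Lemma mhsq c r : measurable (hsq c r).
Proof.
rewrite (_ : hsq c r = `[c.1 - r, c.1 + r[%classic `*` `[c.2 - r, c.2 + r[%classic).
 exact: measurableX.
by apply/seteqP; split => z /=; rewrite /hsq /= !in_itv /=; [move=> /andP|move=> /andP].
Qed.

Lemma hsq_sqr c r : hsq c r `<=` sqr_at c r.
Proof.
move=> z /andP[/andP[h1 h2] /andP[h3 h4]]; split => /=; rewrite in_itv /=.
 by rewrite h1 ltW.
by rewrite h3 ltW.
Qed.

Definition dcell (n : nat) (i : int * int) : set P :=
 [set z | (i.1%:~R / 2 ^+ n <= z.1 < (i.1 + 1)%:~R / 2 ^+ n) &&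
      (i.2%:~R / 2 ^+ n <= z.2 < (i.2 + 1)%:~R / 2 ^+ n)].

Let p2 n : 0 < 2 ^+ n :> R. Proof. by rewrite exprn_gt0. Qed.

Lemma dcell_hsq n i : dcell n i =
 hsq ((i.1%:~R + 2^-1) / 2 ^+ n, (i.2%:~R + 2^-1) / 2 ^+ n) (2^-1 / 2 ^+ n).
Proof.
rewrite /dcell /hsq /=; apply/seteqP; split => z /=;
by rewrite -!mulrBl -!mulrDl !addrK !rmorphD /= -!addrA (_ : 2^-1 + 2^-1 = 1 :> R)//; field.
Qed.

Lemma dcell_floor n z : dcell n (Num.floor (2 ^+ n * z.1), Num.floor (2 ^+ n * z.2)) z.
Proof.
by rewrite /dcell /= !ler_pdivrMr// !ltr_pdivlMr// ![_ * 2 ^+ n]mulrC !floor_le_tmp !floorD1_gt.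
Qed.

Lemma dcell_inj n i j z : dcell n i z -> dcell n j z -> i = j.
Proof.
have H (a b : int) (t : R) : a%:~R / 2 ^+ n <= t < (a + 1)%:~R / 2 ^+ n ->
  b%:~R / 2 ^+ n <= t < (b + 1)%:~R / 2 ^+ n -> a <= b.
 move=> /andP[h1 _] /andP[_ h2]; have := le_lt_trans h1 h2.
 by rewrite ltr_pM2r ?invr_gt0// ltr_int ltzD1.
move=> /andP[a1 a2] /andP[b1 b2]; case: i j a1 a2 b1 b2 => i1 i2 [j1 j2] /= a1 a2 b1 b2.
by congr pair; apply/le_anti/andP; split; apply: H; eassumption.
Qed.

Lemma dcell_same n i z z' : dcell n i z -> dcell n i z' -> same_cell n z z'.
Proof.
have H (a b : int) (t : R) : a%:~R / 2 ^+ n <= t < (a + 1)%:~R / 2 ^+ n ->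
  (b%:~R / 2 ^+ n <= t) = (b <= a).
 move=> /andP[h1 h2]; apply/idP/idP => h.
  by have := le_lt_trans h h2; rewrite ltr_pM2r ?invr_gt0// ltr_int ltzD1.
 by apply: le_trans h1; rewrite ler_pM2r ?invr_gt0// ler_int.
move=> /andP[a1 a2] /andP[b1 b2] k.
by rewrite (H _ _ _ a1) (H _ _ _ a2) (H _ _ _ b1) (H _ _ _ b2).
Qed.

Lemma dcell_diam n i z z' : dcell n i z -> dcell n i z' -> `|z - z'| <= (2 ^+ n)^-1.
Proof.
move=> /andP[/andP[a1 a2] /andP[a3 a4]] /andP[/andP[b1 b2] /andP[b3 b4]].
move: a2 a4 b2 b4; rewrite !rmorphD /= !mulrDl div1r => a2 a4 b2 b4.
by rewrite norm_le2 /= !ler_norml; apply/andP; split; apply/andP; split; lra.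
Qed.

Lemma cont_meas_plane (g : P -> P) (A : set P) :
 continuous g -> measurable A -> measurable (g @^-1` A).
Proof.
move=> cg mA; rewrite -[g @^-1` A]setTI.
suff mg : measurable_fun setT g by exact: mg.
rewrite (_ : g = (fun z => ((g z).1, (g z).2))); last by apply/funext => z; case: (g z).
apply/measurable_fun_pairP; split; apply: cont_meas2 => z.
 by apply: (@cvg_comp _ _ _ g fst); [exact: cg|exact: cvg_fst].
by apply: (@cvg_comp _ _ _ g snd); [exact: cg|exact: cvg_snd].
Qed.

Definition dist2 (ux uy vx vy : P -> R) (a b c d : R) (z : P) : R :=
 (ux z - a) ^+ 2 + (uy z - b) ^+ 2 + (vx z - c) ^+ 2 + (vy z - d) ^+ 2.

(* The derivative is approximated in [L^2] by a matrix field that is constant on dyadic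
  cells; the error term disappears in the limit. *)
Lemma grid_le (U : set P) (N K C : R) (g : P -> P) (h ux uy vx vy : P -> R) :
 open U -> (forall z, U z -> `|z| <= N) -> 0 <= K -> 0 <= C -> continuous g ->
 (mu2 (g @^-1` U) < +oo)%E ->
 locint h -> (forall z, 0 <= h z) ->
 locint ux -> locint (fun z => ux z ^+ 2) ->
 locint uy -> locint (fun z => uy z ^+ 2) ->
 locint vx -> locint (fun z => vx z ^+ 2) ->
 locint vy -> locint (fun z => vy z ^+ 2) ->
 (forall q r a b c d, 0 < r -> hsq q r `<=` U ->
  \int[mu2]_(z in hsq q r) h z <= K * fine (mu2 (g @^-1` hsq q r)) +
   C * \int[mu2]_(z in hsq q r) dist2 ux uy vx vy a b c d z) ->
 \int[mu2]_(z in U) h z <= K * fine (mu2 (g @^-1` U)).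
Proof.
move=> oU UN K0 C0 cg gU hi h0 ix ixx iy iyy jx jxx jy jyy H.
pose D := sqr_at (0 : P) (Num.max N 0).
have UD : U `<=` D.
 by move=> z /UN zN; apply/sqr_atP; rewrite subr0 le_max zN.
have mD : measurable D by exact: msqr_at.
have mU := open_measurable2 oU.
have N0 : 0 <= Num.max N 0 by rewrite le_max lexx orbT.
have Dfin : (mu2 D < +oo)%E by rewrite mu_sqr_at// ltry.
have l0 (c : R) : c - Num.max N 0 <= c + Num.max N 0 by rewrite lerD2l ge0_cp.
have sqi f : locint f -> locint (fun z => f z ^+ 2) -> sq_int D f.
 by move=> bf bff; split; [exact: bf.1|exact: (bff.2 _ _ _ _ (l0 _) (l0 _))].
have hD : mu2.-integrable D (EFin \o h) by exact: (hi.2 _ _ _ _ (l0 _) (l0 _)).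
have mgU A : measurable A -> measurable (g @^-1` A).
 exact: cont_meas_plane.
apply/ler_addgt0Pr => e e0.
(* Each of the four entries of the derivative is approximated up to this error, so that C times
   their sum stays below e. *)
have e4 : 0 < e / (4 * C + 1) by rewrite divr_gt0// ltr_wpDl// mulr_ge0.
have [_ /(_ _ e4)[n1 [s1 [hs1 es1]]]] := near_step_sq_int mD Dfin (sqi _ ix ixx).
have [_ /(_ _ e4)[n2 [s2 [hs2 es2]]]] := near_step_sq_int mD Dfin (sqi _ iy iyy).
have [_ /(_ _ e4)[n3 [s3 [hs3 es3]]]] := near_step_sq_int mD Dfin (sqi _ jx jxx).
have [_ /(_ _ e4)[n4 [s4 [hs4 es4]]]] := near_step_sq_int mD Dfin (sqi _ jy jyy).
pose d z := (ux z - s1 z) ^+ 2 + (uy z - s2 z) ^+ 2 + (vx z - s3 z) ^+ 2 + (vy z - s4 z) ^+ 2.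
have i1 := (sq_intB mD (sqi _ ix ixx) hs1.1).2; have i2 := (sq_intB mD (sqi _ iy iyy) hs2.1).2.
have i3 := (sq_intB mD (sqi _ jx jxx) hs3.1).2; have i4 := (sq_intB mD (sqi _ jy jyy) hs4.1).2.
have id : mu2.-integrable D (EFin \o d) by do 3!apply: RiD => //.
have d0 z : 0 <= d z by rewrite !addr_ge0 ?sqr_ge0.
have dE : \int[mu2]_(z in D) d z <= 4 * (e / (4 * C + 1)).
 rewrite /d !RintegralD//; [by move: es1 es2 es3 es4; clear; lra|exact: RiD|by do 2!apply: RiD => //].
(* L is additive on subsets of U and nonnegative on every cell inside U that is fine enough for the
   four step functions to be constant on it. Hence it is nonnegative on the unions [V n], which
   exhaust U. *)
pose L (A : set P) := K * fine (mu2 (g @^-1` A)) + C * \int[mu2]_(z in A) d z - \int[mu2]_(z in A) h z.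
have fing A : measurable A -> A `<=` U -> (mu2 (g @^-1` A) < +oo)%E.
 move=> mA AU; apply: le_lt_trans gU; apply: le_measure; rewrite ?inE; [exact: mgU|exact: mgU|].
 by move=> z; exact: AU.
have fing' A : measurable A -> A `<=` U -> mu2 (g @^-1` A) \is a fin_num.
 by move=> mA AU; rewrite ge0_fin_numE; [exact: fing|exact: measure_ge0].
have LU A B : measurable A -> measurable B -> A `<=` U -> B `<=` U -> A `&` B = set0 -> L (A `|` B) = L A + L B.
 move=> mA mB AU BU AB; rewrite /L preimage_setU measureU; last 3 first.
 - exact: mgU.
 - exact: mgU.
 - by rewrite -preimage_setI AB preimage_set0.
 have ABD : A `|` B `<=` D by move=> z [/AU/UD|/BU/UD].
 have dAB : [disjoint A & B] by apply/disj_setPS; rewrite AB.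
 have mAB := measurableU _ _ mA mB.
 rewrite fineD ?fing'// !Rintegral_setU//; [by ring|exact: Ris hD|exact: Ris id].
pose B (n : nat) := Num.bound (2 ^+ n * (Num.max N 0)).
pose rng n : seq int := [seq k%:Z - (B n)%:Z | k <- iota 0 (2 * B n).+1].
pose s n := undup [seq i <- [seq (i, j) | i <- rng n, j <- rng n] | `[< dcell n i `<=` U >]].
pose V n := \big[setU/set0]_(i <- s n) dcell n i.
have VU n : V n `<=` U.
 rewrite /V -bigcup_seq => z [i /= si iz].
 by move: si; rewrite mem_undup mem_filter => /andP[/asboolP iU _]; exact: iU.
have mcell n i : measurable (dcell n i) by rewrite dcell_hsq; exact: mhsq.
have mV n : measurable (V n) by apply: bigsetU_measurable => i _.
have inV n z : U z -> dcell n (Num.floor (2 ^+ n * z.1), Num.floor (2 ^+ n * z.2)) `<=` U -> V n z.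
 move=> Uz cU; rewrite /V -bigcup_seq; eexists; last exact: dcell_floor.
 rewrite /= mem_undup mem_filter; apply/andP; split; first exact/asboolP.
 have rg (t : R) : `|t| <= Num.max N 0 -> Num.floor (2 ^+ n * t) \in rng n.
  move=> tN; have Bn : 2 ^+ n * Num.max N 0 < (B n)%:R.
   by apply: archi_boundP; rewrite mulr_ge0// ltW.
  have tB : `|2 ^+ n * t| < (B n)%:R.
   by apply: le_lt_trans Bn; rewrite normrM gtr0_norm// ler_pM2l.
  move: tB; rewrite ltr_norml => /andP[t1 t2].
  have f1 : - (B n)%:Z <= Num.floor (2 ^+ n * t).
   by rewrite floor_ge_int_tmp// rmorphN /= ltW.
  have f2 : Num.floor (2 ^+ n * t) <= (B n)%:Z.
   by rewrite -(ler_int R); apply: le_trans (floor_le_tmp _) (ltW t2).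
  apply/mapP; exists (absz (Num.floor (2 ^+ n * t) + (B n)%:Z)).
   by rewrite mem_iota add0n /=; move: f1 f2; clear; lia.
  by move: f1; clear; lia.
 have /UD/sqr_atP := Uz; rewrite subr0 => zN.
 apply/allpairsP; eexists (_, _); split; last by reflexivity.
  by apply: rg; apply: le_trans zN; exact: norm1_le.
 by apply: rg; apply: le_trans zN; exact: norm2_le.
have LV n : (n1 + n2 + n3 + n4 <= n)%N -> 0 <= L (V n).
 move=> nn; apply: (additive_ge0 (D := U)) => //.
 - by rewrite /L preimage_set0 measure0 !Rintegral_set0 /= !mulr0 addr0 subr0.
 - exact: undup_uniq.
 - move=> i; rewrite mem_undup mem_filter => /andP[/asboolP iU _]; split => //.
  have [w wi] : exists w, dcell n i w.
   exists (i.1%:~R / 2 ^+ n, i.2%:~R / 2 ^+ n); rewrite /dcell /= !lexx /=.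
   by rewrite !ltr_pM2r ?invr_gt0// !ltr_int !ltzD1 !lexx.
  have st m' t z : (m' <= n)%N -> step D m' t -> dcell n i z -> t z = t w.
   by move=> mn [_ ht] iz; apply: ht; apply: (same_cellS mn); exact: dcell_same iz wi.
  rewrite /L subr_ge0.
  have -> : \int[mu2]_(z in dcell n i) d z =
    \int[mu2]_(z in dcell n i) dist2 ux uy vx vy (s1 w) (s2 w) (s3 w) (s4 w) z.
   apply: eq_Rintegral => z /set_mem iz; rewrite /d /dist2.
   rewrite (st _ _ _ _ hs1 iz) ?(st _ _ _ _ hs2 iz) ?(st _ _ _ _ hs3 iz) ?(st _ _ _ _ hs4 iz)//;
   by move: nn; clear; lia.
  rewrite dcell_hsq; apply: H; last by rewrite -dcell_hsq.
  by rewrite divr_gt0.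
 - move=> i j ij; apply/seteqP; split => // z [iz jz].
  by move: ij; rewrite (dcell_inj iz jz) eqxx.
have cV : (\int[mu2]_(z in V n) h z) @[n --> \oo] --> \int[mu2]_(z in U) h z.
 under eq_fun do rewrite Rintegral_mkcond; rewrite Rintegral_mkcond.
 apply: (@Rdominated_cvg _ _ _ mu2 setT _ _ (h \_ D)) => //.
 - by move=> n; apply/(measurable_restrictT _ _).1 => //; apply: measurable_funTS; exact: hi.1.
 - by apply/(measurable_restrictT _ _).1 => //; apply: measurable_funTS; exact: hi.1.
 - move=> z _; have [Uz|nUz] := pselect (U z); last first.
   apply: cvg_near_cst; apply: nearW => n; rewrite !patchE !memNset//.
   by move=> /VU.
  have /nbhs_ballP[r /= r0 rU] : nbhs z U by apply: open_nbhs_nbhs; split.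
  have := archi_boundP (ltW (divr_gt0 (@ltr01 R) r0)); set M := Num.bound _ => hM.
  apply: cvg_near_cst; exists M => // n /= Mn; rewrite !patchE !mem_set//.
  apply: inV => // z' iz'; apply: rU; rewrite -ball_normE /=.
  apply: le_lt_trans (dcell_diam (dcell_floor n z) iz') _.
  rewrite -[ltRHS]invrK ltf_pV2 ?posrE ?invr_gt0// -div1r; apply: (lt_le_trans hM).
  by rewrite -natrX ler_nat; apply: (leq_trans Mn); rewrite ltnW// ltn_expl.
 - have := (integrable_mkcond (mu := mu2) (EFin \o h) mD).1 hD.
  by rewrite restrict_EFin.
 - move=> n z _; rewrite !patchE; case: ifPn => [/set_mem/VU/UD zD|_].
   by rewrite mem_set// ger0_norm.
  by rewrite normr0; case: ifP.
have bnd n : (n1 + n2 + n3 + n4 <= n)%N -> \int[mu2]_(z in V n) h z <= K * fine (mu2 (g @^-1` U)) + e.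
 move=> nn; have := LV n nn; rewrite /L subr_ge0 => h1; apply: (le_trans h1).
 apply: lerD.
  apply: ler_wpM2l => //; apply: fine_le; [exact: fing'|exact: fing'|].
  by apply: le_measure; rewrite ?inE; [exact: mgU|exact: mgU|move=> z; exact: VU].
 apply: (@le_trans _ _ (C * (4 * (e / (4 * C + 1))))).
  apply: ler_wpM2l => //; apply: le_trans dE.
  have VD : V n `<=` D by move=> z /VU/UD.
  apply: fine_le; [exact: (integrable_fin_num (mV n) (Ris mD (mV n) VD id))|exact: (integrable_fin_num mD id)|].
  apply: ge0_subset_integral => //; first by apply: measurable_int id.
  by move=> z _; rewrite lee_fin.
 rewrite mulrA mulrA ler_pdivrMr ?ltr_wpDl ?mulr_ge0//.
 by move: e0; clear; lra.
rewrite -(cvg_lim _ cV)//; apply: limr_le; first by apply/cvg_ex; eexists; exact: cV.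
by exists (n1 + n2 + n3 + n4)%N => // n /= /bnd.
Qed.

End grid.

(** * Almost conformal squares and the area inequality *)

Section quasiconformal_squares.
Variable R : realType.
Local Notation P := (R * R)%type.
Local Notation mu2 := (@lbm R \x @lbm R)%E.

(* Squared moduli of the conformal and anticonformal parts of the matrix
  [[a, b], [c, d]]. *)
Definition cf2 (a b c d : R) : R := ((a + d) ^+ 2 + (c - b) ^+ 2) / 4.
Definition ac2 (a b c d : R) : R := ((a - d) ^+ 2 + (c + b) ^+ 2) / 4.

Lemma cf2_le (a b c d x y s t : R) :
 cf2 a b c d <= 2 * cf2 x y s t + 2 * cf2 (x - a) (y - b) (s - c) (t - d).
Proof.
rewrite -subr_ge0 (_ : _ - _ = ((a + d - 2 * (x + t)) ^+ 2 + (c - b - 2 * (s - y)) ^+ 2) / 4).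
 by rewrite divr_ge0// addr_ge0 ?sqr_ge0.
by rewrite /cf2; field.
Qed.

Lemma ac2_le (a b c d x y s t : R) :
 ac2 a b c d <= 2 * ac2 x y s t + 2 * ac2 (x - a) (y - b) (s - c) (t - d).
Proof.
rewrite -subr_ge0 (_ : _ - _ = ((a - d - 2 * (x - t)) ^+ 2 + (c + b - 2 * (s + y)) ^+ 2) / 4).
 by rewrite divr_ge0// addr_ge0 ?sqr_ge0.
by rewrite /ac2; field.
Qed.

(** The dilatation bound is stated without orientation: at almost every point one of the two parts
    is dominated by the other, but which one may a priori vary from point to point. The number k
    bounds the Beltrami coefficient of the map or of its conjugate. *)
Record qcmap (k : R) (f g : P -> P) (ux uy vx vy : P -> R) : Prop := Qcmap {
 qc_fK : cancel f g;
 qc_gK : cancel g f;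
 qc_cf : continuous f;
 qc_cg : continuous g;
 qc_u : grad2 (fun z => (f z).1) ux uy;
 qc_v : grad2 (fun z => (f z).2) vx vy;
 qc_ae : {ae mu2, forall z,
  ac2 (ux z) (uy z) (vx z) (vy z) <= k ^+ 2 * cf2 (ux z) (uy z) (vx z) (vy z) \/
  cf2 (ux z) (uy z) (vx z) (vy z) <= k ^+ 2 * ac2 (ux z) (uy z) (vx z) (vy z)} }.

Lemma cf2_ge0 a b c d : 0 <= cf2 a b c d.
Proof. by rewrite divr_ge0// addr_ge0 ?sqr_ge0. Qed.

Lemma ac2_ge0 a b c d : 0 <= ac2 a b c d.
Proof. by rewrite divr_ge0// addr_ge0 ?sqr_ge0. Qed.

Lemma cf2N (a b c d : R) : cf2 a b (- c) (- d) = ac2 a b c d.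
Proof. by rewrite /cf2 /ac2; congr (_ / _); ring. Qed.

Lemma ac2N (a b c d : R) : ac2 a b (- c) (- d) = cf2 a b c d.
Proof. by rewrite /cf2 /ac2; congr (_ / _); ring. Qed.

Lemma ae_le_Rint (D : set P) (f g : P -> R) : measurable D ->
 mu2.-integrable D (EFin \o f) -> mu2.-integrable D (EFin \o g) ->
 {ae mu2, forall z, D z -> f z <= g z} -> \int[mu2]_(z in D) f z <= \int[mu2]_(z in D) g z.
Proof.
move=> mD fi gi fg.
have mi : mu2.-integrable D (EFin \o (fun z => Num.min (f z) (g z))).
 apply: (@Rile _ _ _ mu2 D mD _ (fun z => `|f z| + `|g z|)).
 - by apply: measurable_minr; [exact: Rim fi|exact: Rim gi].
 - by move=> z _; rewrite minEle; case: ifP => _; rewrite ?lerDl ?lerDr.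
 - by apply: RiD => //; exact: RiN.
have -> : \int[mu2]_(z in D) f z = \int[mu2]_(z in D) Num.min (f z) (g z).
 congr fine; apply: ae_eq_integral => //; [exact: measurable_int fi|exact: measurable_int mi|].
 by apply: aeS fg => z h Dz /=; rewrite min_l// h.
by apply: le_Rintegral => // z _; rewrite ge_min lexx orbT.
Qed.

Lemma locint_le (f g : P -> R) : measurable_fun setT f ->
 (forall z, `|f z| <= g z) -> locint g -> locint f.
Proof.
move=> mf fg [mg gi]; split => // a b c d ab cd.
apply: (@Rile _ _ _ mu2 _ (mcbox a b c d) _ g) => //; last exact: gi.
exact: measurable_funTS.
Qed.

Lemma locint_hsq (f : P -> R) c r : 0 <= r -> locint f ->
 mu2.-integrable (hsq c r) (EFin \o f).
Proof.
move=> r0 [_ fi]; apply: (Ris (msqr_at c r) (mhsq c r) (@hsq_sqr _ c r)).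
by apply: fi; rewrite lerD2l ge0_cp.
Qed.

Lemma mu_hsq (c : P) r : 0 <= r -> mu2 (hsq c r) = (4 * r ^+ 2)%:E.
Proof.
move=> r0.
rewrite (_ : hsq c r = `[c.1 - r, c.1 + r[%classic `*` `[c.2 - r, c.2 + r[%classic); last first.
 by apply/seteqP; split => z /=; rewrite /hsq /= !in_itv /=; [move=> /andP|move=> /andP].
have H x : @lbm R `[x - r, x + r[%classic = (2 * r)%:E.
 rewrite /lbm lebesgue_measure_itv /= lte_fin; case: ltP => h; first by congr EFin; ring.
 by congr EFin; lra.
rewrite product_measure1E//= !H -EFinM; congr EFin; ring.
Qed.

Lemma locint_dist2 (ux uy vx vy : P -> R) (a b c d : R) (f g : P -> P) k :
 qcmap k f g ux uy vx vy -> locint (dist2 ux uy vx vy a b c d).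
Proof.
move=> Q.
have := energy_locint (grad2_affine a b (qc_u Q)).
have := energy_locint (grad2_affine c d (qc_v Q)).
move=> h1 h2; have := locintD h2 h1.
by congr locint; apply/funext => z; rewrite /dist2; ring.
Qed.

Lemma cf2_ac2_sum (a b c d : R) : 2 * (cf2 a b c d + ac2 a b c d) = a ^+ 2 + b ^+ 2 + c ^+ 2 + d ^+ 2.
Proof. by rewrite /cf2 /ac2; field. Qed.

Lemma qc_measurable k f g ux uy vx vy : qcmap k f g ux uy vx vy ->
 [/\ measurable_fun setT ux, measurable_fun setT uy, measurable_fun setT vx & measurable_fun setT vy].
Proof.
move=> Q; split; [exact: (xac_box (grad2_x (qc_u Q))).1|exact: (yac_box (grad2_y (qc_u Q))).1|
 exact: (xac_box (grad2_x (qc_v Q))).1|exact: (yac_box (grad2_y (qc_v Q))).1].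
Qed.

Lemma pair_cont (T : topologicalType) (f1 f2 : T -> R) : continuous f1 -> continuous f2 ->
 continuous (fun z => (f1 z, f2 z)).
Proof. by move=> c1 c2 z; exact: (cvg_pair (c1 z) (c2 z)). Qed.

(** Conjugating the values exchanges the conformal and the anticonformal part. *)
Lemma qc_reflect k f g ux uy vx vy : qcmap k f g ux uy vx vy ->
 qcmap k (fun z => ((f z).1, - (f z).2)) (fun z => g (z.1, - z.2))
  ux uy (fun z => - vx z) (fun z => - vy z).
Proof.
move=> [fK gK cf cg Gu Gv ae].
have neg (q qx : P -> R) : xac q qx -> xac (fun z => - q z) (fun z => - qx z).
 by move=> /(xacZ (-1)); congr xac; apply/funext => z; rewrite mulN1r.
split => //.
- by move=> z; rewrite /= opprK -surjective_pairing fK.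
- by move=> z; rewrite gK /= opprK -surjective_pairing.
- apply: pair_cont; first by move=> z; apply: (@continuous_comp _ _ _ f fst); [exact: cf|exact: cvg_fst].
 by move=> z; apply: cvgN; apply: (@continuous_comp _ _ _ f snd); [exact: cf|exact: cvg_snd].
- move=> z; apply: (@continuous_comp _ _ _ (fun z : P => (z.1, - z.2)) g); last exact: cg.
 by apply: pair_cont => {}z; [exact: cvg_fst|apply: cvgN; exact: cvg_snd].
- case: Gv => gx gy gxx gyy; split.
 + exact: neg.
 + exact: (neg _ _ gy).
 + by move: gxx; congr locint; apply/funext => z; rewrite sqrrN.
 + by move: gyy; congr locint; apply/funext => z; rewrite sqrrN.
- by apply: aeS ae => z; rewrite cf2N ac2N => -[]; [right|left].
Qed.

(** The linear map z -> (p + i q) z, up to an error relative to r m, the size of the image.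
    Differences of values are compared, so no translation has to be fixed. *)
Definition conf_on (f : P -> P) (c : P) (r e m p q : R) : Prop :=
 [/\ 0 < m, m ^+ 2 = p ^+ 2 + q ^+ 2 & forall z z', sqr_at c r z -> sqr_at c r z' ->
  `|(f z).1 - (f z').1 - (p * (z.1 - z'.1) - q * (z.2 - z'.2))| <= e * (r * m) /\
  `|(f z).2 - (f z').2 - (q * (z.1 - z'.1) + p * (z.2 - z'.2))| <= e * (r * m)].

Lemma fine_mu_hsq (c : P) (r : R) : 0 < r -> fine (mu2 (hsq c r)) = 4 * r ^+ 2.
Proof. by move=> r0; rewrite mu_hsq// ltW. Qed.

(** Almost everywhere one part of the derivative is at most k^2 times the other one. Comparison with
    the constant matrix costs [dist2] pointwise, and integration over the square yields a bound on
    the constant matrix itself. *)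
Lemma min_cf2_ac2 k f g ux uy vx vy (c : P) r a b c' d :
 qcmap k f g ux uy vx vy -> 0 <= k <= 1 -> 0 < r ->
 Num.min (cf2 a b c' d) (ac2 a b c' d) * (4 * r ^+ 2) <=
  16 * k ^+ 2 * r ^+ 2 * (cf2 a b c' d + ac2 a b c' d) +
  3 * \int[mu2]_(z in hsq c r) dist2 ux uy vx vy a b c' d z.
Proof.
move=> Q /andP[k0 k1] r0.
have mq := @mhsq R c r.
have id := locint_hsq c (ltW r0) (locint_dist2 a b c' d Q).
have ik (x : R) : mu2.-integrable (hsq c r) (EFin \o cst x).
 by apply: (@locint_hsq (cst x) c r (ltW r0)); apply: locint_cont => z; exact: cvg_cst.
set A := cf2 a b c' d; set B := ac2 a b c' d.
have fr := fine_mu_hsq c r0.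
have H : \int[mu2]_(z in hsq c r) (cst (Num.min A B) z) <=
  \int[mu2]_(z in hsq c r) (cst (4 * k ^+ 2 * (A + B)) z + 3 * dist2 ux uy vx vy a b c' d z).
 apply: ae_le_Rint => //; first by apply: RiD => //; exact: RiZ.
 apply: aeS (qc_ae Q) => z /= H _.
 have k2 : k ^+ 2 <= 1 by rewrite expr_le1.
 have K0 := sqr_ge0 k; rewrite ge_min.
 set x := ux z in H *; set y := uy z in H *; set s := vx z in H *; set t := vy z in H *.
 have d2 : dist2 ux uy vx vy a b c' d z =
   2 * (cf2 (x - a) (y - b) (s - c') (t - d) + ac2 (x - a) (y - b) (s - c') (t - d)).
  by rewrite cf2_ac2_sum.
 have c1 := cf2_le a b c' d x y s t; have c2 := ac2_le a b c' d x y s t.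
 have c3 := cf2_le x y s t a b c' d; have c4 := ac2_le x y s t a b c' d.
 have swp : cf2 (a - x) (b - y) (c' - s) (d - t) = cf2 (x - a) (y - b) (s - c') (t - d) by rewrite /cf2; field.
 have swp' : ac2 (a - x) (b - y) (c' - s) (d - t) = ac2 (x - a) (y - b) (s - c') (t - d) by rewrite /ac2; field.
 rewrite swp in c3; rewrite swp' in c4; rewrite d2.
 have e1 := cf2_ge0 (x - a) (y - b) (s - c') (t - d); have e2 := ac2_ge0 (x - a) (y - b) (s - c') (t - d).
 have A0 : 0 <= A := cf2_ge0 _ _ _ _; have B0 : 0 <= B := ac2_ge0 _ _ _ _.
 rewrite -/A -/B in c1 c2 c3 c4.
 set ea := cf2 (x - a) _ _ _ in c1 c2 c3 c4 e1 e2 *; set eb := ac2 (x - a) _ _ _ in c1 c2 c3 c4 e1 e2 *.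
 have m1 := ler_wpM2l K0 c3; have m2 := ler_wpM2l K0 c4.
 have m3 := ler_wpM2r e1 k2; have m4 := ler_wpM2r e2 k2.
 have m5 := mulr_ge0 K0 A0; have m6 := mulr_ge0 K0 B0.
 move: c1 c2 m1 m2 m3 m4 m5 m6 e1 e2 H; clear; set K := k ^+ 2; move: (cf2 x y s t) (ac2 x y s t) => X Y.
 by move=> ? ? ? ? ? ? ? ? ? ? []?; apply/orP; [right|left]; lra.
rewrite Rintegral_cst// fr RintegralD// in H; last exact: RiZ.
rewrite Rintegral_cst// fr RintegralZl// in H.
by move: H; clear; lra.
Qed.

Lemma sqr_hsq (c : P) r r' : r' < r -> sqr_at c r' `<=` hsq c r.
Proof.
move=> rr z /sqr_atP; rewrite norm_le2 /= !ler_distl => /andP[/andP[h1 h2] /andP[h3 h4]].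
by apply/andP; split; apply/andP; split; move: rr h1 h2 h3 h4; clear; lra.
Qed.

(** The constant matrix is replaced by its conformal part, at the cost of its small anticonformal
    part, and [near_linear] is applied to both coordinates with the same p and q. *)
Lemma near_conformal (eta tau : R) : 0 < eta -> 0 < tau < 1 -> exists2 del, 0 < del &
 forall k f g ux uy vx vy (c : P) r a b c' d, qcmap k f g ux uy vx vy -> 0 < r ->
 0 < cf2 a b c' d -> ac2 a b c' d <= del * cf2 a b c' d ->
 \int[mu2]_(z in hsq c r) dist2 ux uy vx vy a b c' d z <= del * cf2 a b c' d * r ^+ 2 ->
 conf_on f c ((1 - tau) * r) eta (Num.sqrt (cf2 a b c' d)) ((a + d) / 2) ((c' - b) / 2).
Proof.
move=> e0 /andP[t0 t1].
(* Two shrinkings are made, to a closed square inside the half-open one and inside [near_linear],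
   and (1 - tau/2)^2 >= 1 - tau. The factor 1 - tau next to eta makes the error relative to the
   smaller radius. *)
have t2 : 0 < tau / 2 < 1 by apply/andP; split; lra.
have e2 : 0 < eta * (1 - tau) by rewrite mulr_gt0// subr_gt0.
have [del0 d0 H] := near_linear e2 t2.
pose del := del0 / 128.
exists del; first by rewrite divr_gt0.
move=> k f g ux uy vx vy c r a b c' d Q r0 A0 BA E.
set A := cf2 a b c' d in A0 BA E *; set B := ac2 a b c' d in BA.
set p := (a + d) / 2; set q := (c' - b) / 2; set m := Num.sqrt A.
have m0 : 0 < m by rewrite sqrtr_gt0.
have mA : m ^+ 2 = A by rewrite sqr_sqrtr// ltW.
have Apq : A = p ^+ 2 + q ^+ 2 by rewrite /A /cf2 /p /q; field.
have sqle (x y : R) : x ^+ 2 + y ^+ 2 = A -> `|x| <= m.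
 move=> xy; rewrite -ler_sqr ?nnegrE ?(ltW m0)// real_normK ?num_real// mA -xy lerDl sqr_ge0//.
have pm : `|p| <= m by apply: (sqle _ q); rewrite Apq.
have qm : `|q| <= m by apply: (sqle _ p); rewrite Apq addrC.
have nqm : `|- q| <= m by rewrite normrN.
pose r' := (1 - tau / 2) * r.
have r'0 : 0 < r' by rewrite mulr_gt0// subr_gt0; lra.
have rr' : r' < r by rewrite /r' gtr_pMl//; lra.
have sub := sqr_hsq (c := c) rr'.
have mq := @mhsq R c r.
have En : \int[mu2]_(z in sqr_at c r') dist2 ux uy vx vy p (- q) q p z <= del0 * (r' * m) ^+ 2.
 have i1 := locint_dist2 p (- q) q p Q; have i2 := locint_dist2 a b c' d Q.
 have j1 := locint_hsq c (ltW r0) i1; have j2 := locint_hsq c (ltW r0) i2.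
 apply: (@le_trans _ _ (\int[mu2]_(z in hsq c r) dist2 ux uy vx vy p (- q) q p z)).
  have mq' := msqr_at c r'.
  apply: fine_le; [exact: (integrable_fin_num mq' (Ris mq mq' sub j1))|exact: (integrable_fin_num mq j1)|].
  apply: ge0_subset_integral => //; first by apply: measurable_int j1.
  by move=> z _; rewrite lee_fin /dist2 !addr_ge0 ?sqr_ge0.
 apply: (@le_trans _ _ (\int[mu2]_(z in hsq c r) (2 * dist2 ux uy vx vy a b c' d z + cst (4 * B) z))).
  apply: le_Rintegral => //.
   apply: RiD => //; first exact: RiZ.
   by apply: (@locint_hsq (cst (4 * B)) c r (ltW r0)); apply: locint_cont => z; exact: cvg_cst.
  move=> z _; rewrite /dist2 /B /ac2 /p /q /=; rewrite -subr_ge0.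
  set x := ux z; set y := uy z; set s := vx z; set t := vy z.
  rewrite (_ : _ - _ = (x - a - (a - d) / 2) ^+ 2 + (t - d + (a - d) / 2) ^+ 2 +
    (y - b - (c' + b) / 2) ^+ 2 + (s - c' - (c' + b) / 2) ^+ 2).
   by rewrite !addr_ge0 ?sqr_ge0.
  by field.
 rewrite RintegralD//; last 2 first.
 - exact: RiZ.
 - by apply: (@locint_hsq (cst (4 * B)) c r (ltW r0)); apply: locint_cont => z; exact: cvg_cst.
 have fr := fine_mu_hsq c r0.
 rewrite RintegralZl// Rintegral_cst// fr.
 have r2 : 0 <= r ^+ 2 by exact: sqr_ge0.
 have := ler_wpM2r r2 BA; rewrite exprMn mA => BA'.
 have : r ^+ 2 <= 4 * r' ^+ 2.
  rewrite (_ : 4 * r' ^+ 2 = (2 * r') ^+ 2); last by ring.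
  by rewrite ler_sqr ?nnegrE ?mulr_ge0 ?(ltW r0) ?(ltW r'0)// /r'; have := mulr_gt0 t0 r0; have := mulr_gt0 (_ : 0 < 1 - tau) r0; rewrite subr_gt0 => /(_ t1); lra.
 move=> h; have := ler_wpM2l (mulr_ge0 (ltW d0) (ltW A0)) h.
 have := mulr_ge0 (mulr_ge0 (ltW d0) (ltW A0)) (sqr_ge0 r').
 by move: E BA'; rewrite /del; clear; lra.
have [mo1 mo2] := homeo_monotone (qc_fK Q) (qc_gK Q) (qc_cf Q) (qc_cg Q).
have l0 (x : R) : x - r' <= x + r' by rewrite lerD2l; lra.
have iU := (energy_locint (grad2_affine p (- q) (qc_u Q))).2 _ _ _ _ (l0 c.1) (l0 c.2).
have iV := (energy_locint (grad2_affine q p (qc_v Q))).2 _ _ _ _ (l0 c.1) (l0 c.2).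
have iD := (locint_dist2 p (- q) q p Q).2 _ _ _ _ (l0 c.1) (l0 c.2).
have EU : energy (fun z => ux z - p) (fun z => uy z - - q) (sqr_at c r') <= del0 * (r' * m) ^+ 2.
 apply: le_trans En; apply: le_Rintegral => //; first exact: msqr_at.
 by move=> z _; rewrite /dist2 -addrA lerDl addr_ge0 ?sqr_ge0.
have EV : energy (fun z => vx z - q) (fun z => vy z - p) (sqr_at c r') <= del0 * (r' * m) ^+ 2.
 apply: le_trans En; apply: le_Rintegral => //; first exact: msqr_at.
 by move=> z _; rewrite /dist2 -addrA lerDr addr_ge0 ?sqr_ge0.
have HU := H _ _ _ _ _ _ _ _ (qc_u Q) mo1 r'0 m0 pm nqm EU.
have HV := H _ _ _ _ _ _ _ _ (qc_v Q) mo2 r'0 m0 qm pm EV.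
split => //; first by rewrite mA.
have sub2 z : sqr_at c ((1 - tau) * r) z -> sqr_at c ((1 - tau / 2) * r') z.
 move=> /sqr_atP h; apply/sqr_atP; apply: (le_trans h); rewrite /r' mulrA ler_pM2r// -subr_ge0.
 by rewrite (_ : _ - _ = (tau / 2) ^+ 2) ?sqr_ge0//; field.
have er : eta * (1 - tau) * (r' * m) <= eta * ((1 - tau) * r * m).
 by have := ler_wpM2l (ltW e2) (ler_wpM2r (ltW m0) (ltW rr')); clear; lra.
move=> z z' /sub2 hz /sub2 hz'; split; apply: le_trans er.
 by have := HU _ _ hz hz'; rewrite mulNr.
exact: HV.
Qed.

Definition mirror (f : P -> P) (z : P) : P := ((f z).1, - (f z).2).

(** The strict bound on the defect prevents the constant matrix from vanishing, and [min_cf2_ac2]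
    makes one of its parts negligible. If it is the conformal one, [near_conformal] is applied to
    the reflected map. *)
Lemma good_square (eta tau nu : R) : 0 < eta -> 0 < tau < 1 -> 0 < nu -> exists2 del, 0 < del &
 forall k f g ux uy vx vy (c : P) r a b c' d, qcmap k f g ux uy vx vy -> 0 <= k <= del -> 0 < r ->
 \int[mu2]_(z in hsq c r) dist2 ux uy vx vy a b c' d z < del * (cf2 a b c' d + ac2 a b c' d) * r ^+ 2 ->
 (ac2 a b c' d <= nu * cf2 a b c' d /\ exists p q,
   conf_on f c ((1 - tau) * r) eta (Num.sqrt (cf2 a b c' d)) p q) \/
 (cf2 a b c' d <= nu * ac2 a b c' d /\ exists p q,
   conf_on (mirror f) c ((1 - tau) * r) eta (Num.sqrt (ac2 a b c' d)) p q).
Proof.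
move=> e0 t01 n0; have [del0 d0 H] := near_conformal e0 t01.
pose d1 := Num.min (Num.min del0 nu) 1.
have d10 : 0 < d1 by rewrite !lt_min d0 n0 ltr01.
have d1d : d1 <= del0 by rewrite !ge_min lexx.
have d1n : d1 <= nu by rewrite !ge_min lexx orbT.
have d11 : d1 <= 1 by rewrite !ge_min lexx orbT.
exists (d1 / 4); first by rewrite divr_gt0.
move=> k f g ux uy vx vy c r a b c' d Q /andP[k0 kd] r0 E.
have k1 : 0 <= k <= 1 by rewrite k0 /=; lra.
have M := min_cf2_ac2 c a b c' d Q k1 r0.
have r2 : 0 < r ^+ 2 by rewrite exprn_gt0.
have k2 : k ^+ 2 <= d1 / 16.
 have h1 : k ^+ 2 <= (d1 / 4) ^+ 2 by rewrite ler_sqr ?nnegrE// divr_ge0// ltW.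
 apply: (le_trans h1); rewrite exprMn; have := ler_wpM2l (ltW d10) d11; lra.
have := cf2_ge0 a b c' d; have := ac2_ge0 a b c' d; rewrite le_eqVlt => /predU1P B0 A0.
have m0 : 0 < cf2 a b c' d + ac2 a b c' d.
 have : 0 < d1 / 4 * (cf2 a b c' d + ac2 a b c' d) * r ^+ 2.
  by apply: le_lt_trans E; apply: Rintegral_ge0 => z _; rewrite /dist2 !addr_ge0 ?sqr_ge0.
 by rewrite pmulr_lgt0// pmulr_rgt0// divr_gt0.
have key : Num.min (cf2 a b c' d) (ac2 a b c' d) <= d1 / 2 * (cf2 a b c' d + ac2 a b c' d).
 rewrite -(ler_pM2r (_ : 0 < 4 * r ^+ 2)) ?mulr_gt0//; apply: (le_trans M).
 have := ler_wpM2r (mulr_ge0 (ltW m0) (ltW r2)) k2.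
 have := mulr_gt0 (mulr_gt0 d10 m0) r2.
 by move: E; clear; lra.
have fin (A B : R) : 0 <= A -> 0 <= B -> B <= d1 / 2 * (A + B) -> 0 < A + B -> [/\ 0 < A, B <= d1 * A & A + B <= 2 * A].
 move=> A0' B0' h h0; have h1 := ler_wpM2r B0' d11; rewrite mul1r in h1.
 have BA : B <= d1 * A by move: h0 h1 h A0' B0'; clear; lra.
 have dA := ler_wpM2r A0' d11; rewrite mul1r in dA.
 by split; move: h0 BA dA h A0' B0'; clear; lra.
have B0' := ac2_ge0 a b c' d.
have [AB|BA] := leP (cf2 a b c' d) (ac2 a b c' d).
 right; rewrite min_l// in key; rewrite addrC in m0 key E.
 have [B1 h1 h2] := fin _ _ B0' A0 key m0.
 split; first by apply: (le_trans h1); rewrite ler_wpM2r.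
 have Q' := qc_reflect Q.
 have e1 := cf2N a b c' d; have e2 := ac2N a b c' d.
 have := @H _ _ _ _ _ _ _ c r a b (- c') (- d) Q' r0; rewrite e1 e2 => /(_ B1 _)/wrap[|H1].
  by apply: (le_trans h1); rewrite ler_wpM2r.
 exists ((a - d) / 2), ((- c' - b) / 2); apply: H1.
 rewrite (_ : \int[mu2]_(z in _) _ = \int[mu2]_(z in hsq c r) dist2 ux uy vx vy a b c' d z); last first.
  by apply: eq_Rintegral => z _; rewrite /dist2; ring.
 apply: (le_trans (ltW E)).
 have := ler_wpM2r (ltW r2) (ler_wpM2l (ltW d10) h2); have := ler_wpM2r (ltW r2) (ler_wpM2r (ltW B1) d1d).
 have := mulr_gt0 (mulr_gt0 d10 B1) r2; clear; lra.
left; rewrite min_r ?(ltW BA)// in key.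
have [A1 h1 h2] := fin _ _ A0 B0' key m0.
split; first by apply: (le_trans h1); rewrite ler_wpM2r.
exists ((a + d) / 2), ((c' - b) / 2); apply: (H _ _ _ _ _ _ _ _ _ _ _ _ _ Q r0 A1).
 by apply: (le_trans h1); rewrite ler_wpM2r.
apply: (le_trans (ltW E)).
have := ler_wpM2r (ltW r2) (ler_wpM2l (ltW d10) h2); have := ler_wpM2r (ltW r2) (ler_wpM2r (ltW A1) d1d).
have := mulr_gt0 (mulr_gt0 d10 A1) r2; clear; lra.
Qed.

(** A segment from f c to a point outside the image of the square crosses the image of its boundary,
    where |f z - f c| is almost at least r m. This inscribed disc takes the place of the change of
    variables formula. *)
Lemma conf_disc (f g : P -> P) c r e m p q : cancel f g -> cancel g f -> continuous f -> continuous g ->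
 conf_on f c r e m p q -> 0 < r -> 0 < e -> forall w,
 (w.1 - (f c).1) ^+ 2 + (w.2 - (f c).2) ^+ 2 < (1 - 4 * e) * (r * m) ^+ 2 -> sqr_at c r (g w).
Proof.
move=> fK gK cf cg [m0 mpq H] r0 e0 w hw.
have RS z : rect (c.1 - r) (c.1 + r) (c.2 - r) (c.2 + r) z = `[< sqr_at c r z >].
 apply/idP/asboolP => [/andP[h1 h2]|[]]; first by split; rewrite /= in_itv.
 by rewrite /= !in_itv /= => h1 h2; apply/andP.
apply: contrapT => hn.
have hc : rect (c.1 - r) (c.1 + r) (c.2 - r) (c.2 + r) c.
 by rewrite RS; apply/asboolP/sqr_atP; rewrite subrr normr0 ltW.
have hg : ~~ rect (c.1 - r) (c.1 + r) (c.2 - r) (c.2 + r) (g w) by rewrite RS; apply/asboolPn.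
have [t [z [/andP[t0 t1] [bz1 bz2] fz]]] := rect_hit fK gK cg hc hg.
have cs : sqr_at c r c by apply/sqr_atP; rewrite subrr normr0 ltW.
have zs : sqr_at c r z by move: bz1; rewrite RS => /asboolP.
have [H1 H2] := H z c zs cs.
set dx := z.1 - c.1 in H1 H2; set dy := z.2 - c.2 in H1 H2.
set D1 := (f z).1 - (f c).1 in H1; set D2 := (f z).2 - (f c).2 in H2.
have dd : r ^+ 2 <= dx ^+ 2 + dy ^+ 2.
 have := sqr_ge0 dx; have := sqr_ge0 dy; rewrite /dx /dy.
 by case: bz2 => [->|[->|[->|->]]] h1 h2; nra.
have D12 : D1 ^+ 2 + D2 ^+ 2 <= (w.1 - (f c).1) ^+ 2 + (w.2 - (f c).2) ^+ 2.
 rewrite /D1 /D2 fz /seg /= !(addrC (_.1) (t * _)) !(addrC (_.2) (t * _)) !addrK !exprMn -mulrDr.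
 by apply: ler_piMl; [rewrite addr_ge0 ?sqr_ge0|exact: exprn_ile1].
set X := p * dx - q * dy in H1; set Y := q * dx + p * dy in H2.
have XY : (r * m) ^+ 2 <= X ^+ 2 + Y ^+ 2.
 rewrite (_ : X ^+ 2 + Y ^+ 2 = (dx ^+ 2 + dy ^+ 2) * m ^+ 2); last by rewrite mpq /X /Y; ring.
 by rewrite exprMn ler_wpM2r// sqr_ge0.
have rm0 : 0 < r * m by rewrite mulr_gt0.
have sqe (x : R) : `|x| <= e * (r * m) -> x ^+ 2 <= e ^+ 2 * (r * m) ^+ 2.
 by move=> h; rewrite -exprMn -(real_normK (num_real x)) ler_sqr ?nnegrE// mulr_ge0// ltW.
(* Young's inequality with weight e: the true differences D1, D2 are bounded below by the linear
   values X, Y with a relative loss of order e. *)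
have am (x y : R) : e * x ^+ 2 <= e * (1 + e) * y ^+ 2 + (1 + e) * (y - x) ^+ 2.
 rewrite -subr_ge0 (_ : _ - _ = (e * y + (y - x)) ^+ 2); first exact: sqr_ge0.
 by ring.
have a1 := am X D1; have a2 := am Y D2; have s1 := sqe _ H1; have s2 := sqe _ H2.
have rm2 : 0 < (r * m) ^+ 2 by rewrite exprn_gt0.
set N := (r * m) ^+ 2 in rm2 XY s1 s2 hw.
have h3 : e * N <= e * (1 + e) * (D1 ^+ 2 + D2 ^+ 2) + (1 + e) * (2 * (e ^+ 2 * N)).
 have := ler_wpM2l (ltW e0) XY; have e1 : 0 <= 1 + e by rewrite addr_ge0 ?ltW.
 by have := ler_wpM2l e1 s1; have := ler_wpM2l e1 s2; move: a1 a2; clear; lra.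
have h4 : e * N <= e * ((1 + e) * (D1 ^+ 2 + D2 ^+ 2) + 2 * (e + e ^+ 2) * N) by move: h3; clear; lra.
rewrite ler_pM2l// in h4.
have e1 : 0 < 1 + e by rewrite addr_gt0.
have := le_lt_trans D12 hw; rewrite -(ltr_pM2l e1) => h5.
have : 0 < e ^+ 2 * N by rewrite mulr_gt0// exprn_gt0.
have := mulr_gt0 e0 rm2.
by move: h4 h5; clear; lra.
Qed.

Lemma strip_measure (A : set P) a b c d : measurable A -> (mu2 A < +oo)%E -> a <= b -> c <= d ->
 (forall z, a <= z.1 < b -> c <= z.2 < d -> A z) ->
 fine (mu2 (A `&` [set z | z.1 < a])) + (b - a) * (d - c) <= fine (mu2 (A `&` [set z | z.1 < b])).
Proof.
move=> mA Af ab cd H.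
have mh x : measurable [set z : P | z.1 < x].
 have mp : measurable_fun setT (fst : P -> R) by exact: measurable_fst.
 have := mp measurableT `]-oo, x[%classic (measurable_itv _); rewrite setTI.
 by rewrite (_ : fst @^-1` _ = [set z : P | z.1 < x])//; apply/seteqP; split => z /=; rewrite in_itv.
pose B : set P := `[a, b[%classic `*` `[c, d[%classic.
have mB : measurable B by exact: measurableX.
have itv x y : x <= y -> @lbm R `[x, y[%classic = (y - x)%:E.
 by move=> xy; rewrite /lbm lebesgue_measure_itv /= lte_fin; case: ltP => h //; congr EFin; lra.
have muB : mu2 B = ((b - a) * (d - c))%:E by rewrite product_measure1E//= (itv _ _ ab) (itv _ _ cd).
have sub : (A `&` [set z | z.1 < a]) `|` B `<=` A `&` [set z | z.1 < b].
 move=> z [[Az /= za]|[/= + +]]; first by split => //=; exact: lt_le_trans ab.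
 by rewrite /= !in_itv /= => h1 h2; split; [exact: H|have /andP[] := h1].
have m1 := measurableI _ _ mA (mh a); have m2 := measurableI _ _ mA (mh b).
have fin S : measurable S -> S `<=` A -> mu2 S \is a fin_num.
 move=> mS SA; rewrite ge0_fin_numE//; apply: le_lt_trans Af; apply: le_measure; rewrite ?inE//.
have mU : mu2 ((A `&` [set z | z.1 < a]) `|` B) = (mu2 (A `&` [set z | (z.1 < a)%R]) + mu2 B)%E.
 rewrite measureU//.
 by apply/seteqP; split => // z [[_ /= za] [/=]]; rewrite in_itv /= => /andP[/le_lt_trans/(_ za)]; rewrite ltxx.
have h : (mu2 ((A `&` [set z | (z.1 < a)%R]) `|` B) <= mu2 (A `&` [set z | (z.1 < b)%R]))%E.
 by apply: le_measure; rewrite ?inE//; exact: measurableU.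
rewrite mU muB in h.
have f1 : mu2 (A `&` [set z | z.1 < a]) \is a fin_num by apply: fin => // z [].
have f2 : mu2 (A `&` [set z | z.1 < b]) \is a fin_num by apply: fin => // z [].
rewrite -[(b - a) * _]/(fine ((b - a) * (d - c))%:E) -fineD//.
by apply: fine_le => //; rewrite fin_numD f1.
Qed.

(* Inscribed staircase with the Pythagorean corners (7, 24), (15, 20), (20, 15), (24, 7). *)
Lemma strip_sum (F : R -> R) (T m : R) :
 (forall x y i j, 0 <= y -> - x <= i -> i <= j -> j <= x -> x ^+ 2 + y ^+ 2 = 1 ->
  F i + (j - i) * (2 * y) * T <= F j) ->
 (forall i, 0 <= F i) -> (forall i, F i <= m) -> 1724 / 625 * T <= m.
Proof.
move=> K F0 F1.
have [a [b [c [d [[a0 ab bc cd] [ad bc1 abcd]]]]]] : exists a b c d : R,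
  [/\ 0 < a, a < b, b < c & c < d] /\
  [/\ d ^+ 2 + a ^+ 2 = 1, c ^+ 2 + b ^+ 2 = 1 &
   2 * ((d - c) * (2 * a) + (c - b) * (2 * b) + (b - a) * (2 * c)) + 2 * a * (2 * d) = 1724 / 625].
 by exists (7 / 25), (3 / 5), (4 / 5), (24 / 25); split; split; lra.
rewrite -abcd; clear abcd.
have ba : a ^+ 2 + d ^+ 2 = 1 by rewrite addrC.
have cb : b ^+ 2 + c ^+ 2 = 1 by rewrite addrC.
move: (ltW a0) (ltW ab) (ltW bc) (ltW cd) => {}a0 {}ab {}bc {}cd.
have b0 := le_trans a0 ab; have c0 := le_trans b0 bc; have d0 := le_trans c0 cd.
have n0 (x : R) : 0 <= x -> - x <= x by clear; lra.
have N (x y : R) : x <= y -> - y <= - x by rewrite lerN2.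
have nn (x y : R) : 0 <= x -> 0 <= y -> - x <= y by clear; lra.
have h1 := K d a (- d) (- c) a0 (lexx _) (N _ _ cd) (nn _ _ c0 d0) ad.
have h2 := K c b (- c) (- b) b0 (lexx _) (N _ _ bc) (nn _ _ b0 c0) bc1.
have h3 := K b c (- b) (- a) c0 (lexx _) (N _ _ ab) (nn _ _ a0 b0) cb.
have h4 := K a d (- a) a d0 (lexx _) (n0 _ a0) (lexx _) ba.
have h5 := K b c a b c0 (nn _ _ b0 a0) ab (lexx _) cb.
have h6 := K c b b c b0 (nn _ _ c0 b0) bc (lexx _) bc1.
have h7 := K d a c d a0 (nn _ _ d0 c0) cd (lexx _) ad.
move: (F0 (- d)) (F1 d) h1 h2 h3 h4 h5 h6 h7; clear; lra.
Qed.

(** The margin between 1724/625 and 11/4 pays for moving the closed staircase into the open disc. *)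
Lemma shrink_factor : exists l : R, [/\ 0 < l, l < 1 & 11 / 4 <= 1724 / 625 * l ^+ 2].
Proof. by exists (999 / 1000); split; lra. Qed.

(** 11/4 is a rational lower bound for pi, large enough for the factor 3/2 in [area_square]. *)
Lemma disc_measure (A : set P) w0 s : measurable A -> (mu2 A < +oo)%E -> 0 < s ->
 (forall w, (w.1 - w0.1) ^+ 2 + (w.2 - w0.2) ^+ 2 < s ^+ 2 -> A w) ->
 11 / 4 * s ^+ 2 <= fine (mu2 A).
Proof.
move=> mA Af s0 H.
have [l [l0 l1 l2]] := shrink_factor.
pose t := l * s.
have t0 : 0 < t by rewrite mulr_gt0.
have ts : t ^+ 2 < s ^+ 2 by rewrite /t exprMn gtr_pMl ?exprn_gt0// expr_lt1// ltW.
have st : 11 / 4 * s ^+ 2 <= 1724 / 625 * t ^+ 2.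
 by have := ler_wpM2r (sqr_ge0 s) l2; rewrite /t exprMn; clear; lra.
clearbody t; clear l l0 l1 l2.
have K (x y i j : R) : 0 <= y -> - x <= i -> i <= j -> j <= x -> x ^+ 2 + y ^+ 2 = 1 ->
  fine (mu2 (A `&` [set z | z.1 < w0.1 + i * t])) + (j - i) * (2 * y) * t ^+ 2 <=
  fine (mu2 (A `&` [set z | z.1 < w0.1 + j * t])).
 move=> y0 ix1 ij jx2 xy.
 have := @strip_measure A (w0.1 + i * t) (w0.1 + j * t) (w0.2 - y * t) (w0.2 + y * t) mA Af.
 rewrite (_ : _ * (w0.2 + y * t - (w0.2 - y * t)) = (j - i) * (2 * y) * t ^+ 2); last by ring.
 apply.
 - by rewrite lerD2l ler_pM2r.
 - by have := mulr_ge0 y0 (ltW t0); clear; lra.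
 - move=> z /andP[h1 h2] /andP[h3 h4]; apply: H; apply: le_lt_trans ts.
  rewrite -[leRHS]mul1r -xy mulrDl; apply: lerD.
   rewrite -exprMn -(real_normK (num_real (_ - _))) ler_sqr ?nnegrE//; last first.
    by rewrite mulr_ge0// ?(ltW t0)//; move: ix1 ij jx2; clear; lra.
   rewrite !ler_norml.
   have := ler_wpM2r (ltW t0) ix1; have := ler_wpM2r (ltW t0) jx2; rewrite mulNr => q1 q2.
   by apply/andP; split; move: h1 h2 q1 q2; clear; lra.
  rewrite -exprMn -(real_normK (num_real (_ - _))) ler_sqr ?nnegrE//; last first.
   by rewrite mulr_ge0// ltW.
  by rewrite !ler_norml; apply/andP; split; move: h3 h4; clear; lra.
rewrite (le_trans st)//.
apply: (strip_sum (F := fun i => fine (mu2 (A `&` [set z | z.1 < w0.1 + i * t])))) => [|i|i]; first exact: K.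
 by apply: fine_ge0; exact: measure_ge0.
 have mI : measurable (A `&` [set z | z.1 < w0.1 + i * t]).
  apply: measurableI => //; have mp : measurable_fun setT (fst : P -> R) by exact: measurable_fst.
  have := mp measurableT `]-oo, w0.1 + i * t[%classic (measurable_itv _); rewrite setTI.
  by congr measurable; apply/seteqP; split => z /=; rewrite in_itv.
 have le : (mu2 (A `&` [set z | (z.1 < w0.1 + i * t)%R]) <= mu2 A)%E.
  by apply: le_measure; rewrite ?inE // => z [].
 apply: fine_le => //; rewrite ge0_fin_numE//; exact: le_lt_trans Af.
Qed.

Lemma image_hsq_fin (f g : P -> P) (c : P) r : cancel g f -> continuous f -> continuous g ->
 (mu2 (g @^-1` hsq c r) < +oo)%E.
Proof.
move=> gK cf cg; have [M M0 HM] := bounded_on_box cf (c.1 - r) (c.1 + r) (c.2 - r) (c.2 + r).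
apply: (@le_lt_trans _ _ (mu2 (sqr_at (0 : P) M))); last by rewrite mu_sqr_at ?ltry// ltW.
apply: le_measure; rewrite ?inE; [|exact: msqr_at|].
 by apply: cont_meas_plane => //; exact: mhsq.
by move=> w /hsq_sqr/HM; rewrite gK => h; apply/sqr_atP; rewrite subr0.
Qed.

(** The integral of the squared parts over an almost conformal square is close to 4 r^2 m^2, while
    the image contains almost a disc of radius r m; the quotient 16/11 of 4 by 11/4 leaves room
    below 3/2. *)
Lemma area_square : exists2 k0 : R, 0 < k0 & exists2 C, 0 <= C &
 forall k f g ux uy vx vy (c : P) r a b c' d, qcmap k f g ux uy vx vy -> 0 <= k <= k0 -> 0 < r ->
 \int[mu2]_(z in hsq c r) (cf2 (ux z) (uy z) (vx z) (vy z) + ac2 (ux z) (uy z) (vx z) (vy z)) <=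
  3 / 2 * fine (mu2 (g @^-1` hsq c r)) +
  C * \int[mu2]_(z in hsq c r) dist2 ux uy vx vy a b c' d z.
Proof.
(* 33/8 is 3/2 times 11/4; the remaining factors collect the losses of size e in the integral, in
   the radius and in the shrunken square. *)
have [e [e0 e1 e2]] : exists e : R, [/\ 0 < e, e < 1 &
  4 * (1 + 2 * e) * (1 + e) <= 33 / 8 * ((1 - 4 * e) * (1 - e) ^+ 2)].
 by exists (1 / 1000); split; lra.
have e01 : 0 < e < 1 by rewrite e0.
have [del d0 H] := good_square e0 e01 e0.
exists del => //.
pose C := Num.max (1 + 8 / del) ((1 + (2 * e)^-1) / 2).
have C1 : 1 + 8 / del <= C by rewrite le_max lexx.
have C2 : (1 + (2 * e)^-1) / 2 <= C by rewrite le_max lexx orbT.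
have d80 : 0 <= 8 / del by rewrite divr_ge0// ltW.
have C0 : 0 <= C by apply: le_trans C1; rewrite addr_ge0.
exists C => // k f g ux uy vx vy c r a b c' d Q k01 r0.
set m2 := cf2 a b c' d + ac2 a b c' d.
have id := locint_hsq c (ltW r0) (locint_dist2 a b c' d Q).
have mq := @mhsq R c r.
have Id0 : 0 <= \int[mu2]_(z in hsq c r) dist2 ux uy vx vy a b c' d z.
 by apply: Rintegral_ge0 => z _; rewrite /dist2 !addr_ge0 ?sqr_ge0.
have hE z : cf2 (ux z) (uy z) (vx z) (vy z) + ac2 (ux z) (uy z) (vx z) (vy z) = 2^-1 * dist2 ux uy vx vy 0 0 0 0 z.
 by rewrite /dist2 !subr0 -cf2_ac2_sum mulKf.
have fr := fine_mu_hsq c r0.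
have up t : 0 < t -> \int[mu2]_(z in hsq c r) (cf2 (ux z) (uy z) (vx z) (vy z) + ac2 (ux z) (uy z) (vx z) (vy z)) <=
  (1 + t) * m2 * (4 * r ^+ 2) + (1 + t^-1) / 2 * \int[mu2]_(z in hsq c r) dist2 ux uy vx vy a b c' d z.
 move=> t0.
 have ik (x : R) : mu2.-integrable (hsq c r) (EFin \o cst x).
  by apply: (@locint_hsq (cst x) c r (ltW r0)); apply: locint_cont => z; exact: cvg_cst.
 rewrite -fr -Rintegral_cst// -RintegralZl// -RintegralD//; [|exact: ik|exact: RiZ].
 apply: le_Rintegral => //.
 - under eq_fun do rewrite hE; apply: RiZ => //.
  exact: (locint_hsq c (ltW r0) (locint_dist2 0 0 0 0 Q)).
 - by apply: RiD => //; [exact: ik|exact: RiZ].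
 move=> z _; rewrite hE /m2 /dist2 !subr0.
 have am (x y : R) : x ^+ 2 <= (1 + t) * y ^+ 2 + (1 + t^-1) * (x - y) ^+ 2.
  rewrite -subr_ge0 (_ : _ - _ = (t * y - (x - y)) ^+ 2 / t); first by rewrite divr_ge0 ?sqr_ge0// ltW.
  by field; rewrite gt_eqF.
 have := cf2_ac2_sum a b c' d.
 have := am (ux z) a; have := am (uy z) b; have := am (vx z) c'; have := am (vy z) d.
 set T := t^-1; clearbody T; clear.
 move: (cf2 a b c' d) (ac2 a b c' d) => X Y h1 h2 h3 h4 E.
 have {E} -> : X + Y = 2^-1 * (a ^+ 2 + b ^+ 2 + c' ^+ 2 + d ^+ 2) by lra.
 lra.
have mgr : 0 <= fine (mu2 (g @^-1` hsq c r)) by apply: fine_ge0; exact: measure_ge0.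
set I := \int[mu2]_(z in hsq c r) dist2 _ _ _ _ _ _ _ _ _ in id Id0 up *.
(* If the derivative is far from the constant matrix, the error term with its large constant C
   dominates everything; otherwise [good_square] applies. *)
have [le|lt] := leP (del * m2 * r ^+ 2) I.
 apply: (le_trans (up 1 ltr01)); rewrite invr1.
 have h1 : m2 * r ^+ 2 <= I / del by rewrite ler_pdivlMr// mulrC mulrA.
 have := ler_wpM2r Id0 C1; have := mulr_ge0 (ler0n R 3) mgr; move: h1; clear.
 set D := del^-1; set F := fine _; lra.
have t0 : 0 < 2 * e by rewrite mulr_gt0.
apply: (le_trans (up _ t0)); apply: lerD; last by rewrite ler_wpM2r.
have mA : measurable (g @^-1` hsq c r) by apply: cont_meas_plane => //; exact: qc_cg Q.
have Af := image_hsq_fin c r (qc_gK Q) (qc_cf Q) (qc_cg Q).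
have r'0 : 0 < (1 - e) * r by rewrite mulr_gt0// subr_gt0.
have sub : sqr_at c ((1 - e) * r) `<=` hsq c r by apply: sqr_hsq; rewrite gtr_pMl// ltrBlDr ltrDl.
have fin (mm : R) w0 : 0 < mm -> m2 <= (1 + e) * mm ->
  (forall w, (w.1 - w0.1) ^+ 2 + (w.2 - w0.2) ^+ 2 < (1 - 4 * e) * ((1 - e) * r * Num.sqrt mm) ^+ 2 ->
   (g @^-1` hsq c r) w) ->
  (1 + 2 * e) * m2 * (4 * r ^+ 2) <= 3 / 2 * fine (mu2 (g @^-1` hsq c r)).
 move=> mm0 mmle Hw.
 have e4 : 0 < 1 - 4 * e.
  rewrite -(pmulr_lgt0 _ (_ : 0 < 33 / 8 * (1 - e) ^+ 2)); last by rewrite mulr_gt0// exprn_gt0// subr_gt0.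
  apply: lt_le_trans (_ : 4 * (1 + 2 * e) * (1 + e) <= _); last by rewrite mulrCA [X in _ <= X]mulrC; move: e2; clear; lra.
  by rewrite !mulr_gt0// addr_gt0.
 pose s := Num.sqrt (1 - 4 * e) * ((1 - e) * r * Num.sqrt mm).
 have s0 : 0 < s by rewrite !mulr_gt0 ?sqrtr_gt0// subr_gt0.
 have sE : s ^+ 2 = (1 - 4 * e) * ((1 - e) * r * Num.sqrt mm) ^+ 2 by rewrite /s exprMn sqr_sqrtr// ltW.
 have := @disc_measure _ w0 s mA Af s0; rewrite sE => /(_ Hw).
 rewrite !exprMn sqr_sqrtr ?(ltW mm0)// => dm.
 have r2 : 0 < r ^+ 2 by rewrite exprn_gt0.
 have mr : 0 <= mm * r ^+ 2 by rewrite mulr_ge0// ltW.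
 have := ler_wpM2r mr e2 => h1.
 have h2 : (1 + 2 * e) * m2 * (4 * r ^+ 2) <= (1 + 2 * e) * ((1 + e) * mm) * (4 * r ^+ 2).
  have p1 : 0 <= 1 + 2 * e by rewrite addr_ge0// ltW.
  have p2 : 0 <= 4 * r ^+ 2 by rewrite mulr_ge0// ltW.
  exact: ler_wpM2r p2 _ _ (ler_wpM2l p1 mmle).
 apply: (le_trans h2); move: h1 dm; set F := fine _; clear; lra.
have [[BA [p [q cf]]]|[AB [p [q cf]]]] := H _ _ _ _ _ _ _ c r a b c' d Q k01 r0 lt.
 have A0 : 0 < cf2 a b c' d by case: cf => m0 _ _; rewrite -sqrtr_gt0.
 apply: (fin _ (f c) A0); first by rewrite /m2; move: BA; clear; lra.
 by move=> w hw; apply: sub; exact: (conf_disc (qc_fK Q) (qc_gK Q) (qc_cf Q) (qc_cg Q) cf r'0 e0 hw).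
have B0 : 0 < ac2 a b c' d by case: cf => m0 _ _; rewrite -sqrtr_gt0.
have Q' := qc_reflect Q.
apply: (fin _ (f c) B0); first by rewrite /m2; move: AB; clear; lra.
move=> w hw; apply: sub.
have := @conf_disc _ _ _ _ _ _ _ _ (qc_fK Q') (qc_gK Q') (qc_cf Q') (qc_cg Q') cf r'0 e0 (w.1, - w.2).
have ww : (w.1, - - w.2) = w by rewrite opprK -surjective_pairing.
rewrite /= ww; apply.
by rewrite (_ : (- w.2 - - (f c).2) ^+ 2 = (w.2 - (f c).2) ^+ 2) //; ring.
Qed.

Lemma qc_density_box k f g ux uy vx vy : qcmap k f g ux uy vx vy ->
 locint (fun z => cf2 (ux z) (uy z) (vx z) (vy z) + ac2 (ux z) (uy z) (vx z) (vy z)).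
Proof.
move=> Q; have := locintZ 2^-1 (locint_dist2 0 0 0 0 Q).
by congr locint; apply/funext => z; rewrite /dist2 !subr0 -cf2_ac2_sum mulKf.
Qed.

Lemma qc_cf2_box k f g ux uy vx vy : qcmap k f g ux uy vx vy ->
 locint (fun z => cf2 (ux z) (uy z) (vx z) (vy z)).
Proof.
move=> Q; have gu := qc_u Q; have gv := qc_v Q.
have mux := (xac_box (grad2_x gu)).1; have muy := (yac_box (grad2_y gu)).1.
have mvx := (xac_box (grad2_x gv)).1; have mvy := (yac_box (grad2_y gv)).1.
apply: (locint_le _ _ (qc_density_box Q)).
 apply: measurable_funM => //; apply: measurable_funD; apply: measurable_funX.
  exact: measurable_funD. exact: measurable_funB.
by move=> z; rewrite ger0_norm ?cf2_ge0// lerDl ac2_ge0.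
Qed.

Lemma image_box_bounded (f g : P -> P) w0 t : cancel f g -> continuous g ->
 exists2 N, 0 < N & forall z, `|f z - w0| < t -> `|z| <= N.
Proof.
move=> fK cg; have [N N0 HN] := bounded_on_box cg (w0.1 - t) (w0.1 + t) (w0.2 - t) (w0.2 + t).
by exists N => // z zt; rewrite -[z]fK; apply: HN; apply/sqr_atP; exact: ltW.
Qed.

(** The image of the set is the whole open square of radius t, of area at most 4 t^2, whence 6 = 3/2
    * 4. [grid_le] removes the error terms of [area_square]. *)
Lemma area_box : exists2 k0 : R, 0 < k0 &
 forall k f g ux uy vx vy (w0 : P) t, qcmap k f g ux uy vx vy -> 0 <= k <= k0 -> 0 < t ->
 \int[mu2]_(z in [set z | `|f z - w0| < t])
  (cf2 (ux z) (uy z) (vx z) (vy z) + ac2 (ux z) (uy z) (vx z) (vy z)) <= 6 * t ^+ 2.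
Proof.
have [k0 k00 [C C0 H]] := area_square.
exists k0 => // k f g ux uy vx vy w0 t Q k01 t0.
pose V := [set w : P | `|w - w0| < t]; pose U := [set z | `|f z - w0| < t].
have VU : g @^-1` U = V by apply/seteqP; split => w; rewrite /U /V /= (qc_gK Q).
have oV : open V.
 rewrite (_ : V = ball w0 t); first exact: ball_open.
 by rewrite -ball_normE; apply/seteqP; split => w /=; rewrite distrC.
have oU : open U by apply: (continuousP f).1 oV; exact: qc_cf Q.
have Vs : V `<=` sqr_at w0 t by move=> w /ltW wt; apply/sqr_atP.
have Vm : (mu2 V <= (4 * t ^+ 2)%:E)%E.
 rewrite -(mu_sqr_at w0 (ltW t0)); apply: le_measure; rewrite ?inE//; first exact: open_measurable2.
 exact: msqr_at.
have [N N0 HN] := image_box_bounded w0 t (qc_fK Q) (qc_cg Q).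
have Vf : (mu2 V < +oo)%E by apply: le_lt_trans Vm _; rewrite ltry.
have gu := qc_u Q; have gv := qc_v Q.
have := @grid_le R U N (3 / 2) C g _ ux uy vx vy oU HN _ C0 (qc_cg Q) _ (qc_density_box Q).
rewrite VU => G; apply: le_trans (G _ _ _ _ _ _ _ _ _ _ _ _) _.
- by rewrite divr_ge0.
- exact: Vf.
- by move=> z; rewrite addr_ge0 ?cf2_ge0 ?ac2_ge0.
- exact: xac_box (grad2_x gu).
- exact: grad2_xx gu.
- exact: yac_box (grad2_y gu).
- exact: grad2_yy gu.
- exact: xac_box (grad2_x gv).
- exact: grad2_xx gv.
- exact: yac_box (grad2_y gv).
- exact: grad2_yy gv.
- by move=> q r a b c d r0 _; exact: H Q k01 r0.
have : fine (mu2 V) <= 4 * t ^+ 2.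
 rewrite -[leRHS]/(fine (4 * t ^+ 2)%:E); apply: fine_le => //.
 by rewrite ge0_fin_numE.
by clear; lra.
Qed.

End quasiconformal_squares.

(** * Constancy of the orientation *)

Section orientation.
Variable R : realType.
Local Notation P := (R * R)%type.
Local Notation mu2 := (@lbm R \x @lbm R)%E.

(** Explicit continuous angle functions stand in for winding numbers; the free positive factor makes
    lengths irrelevant. *)
Definition turned (t : R) (a b : P) : Prop := exists2 l, 0 < l &
 b.1 = l * (cos t * a.1 - sin t * a.2) /\ b.2 = l * (sin t * a.1 + cos t * a.2).

Definition conjp (a : P) : P := (a.1, - a.2).

Lemma turned_trans s t a b d : turned s a b -> turned t b d -> turned (s + t) a d.
Proof.
move=> [l l0 [h1 h2]] [m m0 [h3 h4]]; exists (l * m); first exact: mulr_gt0.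
by rewrite h3 h4 h1 h2 cosD sinD; split; ring.
Qed.

Lemma turned_conj t a b : turned t a b -> turned t (conjp b) (conjp a).
Proof.
move=> [l l0 [h1 h2]]; exists l^-1; first by rewrite invr_gt0.
have cs := cos2Dsin2 t.
have E (u : R) : (cos t ^+ 2 + sin t ^+ 2) * u = u by rewrite cs mul1r.
rewrite /conjp /= h1 h2; split.
 by rewrite -[LHS]E; field; exact: lt0r_neq0.
by rewrite -[in LHS](E a.2); field; exact: lt0r_neq0.
Qed.

Lemma turned_pi t a b : a.1 ^+ 2 + a.2 ^+ 2 != 0 -> turned t a b -> turned (t + pi) a b -> False.
Proof.
move=> a0 [l l0 [h1 h2]] [m m0 [h3 h4]].
rewrite cosDpi sinDpi in h3 h4.
have lm : 0 < l + m by rewrite addr_gt0.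
have E1 : (l + m) * (cos t * a.1 - sin t * a.2) = 0.
 by rewrite mulrDl -h1 h3; ring.
have E2 : (l + m) * (sin t * a.1 + cos t * a.2) = 0.
 by rewrite mulrDl -h2 h4; ring.
move/eqP: E1; rewrite mulf_eq0 gt_eqF//= => /eqP E1.
move/eqP: E2; rewrite mulf_eq0 gt_eqF//= => /eqP E2.
move/negP: a0; apply; apply/eqP; rewrite -[LHS]mul1r -(cos2Dsin2 t).
rewrite (_ : _ * _ = (cos t * a.1 - sin t * a.2) ^+ 2 + (sin t * a.1 + cos t * a.2) ^+ 2); last by ring.
by rewrite E1 E2; ring.
Qed.

(** With a positive scalar product the angle is an arctangent of the quotient of cross and scalar
    product, hence continuous in both vectors. *)
Lemma turned_dot (a b : P) : 0 < a.1 * b.1 + a.2 * b.2 ->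
 turned (atan ((a.1 * b.2 - a.2 * b.1) / (a.1 * b.1 + a.2 * b.2))) a b.
Proof.
set d := a.1 * b.1 + a.2 * b.2; set c := a.1 * b.2 - a.2 * b.1 => d0.
set t := atan _; have c0 : 0 < cos t by rewrite cos_atan invr_gt0 sqrtr_gt0 ltr_pwDl// sqr_ge0.
have sE : sin t = c / d * cos t by rewrite -[c / d]atanK -/t /tan divfK// gt_eqF.
have n0 : 0 < a.1 ^+ 2 + a.2 ^+ 2.
 rewrite lt0r addr_ge0 ?sqr_ge0// andbT; apply: contraTneq d0 => /eqP.
 rewrite paddr_eq0 ?sqr_ge0// !sqrf_eq0 => /andP[/eqP a1 /eqP a2].
 by rewrite /d a1 a2 !mul0r addr0 ltxx.
exists (d / ((a.1 ^+ 2 + a.2 ^+ 2) * cos t)); first by rewrite divr_gt0// mulr_gt0.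
have dn : d != 0 by rewrite gt_eqF.
have nn : a.1 ^+ 2 + a.2 ^+ 2 != 0 by rewrite gt_eqF.
have cn : cos t != 0 by rewrite gt_eqF.
rewrite sE; clearbody t; move: dn nn cn; rewrite /d /c => dn nn cn.
by split; field; rewrite nn cn dn.
Qed.

(** Equal end values: the angle between the two loops has no net winding. *)
Definition lift_ok (a : R -> R) := continuous a /\ a (2 * pi) = a 0.

(** Loops that stay at an acute angle wind equally often. The maximum with [del] in the denominator
    makes the angle continuous on the whole line without changing it on [0, 2 pi]. *)
Lemma lift_step (L M : R -> P) del : 0 < del ->
 continuous (fun t => (L t).1) -> continuous (fun t => (L t).2) ->
 continuous (fun t => (M t).1) -> continuous (fun t => (M t).2) ->
 L (2 * pi) = L 0 -> M (2 * pi) = M 0 ->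
 (forall t, 0 <= t <= 2 * pi -> del <= (L t).1 * (M t).1 + (L t).2 * (M t).2) ->
 exists2 a, lift_ok a & forall t, 0 <= t <= 2 * pi -> turned (a t) (L t) (M t).
Proof.
move=> d0 c1 c2 c3 c4 EL EM H.
pose d t := (L t).1 * (M t).1 + (L t).2 * (M t).2.
pose c t := (L t).1 * (M t).2 - (L t).2 * (M t).1.
have cd : continuous d by move=> t; apply: cvgD; apply: cvgM; [exact: c1|exact: c3|exact: c2|exact: c4].
have cc : continuous c by move=> t; apply: cvgB; apply: cvgM; [exact: c1|exact: c4|exact: c2|exact: c3].
have m0 t : 0 < Num.max (d t) del by rewrite lt_max d0 orbT.
exists (fun t => atan (c t / Num.max (d t) del)).
 split; last by rewrite /c /d EL EM.
 move=> t; apply: (@continuous_comp _ _ _ (fun t => c t / Num.max (d t) del) atan).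
  apply: cvgM; first exact: cc.
  apply: cvgV; first by rewrite gt_eqF.
  by apply: continuous_max; [exact: cd|exact: cvg_cst].
 exact: continuous_atan.
move=> t t01; have dt := H t t01; rewrite max_l//.
by apply: turned_dot; exact: lt_le_trans dt.
Qed.

Definition ring_pt (z : P) (r t : R) : P := (z.1 + r * cos t, z.2 + r * sin t).

Lemma ring_pt_neq (z : P) (r t : R) : 0 < r -> ring_pt z r t = z -> False.
Proof.
case: z => x y r0 E.
have h1 : r * cos t = 0 by have := congr1 fst E; rewrite /ring_pt /=; set u := r * _; clear; lra.
have h2 : r * sin t = 0 by have := congr1 snd E; rewrite /ring_pt /=; set u := r * _; clear; lra.
have rn := lt0r_neq0 r0.
have c0 : cos t = 0 by apply: (mulfI rn); rewrite mulr0.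
have s0 : sin t = 0 by apply: (mulfI rn); rewrite mulr0.
by have := cos2Dsin2 t; rewrite c0 s0 !expr0n /= addr0 => /eqP; rewrite eq_sym oner_eq0.
Qed.

(** The circle about c is deformed into the circle about c', and injectivity keeps the image of the
    circle away from the image of its centre. By compactness finitely many small deformations
    suffice, each an instance of [lift_step], and their angles add up. *)
Lemma circle_lift (f g : P -> P) c c' r r' : cancel f g -> continuous f -> 0 < r -> 0 < r' ->
 exists2 a, lift_ok a & forall t, 0 <= t <= 2 * pi ->
  turned (a t) ((f (ring_pt c r t)).1 - (f c).1, (f (ring_pt c r t)).2 - (f c).2)
   ((f (ring_pt c' r' t)).1 - (f c').1, (f (ring_pt c' r' t)).2 - (f c').2).
Proof.
move=> fK cf r0 r'0.
pose z s : P := (c.1 + s * (c'.1 - c.1), c.2 + s * (c'.2 - c.2)).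
(* Radii are interpolated through the exponential, which keeps them positive for every real s. *)
pose rho s := expR (ln r + s * (ln r' - ln r)).
have z0 : z 0 = c by rewrite /z !mul0r !addr0 -surjective_pairing.
have z1 : z 1 = c' by rewrite /z [RHS]surjective_pairing; congr pair; ring.
have rho0 : rho 0 = r by rewrite /rho mul0r addr0 lnK.
have rho1 : rho 1 = r' by rewrite /rho mul1r addrC subrK lnK.
pose H (x : P) : P := ((f (ring_pt (z x.1) (rho x.1) x.2)).1 - (f (z x.1)).1,
  (f (ring_pt (z x.1) (rho x.1) x.2)).2 - (f (z x.1)).2).
have cx : continuous (fun x : P => x.1) by move=> x; exact: cvg_fst.
have cy : continuous (fun x : P => x.2) by move=> x; exact: cvg_snd.
have crho : continuous (fun x : P => rho x.1).
 move=> x; apply: (@continuous_comp _ _ _ (fun x : P => ln r + x.1 * (ln r' - ln r)) expR); last exact: continuous_expR.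
 by apply: cvgD; [exact: cvg_cst|apply: cvgM; [exact: cx|exact: cvg_cst]].
have caff (u v : R) : continuous (fun x : P => u + x.1 * (v - u)).
 by move=> x; apply: cvgD; [exact: cvg_cst|apply: cvgM; [exact: cx|exact: cvg_cst]].
have ccos : continuous (fun x : P => cos x.2) by move=> x; apply: (@continuous_comp _ _ _ (fun x : P => x.2) cos); [exact: cy|exact: continuous_cos].
have csin : continuous (fun x : P => sin x.2) by move=> x; apply: (@continuous_comp _ _ _ (fun x : P => x.2) sin); [exact: cy|exact: continuous_sin].
have cz : continuous (fun x : P => z x.1) by apply: pair_cont; exact: caff.
have crp : continuous (fun x : P => ring_pt (z x.1) (rho x.1) x.2).
 apply: pair_cont => x; apply: cvgD; first [exact: caff|apply: cvgM; first [exact: crho|exact: ccos|exact: csin]].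
have cH1 : continuous (fun x => (H x).1).
 move=> x; apply: cvgB.
  apply: (@continuous_comp _ _ _ (fun x : P => ring_pt (z x.1) (rho x.1) x.2) (fun w => (f w).1)); first exact: crp.
  by apply: (@continuous_comp _ _ _ f fst); [exact: cf|exact: cvg_fst].
 apply: (@continuous_comp _ _ _ (fun x : P => z x.1) (fun w => (f w).1)); first exact: cz.
 by apply: (@continuous_comp _ _ _ f fst); [exact: cf|exact: cvg_fst].
have cH2 : continuous (fun x => (H x).2).
 move=> x; apply: cvgB.
  apply: (@continuous_comp _ _ _ (fun x : P => ring_pt (z x.1) (rho x.1) x.2) (fun w => (f w).2)); first exact: crp.
  by apply: (@continuous_comp _ _ _ f snd); [exact: cf|exact: cvg_snd].
 apply: (@continuous_comp _ _ _ (fun x : P => z x.1) (fun w => (f w).2)); first exact: cz.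
 by apply: (@continuous_comp _ _ _ f snd); [exact: cf|exact: cvg_snd].
pose N x := (H x).1 ^+ 2 + (H x).2 ^+ 2.
have N0 x : 0 < N x.
 rewrite lt0r addr_ge0 ?sqr_ge0// andbT paddr_eq0 ?sqr_ge0// !sqrf_eq0 !subr_eq0.
 apply/negP => /andP[/eqP e1 /eqP e2].
 have /(can_inj fK) : f (ring_pt (z x.1) (rho x.1) x.2) = f (z x.1).
  by rewrite [LHS]surjective_pairing e1 e2 -surjective_pairing.
 by apply: ring_pt_neq; exact: expR_gt0.
have cN : continuous N by move=> x; apply: cvgD; rewrite !expr2; apply: cvgM; first [exact: cH1|exact: cH2].
pose K := cbox 0 1 0 (2 * pi) : set P.
have cK : compact K by exact: compact_cbox.
have [M [M0 HM]] : exists M, 0 < M /\ forall x, K x -> `|(N x)^-1| <= M.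
 by apply: bounded_on_compact => // x; apply: cvgV; [rewrite gt_eqF|exact: cN].
have [B1 [B10 HB1]] := bounded_on_compact cH1 cK.
have [B2 [B20 HB2]] := bounded_on_compact cH2 cK.
pose e := (4 * M * (B1 + B2))^-1.
have e0 : 0 < e by rewrite invr_gt0 !mulr_gt0// addr_gt0.
have [d1 d10 Hd1] := unif_compact e0 cK cH1.
have [d2 d20 Hd2] := unif_compact e0 cK cH2.
pose d := Num.min d1 d2; have d0 : 0 < d by rewrite lt_min d10.
pose n := Num.bound d^-1; have nd : d^-1 < n%:R by apply: archi_boundP; rewrite invr_ge0 ltW.
have n0 : 0 < n%:R :> R by apply: lt_trans nd; rewrite invr_gt0.
have nd' : n%:R^-1 < d by rewrite -[ltRHS]invrK ltf_pV2 ?posrE ?invr_gt0.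
have p20 : 2 * pi = pi *+ 2 :> R by rewrite mulr_natl.
have per s : H (s, 2 * pi) = H (s, 0) by rewrite /H /ring_pt /= p20 cos2pi sin2pi cos0 sin0.
suff ind i : (i <= n)%N -> exists2 a, lift_ok a & forall t, 0 <= t <= 2 * pi -> turned (a t) (H (0, t)) (H (i%:R / n%:R, t)).
 have [a ha Ha] := ind n (leqnn n); exists a => // t /Ha.
 by rewrite divff ?gt_eqF// /H /= z0 z1 rho0 rho1.
elim: i => [|i IH] ni.
 exists (cst 0); first by split => // x; exact: cvg_cst.
 by move=> t _; rewrite mul0r; exists 1 => //; rewrite cos0 sin0; split; ring.
have [a [ca a2] Ha] := IH (ltnW ni).
have cl s : continuous (fun t => (H (s, t)).1) /\ continuous (fun t => (H (s, t)).2).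
 by split; [exact: (@continuous_col _ (fun x => (H x).1) s cH1)|exact: (@continuous_col _ (fun x => (H x).2) s cH2)].
have M20 : 0 < (2 * M)^-1 by rewrite invr_gt0 mulr_gt0.
have [t t01|b [cb b2] Hb] := @lift_step (fun t => H (i%:R / n%:R, t)) (fun t => H (i.+1%:R / n%:R, t)) _ M20
 (cl _).1 (cl _).2 (cl _).1 (cl _).2 (per _) (per _).
 set x : P := (i%:R / n%:R, t); set y : P := (i.+1%:R / n%:R, t).
 have Kx : K x.
  split; rewrite /= in_itv /=; last by [].
  by rewrite divr_ge0//= ler_pdivrMr// mul1r ler_nat ltnW.
 have xy : `|y - x| < d.
  rewrite prod_normE /= subrr normr0 -mulrBl -natr1 addrAC subrr add0r mul1r.
  by rewrite (ger0_norm (_ : 0 <= n%:R^-1)) ?invr_ge0 ?ltW// max_l ?invr_ge0// ltW.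
 have h1 := Hd1 _ _ Kx (lt_le_trans xy (_ : d <= d1)); have h2 := Hd2 _ _ Kx (lt_le_trans xy (_ : d <= d2)).
 have {}h1 := h1 (ltac:(by rewrite ge_min lexx)); have {}h2 := h2 (ltac:(by rewrite ge_min lexx orbT)).
 have b1 := HB1 x Kx; have b2 := HB2 x Kx; have := HM x Kx.
 rewrite ger0_norm ?invr_ge0 ?(ltW (N0 _))// => hN.
 have {}hN : M^-1 <= N x by rewrite -[leRHS]invrK lef_pV2 ?posrE ?invr_gt0.
 have k1 : `|(H x).1 * ((H y).1 - (H x).1)| <= B1 * e by rewrite normrM ler_pM.
 have k2 : `|(H x).2 * ((H y).2 - (H x).2)| <= B2 * e by rewrite normrM ler_pM.
 have eE : (B1 + B2) * e = M^-1 / 4 by rewrite /e; field; rewrite !gt_eqF ?addr_gt0.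
 rewrite (_ : (H x).1 * (H y).1 + (H x).2 * (H y).2 =
  N x + (H x).1 * ((H y).1 - (H x).1) + (H x).2 * ((H y).2 - (H x).2)); last by rewrite /N; ring.
 rewrite invfM; have := invr_gt0 M; rewrite M0 => Mi.
 move: k1 k2 hN eE; rewrite !ler_norml mulrDl => /andP[k1 _] /andP[k2 _] hN eE.
 by move: k1 k2 hN eE Mi; clear; set w := M^-1; lra.
exists (fun t => a t + b t).
 by split; [move=> t; apply: cvgD; [exact: ca|exact: cb]|rewrite a2 b2].
by move=> t t01; exact: turned_trans (Ha t t01) (Hb t t01).
Qed.

(** The image loop stays at an acute angle with the loop r (p + i q) e^(i t), so its angle to the
    fixed vector (p, q) is t plus a function without winding. *)
Lemma conf_lift (f : P -> P) c r e m p q : continuous f -> conf_on f c r e m p q -> 0 < r -> 0 < e <= 1 / 8 ->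
 exists2 a, lift_ok a & forall t, 0 <= t <= 2 * pi ->
  turned (t + a t) (p, q) ((f (ring_pt c r t)).1 - (f c).1, (f (ring_pt c r t)).2 - (f c).2).
Proof.
move=> cf [m0 mpq H] r0 /andP[e0 e1].
pose A t : P := (r * (p * cos t - q * sin t), r * (q * cos t + p * sin t)).
pose L t : P := ((f (ring_pt c r t)).1 - (f c).1, (f (ring_pt c r t)).2 - (f c).2).
have cc := @continuous_cos R; have csn := @continuous_sin R.
have lin (u v : R) : continuous (fun t : R => u * cos t + v * sin t).
 by move=> t; apply: cvgD; (apply: cvgM; [exact: cvg_cst|]); [exact: cc|exact: csn].
have cA1 : continuous (fun t => (A t).1).
 move=> t; apply: cvgM; first exact: cvg_cst.
 by apply: cvgB; (apply: cvgM; [exact: cvg_cst|]); [exact: cc|exact: csn].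
have cA2 : continuous (fun t => (A t).2) by move=> t; apply: cvgM; [exact: cvg_cst|exact: lin].
have crp : continuous (fun t : R => ring_pt c r t).
 by apply: pair_cont => t; (apply: cvgD; [exact: cvg_cst|apply: cvgM; [exact: cvg_cst|]]); [exact: cc|exact: csn].
have cL1 : continuous (fun t => (L t).1).
 move=> t; apply: cvgB; last exact: cvg_cst.
 apply: (@continuous_comp _ _ _ (fun t : R => ring_pt c r t) (fun w => (f w).1)); first exact: crp.
 by apply: (@continuous_comp _ _ _ f fst); [exact: cf|exact: cvg_fst].
have cL2 : continuous (fun t => (L t).2).
 move=> t; apply: cvgB; last exact: cvg_cst.
 apply: (@continuous_comp _ _ _ (fun t : R => ring_pt c r t) (fun w => (f w).2)); first exact: crp.
 by apply: (@continuous_comp _ _ _ f snd); [exact: cf|exact: cvg_snd].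
have rm0 : 0 < r * m by rewrite mulr_gt0.
have del0 : 0 < (r * m) ^+ 2 / 2 by rewrite divr_gt0// exprn_gt0.
have [||t t01|a ha Ha] := lift_step del0 cA1 cA2 cL1 cL2.
- by rewrite mulr_natl /A cos2pi sin2pi cos0 sin0.
- by rewrite mulr_natl /L /ring_pt cos2pi sin2pi cos0 sin0.
- have cs := cos2Dsin2 t.
 have zc : sqr_at c r c by apply/sqr_atP; rewrite subrr normr0 ltW.
 have zt : sqr_at c r (ring_pt c r t).
  apply/sqr_atP; rewrite norm_le2 /ring_pt /= !(addrC (fst c)) !(addrC (snd c)) !addrK !normrM !(gtr0_norm r0).
  by rewrite !ger_pMr// cos_max sin_max.
 have [] := H _ _ zt zc.
 rewrite /ring_pt /= !(addrC (fst c)) !(addrC (snd c)) !addrK -!(addrC (fst c)) -!(addrC (snd c)) -/(ring_pt c r t).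
 rewrite -/(L t).
 set E1 := _ - (p * _ - _); set E2 := _ - (q * _ + _) => h1 h2.
 have L1 : (L t).1 = (A t).1 + E1 by rewrite /E1 /A /=; ring.
 have L2 : (L t).2 = (A t).2 + E2 by rewrite /E2 /A /=; ring.
 have AA : (A t).1 ^+ 2 + (A t).2 ^+ 2 = (r * m) ^+ 2.
  rewrite (_ : _ + _ = r ^+ 2 * (p ^+ 2 + q ^+ 2) * (cos t ^+ 2 + sin t ^+ 2)); last by rewrite /A /=; ring.
  by rewrite cs mulr1 exprMn mpq.
 have bd (x y : R) : x ^+ 2 + y ^+ 2 = (r * m) ^+ 2 -> `|x| <= r * m.
  move=> xy; rewrite -ler_sqr ?nnegrE ?(ltW rm0)// real_normK ?num_real// -xy lerDl sqr_ge0//.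
 have b1 := bd _ _ AA; have b2 : `|(A t).2| <= r * m by apply: (bd _ (A t).1); rewrite addrC.
 have k1 : `|(A t).1 * E1| <= r * m * (e * (r * m)) by rewrite normrM ler_pM.
 have k2 : `|(A t).2 * E2| <= r * m * (e * (r * m)) by rewrite normrM ler_pM.
 rewrite -[leRHS]/((A t).1 * (L t).1 + (A t).2 * (L t).2) L1 L2.
 have EE (x y u v : R) : x * (x + u) + y * (y + v) = (x ^+ 2 + y ^+ 2) + x * u + y * v by ring.
 rewrite EE AA; have := ler_wpM2r (sqr_ge0 (r * m)) e1.
 move: k1 k2; rewrite !ler_norml => /andP[k1 _] /andP[k2 _].
 rewrite (_ : r * m * (e * (r * m)) = e * (r * m) ^+ 2) in k1 k2; last by ring.
 by move: k1 k2 del0; clear; lra.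
exists a => // t /Ha h; apply: turned_trans h; exists r => //.
by rewrite /A /=; split; ring.
Qed.

(** The accumulated angle from (p, q) to the conjugate of (p', q') grows by 4 pi over one turn. At
    some instant it is the initial angle plus pi, which is impossible for two fixed vectors. *)
Lemma no_opposite (f g : P -> P) (c c' : P) (r r' e m p q m' p' q' : R) : cancel f g -> continuous f ->
 conf_on f c r e m p q -> conf_on (mirror f) c' r' e m' p' q' -> 0 < r -> 0 < r' -> 0 < e <= 1 / 8 -> False.
Proof.
move=> fK cf C C' r0 r'0 e01.
have cf' : continuous (mirror f).
 apply: pair_cont => z; first by apply: (@continuous_comp _ _ _ f fst); [exact: cf|exact: cvg_fst].
 by apply: cvgN; apply: (@continuous_comp _ _ _ f snd); [exact: cf|exact: cvg_snd].
have [a [ca a2] Ha] := conf_lift cf C r0 e01.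
have [a' [ca' a2'] Ha'] := conf_lift cf' C' r'0 e01.
have [b [cb b2] Hb] := circle_lift c c' fK cf r0 r'0.
pose G t := (t + a t) + b t + (t + a' t).
have cG : continuous G.
 by move=> t; do !apply: cvgD; [exact: cvg_id|exact: ca|exact: cb|exact: cvg_id|exact: ca'].
have HG t : 0 <= t <= 2 * pi -> turned (G t) (p, q) (conjp (p', q')).
 move=> t01; apply: turned_trans (turned_trans (Ha t t01) (Hb t t01)) _.
 have := turned_conj (Ha' t t01); congr turned.
 by rewrite /conjp /mirror /=; congr pair; ring.
have pi0 := @pi_gt0 R.
have G2 : G (2 * pi) = G 0 + 4 * pi by rewrite /G a2 a2' b2; ring.
have [|||t] := @IVT R G 0 (2 * pi) (G 0 + pi).
- by rewrite mulr_ge0// ltW.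
- exact: continuous_subspaceT.
- rewrite G2 min_l ?max_r ?lerDl ?mulr_ge0 ?(ltW pi0)//.
 by move: pi0; clear => h; apply/andP; split; lra.
rewrite in_itv /= => t01 Gt.
have z01 : 0 <= (0 : R) <= 2 * pi by rewrite lexx mulr_ge0// ltW.
apply: (turned_pi _ (HG 0 z01)); last by rewrite -Gt; exact: HG.
by case: C => m0 mpq _; rewrite /= -mpq expf_neq0// gt_eqF.
Qed.

Lemma integral0_ae (h : P -> R) : locint h -> (forall z, 0 <= h z) ->
 (forall N, 0 < N -> \int[mu2]_(z in [set z | `|z| < N]) h z <= 0) -> {ae mu2, forall z, h z = 0}.
Proof.
move=> bh h0 H.
suff Hn (n : nat) : {ae mu2, forall z : P, `|z| < n.+1%:R -> h z = 0}.
 apply: aeS (ae_countable Hn) => z hz; have := archi_boundP (normr_ge0 z).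
 by move=> zn; apply: (hz (Num.bound `|z|)); apply: lt_trans zn _; rewrite ltr_nat.
pose D := [set z : P | `|z| < n.+1%:R].
have mD : measurable D.
 apply: open_measurable2; rewrite (_ : D = ball (0 : P) n.+1%:R); first exact: ball_open.
 by rewrite -ball_normE; apply/seteqP; split => z /=; rewrite sub0r normrN.
have hD : mu2.-integrable D (EFin \o h).
 apply: (Ris (msqr_at 0 n.+1%:R) mD); last by apply: bh.2; rewrite lerD2l ge0_cp.
 by move=> z /ltW zn; apply/sqr_atP; rewrite subr0.
have mh : measurable_fun D (EFin \o h) by exact: measurable_int hD.
have I0 : (\int[mu2]_(z in D) `|(EFin \o h) z|)%E = 0%E.
 under eq_integral do rewrite /= ger0_norm//.
 have e := fineK (integrable_fin_num mD hD).
 rewrite -e; congr EFin; apply/eqP; rewrite eq_le.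
 have := H n.+1%:R (ltr0Sn _ _); rewrite /Rintegral => -> /=.
 by apply: fine_ge0; apply: integral_ge0 => z _; rewrite lee_fin.
have := (ae_eq_integral_abs mu2 mD mh).1 I0.
by apply: aeS => z /= hz zn; have [] := hz zn.
Qed.

(** If no square is almost conformal, every square satisfies an estimate for the positive part of
    cf2 - ac2 with the error term alone on the right, and [grid_le] with area coefficient 0 makes
    this positive part vanish. *)
Lemma no_square_ae (e : R) : 0 < e -> exists2 k0 : R, 0 < k0 & forall k f g ux uy vx vy,
 qcmap k f g ux uy vx vy -> 0 <= k <= k0 ->
 ~ (exists c r m p q, 0 < r /\ conf_on f c r e m p q) ->
 {ae mu2, forall z, cf2 (ux z) (uy z) (vx z) (vy z) <= k ^+ 2 * ac2 (ux z) (uy z) (vx z) (vy z)}.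
Proof.
move=> e0.
have h01 : 0 < (1 / 2 : R) < 1 by apply/andP; split; lra.
have nu0 : 0 < (1 / 8 : R) by lra.
have [del d0 H] := good_square e0 h01 nu0.
pose k0 := Num.min del (1 / 2).
exists k0; first by rewrite lt_min d0; lra.
move=> k f g ux uy vx vy Q /andP[kk0 kk1] N.
have kd : k <= del by apply: le_trans kk1 _; rewrite ge_min lexx.
have k2 : k <= 1 / 2 by apply: le_trans kk1 _; rewrite ge_min lexx orbT.
have k24 : k ^+ 2 <= 1 / 4.
 have h := ler_pM kk0 kk0 k2 k2; rewrite expr2; apply: (le_trans h); clear; lra.
have K0 := sqr_ge0 k.
pose h z := Num.max (cf2 (ux z) (uy z) (vx z) (vy z) - ac2 (ux z) (uy z) (vx z) (vy z)) 0.
have hle z : h z <= cf2 (ux z) (uy z) (vx z) (vy z).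
 by rewrite /h ge_max cf2_ge0 andbT gerBl ac2_ge0.
have h0 z : 0 <= h z by rewrite le_max lexx orbT.
have [mux muy mvx mvy] := qc_measurable Q.
have mh : measurable_fun setT h.
 apply: measurable_maxr => //; apply: measurable_funB; apply: measurable_funM => //;
  apply: measurable_funD; apply: measurable_funX;
  do ?[exact: measurable_funD|exact: measurable_funB].
have bh : locint h.
 apply: locint_le mh _ (qc_density_box Q) => z; rewrite ger0_norm//.
 by apply: le_trans (hle z) _; rewrite lerDl ac2_ge0.
pose C := 2 + 8 / del.
have d80 : 0 <= 8 / del by rewrite divr_ge0// ltW.
have C0 : 0 <= C by rewrite addr_ge0.
have sq c r a b c' d : 0 < r -> \int[mu2]_(z in hsq c r) h z <= C * \int[mu2]_(z in hsq c r) dist2 ux uy vx vy a b c' d z.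
 move=> r0.
 have id := locint_hsq c (ltW r0) (locint_dist2 a b c' d Q).
 have ih := locint_hsq c (ltW r0) bh.
 have mq := @mhsq R c r.
 set I := \int[mu2]_(z in hsq c r) dist2 _ _ _ _ _ _ _ _ _.
 have I0 : 0 <= I by apply: Rintegral_ge0 => z _; rewrite /dist2 !addr_ge0 ?sqr_ge0.
 have d2 z : dist2 ux uy vx vy a b c' d z = 2 * (cf2 (ux z - a) (uy z - b) (vx z - c') (vy z - d) +
   ac2 (ux z - a) (uy z - b) (vx z - c') (vy z - d)) by rewrite cf2_ac2_sum.
 have [le|lt] := leP (del * (cf2 a b c' d + ac2 a b c' d) * r ^+ 2) I.
  have : \int[mu2]_(z in hsq c r) h z <= 2 * cf2 a b c' d * (4 * r ^+ 2) + I.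
   have ik : mu2.-integrable (hsq c r) (EFin \o cst (2 * cf2 a b c' d)).
    by apply: (@locint_hsq _ (cst _) c r (ltW r0)); apply: locint_cont => z; exact: cvg_cst.
   have fr := fine_mu_hsq c r0.
   rewrite -fr -Rintegral_cst// -RintegralD//; apply: le_Rintegral => //; first exact: RiD.
   move=> z _; apply: (le_trans (hle z)); rewrite d2.
   have := cf2_le (ux z) (uy z) (vx z) (vy z) a b c' d.
   rewrite (_ : cf2 (a - ux z) (b - uy z) (c' - vx z) (d - vy z) = cf2 (ux z - a) (uy z - b) (vx z - c') (vy z - d)).
    by have := ac2_ge0 (ux z - a) (uy z - b) (vx z - c') (vy z - d); clear; lra.
   by rewrite /cf2; congr (_ / _); ring.
  have h1 : (cf2 a b c' d + ac2 a b c' d) * r ^+ 2 <= I / del by rewrite ler_pdivlMr// mulrC mulrA.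
  have h2 := mulr_ge0 (ac2_ge0 a b c' d) (sqr_ge0 r).
  rewrite /C; move: h1 h2 I0; clear; set D := del^-1; lra.
 have [[_ [p [q cf]]]|[AB _]] := H _ _ _ _ _ _ _ c r a b c' d Q (introT andP (conj kk0 kd)) r0 lt.
  exfalso; apply: N; exists c, ((1 - 1 / 2) * r), (Num.sqrt (cf2 a b c' d)), p, q; split => //.
  by rewrite mulr_gt0//; lra.
 apply: (@le_trans _ _ (2 * I)); last by rewrite ler_wpM2r// lerDl.
 rewrite /I -RintegralZl//; apply: ae_le_Rint => //; first exact: RiZ.
 apply: aeS (qc_ae Q) => z H' _; move: H'; rewrite d2 /h.
 set x := ux z; set y := uy z; set s := vx z; set t := vy z.
 have e1 := cf2_ge0 (x - a) (y - b) (s - c') (t - d); have e2 := ac2_ge0 (x - a) (y - b) (s - c') (t - d).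
 have A0 := cf2_ge0 x y s t; have B0 := ac2_ge0 x y s t.
 have c2 := ac2_le a b c' d x y s t.
 have c3 := cf2_le x y s t a b c' d.
 rewrite (_ : cf2 (a - x) (b - y) (c' - s) (d - t) = cf2 (x - a) (y - b) (s - c') (t - d)) in c3; last first.
  by rewrite /cf2; congr (_ / _); ring.
 have kA := ler_wpM2r A0 k24; have kB := ler_wpM2r B0 k24.
 rewrite ge_max; move: AB e1 e2 A0 B0 c2 c3 kA kB; clear.
 set ea := cf2 (x - a) _ _ _; set eb := ac2 (x - a) _ _ _.
 set X := cf2 x y s t; set Y := ac2 x y s t; set K := k ^+ 2; set A := cf2 a b c' d; set B := ac2 a b c' d.
 by move=> ? ? ? ? ? ? ? ? ? []?; apply/andP; split; lra.
have cid : continuous (id : P -> P) by move=> z.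
have := integral0_ae bh h0 => /(_ _)/wrap[M M0|hz].
 have gu := qc_u Q; have gv := qc_v Q.
 have oU : open [set z : P | `|z| < M].
  rewrite (_ : [set z : P | `|z| < M] = ball (0 : P) M); first exact: ball_open.
  by rewrite -ball_normE; apply/seteqP; split => z /=; rewrite sub0r normrN.
 have UM z : [set z : P | `|z| < M] z -> `|z| <= M by move=> /ltW.
 have := @grid_le R _ M 0 C id h ux uy vx vy oU UM (lexx _) C0 cid _ bh h0 (xac_box (grad2_x gu))
  (grad2_xx gu) (yac_box (grad2_y gu)) (grad2_yy gu) (xac_box (grad2_x gv)) (grad2_xx gv)
  (yac_box (grad2_y gv)) (grad2_yy gv).
 rewrite mul0r; apply.
  apply: (@le_lt_trans _ _ (mu2 (sqr_at (0 : P) M))); last by rewrite mu_sqr_at ?ltry// ltW.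
  apply: le_measure; rewrite ?inE; [exact: open_measurable2|exact: msqr_at|].
  by move=> z zM; apply/sqr_atP; rewrite subr0; exact: UM.
 by move=> q r a b c d r0 _; rewrite mul0r add0r; exact: sq.
apply: aeS (aeI hz (qc_ae Q)) => z [h0z []//].
have A0 := cf2_ge0 (ux z) (uy z) (vx z) (vy z); have B0 := ac2_ge0 (ux z) (uy z) (vx z) (vy z).
have := hle z; rewrite h0z => _; have : cf2 (ux z) (uy z) (vx z) (vy z) - ac2 (ux z) (uy z) (vx z) (vy z) <= 0.
 by rewrite -h0z /h le_max lexx.
have kA := ler_wpM2r A0 k24; have kB := mulr_ge0 K0 B0; clear -A0 B0 kA kB; lra.
Qed.

Record qcpos (k : R) (f g : P -> P) (ux uy vx vy : P -> R) : Prop := Qcpos {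
 qp_map : qcmap k f g ux uy vx vy;
 qp_ae : {ae mu2, forall z,
  ac2 (ux z) (uy z) (vx z) (vy z) <= k ^+ 2 * cf2 (ux z) (uy z) (vx z) (vy z)} }.

(** [no_opposite] forbids an almost conformal square together with an almost anticonformal one; the
    kind that does not occur is then excluded almost everywhere by [no_square_ae], applied to the
    map or to its reflection. *)
Lemma constant_orientation : exists2 k0 : R, 0 < k0 & forall k f g ux uy vx vy,
 qcmap k f g ux uy vx vy -> 0 <= k <= k0 ->
 qcpos k f g ux uy vx vy \/
 qcpos k (fun z => ((f z).1, - (f z).2)) (fun z => g (z.1, - z.2))
  ux uy (fun z => - vx z) (fun z => - vy z).
Proof.
have e0 : 0 < (1 / 8 : R) by lra.
have e01 : 0 < (1 / 8 : R) <= 1 / 8 by rewrite e0 lexx.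
have [k0 k00 H] := no_square_ae e0.
exists k0 => // k f g ux uy vx vy Q k01; have Q' := qc_reflect Q.
have [[c [r [m [p [q [r0 C]]]]]]|N] := pselect (exists c r m p q, 0 < r /\ conf_on f c r (1 / 8) m p q); last first.
 right; split => //; apply: aeS (H _ _ _ _ _ _ _ Q k01 N) => z.
 by rewrite cf2N ac2N.
have [[c' [r' [m' [p' [q' [r'0 C']]]]]]|N'] := pselect (exists c r m p q, 0 < r /\ conf_on (mirror f) c r (1 / 8) m p q).
 by exfalso; exact: (no_opposite (qc_fK Q) (qc_cf Q) C C' r0 r'0 e01).
left; split => //; apply: aeS (H _ _ _ _ _ _ _ Q' k01 N') => z.
by rewrite cf2N ac2N.
Qed.

End orientation.

(** * Ring estimates and weak quasisymmetry *)

Section distortion.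
Variable R : realType.
Local Notation P := (R * R)%type.
Local Notation mu2 := (@lbm R \x @lbm R)%E.

Lemma locint_sqD (f g : P -> R) : locint f -> locint g ->
 locint (fun z => f z ^+ 2) -> locint (fun z => g z ^+ 2) ->
 locint (fun z => (f z + g z) ^+ 2).
Proof.
move=> bf bg bff bgg.
apply: (locint_le (g := fun z => 2 * f z ^+ 2 + 2 * g z ^+ 2)).
- by apply: measurable_funX; apply: measurable_funD; [exact: bf.1|exact: bg.1].
- move=> z; rewrite ger0_norm ?sqr_ge0// -subr_ge0.
 by rewrite (_ : _ - _ = (f z - g z) ^+ 2) ?sqr_ge0//; ring.
- by apply: locintD; exact: locintZ.
Qed.

Lemma locint_sqM (c f : P -> R) : continuous c ->
 locint (fun z => f z ^+ 2) -> locint (fun z => (c z * f z) ^+ 2).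
Proof.
move=> cc ff; have := locintMc (h := fun z => c z ^+ 2) _ ff.
rewrite (_ : (fun z => (c z * f z) ^+ 2) = (fun z => c z ^+ 2 * f z ^+ 2)); last by apply/funext => z; rewrite exprMn.
by apply => z; exact: (cvgM (cc z) (cc z)).
Qed.

Lemma grad2_comp (p p' : R -> R) (f fx fy : P -> R) : continuous p' ->
 (forall x : R, is_derive x (1 : R) p (p' x)) -> grad2 f fx fy ->
 grad2 (fun z => p (f z)) (fun z => p' (f z) * fx z) (fun z => p' (f z) * fy z).
Proof.
move=> cp dp [gx gy gxx gyy].
have cf := xac_cont gx.
have cc : continuous (fun z => p' (f z)).
 by move=> z; apply: (@continuous_comp _ _ _ f p'); [exact: cf|exact: cp].
split.
- exact: xac_comp.
- exact: (xac_comp cp dp gy).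
- exact: locint_sqM.
- exact: locint_sqM.
Qed.

Lemma grad2D (f fx fy g gx gy : P -> R) : grad2 f fx fy -> grad2 g gx gy ->
 grad2 (fun z => f z + g z) (fun z => fx z + gx z) (fun z => fy z + gy z).
Proof.
move=> [a1 a2 a3 a4] [b1 b2 b3 b4]; split.
- exact: xacD.
- exact: (xacD a2 b2).
- by apply: locint_sqD => //; [exact: xac_box a1|exact: xac_box b1].
- by apply: locint_sqD => //; [exact: yac_box a2|exact: yac_box b2].
Qed.

(** A squared Euclidean distance, so that smooth functions of it obey the chain rule; balls are
    taken in the sup norm, whose square is comparable up to the factor 2. *)
Definition sqdist (f : P -> P) (w : P) (z : P) : R :=
 ((f z).1 - w.1) ^+ 2 + ((f z).2 - w.2) ^+ 2.

Lemma grad2_sqdist k f g ux uy vx vy (w : P) : qcmap k f g ux uy vx vy ->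
 grad2 (sqdist f w)
  (fun z => 2 * ((f z).1 - w.1) * ux z + 2 * ((f z).2 - w.2) * vx z)
  (fun z => 2 * ((f z).1 - w.1) * uy z + 2 * ((f z).2 - w.2) * vy z).
Proof.
move=> Q.
have sq (a : R) : forall x : R, is_derive x (1 : R) (fun x => (x - a) ^+ 2) (2 * (x - a)).
 by move=> x; apply: is_derive_eq; rewrite /GRing.scale /=; ring.
have cl (a : R) : continuous (fun x : R => 2 * (x - a)).
 by move=> x; apply: cvgM; [exact: cvg_cst|apply: cvgB; [exact: cvg_id|exact: cvg_cst]].
exact: (grad2D (grad2_comp (cl w.1) (sq w.1) (qc_u Q)) (grad2_comp (cl w.2) (sq w.2) (qc_v Q))).
Qed.

(** The squared operator norm is (|f_z| + |f_zbar|)^2 <= (1 + th) |f_z|^2 + (1 + 1/th) |f_zbar|^2,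
    and the condition on k absorbs the large second weight. *)
Lemma gradient_le (th k a b c d x y : R) : 0 < th -> (1 + th^-1) * k ^+ 2 <= th ->
 ac2 a b c d <= k ^+ 2 * cf2 a b c d ->
 (x * a + y * c) ^+ 2 + (x * b + y * d) ^+ 2 <=
 (1 + 2 * th) * (cf2 a b c d + ac2 a b c d) * (x ^+ 2 + y ^+ 2).
Proof.
move=> t0 kt H.
have H1 : (x * a + y * c) ^+ 2 + (x * b + y * d) ^+ 2 <=
  ((1 + th) * cf2 a b c d + (1 + th^-1) * ac2 a b c d) * (x ^+ 2 + y ^+ 2).
 rewrite -subr_ge0.
 rewrite (_ : _ - _ = ((th * (x * (a + d) + y * (c - b)) - (x * (a - d) + y * (c + b))) ^+ 2 +
   (th * (y * (a + d) - x * (c - b)) - (x * (c + b) - y * (a - d))) ^+ 2) / (4 * th)).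
  by rewrite divr_ge0 ?addr_ge0 ?sqr_ge0// mulr_ge0// ltW.
 by rewrite /cf2 /ac2; field; rewrite gt_eqF.
apply: (le_trans H1); apply: ler_wpM2r; first by rewrite addr_ge0 ?sqr_ge0.
have c0 := cf2_ge0 a b c d; have a0 := ac2_ge0 a b c d.
have ti : 0 <= 1 + th^-1 by rewrite addr_ge0// invr_ge0 ltW.
have h2 := ler_wpM2l ti H; have h3 := ler_wpM2r c0 kt.
have h4 := mulr_ge0 (ltW t0) a0.
by move: h2 h3 h4 a0; clear; lra.
Qed.

(** Only integrals over preimages of whole balls are controlled, by [area_box]. This is why the
    weight must be majorized by a nonnegative combination of indicators of concentric balls. *)
Lemma log_energy : exists2 k0 : R, 0 < k0 & forall k f g ux uy vx vy (w0 z0 : P) (th r : R)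
  (p p' : R -> R) (N : nat) (c t : nat -> R),
 qcpos k f g ux uy vx vy -> 0 <= k <= k0 -> 0 < th -> (1 + th^-1) * k ^+ 2 <= th -> 0 < r ->
 continuous p' -> (forall x : R, is_derive x (1 : R) p (p' x)) ->
 (forall i, 0 <= c i) -> (forall i, 0 < t i) ->
 (forall z, sqr_at z0 r z -> 4 * p' (sqdist f w0 z) ^+ 2 * sqdist f w0 z <=
   \sum_(i < N) (if `|f z - w0| < t i then c i else 0)) ->
 energy (fun z => p' (sqdist f w0 z) * (2 * ((f z).1 - w0.1) * ux z + 2 * ((f z).2 - w0.2) * vx z))
  (fun z => p' (sqdist f w0 z) * (2 * ((f z).1 - w0.1) * uy z + 2 * ((f z).2 - w0.2) * vy z)) (sqr_at z0 r) <=
 (1 + 2 * th) * \sum_(i < N) 6 * c i * t i ^+ 2.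
Proof.
have [k0 k00 H] := area_box R.
exists k0 => // k f g ux uy vx vy w0 z0 th r p p' N c t QP k01 t0 kt r0 cp dp c0 tp Hc.
have Q := qp_map QP.
have G := grad2_comp cp dp (grad2_sqdist w0 Q).
pose e z := cf2 (ux z) (uy z) (vx z) (vy z) + ac2 (ux z) (uy z) (vx z) (vy z).
have e0 z : 0 <= e z by rewrite addr_ge0 ?cf2_ge0 ?ac2_ge0.
have be : locint e := qc_density_box Q.
pose U i := [set z | `|f z - w0| < t i].
have mU i : measurable (U i).
 apply: open_measurable2; rewrite (_ : U i = f @^-1` ball w0 (t i)).
  by apply: (continuousP f).1; [exact: qc_cf Q|exact: ball_open].
 by rewrite -ball_normE; apply/seteqP; split => z /=; rewrite distrC.
have bU i : locint (e \_ (U i)).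
 apply: (locint_le _ _ be).
  by apply/(measurable_restrictT _ _).1 => //; apply: measurable_funTS; exact: be.1.
 by move=> z; rewrite patchE; case: ifP => _; rewrite ?normr0 ?e0// ger0_norm.
have r2 (x : R) : x - r <= x + r by rewrite lerD2l; lra.
have mD := msqr_at z0 r.
have IU i : \int[mu2]_(z in sqr_at z0 r) (e \_ (U i)) z <= 6 * t i ^+ 2.
 have Hi : \int[mu2]_(z in U i) e z <= 6 * t i ^+ 2 := H _ _ _ _ _ _ _ w0 (t i) Q k01 (tp i).
 rewrite -Rintegral_mkcondr; apply: le_trans Hi.
 have [M M0 HM] := image_box_bounded w0 (t i) (qc_fK Q) (qc_cg Q).
 have UM : U i `<=` sqr_at 0 M by move=> z /HM h; apply/sqr_atP; rewrite subr0.
 have iU : mu2.-integrable (U i) (EFin \o e).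
  by apply: (Ris (msqr_at 0 M) (mU i) UM); apply: be.2; rewrite lerD2l ge0_cp// ltW.
 have mDU := measurableI _ _ mD (mU i).
 have sub : sqr_at z0 r `&` U i `<=` U i by move=> z [].
 apply: fine_le; [exact: (integrable_fin_num mDU (Ris (mU i) mDU sub iU))|exact: (integrable_fin_num (mU i) iU)|].
 by apply: ge0_subset_integral => //; [exact: measurable_int iU|move=> z _; rewrite lee_fin].
have bS (n : nat) : locint (fun z => \sum_(i < n) c i * (e \_ (U i)) z) /\
  \int[mu2]_(z in sqr_at z0 r) (\sum_(i < n) c i * (e \_ (U i)) z) <= \sum_(i < n) 6 * c i * t i ^+ 2.
 elim: n => [|n [bn In]].
  have E0 : \sum_(i < 0) 6 * c i * t i ^+ 2 = 0 by exact: big_ord0.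
  rewrite E0; under eq_fun do rewrite big_ord0; split; first by apply: locint_cont => z; exact: cvg_cst.
  by rewrite Rintegral_cst// mul0r.
 have bc := locintZ (c n) (bU n).
 under eq_fun do rewrite big_ord_recr /=; split; first exact: locintD.
 rewrite RintegralD//; [|exact: bn.2|exact: bc.2].
 rewrite RintegralZl//; last exact: (bU n).2.
 rewrite big_ord_recr /=; apply: lerD => //.
 by have := ler_wpM2l (c0 n) (IU n); clear; lra.
apply: le_trans (ler_wpM2l _ (bS N).2); last by lra.
rewrite -RintegralZl//; last exact: (bS N).1.2.
have bS' := locintZ (1 + 2 * th) (bS N).1.
have bE := energy_locint G.
pose mI h := \int[mu2]_(z in sqr_at z0 r) h z.
have iE := bE.2 _ _ _ _ (r2 z0.1) (r2 z0.2).
have iS := bS'.2 _ _ _ _ (r2 z0.1) (r2 z0.2).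
rewrite /energy; apply: ae_le_Rint => //; apply: aeS (qp_ae QP) => z Hz zD.
have := gradient_le ((f z).1 - w0.1) ((f z).2 - w0.2) t0 kt Hz; rewrite -/(sqdist f w0 z) -/(e z) => h1.
have := ler_wpM2l (mulr_ge0 (ler0n R 4) (sqr_ge0 (p' (sqdist f w0 z)))) h1 => h2.
have t1 : 0 <= 1 + 2 * th by lra.
have h3 := ler_wpM2l (mulr_ge0 t1 (e0 z)) (Hc z zD).
have -> : \sum_(i < N) c i * (e \_ (U i)) z = e z * \sum_(i < N) (if `|f z - w0| < t i then c i else 0).
 rewrite mulr_sumr; apply: eq_bigr => i _; rewrite patchE.
 by have [h|h] := ltP `|f z - w0| (t i); [rewrite mem_set// mulrC|rewrite memNset ?mulr0// /U /= ltNge h].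
rewrite mulrA; apply: le_trans h3; move: h2; clear.
set pp := p' _; set s := sqdist _ _ _; set x := _ - _; set y := _ - w0.2; lra.
Qed.

(** At x = |f - w|^2 this is close to ln |f - w| for large distances, smoothly cut off at distance
    a^(1/4). *)
Definition lnq (a x : R) : R := ln (a + x ^+ 2) / 4.
Definition lnq' (a x : R) : R := x / (2 * (a + x ^+ 2)).

Lemma lnq_der (a : R) : 0 < a -> forall x : R, is_derive x (1 : R) (lnq a) (lnq' a x).
Proof.
move=> a0 x; have ax : 0 < a + x ^+ 2 by rewrite ltr_wpDr ?sqr_ge0.
have d2 : is_derive x (1 : R) (fun y => a + y ^+ 2) (2 * x).
 by apply: is_derive_eq; rewrite /GRing.scale /=; ring.
have d3 := is_derive1_ln ax.
have d4 : is_derive x (1 : R) (fun y => ln (a + y ^+ 2)) ((a + x ^+ 2)^-1 * (2 * x)).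
 exact: (@der_comp _ (@ln R) (fun y => a + y ^+ 2) x _ _ _ d3 d2 erefl).
rewrite /lnq; apply: is_derive_eq; rewrite /GRing.scale /= /lnq'.
by field; rewrite gt_eqF.
Qed.

Lemma lnq'_cont (a : R) : 0 < a -> continuous (lnq' a).
Proof.
move=> a0 x; have ax : a + x ^+ 2 != 0 by rewrite gt_eqF// ltr_wpDr ?sqr_ge0.
apply: cvgM; first exact: cvg_id.
apply: cvgV; first by rewrite mulf_neq0.
apply: cvgM; first exact: cvg_cst.
by apply: cvgD; [exact: cvg_cst|exact: exprn_continuous].
Qed.

Lemma ln_ge (x : R) : 0 < x -> 1 - x^-1 <= ln x.
Proof.
move=> x0; have xi : 0 < x^-1 by rewrite invr_gt0.
have p : -1 < x^-1 - 1 by move: xi; clear; lra.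
have := le_ln1Dx p; rewrite (_ : 1 + (x^-1 - 1) = x^-1); last by ring.
by rewrite lnV ?posrE//; clear; lra.
Qed.

Lemma le_lnW (x y : R) : 0 < x -> x <= y -> ln x <= ln y.
Proof. by move=> x0 xy; rewrite ler_ln ?posrE// (lt_le_trans x0). Qed.

Lemma quadratic_beats_linear (K : R) : 0 < K -> exists J : nat, forall j : nat, (J < j)%N ->
 K * (j%:R + 2) < ((4 * j%:R - 7) / 8) ^+ 2 :> R.
Proof.
move=> K0; exists (Num.bound (48 * K + 4)) => j Jj.
have k4 : 0 <= 48 * K + 4 by move: K0; clear; lra.
have h := archi_boundP k4.
have jj : 48 * K + 4 < j%:R by apply: (lt_trans h); rewrite ltr_nat.
clear h; move: jj; set r := j%:R => jj; have r4 : 4 < r by move: jj K0; clear; lra.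
have r0 : 0 < r by move: r4; clear; lra.
apply: (@lt_le_trans _ _ ((r / 4) ^+ 2)); last first.
 by rewrite ler_sqr ?nnegrE; move: r4; clear; lra.
have kr : K * 4 < K * r by rewrite ltr_pM2l.
have := ler_wpM2r (ltW r0) (ltW jj); have := mulr_gt0 K0 r0; move: kr r0 K0; clear; lra.
Qed.

(** The subtraction is truncated: the terms up to j equal 1 and the later ones are geometric. The
    extra summand is the remaining tail, which makes the induction close. *)
Lemma half_powers_sum (j n : nat) :
 \sum_(i < n) (2 ^+ (i - j))^-1 + 2 * (2 ^+ (n - j))^-1 <= (minn n j)%:R + 2 :> R.
Proof.
elim: n => [|n IH]; first by rewrite big_ord0 sub0n min0n expr0; lra.
rewrite big_ord_recr /=.
have [nj|jn] := ltnP n j.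
 have e1 : (n - j)%N = 0%N by apply/eqP; rewrite subn_eq0 ltnW.
 have e2 : (n.+1 - j)%N = 0%N by apply/eqP; rewrite subn_eq0.
 move: IH; rewrite e1 e2.
 by rewrite expr0 (minn_idPl nj) (minn_idPl (ltnW nj)) -natr1; lra.
move: IH; rewrite subSn// exprS (minn_idPr jn) (minn_idPr (leqW jn)) invfM.
by set a := (2 ^+ _)^-1; set b := \sum_(i < n) _; lra.
Qed.

Lemma half_powers_le (j n : nat) : \sum_(i < n) (2 ^+ (i - j))^-1 <= j%:R + 2 :> R.
Proof.
have h := half_powers_sum j n.
have h1 : (minn n j)%:R <= j%:R :> R by rewrite ler_nat geq_minr.
have h2 : 0 <= 2 * (2 ^+ (n - j))^-1 :> R by rewrite mulr_ge0// invr_ge0 exprn_ge0.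
by move: h h1 h2; set S := \sum_(i < n) _; clear; lra.
Qed.

Lemma sqdist_bounds (f : P -> P) (w z : P) : `|f z - w| ^+ 2 <= sqdist f w z <= 2 * `|f z - w| ^+ 2.
Proof.
rewrite /sqdist; have n1 := norm1_le (f z - w); have n2 := norm2_le (f z - w).
rewrite /= in n1 n2; rewrite -(real_normK (num_real (_.1 - _))) -(real_normK (num_real (_.2 - _))).
have a1 := normr_ge0 ((f z).1 - w.1); have a2 := normr_ge0 ((f z).2 - w.2).
have N0 := normr_ge0 (f z - w).
have s1 : `|(f z).1 - w.1| ^+ 2 <= `|f z - w| ^+ 2 by rewrite ler_sqr ?nnegrE.
have s2 : `|(f z).2 - w.2| ^+ 2 <= `|f z - w| ^+ 2 by rewrite ler_sqr ?nnegrE.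
have p1 := sqr_ge0 `|(f z).1 - w.1|; have p2 := sqr_ge0 `|(f z).2 - w.2|.
apply/andP; split; last by move: s1 s2; clear; lra.
have E := prod_normE (f z - w); rewrite maxEle /= in E.
by move: p1 p2; rewrite [in X in _ -> _ -> X ^+ 2 <= _]E; case: ifP => _; clear; lra.
Qed.

(** The potential is the difference of logarithms cut off at m and at 2^j m. Its slope is like 1 /
    |f - w| in the ring between and decays faster beyond, so about j shells contribute a bounded
    amount each. *)
Lemma potential_shell (m F : R) (j i : nat) : 0 < m -> 0 <= F -> F <= 2 * (2 ^+ i * m) ^+ 2 ->
 (i = 0%N \/ (2 ^+ i * m) ^+ 2 / 4 <= F) ->
 4 * (lnq' (m ^+ 4) F - lnq' ((2 ^+ j * m) ^+ 4) F) ^+ 2 * F <= 128 * (2 ^+ (i - j))^-1 / (2 ^+ i * m) ^+ 2.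
Proof.
move=> m0 F0 Fle Fge.
pose a := m ^+ 4; pose b := (2 ^+ j * m) ^+ 4.
have a0 : 0 < a by rewrite exprn_gt0.
have jm0 : 0 < 2 ^+ j * m by rewrite mulr_gt0// exprn_gt0.
have b0 : 0 < b by rewrite exprn_gt0.
have ab : a <= b.
 by rewrite ler_pXn2r ?nnegrE ?(ltW m0) ?(ltW jm0)// ler_peMl ?(ltW m0)// exprn_ege1// ler1n.
have aF : 0 < a + F ^+ 2 by rewrite ltr_wpDr ?sqr_ge0.
have bF : 0 < b + F ^+ 2 by rewrite ltr_wpDr ?sqr_ge0.
have dE : lnq' a F - lnq' b F = F / 2 * ((b - a) / ((a + F ^+ 2) * (b + F ^+ 2))).
 by rewrite /lnq'; field; rewrite !gt_eqF.
have q0 : 0 <= (b - a) / ((a + F ^+ 2) * (b + F ^+ 2)) by apply: divr_ge0; [rewrite subr_ge0|apply: mulr_ge0; exact: ltW].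
have q1 : (b - a) / ((a + F ^+ 2) * (b + F ^+ 2)) <= b / (b + F ^+ 2) / (a + F ^+ 2).
 rewrite -mulrA -invfM [X in _ / X]mulrC ler_pM2r ?invr_gt0 ?mulr_gt0//; lra.
rewrite -/a -/b dE.
set q := (b - a) / _ in q0 q1 *.
have B1 : b / (b + F ^+ 2) <= 1 by rewrite ler_pdivrMr// mul1r lerDl sqr_ge0.
have B0 : 0 <= b / (b + F ^+ 2) by apply: divr_ge0; exact: ltW.
set B := b / (b + F ^+ 2) in B0 B1 q1.
have A0 : 0 < (a + F ^+ 2)^-1 by rewrite invr_gt0.
have sq : q ^+ 2 <= B * (a + F ^+ 2)^-1 ^+ 2.
 apply: (@le_trans _ _ ((B / (a + F ^+ 2)) ^+ 2)).
  by rewrite ler_sqr ?nnegrE//; apply: mulr_ge0 => //; exact: ltW.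
 by rewrite exprMn ler_wpM2r ?sqr_ge0// expr2 ler_piMl.
have F3 := exprn_ge0 3 F0.
have st : 4 * (F / 2 * q) ^+ 2 * F <= B * (F ^+ 3 * (a + F ^+ 2)^-1 ^+ 2).
 by have := ler_wpM2l F3 sq; clear; lra.
apply: (le_trans st).
have im0 : 0 < 2 ^+ i * m by rewrite mulr_gt0// exprn_gt0.
have i2 : 0 < (2 ^+ (i - j))^-1 :> R by rewrite invr_gt0 exprn_gt0.
have AV : (a + F ^+ 2)^-1 ^+ 2 = ((a + F ^+ 2) ^+ 2)^-1 by rewrite exprVn.
have aF2 : 0 < (a + F ^+ 2) ^+ 2 by rewrite exprn_gt0.
rewrite AV.
have [i0|i0] := posnP i.
 rewrite i0 sub0n !expr0 mul1r invr1 mulr1.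
 have m2 : 0 < m ^+ 2 by rewrite exprn_gt0.
 have h : F ^+ 3 / (a + F ^+ 2) ^+ 2 <= (m ^+ 2)^-1.
  rewrite ler_pdivrMr// mulrC ler_pdivlMr// /a -subr_ge0.
  rewrite (_ : _ - _ = m ^+ 8 + 3 / 2 * (m ^+ 2 * F) ^+ 2 + (F ^+ 2) ^+ 2 / 2 + (F * (F - m ^+ 2)) ^+ 2 / 2).
   have := exprn_ge0 8 (ltW m0); have := sqr_ge0 (m ^+ 2 * F); have := sqr_ge0 (F ^+ 2).
   by have := sqr_ge0 (F * (F - m ^+ 2)); clear; lra.
  by field.
 have h0 : 0 <= F ^+ 3 / (a + F ^+ 2) ^+ 2 by rewrite divr_ge0// ltW.
 have := ler_wpM2r h0 B1; have := invr_gt0 (m ^+ 2); rewrite m2.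
 by move: h; clear; lra.
case: Fge => [E|Fge]; first by rewrite E in i0.
set T := (2 ^+ i * m) ^+ 2 in Fge *.
have T0 : 0 < T by rewrite exprn_gt0.
have F1 : 0 < F by apply: lt_le_trans Fge; rewrite divr_gt0.
have h : F ^+ 3 / (a + F ^+ 2) ^+ 2 <= 4 / T.
 apply: (@le_trans _ _ F^-1); last by rewrite -[leRHS]invrK lef_pV2 ?posrE ?invr_gt0 ?divr_gt0// invf_div.
 rewrite ler_pdivrMr// mulrC ler_pdivlMr// -exprSr (_ : F ^+ 4 = (F ^+ 2) ^+ 2); last by ring.
 by rewrite ler_sqr ?nnegrE ?sqr_ge0 ?(ltW aF)// lerDr ltW.
have Bj : B <= 32 * (2 ^+ (i - j))^-1.
 have [ij|ji] := leqP i j.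
  have -> : (i - j)%N = 0%N by apply/eqP; rewrite subn_eq0.
  by rewrite expr0 invr1 mulr1; apply: (le_trans B1); clear; lra.
 have iE : 2 ^+ i = 2 ^+ (i - j) * 2 ^+ j :> R by rewrite -exprD subnK// ltnW.
 have l1 : 1 <= 2 ^+ (i - j) :> R by rewrite exprn_ege1// ler1n.
 set l := 2 ^+ (i - j) in iE l1 i2 *.
 have l0 : 0 < l by apply: lt_le_trans l1.
 have F2 : b * l ^+ 4 <= 16 * F ^+ 2.
  have -> : b * l ^+ 4 = T ^+ 2 by rewrite /b /T iE; ring.
  have := ler_pM (divr_ge0 (ltW T0) (ler0n R 4)) (divr_ge0 (ltW T0) (ler0n R 4)) Fge Fge.
  by clear; lra.
 rewrite /B ler_pdivrMr// mulrAC ler_pdivlMr//.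
 have l4 : b * l <= b * l ^+ 4.
  by rewrite ler_pM2l// exprS ler_peMr ?(ltW l0)// exprn_ege1.
 by move: F2 l4 b0; have := sqr_ge0 F; clear; lra.
have h4 : 0 <= 4 / T by rewrite divr_ge0// ltW.
have h0 : 0 <= F ^+ 3 / (a + F ^+ 2) ^+ 2 by rewrite divr_ge0// ltW.
by have := ler_pM B0 h0 Bj h; clear; set u := _^-1; set v := T^-1; lra.
Qed.

Lemma dyadic_bracket (m M : R) : 0 < m -> m <= M -> exists2 j : nat,
 M <= 2 ^+ j * m & 2 ^+ j * m <= 2 * M.
Proof.
move=> m0 mM.
have ex : exists j, M <= 2 ^+ j * m.
 exists (Num.bound (M / m)); have := archi_boundP (divr_ge0 (le_trans (ltW m0) mM) (ltW m0)).
 rewrite ltr_pdivrMr// => /ltW h; apply: (le_trans h); rewrite ler_pM2r// -natrX ler_nat ltnW// ltn_expl//.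
have [j Hj Hmin] := ex_minnP ex; exists j => //.
case: j Hj Hmin => [|j] Hj Hmin; first by rewrite mul1r; lra.
have : ~~ (M <= 2 ^+ j * m) by apply/negP => /Hmin; rewrite ltnn.
by rewrite -ltNge exprS => /ltW; lra.
Qed.

Lemma first_index (t : nat -> R) (s : R) (N : nat) : s < t N ->
 exists2 i, (i <= N)%N & s < t i /\ (i = 0%N \/ t i.-1 <= s).
Proof.
move=> sN; have [i Hi Hmin] := ex_minnP (ex_intro (fun i => s < t i) N sN).
exists i; first exact: Hmin.
split => //; case: i Hi Hmin => [|i] Hi Hmin; [by left|right].
by rewrite /= leNgt; apply/negP => /Hmin; rewrite ltnn.
Qed.

Lemma le_sum_term (N i : nat) (F : nat -> R) (x : R) : (i < N)%N -> (forall i, 0 <= F i) -> x <= F i ->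
 x <= \sum_(i < N) F i.
Proof.
move=> iN F0 xF; rewrite (bigD1 (Ordinal iN))//=; apply: (le_trans xF); rewrite lerDl.
by apply: sumr_ge0 => j _.
Qed.

Lemma midpoint_dist (x y : P) (c := (2^-1 * (x.1 + y.1), 2^-1 * (x.2 + y.2)) : P) :
 `|x - c| <= `|x - y| / 2 /\ `|y - c| <= `|x - y| / 2.
Proof.
have n1 := norm1_le (x - y); have n2 := norm2_le (x - y); rewrite /= in n1 n2.
have h (u v w : R) : `|u - v| <= w -> `|u - 2^-1 * (u + v)| <= w / 2 /\ `|v - 2^-1 * (u + v)| <= w / 2.
 by rewrite !ler_norml => /andP[? ?]; split; apply/andP; split; lra.
have [a1 a2] := h _ _ _ n1; have [b1 b2] := h _ _ _ n2.
by split; rewrite norm_le2 /=; apply/andP.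
Qed.

(** Additive losses are collected by ln 17 + ln 5 <= 7 ln 2, and ln 2 >= 1/2 gives the stated
    quantity. *)
Lemma lnq_gap (a b F G m M : R) (j : nat) : 0 < m -> m <= M -> (1 < j)%N ->
 M <= 2 ^+ j * m -> 2 ^+ j * m <= 2 * M -> a = m ^+ 4 -> b = (2 ^+ j * m) ^+ 4 ->
 0 <= F -> F <= 2 * m ^+ 2 -> M ^+ 2 <= G ->
 (4 * j%:R - 7) / 8 <= (lnq a G - lnq b G) - (lnq a F - lnq b F).
Proof.
move=> m0 mM j0 Mj jM aE bE F0 Fm MG.
have a0 : 0 < a by rewrite aE exprn_gt0.
have jm0 : 0 < 2 ^+ j * m by rewrite mulr_gt0// exprn_gt0.
have b0 : 0 < b by rewrite bE exprn_gt0.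
have M0 := lt_le_trans m0 mM.
have G0 : 0 < G by apply: lt_le_trans MG; rewrite exprn_gt0.
have l2 : 1 / 2 <= ln 2 :> R by have := @ln_ge 2 ltac:(lra); clear; lra.
have q1 : ln (a + F ^+ 2) <= ln (5 * a).
 apply: le_lnW; first by rewrite ltr_wpDr ?sqr_ge0.
 have := ler_pM F0 F0 Fm Fm; rewrite aE (_ : m ^+ 4 = m ^+ 2 * m ^+ 2); last by ring.
 by clear; lra.
have q2 : ln b <= ln (b + F ^+ 2).
 by apply: le_lnW => //; rewrite lerDl sqr_ge0.
have q3 : ln (G ^+ 2) <= ln (a + G ^+ 2).
 by apply: le_lnW; [rewrite exprn_gt0|rewrite lerDr ltW].
have q4 : ln (b + G ^+ 2) <= ln (17 * G ^+ 2).
 apply: le_lnW; first by rewrite ltr_wpDr ?sqr_ge0.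
 have h1 : b <= 16 * (M ^+ 2) ^+ 2.
  rewrite bE (_ : 16 * _ = (2 * M) ^+ 4); last by ring.
  by rewrite ler_pXn2r ?nnegrE ?(ltW jm0)// mulr_ge0// ltW.
 have h2 : (M ^+ 2) ^+ 2 <= G ^+ 2 by rewrite ler_sqr ?nnegrE ?sqr_ge0// ltW.
 by move: h1 h2; clear; lra.
have e1 : ln (17 * G ^+ 2) = ln 17 + ln (G ^+ 2) by rewrite lnM// posrE// exprn_gt0.
have e2 : ln (5 * a) = ln 5 + ln a by rewrite lnM// posrE.
have e3 : ln b = 4 * j%:R * ln 2 + ln a.
 have -> : b = 2 ^+ (j * 4) * a by rewrite bE aE exprMn exprM.
 rewrite lnM ?posrE ?exprn_gt0// lnXn//; congr (_ + _).
 by rewrite -[LHS]mulr_natr natrM; ring.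
have e4 : ln 17 + ln 5 <= 7 * ln 2 :> R.
 rewrite -lnM ?posrE//; apply: (@le_trans _ _ (ln (2 ^+ 7))).
  by apply: le_lnW; clear; lra.
 by rewrite lnXn// -[leLHS]mulr_natl.
have k0 : 0 <= 4 * j%:R - 7 :> R.
 by have : 2 <= j%:R :> R; [rewrite ler_nat|clear; lra].
rewrite /lnq; have := ler_wpM2l k0 l2; move: q1 q2 q3 q4 e1 e2 e3 e4; clear.
move: (ln (a + F ^+ 2)) (ln (5 * a)) (ln b) (ln (b + F ^+ 2)) (ln (G ^+ 2)) (ln (a + G ^+ 2)) (ln (b + G ^+ 2)) (ln (17 * G ^+ 2)) => x1 x2 x3 x4 x5 x6 x7 x8.
by move: (ln 17) (ln 5) (ln a) (ln 2) => *; lra.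
Qed.

(* A ring separating [x, y] from [z] and infinity, mapped to a ring separating
  [f y, f x] from [f z] and infinity: the length-area estimate bounds the ratio. *)
Lemma ring_bound : exists2 k0 : R, 0 < k0 & exists2 C : R, 1 <= C & forall k f g ux uy vx vy (x y z : P),
 qcpos k f g ux uy vx vy -> 0 <= k <= k0 -> `|x - y| < `|z - (2^-1 * (x.1 + y.1), 2^-1 * (x.2 + y.2))| ->
 `|f x - f y| <= C * `|f z - f y|.
Proof.
have [k1 k10 HE] := log_energy.
pose k0 := Num.min k1 (1 / 4).
exists k0; first by rewrite lt_min k10; lra.
(* 64 comes from [annulus_osc], 2 = 1 + 2 th from [log_energy] at th = 1/2, and 768 = 6 * 128 from
   [area_box] and [potential_shell]. *)
pose K : R := 64 * (2 * 768).
have K0 : 0 < K by rewrite /K; lra.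
have [J HJ] := quadratic_beats_linear K0.
exists (2 ^+ J.+1); first by rewrite exprn_ege1// ler1n.
move=> k f g ux uy vx vy x y z QP /andP[kk0 kk1] xyz.
have Q := qp_map QP; have fK := qc_fK Q; have gK := qc_gK Q; have cf := qc_cf Q; have cg := qc_cg Q.
have k01 : 0 <= k <= k1 by rewrite kk0 (le_trans kk1)// ge_min lexx.
have k2 : k <= 1 / 4 by rewrite (le_trans kk1)// ge_min lexx orbT.
have k24 : (1 + (1 / 2)^-1) * k ^+ 2 <= 1 / 2.
 by have := ler_pM kk0 kk0 k2 k2; rewrite expr2; clear; lra.
have [xc yc] := midpoint_dist x y.
set c : P := (_, _) in xyz xc yc; clearbody c.
set m := `|f z - f y|; set M := `|f x - f y|.
have xy0 := normr_ge0 (x - y).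
have zy : z != y.
 by apply: contraTneq xyz => ->; rewrite -leNgt; move: xy0 yc; clear; lra.
have m0 : 0 < m by rewrite normr_gt0 subr_eq0; apply: contra zy => /eqP/(can_inj fK) ->.
have [Mm|/ltW mM] := leP M m.
 by apply: (le_trans Mm); rewrite ler_peMl ?(ltW m0)// exprn_ege1// ler1n.
have [j j1 j2] := dyadic_bracket m0 mM.
have [jJ|Jj] := leqP j J.+1.
 by apply: (le_trans j1); rewrite ler_pM2r// ler_weXn2l// ler1n.
exfalso.
have j2' : (1 < j)%N by apply: leq_trans Jj.
(* Halfway between |x - y| and |z - c|: then x and y lie in the square of radius rho / 2 about c,
   and z outside the one of radius rho. *)
pose rho := (`|x - y| + `|z - c|) / 2.
have rho0 : 0 < rho by move: xy0 xyz; rewrite /rho; clear; lra.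
have rho1 : `|x - y| < rho by move: xyz; rewrite /rho; clear; lra.
have rho2 : rho < `|z - c| by move: xyz; rewrite /rho; clear; lra.
pose a := m ^+ 4; pose b := (2 ^+ j * m) ^+ 4.
have a0 : 0 < a by rewrite exprn_gt0.
have b0 : 0 < b by rewrite exprn_gt0// mulr_gt0// exprn_gt0.
pose p s := lnq a s - lnq b s; pose p' s := lnq' a s - lnq' b s.
have dp (s : R) : is_derive s (1 : R) p (p' s) by apply: is_deriveB; exact: lnq_der.
have cp : continuous p' by move=> s; apply: cvgB; exact: lnq'_cont.
have [B B0 HB] := bounded_on_box cf (c.1 - rho) (c.1 + rho) (c.2 - rho) (c.2 + rho).
pose t i := 2 ^+ i * m.
have t0 i : 0 < t i by rewrite mulr_gt0// exprn_gt0.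
have [N HN] : exists N, B + `|f y| < t N.
 have h0 : 0 <= (B + `|f y|) / m by rewrite divr_ge0 ?addr_ge0// ltW.
 exists (Num.bound ((B + `|f y|) / m)); have := archi_boundP h0.
 rewrite ltr_pdivrMr// => h; apply: (lt_le_trans h).
 by rewrite /t ler_pM2r// -natrX ler_nat ltnW// ltn_expl.
pose cc i := 128 * (2 ^+ (i - j))^-1 / (t i) ^+ 2.
have cc0 i : 0 <= cc i by rewrite divr_ge0 ?sqr_ge0// mulr_ge0// invr_ge0 exprn_ge0.
have h0 : 0 < (1 / 2 : R) by rewrite divr_gt0.
have pw w : sqr_at c rho w -> 4 * p' (sqdist f (f y) w) ^+ 2 * sqdist f (f y) w <=
  \sum_(i < N.+1) (if `|f w - f y| < t i then cc i else 0).
 move=> /HB hw.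
 have : `|f w - f y| < t N by apply: le_lt_trans HN; apply: (le_trans (ler_normB _ _)); rewrite lerD2r.
 move=> /first_index[i iN [si ti]].
 have ni i' : 0 <= (if `|f w - f y| < t i' then cc i' else 0) by case: ifP.
 have iN1 : (i < N.+1)%N by rewrite ltnS.
 have := @le_sum_term N.+1 i (fun i => if `|f w - f y| < t i then cc i else 0) (cc i) iN1 ni.
 rewrite si => /(_ (lexx _)); apply: le_trans.
 have /andP[F1 F2] := sqdist_bounds f (f y) w.
 have s0 := normr_ge0 (f w - f y).
 have ss : `|f w - f y| ^+ 2 <= (2 ^+ i * m) ^+ 2.
  by rewrite ler_sqr ?nnegrE//; [exact: ltW|exact: ltW (t0 i)].
 apply: potential_shell => //.
 - by apply: le_trans F1; exact: sqr_ge0.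
 - by apply: (le_trans F2); rewrite ler_pM2l.
 - case: ti => [->|ti]; first by left.
  case: i si ti {iN ss iN1} => [|i] si ti; [by left|right].
  apply: le_trans F1; rewrite /= in ti.
  have e2i : 2 ^+ i.+1 = 2 * 2 ^+ i :> R by rewrite exprS.
  rewrite (_ : (2 ^+ i.+1 * m) ^+ 2 / 4 = (t i) ^+ 2); last by rewrite /t e2i; field.
  by rewrite ler_sqr ?nnegrE// ltW.
have En := HE k f g ux uy vx vy (f y) c (1 / 2) rho p p' N.+1 cc t QP k01 h0 k24 rho0 cp dp cc0 t0 pw.
have G := grad2_comp cp dp (grad2_sqdist (f y) Q).
have sumE : \sum_(i < N.+1) 6 * cc i * t i ^+ 2 <= 768 * (j%:R + 2).
 rewrite (eq_bigr (fun i : 'I_N.+1 => 768 * (2 ^+ (i - j))^-1)); last first.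
  move=> i _; rewrite /cc; set u := (2 ^+ (i - j))^-1.
  by field; rewrite gt_eqF.
 rewrite -mulr_sumr; have := half_powers_le j N.+1.
 by move: (\sum_(i < N.+1) _) => S; clear; lra.
have w0 : 0 <= (4 * j%:R - 7) / 8 :> R.
 have : 2 <= j%:R :> R by rewrite ler_nat; apply: leq_trans Jj.
 by clear; lra.
have := @annulus_osc R _ _ _ c rho _ G rho0 w0.
case/(_ _)/wrap => [x1 x2 y1 y2 /andP[hx1 hx2] /andP[hx3 hx4] /andP[hy1 hy2] /andP[hy3 hy4]|].
 have inr w : `|w - c| <= `|x - y| / 2 -> rect x1 x2 y1 y2 w.
  rewrite norm_le2 /= !ler_distl => /andP[/andP[u1 u2] /andP[u3 u4]].
  by apply/andP; split; apply/andP; split; move: rho1 hx2 hx3 hy2 hy3 u1 u2 u3 u4; clear; lra.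
 have yr := inr _ yc; have xr := inr _ xc.
 have zr : ~~ rect x1 x2 y1 y2 (g (f z)).
  rewrite fK; apply/negP => /andP[/andP[u1 u2] /andP[u3 u4]].
  move: rho2; apply/negP; rewrite -leNgt norm_le2 /= !ler_distl.
  by apply/andP; split; apply/andP; split; move: hx1 hx4 hy1 hy4 u1 u2 u3 u4; clear; lra.
 (* The segment from f y to f z crosses within distance m of f y; the ray that starts at f x and
    points away from f y crosses at distance at least M. *)
 have [s [q [/andP[s0 s1] bq fq]]] := rect_hit fK gK cg yr zr.
 have e0 : f x - f y != 0.
  by rewrite -normr_gt0; exact: lt_le_trans mM.
 have [s' [q' [s'0 bq' fq']]] := ray_hit fK gK cf cg xr e0.
 exists q, q'; split => //; rewrite distrC; apply: le_trans (ler_norm _).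
 have /andP[_ Fq] := sqdist_bounds f (f y) q; have /andP[Fq' _] := sqdist_bounds f (f y) q'.
 have nq : `|f q - f y| <= m.
  have -> : f q - f y = s *: (f z - f y).
   by rewrite fq /seg; apply: pair_ext => /=; rewrite /GRing.scale /=; ring.
  by rewrite normrZ ger0_norm// ler_piMl.
 have nq' : M <= `|f q' - f y|.
  have -> : f q' - f y = (1 + s') *: (f x - f y).
   by rewrite fq'; apply: pair_ext => /=; rewrite /GRing.scale /=; ring.
  rewrite normrZ ger0_norm ?addr_ge0//.
  by have := mulr_ge0 s'0 (normr_ge0 (f x - f y)); rewrite /M; clear; lra.
 apply: (lnq_gap m0 mM j2' j1 j2 erefl erefl).
 - by rewrite addr_ge0 ?sqr_ge0.
 - by apply: (le_trans Fq); rewrite ler_pM2l// ler_sqr ?nnegrE// ltW.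
 - by apply: le_trans Fq'; rewrite ler_sqr ?nnegrE ?(le_trans (ltW m0) mM).
rewrite -/a -/b => le.
have E0 := @energy_ge0 R (fun z => p' (sqdist f (f y) z) * (2 * ((f z).1 - (f y).1) * ux z + 2 * ((f z).2 - (f y).2) * vx z))
  (fun z => p' (sqdist f (f y) z) * (2 * ((f z).1 - (f y).1) * uy z + 2 * ((f z).2 - (f y).2) * vy z)) (sqr_at c (rho / 2)).
have := HJ j (ltnW Jj); rewrite /K.
move: le E0 En sumE; clear.
set E := energy _ _ _; set E2 := energy _ _ _; set S := \sum_(i < _) _; set W := (_ / 8) ^+ 2; lra.
Qed.

(** [ring_bound] needs the third point well away from the pair, whereas z may be close to x here.
    Passing through the midpoint w of x and y gives two admissible configurations. *)
Lemma weak_quasisymmetry : exists2 k0 : R, 0 < k0 & exists2 C : R, 1 <= C & forall k f g ux uy vx vy (x y z : P),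
 qcpos k f g ux uy vx vy -> 0 <= k <= k0 -> `|x - y| <= `|z - y| ->
 `|f x - f y| <= C * `|f z - f y|.
Proof.
have [k0 k00 [C C1 H]] := ring_bound.
exists k0 => //; exists (C + C * C); first by have := ler_pM ler01 ler01 C1 C1; move: C1; clear; lra.
have C0 : 0 <= C by apply: le_trans C1.
move=> k f g ux uy vx vy x y z Q k01 xz.
have [->|xy] := eqVneq x y; first by rewrite subrr normr0 mulr_ge0// addr_ge0// mulr_ge0.
have xy0 : 0 < `|x - y| by rewrite normr_gt0 subr_eq0.
pose w : P := 2^-1 *: (x + y).
have wy : w - y = 2^-1 *: (x - y).
 by apply: pair_ext => /=; rewrite /GRing.scale /=; field.
have nwy : `|w - y| = `|x - y| / 2 by rewrite wy normrZ ger0_norm ?invr_ge0// mulrC.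
have mid (p q : P) : ((2^-1 * (p.1 + q.1), 2^-1 * (p.2 + q.2)) : P) = q + 2^-1 *: (p - q).
 by apply: pair_ext => /=; rewrite /GRing.scale /=; field.
have h1 : `|f w - f y| <= C * `|f z - f y|.
 apply: (H _ _ _ _ _ _ _ _ _ _ Q k01); rewrite mid opprD addrA.
 apply: lt_le_trans (lerB_dist _ _); rewrite normrZ nwy ger0_norm ?invr_ge0//.
 by move: xy0 xz; clear; lra.
have h2 : `|f x - f w| <= C * `|f y - f w|.
 apply: (H _ _ _ _ _ _ _ _ _ _ Q k01); rewrite mid.
 have -> : y - (w + 2^-1 *: (x - w)) = (- (3 / 4)) *: (x - y).
  by apply: pair_ext => /=; rewrite /w /GRing.scale /=; field.
 have -> : x - w = 2^-1 *: (x - y).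
  by apply: pair_ext => /=; rewrite /w /GRing.scale /=; field.
 rewrite !normrZ normrN !ger0_norm ?divr_ge0 ?invr_ge0//.
 by move: xy0; clear; lra.
rewrite distrC in h2; rewrite (distrC (f y)) in h2.
have -> : f x - f y = (f w - f y) - (f w - f x).
 by apply: pair_ext => /=; ring.
apply: (le_trans (ler_normB _ _)).
have := ler_wpM2l C0 h1; have := normr_ge0 (f z - f y); move: h1 h2; clear; lra.
Qed.

End distortion.

(** * Energy on squares and hole filling *)

Section growth.
Variable R : realType.
Local Notation P := (R * R)%type.
Local Notation mu2 := (@lbm R \x @lbm R)%E.

Lemma is_derive_quadratic (f : R -> R) (x d K : R) :
 (forall h, `|f (x + h) - f x - h * d| <= K * h ^+ 2) -> is_derive x (1 : R) f d.
Proof.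
move=> H.
have cv : h^-1 *: ((f \o shift x) (h *: 1) - f x) @[h --> 0^'] --> d.
 apply/cvgrPdist_le => e e0.
 pose M := `|K| + 1; have M0 : 0 < M by rewrite ltr_wpDl.
 near=> h.
 have h0 : h != 0 by near: h; exact: nbhs_dnbhs_neq.
 have hs : `|h| <= e / M.
  near: h; apply: dnbhs0_le; exact: divr_gt0.
 rewrite /= /GRing.scale /= mulr1 [h + x]addrC.
 have -> : d - h^-1 * (f (x + h) - f x) = - (h^-1 * (f (x + h) - f x - h * d)) by field.
 rewrite normrN normrM normfV ler_pdivrMl ?normr_gt0//.
 apply: (le_trans (H h)); rewrite -(real_normK (num_real h)) expr2 mulrA mulrC ler_wpM2l//.
 apply: (@le_trans _ _ (M * `|h|)); first by rewrite ler_wpM2r// (le_trans (ler_norm _))// lerDl.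
 by rewrite mulrC -ler_pdivlMr.
have dv : derivable f x 1 by apply/cvg_ex; exists d.
split => //; apply: cvg_lim => //.
Unshelve. all: by end_near.
Qed.

(** 1/t for t >= a, continued below a by its tangent line, hence C^1. At t = |z - c|^2 it
    regularizes 1 / |z - c|^2. *)
Definition qf (a t : R) : R := (Num.max t a)^-1 + (Num.max t a - t) / a ^+ 2.
Definition qf' (a t : R) : R := - (Num.max t a) ^- 2.

Lemma qf_der (a t : R) : 0 < a -> is_derive t (1 : R) (qf a) (qf' a t).
Proof.
move=> a0; apply: (@is_derive_quadratic _ _ _ (3 / a ^+ 3)) => h.
set A := Num.max t a; set B := Num.max (t + h) a.
have Aa : a <= A by rewrite le_max lexx orbT.
have Ba : a <= B by rewrite le_max lexx orbT.
have A0 : 0 < A by exact: lt_le_trans Aa.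
have B0 : 0 < B by exact: lt_le_trans Ba.
have a3 : 0 < a ^+ 3 by rewrite exprn_gt0.
have -> : qf a (t + h) - qf a t - h * qf' a t =
  (B - A) ^+ 2 / (A ^+ 2 * B) + (B - A - h) * (a ^- 2 - A ^- 2).
 by rewrite /qf /qf' -/A -/B; field; rewrite !gt_eqF.
have nh : - `|h| <= h <= `|h| by rewrite -ler_norml.
have BA : `|B - A| <= `|h|.
 rewrite ler_norml; case/andP: nh => n1 n2; have n0 := normr_ge0 h.
 by rewrite /B /A; case: (leP t a) => h1; case: (leP (t + h) a) => h2; apply/andP; split;
  move: h1 h2 n1 n2 n0; clear; lra.
have hh : `|h| ^+ 2 = h ^+ 2 by exact: real_normK (num_real h).
have BB : `|B - A| ^+ 2 = (B - A) ^+ 2 by exact: real_normK (num_real _).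
have s1 : (B - A) ^+ 2 / (A ^+ 2 * B) <= h ^+ 2 / a ^+ 3.
 apply: ler_pM.
 - exact: sqr_ge0.
 - by rewrite invr_ge0 mulr_ge0 ?sqr_ge0// ltW.
 - by rewrite -hh -BB ler_sqr ?nnegrE.
 rewrite lef_pV2 ?posrE ?mulr_gt0 ?exprn_gt0//.
 rewrite exprSr; apply: ler_pM => //; rewrite ?sqr_ge0 ?(ltW a0)//.
 by rewrite ler_sqr ?nnegrE// ltW.
have s0 : 0 <= (B - A) ^+ 2 / (A ^+ 2 * B) by rewrite divr_ge0 ?sqr_ge0// mulr_ge0 ?sqr_ge0// ltW.
have s2 : `|(B - A - h) * (a ^- 2 - A ^- 2)| <= 2 * h ^+ 2 / a ^+ 3.
 have r0 : 0 <= 2 * h ^+ 2 / a ^+ 3.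
  by apply: divr_ge0; [apply: mulr_ge0; [exact: ler0n|exact: sqr_ge0]|exact: ltW].
 have [ta|ta] := leP t a.
  have -> : A = a by rewrite /A max_r.
  by rewrite subrr mulr0 normr0.
 have At : A = t by rewrite /A max_l// ltW.
 have [tb|tb] := leP a (t + h).
  have -> : B = t + h by rewrite /B max_l.
  rewrite At (_ : t + h - t - h = 0); last by ring.
  by rewrite mul0r normr0.
 have Bt : B = a by rewrite /B max_r// ltW.
 have hn : `|h| = - h by rewrite ltr0_norm//; move: ta tb; clear; lra.
 have w1 : `|B - A - h| <= `|h|.
  by rewrite Bt At hn ler_norml; apply/andP; split; move: ta tb; clear; lra.
 have w2 : `|a ^- 2 - A ^- 2| <= 2 * `|h| / a ^+ 3.
  have e : a ^- 2 - A ^- 2 = (A - a) * ((A + a) / A) / (A * a ^+ 2) by field; rewrite !gt_eqF.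
  have Aa2 : 0 <= (A + a) / A <= 2.
   apply/andP; split; first by rewrite divr_ge0// ?addr_ge0// ltW.
   by rewrite ler_pdivrMr//; move: Aa; clear; lra.
  case/andP: Aa2 => g1 g2.
  have Aa0 : 0 <= A - a by rewrite subr_ge0.
  rewrite e ger0_norm; last first.
   by apply: divr_ge0; [exact: mulr_ge0|apply: mulr_ge0; [exact: ltW|exact: sqr_ge0]].
  apply: ler_pM.
  - exact: mulr_ge0.
  - by rewrite invr_ge0 mulr_ge0 ?sqr_ge0// ltW.
  - by rewrite [2 * _]mulrC; apply: ler_pM => //; rewrite hn At; move: tb; clear; lra.
  rewrite lef_pV2 ?posrE ?mulr_gt0 ?exprn_gt0//.
  by rewrite exprS; apply: ler_pM => //; rewrite ?sqr_ge0 ?(ltW a0).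
 rewrite normrM; apply: (le_trans (ler_pM _ _ w1 w2)) => //.
 by rewrite -hh; apply: le_of_eq; ring.
apply: (le_trans (ler_normD _ _)); rewrite (ger0_norm s0).
by move: s1 s2; clear; lra.
Qed.

Lemma qf_cont (a : R) : 0 < a -> continuous (qf a).
Proof. by move=> a0 t; apply: differentiable_continuous; apply/derivable1_diffP; have [] := qf_der t a0. Qed.

Lemma qf'_cont (a : R) : 0 < a -> continuous (qf' a).
Proof.
move=> a0 t; have m0 : Num.max t a != 0 by rewrite gt_eqF// lt_max a0 orbT.
apply: cvgN; apply: cvgV; first by rewrite expf_neq0.
have cm : continuous (fun t : R => Num.max t a).
 by move=> s; apply: continuous_max; [exact: cvg_id|exact: cvg_cst].
by rewrite expr2; under eq_fun do rewrite expr2; apply: cvgM; exact: cm.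
Qed.

Lemma Rint_subset (h : P -> R) (D U : set P) N : locint h -> (forall z, 0 <= h z) ->
 measurable D -> measurable U -> D `<=` U -> (forall z, U z -> `|z| <= N) ->
 \int[mu2]_(z in D) h z <= \int[mu2]_(z in U) h z.
Proof.
move=> [mh hi] h0 mD mU DU UN.
have [N0|N0] := ltP N 0.
 have U0 : U = set0 by rewrite -subset0 => z /UN; rewrite leNgt (lt_le_trans N0)// normr_ge0.
 by move: DU; rewrite U0 subset0 => ->.
have hB : mu2.-integrable (sqr_at 0 N) (EFin \o h) by apply: hi; rewrite /= lerD2l; lra.
have UB : U `<=` sqr_at 0 N by move=> z /UN zN; apply/sqr_atP; rewrite subr0.
have hU := integrableS (@msqr_at _ 0 N) mU UB hB.
have hD := integrableS mU mD DU hU.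
apply: fine_le; [exact: (integrable_fin_num mD hD)|exact: (integrable_fin_num mU hU)|].
apply: ge0_subset_integral => //; first by apply/measurable_EFinP; exact: measurable_funTS.
by move=> z _; rewrite lee_fin.
Qed.

Lemma norm_right_point (c : P) (s : R) : 0 < s -> `|((c.1 + s, c.2) : P) - c| = s.
Proof.
move=> s0; apply/eqP; rewrite eq_le norm_le2 /= [c.1 + s]addrC addrK subrr normr0 (ltW s0) gtr0_norm// lexx /=.
by have := norm1_le (((s + c.1, c.2) : P) - c); rewrite /= addrK gtr0_norm.
Qed.

(** Weak quasisymmetry sends the square into a ball of radius comparable to |f z - f c|, and
    [area_box] controls the energy over the preimage of that ball. *)
Lemma square_energy : exists2 k0 : R, 0 < k0 & exists2 C : R, 1 <= C & forall k f g ux uy vx vy (c z : P),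
 qcpos k f g ux uy vx vy -> 0 <= k <= k0 ->
 energy ux uy (sqr_at c `|z - c|) + energy vx vy (sqr_at c `|z - c|) <= C * `|f z - f c| ^+ 2 /\
 \int[mu2]_(w in sqr_at c `|z - c|) cf2 (ux w) (uy w) (vx w) (vy w) <= C * `|f z - f c| ^+ 2.
Proof.
have [k1 k10 HA] := @area_box R; have [k2 k20 [C C1 HC]] := @weak_quasisymmetry R.
exists (Num.min k1 k2); first by rewrite lt_min k10.
exists (48 * C ^+ 2); first by have := ler_pM ler01 ler01 C1 C1; rewrite expr2; clear; lra.
move=> k f g ux uy vx vy c z QP /andP[kk0]; rewrite le_min => /andP[kk1 kk2].
have Q := qp_map QP; have gu := qc_u Q; have gv := qc_v Q.
have k01 : 0 <= k <= k1 by rewrite kk0. have k02 : 0 <= k <= k2 by rewrite kk0.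
have C0 : 0 < C by apply: lt_le_trans C1.
have Bu := energy_locint gu; have Bv := energy_locint gv.
have mc := (qc_cf2_box Q).1.
have [->|zc] := eqVneq z c.
 have S0 (h : P -> R) : measurable_fun setT h -> \int[mu2]_(w in sqr_at c 0) h w = 0.
  move=> mh; rewrite /Rintegral null_set_integral//; first exact: msqr_at.
   by apply/measurable_EFinP; exact: measurable_funTS.
  have := mu_sqr_at c (lexx 0); rewrite expr0n mulr0; exact.
 by rewrite !subrr !normr0 expr0n !mulr0 /energy !S0 ?addr0//; [exact: Bv.1|exact: Bu.1].
have f0 : 0 < `|f z - f c|.
 by rewrite normr_gt0 subr_eq0; apply: contra zc => /eqP/(can_inj (qc_fK Q)) ->.
pose t := 2 * C * `|f z - f c|; have t0 : 0 < t by rewrite !mulr_gt0.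
have Bs := qc_density_box Q.
have [N N0 HN] := image_box_bounded (f c) t (qc_fK Q) (qc_cg Q).
have oU : open [set w | `|f w - f c| < t].
 have -> : [set w | `|f w - f c| < t] = f @^-1` ball (f c) t.
  by apply/seteqP; split => w /=; rewrite -ball_normE /= distrC.
 by apply: (continuousP f).1; [exact: qc_cf Q|exact: ball_open].
have le : \int[mu2]_(w in sqr_at c `|z - c|)
  (cf2 (ux w) (uy w) (vx w) (vy w) + ac2 (ux w) (uy w) (vx w) (vy w)) <= 6 * t ^+ 2.
 apply: le_trans (HA _ _ _ _ _ _ _ (f c) t Q k01 t0).
 apply: (@Rint_subset _ _ _ N) => //.
 - by move=> w; rewrite addr_ge0 ?cf2_ge0 ?ac2_ge0.
 - exact: msqr_at.
 - exact: open_measurable2.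
 move=> w /sqr_atP/(HC _ _ _ _ _ _ _ w c z QP k02) h; apply: (le_lt_trans h).
 by rewrite /t -mulrA ltr_pMl ?mulr_gt0//; lra.
have e1 : energy ux uy (sqr_at c `|z - c|) + energy vx vy (sqr_at c `|z - c|) <= 48 * C ^+ 2 * `|f z - f c| ^+ 2.
 rewrite /energy -RintegralD//; [|exact: msqr_at|by apply: Bu.2; rewrite lerD2l; have := normr_ge0 (z - c); clear; lra|by apply: Bv.2; rewrite lerD2l; have := normr_ge0 (z - c); clear; lra].
 have -> : \int[mu2]_(x in sqr_at c `|z - c|) (ux x ^+ 2 + uy x ^+ 2 + (vx x ^+ 2 + vy x ^+ 2)) =
   \int[mu2]_(w in sqr_at c `|z - c|) (2 * (cf2 (ux w) (uy w) (vx w) (vy w) + ac2 (ux w) (uy w) (vx w) (vy w))).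
  by apply: eq_Rintegral => w _; rewrite cf2_ac2_sum !addrA.
 rewrite RintegralZl//; [|exact: msqr_at|by apply: Bs.2; rewrite lerD2l; have := normr_ge0 (z - c); clear; lra].
 move: le; rewrite /t !exprMn; set I := Rintegral _ _ _; set X := C ^+ 2; set Y := `|_| ^+ 2.
 by clear; lra.
split => //; apply: le_trans e1.
have rl : `|c.1 - `|z - c| - c.1| = `|z - c| by rewrite addrAC subrr add0r normrN normr_id.
have l1 : c.1 - `|z - c| <= c.1 + `|z - c| by rewrite lerD2l; have := normr_ge0 (z - c); clear; lra.
have l2 : c.2 - `|z - c| <= c.2 + `|z - c| by rewrite lerD2l; have := normr_ge0 (z - c); clear; lra.
rewrite /energy -RintegralD//; [|exact: msqr_at|exact: Bu.2|exact: Bv.2].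
apply: le_Rintegral; [exact: msqr_at| | |].
- apply: (Rile _ _ _ (Bs.2 _ _ _ _ l1 l2)); [exact: msqr_at|exact: measurable_funTS|].
 by move=> w _; rewrite ger0_norm ?cf2_ge0// lerDl ac2_ge0.
- by apply: RiD; [exact: msqr_at|exact: Bu.2|exact: Bv.2].
- move=> w _; have := cf2_ac2_sum (ux w) (uy w) (vx w) (vy w); have := ac2_ge0 (ux w) (uy w) (vx w) (vy w).
 by have := cf2_ge0 (ux w) (uy w) (vx w) (vy w); lra.
Qed.

(** Widman's argument: the energy of the inner square is at most B times the energy of the
    surrounding annulus. Adding B times the inner energy to both sides gives the factor B / (1 + B)
    for each doubling. *)
Lemma hole_filling : exists2 k0 : R, 0 < k0 & exists2 C : R, 1 <= C & exists2 th : R, 0 < th < 1 &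
 forall k f g ux uy vx vy (x z c : P) (n : nat),
 qcpos k f g ux uy vx vy -> 0 <= k <= k0 -> 2 ^+ n * `|x - c| <= `|z - c| ->
 `|f x - f c| ^+ 2 <= C * th ^+ n * `|f z - f c| ^+ 2.
Proof.
have [k1 k10 [A A1 HA]] := square_energy; have [k2 k20 [C C1 HC]] := @weak_quasisymmetry R.
exists (Num.min k1 k2); first by rewrite lt_min k10.
have C0 : 0 < C by apply: lt_le_trans C1.
have A0 : 0 < A by apply: lt_le_trans A1.
pose B := 16 * C ^+ 2 * A.
have B0 : 0 < B by rewrite !mulr_gt0// exprn_gt0.
have CC1 : 1 <= C ^+ 2 by rewrite expr2; have := ler_pM ler01 ler01 C1 C1; rewrite mul1r.
have BC : 16 <= B.
 by rewrite /B -mulrA; have := ler_pM ler01 ler01 CC1 A1; rewrite mul1r; clear; lra.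
pose th := B / (1 + B).
have B10 : 0 < 1 + B by lra.
have th0 : 0 < th by rewrite divr_gt0.
have th1 : th < 1 by rewrite ltr_pdivrMr// mul1r; lra.
exists (C ^+ 2 * B * th^-1).
 have t1 : 1 <= th^-1 by rewrite invf_ge1// ltW.
 have h := ler_pM ler01 ler01 CC1 (le_trans (ler1n R 16) BC).
 by rewrite mul1r in h; have := ler_pM ler01 ler01 h t1; rewrite mul1r.
exists th; first by rewrite th0.
move=> k f g ux uy vx vy x z c n QP /andP[kk0]; rewrite le_min => /andP[kk1 kk2] xz.
have Q := qp_map QP; have fK := qc_fK Q; have gK := qc_gK Q; have cf := qc_cf Q; have cg := qc_cg Q.
have k01 : 0 <= k <= k1 by rewrite kk0. have k02 : 0 <= k <= k2 by rewrite kk0.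
have K0 m : 0 <= C ^+ 2 * B / th * th ^+ m.
 by apply: mulr_ge0; [apply: divr_ge0; [apply: mulr_ge0; [exact: sqr_ge0|exact: ltW]|exact: ltW]|rewrite exprn_ge0// ltW].
have [E|zc] := eqVneq z c.
 suff -> : x = c by rewrite subrr normr0 expr0n /= mulr_ge0// sqr_ge0.
 move: xz; rewrite E subrr normr0 => h; apply/eqP; rewrite -subr_eq0 -normr_eq0 eq_le normr_ge0 andbT.
 by rewrite -(ler_pM2l (exprn_gt0 n (ltr0n R 2))) mulr0.
pose e r := energy ux uy (sqr_at c r).
have cd (p q : P) : `|p - c| <= `|q - c| -> `|f p - f c| ^+ 2 <= C ^+ 2 * `|f q - f c| ^+ 2.
 move=> pq; rewrite -exprMn ler_sqr ?nnegrE ?mulr_ge0//; first exact: (HC _ _ _ _ _ _ _ p c q QP k02).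
 exact: ltW.
have step (p : P) : 0 < `|p - c| -> `|f p - f c| ^+ 2 <= 16 * C ^+ 2 * (e (2 * `|p - c|) - e `|p - c|).
 move=> p0; set r := 2 * `|p - c|.
 have rE : r / 2 = `|p - c| by rewrite /r; field.
 have r0 : 0 < r by rewrite mulr_gt0.
 (* The rays from f c in the two horizontal directions both cross at distance at least |f p - f c| /
    C, so the first coordinate varies by twice that amount. *)
 set w := 2 * (C^-1 * `|f p - f c|).
 have w0 : 0 <= w by rewrite !mulr_ge0// invr_ge0 ltW.
 have := @annulus_osc R _ _ _ c r w (qc_u Q) r0 w0.
 case/(_ _)/wrap => [x1 x2 y1 y2 /andP[hx1 hx2] /andP[hx3 hx4] /andP[hy1 hy2] /andP[hy3 hy4]|].
  have cr : rect x1 x2 y1 y2 c.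
   by apply/andP; split; apply/andP; split; move: r0 hx2 hx3 hy2 hy3; clear; lra.
  have far q : rect_bd x1 x2 y1 y2 q -> C^-1 * `|f p - f c| <= `|f q - f c|.
   move=> [_ bq]; rewrite mulrC ler_pdivrMr// mulrC; apply: (HC _ _ _ _ _ _ _ p c q QP k02).
   rewrite -rE leNgt; apply/negP => qr.
   have := le_lt_trans (norm1_le _) qr; have := le_lt_trans (norm2_le _) qr.
   rewrite /= !ltr_norml => /andP[u1 u2] /andP[u3 u4].
   by move: u1 u2 u3 u4 hx2 hx3 hy2 hy3; case: bq => [<-|[<-|[<-|<-]]]; clear; lra.
  have ei (s : R) : s != 0 -> ((s, 0) : P) != 0 by move=> s0; rewrite xpair_eqE negb_and s0.
  have [s [q [s0 bq fq]]] := ray_hit fK gK cf cg cr (ei 1 (oner_neq0 _)).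
  have m10 : -1 != 0 :> R by rewrite oppr_eq0 oner_neq0.
  have [s' [q' [s'0 bq' fq']]] := ray_hit fK gK cf cg cr (ei (-1) m10).
  exists q, q'; split => //; apply: le_trans (ler_norm _).
  have h1 : `|f q - f c| <= s.
   rewrite (_ : f q - f c = (s, 0)) ?norm_le2 /= ?normr0 ?ger0_norm ?lexx//.
   by rewrite fq; apply: pair_ext => /=; ring.
  have h2 : `|f q' - f c| <= s'.
   rewrite (_ : f q' - f c = (- s', 0)) ?norm_le2 /= ?normr0 ?normrN ?ger0_norm ?lexx//.
   by rewrite fq'; apply: pair_ext => /=; ring.
  rewrite fq fq' /=; have := far _ bq; have := far _ bq'; rewrite /w; move: h1 h2; clear; lra.
 rewrite rE -/(e r) -/(e _) /w !exprMn => h.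
 have Cp : 0 < C ^+ 2 by rewrite exprn_gt0.
 have := ler_wpM2l (ltW Cp) h; rewrite exprVn.
 rewrite (_ : C ^+ 2 * (2 ^+ 2 * ((C ^+ 2)^-1 * `|f p - f c| ^+ 2)) = 4 * `|f p - f c| ^+ 2); last by field; rewrite gt_eqF.
 by set X := C ^+ 2; set Y := e r - _; rewrite [X * (64 * Y)](_ : _ = 64 * (X * Y)) -?[16 * X * Y]mulrA; [clear; lra|ring].
have hole s : 0 < s -> e s <= th * e (2 * s).
 move=> s0; have ps := norm_right_point c s0; set p : P := (_, _) in ps; clearbody p.
 have p0 : 0 < `|p - c| by rewrite ps.
 have h1 := step p p0; have [h2 _] := HA k f g ux uy vx vy c p QP k01.
 have h3 := @energy_ge0 R vx vy (sqr_at c s).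
 rewrite ps -/(e s) in h1 h2; rewrite /th mulrAC ler_pdivlMr//.
 have h4 : e s <= A * `|f p - f c| ^+ 2 by move: h2 h3; clear; lra.
 have := ler_wpM2l (ltW A0) h1; rewrite /B.
 set X := 16 * C ^+ 2; set Y := e (2 * s); rewrite [A * (X * _)]mulrA [A * X]mulrC.
 by move: h4; set Z := X * A; clear; nra.
clearbody th.
have iter s m : 0 < s -> e s <= th ^+ m * e (2 ^+ m * s).
 move=> s0; elim: m => [|m IH]; first by rewrite !expr0 !mul1r.
 apply: (le_trans IH); rewrite !exprSr -!mulrA ler_wpM2l ?exprn_ge0 ?(ltW th0)//.
 by rewrite [2 * s in leRHS]mulrC mulrA [in leRHS](mulrC _ 2); apply: hole; rewrite mulr_gt0// exprn_gt0.
have [xc|xc] := eqVneq x c.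
 by rewrite xc subrr normr0 expr0n /= mulr_ge0// sqr_ge0.
have s0 : 0 < `|x - c| by rewrite normr_gt0 subr_eq0.
case: n xz => [|n] xz.
 rewrite expr0 mul1r in xz; apply: (le_trans (cd _ _ xz)).
 rewrite expr0 mulr1 ler_wpM2r ?sqr_ge0//.
 rewrite -mulrA ler_peMr ?sqr_ge0//.
 have t1 : 1 <= th^-1 by rewrite invf_ge1// ltW.
 by have := ler_pM ler01 ler01 (le_trans (ler1n R 16) BC) t1; rewrite mul1r.
have r0 : 0 < 2 ^+ n * (2 * `|x - c|) by rewrite !mulr_gt0// exprn_gt0.
have pr := norm_right_point c r0; set p : P := (_, _) in pr; clearbody p.
have h1 := step x s0; have h2 := iter (2 * `|x - c|) n (mulr_gt0 (ltr0n R 2) s0).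
have [h3 _] := HA k f g ux uy vx vy c p QP k01; rewrite pr -/(e _) in h3.
have h4 := @energy_ge0 R vx vy (sqr_at c (2 ^+ n * (2 * `|x - c|))).
have h5 : `|f p - f c| ^+ 2 <= C ^+ 2 * `|f z - f c| ^+ 2.
 by apply: cd; rewrite pr mulrA -exprSr.
have h6 := @energy_ge0 R ux uy (sqr_at c `|x - c|); rewrite -/(e _) in h6.
have h7 : e (2 ^+ n * (2 * `|x - c|)) <= A * (C ^+ 2 * `|f z - f c| ^+ 2).
 by apply: (@le_trans _ _ (A * `|f p - f c| ^+ 2)); [move: h3 h4; clear; lra|rewrite ler_wpM2l// ltW].
have X0 : 0 <= 16 * C ^+ 2 by rewrite mulr_ge0// sqr_ge0.
apply: (@le_trans _ _ (16 * C ^+ 2 * (th ^+ n * (A * (C ^+ 2 * `|f z - f c| ^+ 2))))).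
 apply: (le_trans h1); rewrite ler_wpM2l//; apply: (@le_trans _ _ (e (2 * `|x - c|))); first by rewrite gerBl.
 by apply: (le_trans h2); rewrite ler_wpM2l ?exprn_ge0// ltW.
by apply: le_of_eq; rewrite (exprS th) /B; field; rewrite gt_eqF.
Qed.

End growth.

(** * Regularized Cauchy kernel, capacity of rings, growth exponent *)

Section radial_fields.
Variable R : realType.
Local Notation P := (R * R)%type.
Local Notation mu1 := (@lbm R).
Local Notation mu2 := (@lbm R \x @lbm R)%E.
Implicit Types (c z : P) (a r s : R).

Definition radius2 c z : R := (z.1 - c.1) ^+ 2 + (z.2 - c.2) ^+ 2.

Lemma radius2_ge0 c z : 0 <= radius2 c z.
Proof. by rewrite addr_ge0 ?sqr_ge0. Qed.

Lemma xac_fst (k : R) : xac (fun z : P => z.1 + k) (cst 1).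
Proof.
apply: xac_smooth; [by move=> z; apply: cvgD; [exact: cvg_fst|exact: cvg_cst]|by move=> z; exact: cvg_cst|].
by move=> x y /=; apply: is_derive_eq; rewrite addr0.
Qed.

Lemma xac_snd (k : R) : xac (fun z : P => z.2 + k) (cst 0).
Proof.
apply: xac_smooth; [by move=> z; apply: cvgD; [exact: cvg_snd|exact: cvg_cst]|by move=> z; exact: cvg_cst|].
by move=> x y /=; exact: is_derive_cst.
Qed.

Lemma grad2_fst (k : R) : grad2 (fun z : P => z.1 + k) (cst 1) (cst 0).
Proof.
have bc (m : R) : locint (cst m : P -> R) by apply: locint_cont => z; exact: cvg_cst.
split; [exact: (xac_fst k)|exact: (xac_snd k)|exact: (bc (1 ^+ 2))|exact: (bc (0 ^+ 2))].
Qed.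

Lemma grad2_snd (k : R) : grad2 (fun z : P => z.2 + k) (cst 0) (cst 1).
Proof.
have bc (m : R) : locint (cst m : P -> R) by apply: locint_cont => z; exact: cvg_cst.
split; [exact: (xac_snd k)|exact: (xac_fst k)|exact: (bc (0 ^+ 2))|exact: (bc (1 ^+ 2))].
Qed.

Lemma grad2_radius c : grad2 (radius2 c) (fun z => 2 * (z.1 - c.1)) (fun z => 2 * (z.2 - c.2)).
Proof.
have sq : forall x : R, is_derive x (1 : R) (fun x => x ^+ 2) (2 * x).
 by move=> x; apply: is_derive_eq; rewrite /GRing.scale /=; ring.
have cl : continuous (fun x : R => 2 * x).
 by move=> x; apply: cvgM; [exact: cvg_cst|exact: cvg_id].
have := grad2D (grad2_comp cl sq (grad2_fst (- c.1))) (grad2_comp cl sq (grad2_snd (- c.2))).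
by congr grad2; apply/funext => z /=; ring.
Qed.

(** Together with [fieldy] the regularized gradient of ln |z - c|, that is the real part and minus
    the imaginary part of 1 / (z - c). The two coincide with these where |z - c|^2 >= a. *)
Definition fieldx a c z : R := (z.1 - c.1) * qf a (radius2 c z).
Definition fieldy a c z : R := (z.2 - c.2) * qf a (radius2 c z).
(** The divergence of the field ([field_div]): a bump on the disc of squared radius a, approximating
    2 pi times a Dirac mass. *)
Definition source a c z : R := 4 * Num.max (a - radius2 c z) 0 / a ^+ 2.

Definition fieldxx a c z : R :=
 qf a (radius2 c z) + 2 * (z.1 - c.1) ^+ 2 * qf' a (radius2 c z).
Definition fieldyy a c z : R :=
 qf a (radius2 c z) + 2 * (z.2 - c.2) ^+ 2 * qf' a (radius2 c z).
Definition fieldxy a c z : R := 2 * (z.1 - c.1) * (z.2 - c.2) * qf' a (radius2 c z).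

Section fields.
Variables (a : R) (c : P).
Hypothesis a0 : 0 < a.

Let gq := grad2_comp (qf'_cont a0) (fun t => qf_der t a0) (grad2_radius c).

Lemma fieldx_x : xac (fieldx a c) (fieldxx a c).
Proof.
have := xacM (xac_fst (- c.1)) (grad2_x gq); congr xac.
by apply/funext => z; rewrite /fieldxx /=; ring.
Qed.

Lemma fieldy_x : xac (fieldy a c) (fieldxy a c).
Proof.
have := xacM (xac_snd (- c.2)) (grad2_x gq); congr xac.
by apply/funext => z; rewrite /fieldxy /=; ring.
Qed.

Lemma fieldy_y : yac (fieldy a c) (fieldyy a c).
Proof.
have := xacM (xac_fst (- c.2)) (grad2_y gq); congr xac.
by apply/funext => z; rewrite /fieldyy /=; ring.
Qed.

Lemma fieldx_y : yac (fieldx a c) (fieldxy a c).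
Proof.
have := xacM (xac_snd (- c.1)) (grad2_y gq); congr xac.
by apply/funext => z; rewrite /fieldxy /=; ring.
Qed.

Lemma field_div z : fieldxx a c z + fieldyy a c z = source a c z.
Proof.
rewrite /fieldxx /fieldyy /source.
have -> : (z.1 - c.1) ^+ 2 = radius2 c z - (z.2 - c.2) ^+ 2 by rewrite /radius2 addrK.
rewrite /qf /qf'; case: (leP (radius2 c z) a) => h.
 rewrite max_l ?subr_ge0//; field; exact: lt0r_neq0.
rewrite max_r ?subr_le0 ?(ltW h)//; field.
by rewrite !lt0r_neq0// (lt_trans a0).
Qed.

Lemma qf_ge0 (t : R) : 0 <= qf a t.
Proof.
by rewrite addr_ge0// ?invr_ge0 ?le_max ?(ltW a0) ?orbT// divr_ge0 ?sqr_ge0// subr_ge0 le_max lexx.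
Qed.

Lemma source_ge0 z : 0 <= source a c z.
Proof. by rewrite divr_ge0 ?sqr_ge0// mulr_ge0// le_max lexx orbT. Qed.

Lemma source_out z : a <= radius2 c z -> source a c z = 0.
Proof. by move=> h; rewrite /source max_r ?subr_le0// mulr0 mul0r. Qed.

Lemma source_cont : continuous (source a c).
Proof.
have ct := xac_cont (grad2_x (grad2_radius c)).
move=> z; apply: cvgM; last exact: cvg_cst.
apply: cvgM; first exact: cvg_cst.
by apply: (@continuous_max _ _ _ _ z); [apply: cvgB; [exact: cvg_cst|exact: ct]|exact: cvg_cst].
Qed.

Lemma field_norm z : fieldx a c z ^+ 2 + fieldy a c z ^+ 2 = radius2 c z * qf a (radius2 c z) ^+ 2.
Proof. by rewrite /fieldx /fieldy /radius2; ring. Qed.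

End fields.

Lemma gauss (p px q qy : P -> R) c r : 0 < r -> xac p px -> yac q qy ->
 \int[mu2]_(z in sqr_at c r) (px z + qy z) =
 \int[mu1]_(y in `[c.2 - r, c.2 + r]) (p (c.1 + r, y) - p (c.1 - r, y)) +
 \int[mu1]_(x in `[c.1 - r, c.1 + r]) (q (x, c.2 + r) - q (x, c.2 - r)).
Proof.
move=> r0 pp qq.
have l1 : c.1 - r <= c.1 + r by lra. have l2 : c.2 - r <= c.2 + r by lra.
rewrite -(xac_int l1 l2 pp) -(yac_int l1 l2 qq) -RintegralD//; first exact: msqr_at.
- exact: (xac_box pp).2.
- exact: (yac_box qq).2.
Qed.

Lemma yacM (f g h k : P -> R) : yac f g -> yac h k ->
 yac (fun z => f z * h z) (fun z => h z * g z + f z * k z).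
Proof. by move=> fg hk; exact: (xacM fg hk). Qed.

Lemma edge_int (p : P -> R) (L : R -> P) (b : R -> R) a a' M : a <= a' -> continuous p -> continuous L ->
 continuous b -> (forall t : R, a <= t <= a' -> 0 <= b t) -> (forall t : R, a <= t <= a' -> M <= p (L t)) ->
 M * \int[mu1]_(t in `[a, a']) b t <= \int[mu1]_(t in `[a, a']) (p (L t) * b t).
Proof.
move=> aa cp cL cb b0 Mp.
have cpL : continuous (fun t => p (L t)).
 by move=> t; apply: (@continuous_comp _ _ _ L p); [exact: cL|exact: cp].
have bi : mu1.-integrable `[a, a'] (EFin \o b) by exact: cont_int1.
rewrite -RintegralZl//; apply: le_Rintegral => //.
- exact: RiZ.
- by apply: cont_int1 => // t; apply: cvgM; [exact: cpL|exact: cb].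
- by move=> t /=; rewrite in_itv /= => h; rewrite ler_wpM2r ?b0 ?Mp.
Qed.

Lemma sqD_cont (k t0 : R) : continuous (fun t => k + (t - t0) ^+ 2).
Proof. by move=> t; apply: cvgD; [|apply: cvgM; apply: cvgB]; solve [exact: cvg_cst|exact: cvg_id]. Qed.

Lemma vline_cont (x : R) : continuous (fun y : R => (x, y) : P).
Proof. by apply: pair_cont => t; [exact: cvg_cst|exact: cvg_id]. Qed.

Lemma hline_cont (y : R) : continuous (fun x : R => (x, y) : P).
Proof. by apply: pair_cont => t; [exact: cvg_id|exact: cvg_cst]. Qed.

Lemma norm_edge (r x y : R) : (`|x| = r /\ `|y| <= r) \/ (`|y| = r /\ `|x| <= r) -> `|((x, y) : P)| = r.
Proof.
move=> h; apply/eqP; rewrite eq_le norm_le2 /=.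
case: h => -[h1 h2]; rewrite h1 h2 lexx /=.
 by rewrite -h1; exact: (norm1_le (x, y)).
by rewrite -h1; exact: (norm2_le (x, y)).
Qed.

(** Each side of a square carries a quarter of the flux 2 pi, kept in the form 2 atan 1 that
    [flux_low] estimates. *)
Lemma flux1 (r t0 : R) : 0 < r ->
 \int[mu1]_(t in `[t0 - r, t0 + r]) (r / (r ^+ 2 + (t - t0) ^+ 2)) = 2 * atan 1.
Proof.
move=> r0; have l : t0 - r < t0 + r by lra.
have d0 (t : R) : r ^+ 2 + (t - t0) ^+ 2 != 0 by rewrite gt_eqF// ltr_wpDr ?sqr_ge0// exprn_gt0.
have cb : continuous (fun t : R => r / (r ^+ 2 + (t - t0) ^+ 2)).
 move=> t; apply: cvgM; [exact: cvg_cst|apply: cvgV; [exact: d0|]].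
 exact: sqD_cont.
have dF (t : R) : is_derive t (1 : R) (fun t => atan ((t - t0) / r)) (r / (r ^+ 2 + (t - t0) ^+ 2)).
 have d1 : is_derive t (1 : R) (fun t => (t - t0) / r) r^-1.
  by apply: is_derive_eq; rewrite /GRing.scale /=; ring.
 have := @der_comp _ (@atan R) (fun t => (t - t0) / r) t _ _ _ (is_derive1_atan ((t - t0) / r)) d1 erefl.
 move=> h; apply: (is_derive_eq h).
 have := d0 t => h2; field; rewrite !h2 gt_eqF//=.
rewrite (Rint_FTC2 l cb dF) [t0 + r]addrC addrK divff ?gt_eqF// [t0 - r]addrC addrK mulNr divff ?gt_eqF// atanN; ring.
Qed.

Definition edge s r t : R := r * qf (s ^+ 2) (r ^+ 2 + t ^+ 2).

Lemma edge_cont s r t0 : 0 < s -> continuous (fun t => edge s r (t - t0)).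
Proof.
move=> s0; have a0 : 0 < s ^+ 2 by rewrite exprn_gt0.
move=> t; apply: cvgM; first exact: cvg_cst.
apply: (@continuous_comp _ _ _ (fun t : R => r ^+ 2 + (t - t0) ^+ 2) (qf (s ^+ 2))); last exact: qf_cont.
exact: sqD_cont.
Qed.

Lemma edge_ge0 s r t : 0 < s -> 0 <= r -> 0 <= edge s r t.
Proof.
move=> s0; have a0 : 0 < s ^+ 2 by rewrite exprn_gt0.
by move=> r0; rewrite mulr_ge0// qf_ge0. Qed.

Lemma edge_int1 s r t0 : 0 < s -> s <= r -> \int[mu1]_(t in `[t0 - r, t0 + r]) edge s r (t - t0) = 2 * atan 1.
Proof.
move=> s0; have a0 : 0 < s ^+ 2 by rewrite exprn_gt0.
move=> sr; have r0 : 0 < r by exact: lt_le_trans sr.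
rewrite -(flux1 t0 r0); apply: eq_Rintegral => t _; rewrite /edge; congr (_ * _).
have h : (s ^+ 2) <= r ^+ 2 + (t - t0) ^+ 2.
 by rewrite ler_wpDr ?sqr_ge0// ler_sqr ?nnegrE// ltW.
by rewrite /qf max_l// subrr mul0r addr0.
Qed.

Lemma field_edge s c r (t : R) :
 [/\ fieldx (s ^+ 2) c (c.1 + r, t) = edge s r (t - c.2), fieldx (s ^+ 2) c (c.1 - r, t) = - edge s r (t - c.2),
  fieldy (s ^+ 2) c (t, c.2 + r) = edge s r (t - c.1) & fieldy (s ^+ 2) c (t, c.2 - r) = - edge s r (t - c.1)].
Proof.
rewrite /fieldx /fieldy /edge /radius2 /=; split.
- by congr (_ * qf _ _); ring.
- by rewrite -mulNr; congr (_ * qf _ _); ring.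
- by congr (_ * qf _ _); ring.
- by rewrite -mulNr; congr (_ * qf _ _); ring.
Qed.

Lemma mass1 s c r : 0 < s -> s <= r -> \int[mu2]_(z in sqr_at c r) source (s ^+ 2) c z = 8 * atan 1.
Proof.
move=> s0; have a0 : 0 < s ^+ 2 by rewrite exprn_gt0.
move=> sr; have r0 : 0 < r by exact: lt_le_trans sr.
have := gauss c r0 (fieldx_x c a0) (fieldy_y c a0).
have -> : \int[mu2]_(z in sqr_at c r) (fieldxx (s ^+ 2) c z + fieldyy (s ^+ 2) c z) = \int[mu2]_(z in sqr_at c r) source (s ^+ 2) c z.
 by apply: eq_Rintegral => z _; rewrite field_div.
move=> ->.
have -> : \int[mu1]_(y in `[c.2 - r, c.2 + r]) (fieldx (s ^+ 2) c (c.1 + r, y) - fieldx (s ^+ 2) c (c.1 - r, y)) =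
  2 * \int[mu1]_(y in `[c.2 - r, c.2 + r]) edge s r (y - c.2).
 rewrite -RintegralZl//; last by apply: cont_int1; by move=> t; exact: (@edge_cont s r _ s0 t).
 by apply: eq_Rintegral => t _; have [-> -> _ _] := field_edge s c r t; ring.
have -> : \int[mu1]_(y in `[c.1 - r, c.1 + r]) (fieldy (s ^+ 2) c (y, c.2 + r) - fieldy (s ^+ 2) c (y, c.2 - r)) =
  2 * \int[mu1]_(y in `[c.1 - r, c.1 + r]) edge s r (y - c.1).
 rewrite -RintegralZl//; last by apply: cont_int1; by move=> t; exact: (@edge_cont s r _ s0 t).
 by apply: eq_Rintegral => t _; have [_ _ -> ->] := field_edge s c r t; ring.
by rewrite !(edge_int1 _ s0)//; ring.
Qed.

Lemma source_supp s c z : 0 < s -> ~ sqr_at c s z -> source (s ^+ 2) c z = 0.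
Proof.
move=> s0; have a0 : 0 < s ^+ 2 by rewrite exprn_gt0.
move=> h; apply: source_out; rewrite leNgt; apply/negP => l; apply: h; apply/sqr_atP.
rewrite norm_le2 /= -!(ler_sqr (_ : _ \in Num.nneg) (_ : s \in Num.nneg)) ?nnegrE ?(ltW s0)//.
rewrite !(real_normK (num_real _)).
have h1 := sqr_ge0 (z.1 - c.1); have h2 := sqr_ge0 (z.2 - c.2).
by apply/andP; split; move: l h1 h2; rewrite /radius2 ; clear; lra.
Qed.

Lemma source_int s c (p : P -> R) (c' : P) r : 0 < s -> sqr_at c s `<=` sqr_at c' r ->
 \int[mu2]_(z in sqr_at c' r) (p z * source (s ^+ 2) c z) = \int[mu2]_(z in sqr_at c s) (p z * source (s ^+ 2) c z).
Proof.
move=> s0; have a0 : 0 < s ^+ 2 by rewrite exprn_gt0.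
move=> sub; rewrite Rintegral_mkcond [RHS]Rintegral_mkcond; apply: eq_Rintegral => z _.
rewrite !patchE; case: ifPn => [h1|h1]; case: ifPn => [h2|h2] //.
 by rewrite (source_supp s0) ?mulr0//; move: h2; rewrite notin_setE.
by move: h1; rewrite notin_setE => h1; exfalso; apply: h1; apply: sub; rewrite -in_setE.
Qed.

Lemma source_le s c (p : P -> R) (c' : P) r U : 0 < s -> sqr_at c s `<=` sqr_at c' r -> continuous p ->
 (forall z, sqr_at c s z -> p z <= U) ->
 \int[mu2]_(z in sqr_at c' r) (p z * source (s ^+ 2) c z) <= U * (8 * atan 1).
Proof.
move=> s0; have a0 : 0 < s ^+ 2 by rewrite exprn_gt0.
move=> sub cp pU; rewrite (source_int _ s0)// -(mass1 c s0 (lexx s)).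
have l1 : c.1 - s <= c.1 + s by lra. have l2 : c.2 - s <= c.2 + s by lra.
have si := (locint_cont (@source_cont (s ^+ 2) c)).
rewrite -RintegralZl//; [|exact: msqr_at|exact: si.2].
apply: le_Rintegral; [exact: msqr_at| | |].
- exact: (locintMc cp si).2.
- exact: (locintZ U si).2.
- by move=> z /pU h; rewrite ler_wpM2r// source_ge0.
Qed.

(** The divergence theorem for [p] times the field: the boundary contributes at least L times the
    flux, the source at most U times its mass, and both equal 8 atan 1. *)
Lemma flux_ge s c (p px py : P -> R) r L U : 0 < s -> grad2 p px py -> s <= r ->
 (forall z, `|z - c| = r -> L <= p z) -> (forall z, sqr_at c s z -> p z <= U) ->
 (L - U) * (8 * atan 1) <= \int[mu2]_(z in sqr_at c r) (px z * fieldx (s ^+ 2) c z + py z * fieldy (s ^+ 2) c z).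
Proof.
move=> s0; have a0 : 0 < s ^+ 2 by rewrite exprn_gt0.
move=> G sr Lp pU; have r0 : 0 < r by exact: lt_le_trans sr.
have cp := xac_cont (grad2_x G).
have l1 : c.1 - r <= c.1 + r by lra. have l2 : c.2 - r <= c.2 + r by lra.
have sub : sqr_at c s `<=` sqr_at c r by move=> z /sqr_atP h; apply/sqr_atP; exact: le_trans sr.
have hS := source_le s0 sub cp pU.
have Bs := locintMc cp (locint_cont (@source_cont (s ^+ 2) c)).
have Mx := xacM (grad2_x G) (fieldx_x c a0); have My := yacM (grad2_y G) (fieldy_y c a0).
have Bf : locint (fun z => px z * fieldx (s ^+ 2) c z + py z * fieldy (s ^+ 2) c z).
 have h1 := locintMc (xac_cont (fieldx_x c a0)) (xac_box (grad2_x G)).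
 have h2 := locintMc (xac_cont (fieldy_x c a0)) (yac_box (grad2_y G)).
 by have := locintD h1 h2; congr locint; apply/funext => z; ring.
have := gauss c r0 Mx My.
have -> : \int[mu2]_(z in sqr_at c r) (fieldx (s ^+ 2) c z * px z + p z * fieldxx (s ^+ 2) c z +
    (fieldy (s ^+ 2) c z * py z + p z * fieldyy (s ^+ 2) c z)) =
  \int[mu2]_(z in sqr_at c r) (px z * fieldx (s ^+ 2) c z + py z * fieldy (s ^+ 2) c z) +
  \int[mu2]_(z in sqr_at c r) (p z * source (s ^+ 2) c z).
 rewrite -RintegralD//; [|exact: msqr_at|exact: Bf.2|exact: Bs.2].
 by apply: eq_Rintegral => z _; rewrite -field_div//; ring.
have r0' := ltW r0.
have edg (t0 x : R) : t0 - r <= x <= t0 + r -> `|x - t0| <= r by rewrite ler_distl.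
have nr : `|r| = r by rewrite ger0_norm.
have E (q : P -> R) (e1 e2 : R -> P) (t0 : R) : continuous e1 -> continuous e2 ->
  (forall t : R, t0 - r <= t <= t0 + r -> L <= p (e1 t) /\ L <= p (e2 t)) ->
  (forall t : R, q (e1 t) = edge s r (t - t0) /\ q (e2 t) = - edge s r (t - t0)) ->
  4 * atan 1 * L <= \int[mu1]_(t in `[t0 - r, t0 + r]) (p (e1 t) * q (e1 t) - p (e2 t) * q (e2 t)).
 move=> c1 c2 Le qe; have lt : t0 - r <= t0 + r by lra.
 have ce := @edge_cont s r t0 s0.
 have h1 := edge_int lt cp c1 ce (fun t _ => edge_ge0 (t - t0) s0 r0') (fun t h => (Le t h).1).
 have h2 := edge_int lt cp c2 ce (fun t _ => edge_ge0 (t - t0) s0 r0') (fun t h => (Le t h).2).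
 have pc (e : R -> P) : continuous e -> mu1.-integrable `[t0 - r, t0 + r] (EFin \o (fun t => p (e t) * edge s r (t - t0))).
  move=> ec; apply: cont_int1 => // t; apply: cvgM; last exact: ce.
  by apply: (@continuous_comp _ _ _ e p); [exact: ec|exact: cp].
 have -> : \int[mu1]_(t in `[t0 - r, t0 + r]) (p (e1 t) * q (e1 t) - p (e2 t) * q (e2 t)) =
   \int[mu1]_(t in `[t0 - r, t0 + r]) (p (e1 t) * edge s r (t - t0) + p (e2 t) * edge s r (t - t0)).
  by apply: eq_Rintegral => t _; have [-> ->] := qe t; ring.
 rewrite RintegralD//; [|exact: pc|exact: pc].
 by move: h1 h2; rewrite !(edge_int1 _ s0)//; lra.
have fe := field_edge s c r.
have V := @E (fieldx (s ^+ 2) c) (fun y => (c.1 + r, y)) (fun y => (c.1 - r, y)) c.2 (@vline_cont _) (@vline_cont _).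
have H := @E (fieldy (s ^+ 2) c) (fun x => (x, c.2 + r)) (fun x => (x, c.2 - r)) c.1 (@hline_cont _) (@hline_cont _).
move: V => /(_ _)/wrap[t /edg h|/(_ _)/wrap[t|V]].
- split; apply: Lp; apply: norm_edge; left.
  by rewrite /= [c.1 + r]addrC addrK nr.
 by rewrite /= [c.1 - r]addrC addrK normrN nr.
- by have [] := fe t.
move: H => /(_ _)/wrap[t /edg h|/(_ _)/wrap[t|H]].
- split; apply: Lp; apply: norm_edge; right.
  by rewrite /= [c.2 + r]addrC addrK nr.
 by rewrite /= [c.2 - r]addrC addrK normrN nr.
- by have [] := fe t.
move: H V hS; rewrite /=; set I1 := Rintegral _ _ _; set I2 := Rintegral _ _ _; set I3 := Rintegral _ _ _; set I4 := Rintegral _ _ _; clear; lra.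
Qed.

(** A rational lower bound for 2 pi, from 1 / (1 + t^2) >= 1 - t^2 + t^4 / 2 on [-1, 1], integrated
    exactly. *)
Lemma flux_low : 92 / 15 <= 8 * atan 1 :> R.
Proof.
have l : (-1 < 1 :> R) by lra.
have cf : continuous (fun t : R => 1 - t ^+ 2 + t ^+ 4 / 2).
 move=> t; apply: cvgD.
  by apply: cvgB; [exact: cvg_cst|exact: exprn_continuous].
 by apply: cvgM; [exact: exprn_continuous|exact: cvg_cst].
have dF (t : R) : is_derive t (1 : R) (fun t => t - t ^+ 3 / 3 + t ^+ 5 / 10) (1 - t ^+ 2 + t ^+ 4 / 2).
 by apply: is_derive_eq; rewrite /GRing.scale /=; field.
have h1 := Rint_FTC2 l cf dF.
have h2 := flux1 0 (@ltr01 R); rewrite sub0r add0r in h2.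
have le : \int[mu1]_(x in `[-1, 1]) (1 - x ^+ 2 + x ^+ 4 / 2) <= \int[mu1]_(t in `[-1, 1]) (1 / (1 ^+ 2 + (t - 0) ^+ 2)).
 apply: le_Rintegral => //.
 - exact: cont_int1.
 - apply: cont_int1 => // t; apply: cvgM; [exact: cvg_cst|apply: cvgV; first by rewrite gt_eqF// ltr_wpDr ?sqr_ge0// expr1n].
  exact: sqD_cont.
 - move=> t; rewrite /= in_itv /= => /andP[t1 t2].
  rewrite subr0 expr1n ler_pdivlMr ?ltr_wpDr ?sqr_ge0//.
  have t21 : t ^+ 2 <= 1 by rewrite -(expr1n R 2) -real_normK ?num_real// ler_sqr ?nnegrE// ler_norml t1.
  have := sqr_ge0 t; have -> : t ^+ 4 = t ^+ 2 * t ^+ 2 by ring.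
  by move: t21; set y := t ^+ 2; clear; nra.
by move: le; rewrite h1 h2; lra.
Qed.

Lemma radius2_le c z r : `|z - c| <= r -> radius2 c z <= 2 * r ^+ 2.
Proof.
move=> zr; have r0 : 0 <= r by exact: le_trans zr.
have h (x : R) : `|x| <= `|z - c| -> x ^+ 2 <= r ^+ 2.
 by move=> xz; rewrite -(real_normK (num_real x)) ler_sqr ?nnegrE// (le_trans xz).
by rewrite /radius2 mulr_natl mulr2n lerD// h//; [exact: (norm1_le (z - c))|exact: (norm2_le (z - c))].
Qed.

(** Instead of polar coordinates, [flux_ge] is applied to an explicit radial potential; minus its
    gradient, paired with the field, dominates the squared length of the field. *)
Lemma field_energy s c r : 0 < s -> s <= r ->
 \int[mu2]_(z in sqr_at c r) (fieldx (s ^+ 2) c z ^+ 2 + fieldy (s ^+ 2) c z ^+ 2) <=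
 (ln (r / s) + 9) * (8 * atan 1).
Proof.
move=> s0 sr; have r0 : 0 < r by exact: lt_le_trans sr.
set a := s ^+ 2; have a0 : 0 < a by rewrite exprn_gt0.
have aa0 : 0 < a ^+ 2 by rewrite exprn_gt0.
have d0 (t : R) : a ^+ 2 + t ^+ 2 != 0 by rewrite gt_eqF// ltr_wpDr ?sqr_ge0.
(* The arctangent supplies the slope near the centre, where [lnq'] vanishes while [qf] takes the
   value 2 / a. *)
pose p t := - (lnq (a ^+ 2) t + atan (t / a)).
pose p' t := - (lnq' (a ^+ 2) t + a / (a ^+ 2 + t ^+ 2)).
have dp (t : R) : is_derive t (1 : R) p (p' t).
 have dl := @lnq_der R _ aa0 t.
 have d1 : is_derive t (1 : R) (fun t => t / a) a^-1.
  by apply: is_derive_eq; rewrite /GRing.scale /=; ring.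
 have da := @der_comp _ (@atan R) (fun t => t / a) t _ _ _ (is_derive1_atan (t / a)) d1 erefl.
 apply: (is_derive_eq (is_deriveN (is_deriveD dl da))).
 by rewrite /p'; congr (- (_ + _)); have := d0 t => h; field; rewrite h gt_eqF//=.
have cp : continuous p'.
 move=> t; apply: cvgN; apply: cvgD; first exact: lnq'_cont.
 apply: cvgM; first exact: cvg_cst.
 apply: cvgV; first exact: d0.
 by apply: cvgD; [exact: cvg_cst|exact: exprn_continuous].
have G := grad2_comp cp dp (grad2_radius c).
have at2 (x : R) : `|atan x| <= 2.
 rewrite ler_norml; have := atan_gtNpi2 x; have := atan_ltpi2 x; have := @pihalf_lt2 R.
 by move=> h1 h2 h3; apply/andP; split; move: h1 h2 h3; clear; lra.
have lns : ln (a ^+ 2) = 4 * ln s.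
 by rewrite /a -exprM lnXn//; ring.
have key (t : R) : 0 <= t -> t * qf a t ^+ 2 <= - (p' t * 2 * t * qf a t).
 move=> t0; have q0 : 0 <= qf a t by apply: qf_ge0.
 have -> : - (p' t * 2 * t * qf a t) = t * qf a t * ((t + 2 * a) / (a ^+ 2 + t ^+ 2)).
  by rewrite /p' /lnq'; have := d0 t => h; field; rewrite h.
 rewrite expr2 mulrA ler_wpM2l// ?mulr_ge0// ler_pdivlMr ?ltr_wpDr ?sqr_ge0//.
 rewrite /qf; case: (leP t a) => h.
  have -> : (a^-1 + (a - t) / a ^+ 2) * (a ^+ 2 + t ^+ 2) = (2 * a - t) * (1 + (t / a) ^+ 2) by field; exact: lt0r_neq0.
  set x := t / a; have -> : t = x * a by rewrite /x divfK ?gt_eqF.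
  have x0 : 0 <= x by rewrite divr_ge0// ltW.
  have x1 : x <= 1 by rewrite ler_pdivrMr// mul1r.
  have -> : (2 * a - x * a) * (1 + x ^+ 2) = a * ((2 - x) * (1 + x ^+ 2)) by ring.
  have -> : x * a + 2 * a = a * (x + 2) by ring.
  rewrite ler_wpM2l ?(ltW a0)//.
  by move: x0 x1; clear => x0 x1; have := mulr_ge0 x0 (mulr_ge0 (_ : 0 <= 1 - x) (_ : 0 <= 1 - x)); nra.
 have t1 : 0 < t by exact: lt_trans h.
 have -> : (t^-1 + (t - t) / a ^+ 2) * (a ^+ 2 + t ^+ 2) = t + a * (a / t).
  by field; rewrite !lt0r_neq0.
 rewrite lerD2l [2 * a]mulrC ler_wpM2l ?(ltW a0)// ler_pdivrMr//; move: h a0; clear; lra.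
have B1 := locint_cont (xac_cont (fieldx_x c a0)).
have cX := xac_cont (fieldx_x c a0); have cY := xac_cont (fieldy_x c a0).
have := @flux_ge s c _ _ _ r (- (ln r + 3)) (- ln s + 2) s0 G sr.
case/(_ _)/wrap => [z zr|].
 have T2 : radius2 c z <= 2 * r ^+ 2.
  by apply: radius2_le; rewrite zr.
 have T0 := radius2_ge0 c z.
 have ar : a <= r ^+ 2 by rewrite ler_sqr ?nnegrE// ltW.
 have : lnq (a ^+ 2) (radius2 c z) <= ln r + 1.
  have e5 : 0 < 5 * r ^+ 4 by rewrite mulr_gt0// exprn_gt0.
  have h1 : ln (a ^+ 2 + radius2 c z ^+ 2) <= ln (5 * r ^+ 4).
   apply: le_lnW; first by rewrite ltr_wpDr ?sqr_ge0.
   have hh : a ^+ 2 <= (r ^+ 2) ^+ 2 by rewrite ler_sqr ?nnegrE ?sqr_ge0.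
   have hh2 : radius2 c z ^+ 2 <= (2 * r ^+ 2) ^+ 2 by rewrite ler_sqr ?nnegrE//; exact: le_trans T2.
   by move: hh hh2; clear; lra.
  have h2 : ln (5 * r ^+ 4) = ln 5 + 4 * ln r.
   by rewrite lnM ?posrE ?exprn_gt0// lnXn//; ring.
  have h3 : ln (5 : R) <= 4.
   rewrite -[leRHS]expRK; apply: le_lnW => //; have := @expR_ge1Dx R 4; clear; lra.
  by rewrite /lnq; move: h1 h2 h3; clear; lra.
 by have := at2 (radius2 c z / a); rewrite ler_norml /p => /andP[_]; clear; lra.
case/(_ _)/wrap => [z zs|].
 have : ln s <= lnq (a ^+ 2) (radius2 c z).
  rewrite /lnq; have : ln (a ^+ 2) <= ln (a ^+ 2 + radius2 c z ^+ 2) by apply: le_lnW => //; rewrite lerDl sqr_ge0.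
  by rewrite lns; clear; lra.
 by have := at2 (radius2 c z / a); rewrite ler_norml /p => /andP[+ _]; clear; lra.
rewrite lnM ?posrE ?invr_gt0// lnV ?posrE// => h.
have a10 : 0 <= 8 * atan 1 :> R by apply: le_trans flux_low; lra.
have cq : continuous (fun z => p' (radius2 c z)).
 have cr := xac_cont (grad2_x (grad2_radius c)).
 by move=> z; apply: (@continuous_comp _ _ _ (radius2 c) p'); [exact: cr|exact: cp].
have le : \int[mu2]_(z in sqr_at c r) (fieldx a c z ^+ 2 + fieldy a c z ^+ 2) <=
  \int[mu2]_(z in sqr_at c r) (- 1 * (p' (radius2 c z) * (2 * (z.1 - c.1)) * fieldx a c z + p' (radius2 c z) * (2 * (z.2 - c.2)) * fieldy a c z)).
 apply: le_Rintegral; first exact: msqr_at.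
 - have : locint (fun z => fieldx a c z ^+ 2 + fieldy a c z ^+ 2).
   by apply: locint_cont => z; apply: cvgD; rewrite expr2; apply: cvgM; (exact: cX || exact: cY).
  by move=> b; apply: b.2; lra.
 - have b : locint (fun z => -1 * (p' (radius2 c z) * (2 * (z.1 - c.1)) * fieldx a c z + p' (radius2 c z) * (2 * (z.2 - c.2)) * fieldy a c z)).
   apply: locint_cont => z; apply: cvgM; first exact: cvg_cst.
   apply: cvgD; apply: cvgM; [|exact: cX| |exact: cY]; (apply: cvgM; [exact: cq|apply: cvgM; first exact: cvg_cst]).
    by apply: cvgB; [exact: cvg_fst|exact: cvg_cst].
   by apply: cvgB; [exact: cvg_snd|exact: cvg_cst].
  by apply: b.2; lra.
 move=> z _; rewrite field_norm; apply: (le_trans (key _ (radius2_ge0 c z))).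
 by apply: le_of_eq; rewrite /fieldx /fieldy {2}/radius2; ring.
apply: (le_trans le).
have bi : locint (fun z => p' (radius2 c z) * (2 * (z.1 - c.1)) * fieldx a c z + p' (radius2 c z) * (2 * (z.2 - c.2)) * fieldy a c z).
 apply: locint_cont => z.
 apply: cvgD; apply: cvgM; [|exact: cX| |exact: cY]; (apply: cvgM; [exact: cq|apply: cvgM; first exact: cvg_cst]).
  by apply: cvgB; [exact: cvg_fst|exact: cvg_cst].
 by apply: cvgB; [exact: cvg_snd|exact: cvg_cst].
rewrite RintegralZl; [|exact: msqr_at|by apply: bi.2; move: r0; clear; lra].
move: h a10; rewrite -/a; set I := Rintegral _ _ _; set F := 8 * _; set x := ln r; set y := ln s; clear; nra.
Qed.

(** Weights that telescope: from index n on they add up to the inverse square of q^(n-1) m, which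
    gives a step majorant of 1 / |f - w|^2 whose loss tends to 1 with q. The dyadic shells of
    [potential_shell] would be too wasteful for the growth exponent. *)
Definition shell_weight (q m : R) (N i : nat) : R :=
 (q ^+ 2 - 1) / (q ^+ i * m) ^+ 2 + (if i == N then ((q ^+ N * m) ^+ 2)^-1 else 0).

Lemma shell_weight_ge0 q m N i : 1 <= q -> 0 <= shell_weight q m N i.
Proof.
move=> q1; have q2 : 0 <= q ^+ 2 - 1 by rewrite subr_ge0 exprn_ege1.
by rewrite addr_ge0 ?divr_ge0 ?sqr_ge0//; case: ifP => // _; rewrite invr_ge0 sqr_ge0.
Qed.

Lemma shell_telescope q m N n : 1 < q -> 0 < m -> (n <= N)%N ->
 \sum_(i < N.+1) (if (n <= i)%N then shell_weight q m N i else 0) = (q / (q ^+ n * m)) ^+ 2.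
Proof.
move=> q1 m0; have q0 : 0 < q by exact: lt_trans q1.
have qn i : q ^+ i * m != 0 by rewrite mulf_neq0 ?expf_neq0 ?gt_eqF.
move=> nN; rewrite -(subKn nN); move: (N - n)%N (leq_subr n N) => j; elim: j => [|j IH] jN.
 rewrite subn0 (bigD1 ord_max)//= leqnn big1 ?addr0; last first.
  move=> i iN; rewrite ifF//; apply/negbTE; rewrite -ltnNge ltn_neqAle -ltnS ltn_ord andbT.
  by apply: contra iN => /eqP e; apply/eqP/val_inj.
 by rewrite /shell_weight eqxx; move: (qn N); set A := q ^+ N * m => A0; field.
have lt : (N - j.+1 < N.+1)%N by rewrite ltnS leq_subr.
have e : (N - j = (N - j.+1).+1)%N by rewrite subnSK.
rewrite (bigD1 (Ordinal lt))//= leqnn.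
have -> : \sum_(i < N.+1 | i != Ordinal lt) (if (N - j.+1 <= i)%N then shell_weight q m N i else 0) =
  \sum_(i < N.+1) (if (N - j <= i)%N then shell_weight q m N i else 0).
 rewrite [RHS](bigD1 (Ordinal lt))//= e ltnn add0r; apply: eq_bigr => i iN.
 rewrite [in RHS]ltn_neqAle (_ : (N - j.+1 != i)%N = true)//.
 by apply: contra iN => /eqP h; apply/eqP/val_inj; rewrite /= h.
rewrite IH ?(ltnW jN)// e; set k := (N - j.+1)%N.
rewrite /shell_weight ifF ?addr0; last by apply/negbTE; rewrite neq_ltn /k -subSS subSS; apply/orP; left; lia.
rewrite [q ^+ k.+1]exprS; have := qn k; set K := q ^+ k; rewrite mulf_eq0 negb_or => /andP[h1 h2].
by field; rewrite h1 h2 gt_eqF.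
Qed.

(** Every shell contributes the same amount, so the energy is linear in the number of shells, that
    is in the logarithm of the ratio of image sizes. *)
Lemma shell_sum q m N : 1 < q -> 0 < m ->
 \sum_(i < N.+1) 6 * shell_weight q m N i * (q ^+ i * m) ^+ 2 = 6 * (N.+1%:R * (q ^+ 2 - 1) + 1).
Proof.
move=> q1 m0; have q0 : 0 < q by exact: lt_trans q1.
have qn i : q ^+ i * m != 0 by rewrite mulf_neq0 ?expf_neq0 ?gt_eqF.
rewrite (eq_bigr (fun i : 'I_N.+1 => 6 * (q ^+ 2 - 1) + (if i == ord_max then 6 else 0))); last first.
 move=> i _; rewrite /shell_weight -val_eqE /=; case: eqP => [->|_]; [move: (qn N)|move: (qn i)]; set A := _ * m => A0; by field.
rewrite big_split /= sumr_const card_ord (bigD1 ord_max)//= eqxx big1 ?addr0; last by move=> i /negbTE ->.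
by rewrite -mulr_natl; ring.
Qed.

(** For d tending to 0 the left side tends to 12, and 12 / (92/15) is below 199/100. This margin is
    what keeps the growth exponent below 2. *)
Lemma exists_shell_ratio : exists2 d : R, 0 < d <= 1 &
 6 * (1 + d) * (2 + d) * (1 + 2 * d) <= 199 / 100 * (92 / 15).
Proof. exists (1 / 256); lra. Qed.

(** Cauchy-Schwarz between [flux_ge] and [field_energy]: a lower bound for the capacity of a ring
    with leading constant 2 pi, which [annulus_osc] is too crude to give. *)
Lemma flux_cauchy s c (p px py : P -> R) r L U : 0 < s -> grad2 p px py -> s <= r ->
 (forall z, `|z - c| = r -> L <= p z) -> (forall z, sqr_at c s z -> p z <= U) -> 0 < L - U ->
 (L - U) ^+ 2 * (8 * atan 1) <= (ln (r / s) + 9) * energy px py (sqr_at c r).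
Proof.
move=> s0 G sr pL pU W0; have r0 : 0 < r by exact: lt_le_trans sr.
have h1 := flux_ge s0 G sr pL pU; have h2 := field_energy c s0 sr.
have F0 : 0 < 8 * atan 1 :> R by apply: lt_le_trans flux_low; lra.
have l0 : 0 < ln (r / s) + 9.
 by rewrite ltr_wpDl// ln_ge0// ler_pdivlMr// mul1r.
move: F0 h1 h2 l0; set F := 8 * _; set l := ln _ + 9; set W := L - U => F0 h1 h2 l0.
have a0 : 0 < s ^+ 2 by rewrite exprn_gt0.
pose la := l / W; have la0 : 0 < la by rewrite divr_gt0.
have gb := energy_locint G.
have cX := xac_cont (fieldx_x c a0); have cY := xac_cont (fieldy_x c a0).
have fb : locint (fun z => fieldx (s ^+ 2) c z ^+ 2 + fieldy (s ^+ 2) c z ^+ 2).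
 by apply: locint_cont => z; apply: cvgD; rewrite expr2; apply: cvgM; (exact: cX || exact: cY).
have Bf : locint (fun z => px z * fieldx (s ^+ 2) c z + py z * fieldy (s ^+ 2) c z).
 have b1 := locintMc cX (xac_box (grad2_x G)).
 have b2 := locintMc cY (yac_box (grad2_y G)).
 by have := locintD b1 b2; congr locint; apply/funext => z; ring.
have l1 : c.1 - r <= c.1 + r by lra. have l2 : c.2 - r <= c.2 + r by lra.
have mQ : measurable (sqr_at c r) by exact: msqr_at.
have g1 := locintZ (la / 2) gb; have g2 := locintZ (la^-1 / 2) fb.
have := @le_Rintegral _ _ _ mu2 (sqr_at c r) _ _ mQ (Bf.2 _ _ _ _ l1 l2) ((locintD g1 g2).2 _ _ _ _ l1 l2).
case/(_ _)/wrap => [z _|].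
 have am (u v : R) : u * v <= la / 2 * u ^+ 2 + la^-1 / 2 * v ^+ 2.
  rewrite -subr_ge0; have -> : la / 2 * u ^+ 2 + la^-1 / 2 * v ^+ 2 - u * v = la^-1 / 2 * (la * u - v) ^+ 2.
   by field; rewrite gt_eqF.
  by rewrite mulr_ge0 ?sqr_ge0// divr_ge0 ?invr_ge0// ltW.
 have := am (px z) (fieldx (s ^+ 2) c z); have := am (py z) (fieldy (s ^+ 2) c z).
 by set u := fieldx _ _ _; set v := fieldy _ _ _; set A := la / 2; set B := la^-1 / 2; clear; lra.
rewrite RintegralD//; [|exact: g1.2|exact: g2.2].
rewrite RintegralZl//; last exact: gb.2.
rewrite RintegralZl//; last exact: fb.2.
move=> h3; rewrite -/(energy px py (sqr_at c r)) in h3.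
have := le_trans h1 h3; move: h2; set E := energy _ _ _; set B := Rintegral _ _ _ => h2 h4.
have h5 : la^-1 / 2 * B <= W * F / 2.
 apply: (@le_trans _ _ (la^-1 / 2 * (l * F))); first by rewrite ler_wpM2l// divr_ge0// invr_ge0 ltW.
 by apply: le_of_eq; rewrite /la; field; rewrite !gt_eqF.
have h6 : W * F <= la * E by move: h4 h5; clear; lra.
have := ler_wpM2l (ltW W0) h6.
by rewrite (_ : W * (la * E) = l * E) 1?(_ : W ^+ 2 * F = W * (W * F)) //; [ring|rewrite /la; field; rewrite gt_eqF].
Qed.

(** Let n be the first shell that contains y. The weights from n on sum to (q / (q^n m))^2, and
    q^(n-1) m <= y unless n = 0, where the cutoff at m takes over. *)
Lemma shells_cover (q m y : R) N : 1 < q -> 0 < m -> 0 <= y -> forall F : R, y ^+ 2 <= F <= 2 * y ^+ 2 ->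
 y < q ^+ N * m ->
 4 * lnq' (m ^+ 4) F ^+ 2 * F <= \sum_(i < N.+1) (if y < q ^+ i * m then shell_weight q m N i else 0).
Proof.
move=> q1 m0 y0 F /andP[F1 F2] yN; have q0 : 0 < q by exact: lt_trans q1.
have F0 : 0 <= F by apply: le_trans F1; exact: sqr_ge0.
have qe : exists i, y < q ^+ i * m by exists N.
have qN : (ex_minn qe <= N)%N by case: ex_minnP => i _; apply.
have [iy imin] : y < q ^+ (ex_minn qe) * m /\ forall j, y < q ^+ j * m -> (ex_minn qe <= j)%N by case: ex_minnP.
move: (ex_minn qe) qN iy imin => n qN iy imin.
have -> : \sum_(i < N.+1) (if y < q ^+ i * m then shell_weight q m N i else 0) =
  \sum_(i < N.+1) (if (n <= i)%N then shell_weight q m N i else 0).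
 apply: eq_bigr => i _; congr (if _ then _ else _); apply/idP/idP => [/imin//|ni].
 by apply: (lt_le_trans iy); rewrite ler_pM2r// ler_weXn2l// ltW.
rewrite (shell_telescope q1 m0 qN) /lnq'.
have m4 : 0 < m ^+ 4 by rewrite exprn_gt0.
have dn : 0 < m ^+ 4 + F ^+ 2 by rewrite ltr_wpDr ?sqr_ge0.
have -> : 4 * (F / (2 * (m ^+ 4 + F ^+ 2))) ^+ 2 * F = F ^+ 3 / (m ^+ 4 + F ^+ 2) ^+ 2.
 by field; rewrite gt_eqF.
rewrite ler_pdivrMr ?exprn_gt0//.
case: n iy imin {qN} => [|n] iy imin.
 rewrite expr0 mul1r in iy.
 have Fm : F <= 2 * m ^+ 2 by apply: (le_trans F2); rewrite ler_pM2l// ler_sqr ?nnegrE// ltW.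
 have m2 : 0 < m ^+ 2 by rewrite exprn_gt0.
 have q2 : 1 <= q ^+ 2 by rewrite exprn_ege1// ltW.
 rewrite expr0 mul1r expr_div_n mulrAC ler_pdivlMr//.
 have e4 : m ^+ 4 = m ^+ 2 * m ^+ 2 by ring.
 apply: (@le_trans _ _ (1 * (m ^+ 4 + F ^+ 2) ^+ 2)); last by rewrite ler_wpM2r// sqr_ge0.
 rewrite mul1r e4; move: Fm F0 (ltW m2); clear; set M := m ^+ 2 => Fm F0 M0.
 have h1 : F ^+ 3 * M <= 2 * M * (F ^+ 2 * M).
  rewrite (_ : F ^+ 3 * M = F * (F ^+ 2 * M)); last by ring.
  by rewrite ler_wpM2r// mulr_ge0// sqr_ge0.
 have h2 := sqr_ge0 (F ^+ 2); have h3 := sqr_ge0 (M * M).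
 by apply: (le_trans h1); move: h2 h3; clear; lra.
have yn : q ^+ n * m <= y.
 by rewrite leNgt; apply/negP => /imin; rewrite ltnn.
have Qm : 0 < q ^+ n * m by rewrite mulr_gt0// exprn_gt0.
have FQ : (q ^+ n * m) ^+ 2 <= F by apply: le_trans F1; rewrite ler_sqr ?nnegrE// ltW.
have -> : (q / (q ^+ n.+1 * m)) ^+ 2 = ((q ^+ n * m) ^+ 2)^-1.
 rewrite [q ^+ n.+1]exprS; move: Qm => /lt0r_neq0; set K := q ^+ n; rewrite mulf_eq0 negb_or => /andP[g1 g2].
 by field; rewrite g1 g2 gt_eqF.
rewrite mulrC ler_pdivlMr ?exprn_gt0//.
apply: (@le_trans _ _ (F ^+ 3 * F)); first by rewrite ler_wpM2l// exprn_ge0.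
have -> : F ^+ 3 * F = (F ^+ 2) ^+ 2 by ring.
by rewrite ler_sqr ?nnegrE ?sqr_ge0 ?(ltW dn)// lerDr ltW.
Qed.

(** Let W be, up to constants, the logarithm of the ratio of image sizes, and l that of the ratio of
    source sizes. [flux_cauchy] and [log_energy] give W^2 <= l (1.99 W + D), whence W <= 1.99 l +
    D. *)
Lemma growth : exists2 k0 : R, 0 < k0 & exists2 C : R, 1 <= C & exists2 be : R, 1 <= be < 4 &
 forall k f g ux uy vx vy (x z c : P) (n : nat),
 qcpos k f g ux uy vx vy -> 0 <= k <= k0 -> `|x - c| <= 2 ^+ n * `|z - c| ->
 `|f x - f c| <= C * be ^+ n * `|f z - f c|.
Proof.
have [k1 k10 HE] := @log_energy R; have [k2 k20 [C C1 HC]] := @weak_quasisymmetry R.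
have [d /andP[d0 d1] hd] := exists_shell_ratio.
pose k3 := Num.min 1 (d / (1 + d^-1)).
have di0 : 0 < 1 + d^-1 by rewrite addr_gt0// invr_gt0.
exists (Num.min k3 (Num.min k1 k2)); first by rewrite !lt_min k10 k20 ltr01 divr_gt0.
have C0 : 0 < C by apply: lt_le_trans C1.
have lC0 : 0 <= ln C by rewrite ln_ge0.
(* The constant left over when [xx + ln C] is written as W + 3 ln C + 1; 126 bounds the share of the
   two extra shells and of the closing weight. *)
pose D := 199 / 100 * (3 * ln C + 1) + 126.
have D0 : 0 <= D by rewrite /D; move: lC0; clear; lra.
exists (C * expR (199 / 100 * 9 + D + 2 * ln C + 1)).
 rewrite -[leLHS]mulr1; apply: ler_pM => //.
 by rewrite -[leLHS]expR0 ler_expR; move: D0 lC0; clear; lra.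
(* 2^(199/100) < 4: this is the exponent below 2. *)
exists (expR (199 / 100 * ln 2)).
 have l2 : 0 < ln (2 : R) by rewrite ln_gt0// ltr1n.
 apply/andP; split; first by rewrite -[leLHS]expR0 ler_expR; move: l2; clear; lra.
 have -> : (4 : R) = expR (2 * ln 2) by rewrite mulr_natl mulr2n expRD lnK ?posrE//; lra.
 by rewrite ltr_expR; move: l2; clear; lra.
move=> k f g ux uy vx vy x z c n QP /andP[kk0]; rewrite !le_min => /andP[/andP[kl1 kl2] /andP[kk1 kk2]] xz.
have Q := qp_map QP; have fK := qc_fK Q.
have k01 : 0 <= k <= k1 by rewrite kk0. have k02 : 0 <= k <= k2 by rewrite kk0.
have kd : (1 + d^-1) * k ^+ 2 <= d.
 rewrite mulrC -ler_pdivlMr//; apply: le_trans kl2.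
 by rewrite expr2 ler_piMl.
have cd (p q : P) : `|p - c| <= `|q - c| -> `|f p - f c| <= C * `|f q - f c|.
 exact: (HC _ _ _ _ _ _ _ p c q QP k02).
set be := expR (199 / 100 * ln 2); set A := expR (_ + 1).
have [zc|zc] := eqVneq z c.
 move: xz; rewrite zc !subrr !normr0 !mulr0 normr_le0 subr_eq0 => /eqP ->.
 by rewrite subrr normr0.
have s0 : 0 < `|z - c| by rewrite normr_gt0 subr_eq0.
set s := `|z - c| in s0 xz; pose r := 2 ^+ n * s.
have sr : s <= r by rewrite ler_peMl ?(ltW s0)// exprn_ege1// ler1n.
have r0 : 0 < r by exact: lt_le_trans sr.
pose y : P := (c.1 + r, c.2).
have yr : `|y - c| = r := norm_right_point c r0.
have fpos (p : P) : 0 < `|p - c| -> 0 < `|f p - f c|.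
 by rewrite !normr_gt0 !subr_eq0; apply: contra => /eqP/(can_inj fK) ->.
set m := `|f z - f c|; have m0 : 0 < m by exact: fpos.
set M := `|f y - f c|; have M0 : 0 < M by apply: fpos; rewrite yr.
suff MA : M <= A * be ^+ n * m.
 have h1 : `|f x - f c| <= C * M by apply: cd; rewrite yr.
 apply: (le_trans h1); rewrite -!mulrA ler_pM2l// mulrA; exact: MA.
have A1 : 1 <= A by rewrite -[leLHS]expR0 ler_expR; move: D0 lC0; clear; lra.
have be1 : 1 <= be ^+ n.
 by rewrite exprn_ege1// -[leLHS]expR0 ler_expR mulr_ge0 ?divr_ge0 ?ln_ge0 ?ler0n ?ler1n.
have CM0 : 0 < C * M by rewrite mulr_gt0.
have q1 : 1 < 1 + d by rewrite ltrDl.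
have q0 : 0 < 1 + d by exact: lt_trans q1.
have qe : exists i, C * M < (1 + d) ^+ i * m.
 have h0 : 0 <= C * M / m / d by rewrite !divr_ge0// ltW.
 exists (Num.bound (C * M / m / d)); have := archi_boundP h0.
 rewrite ltr_pdivrMr// ltr_pdivrMr// => h; apply: (lt_le_trans h); rewrite ler_pM2r//.
 have b (i : nat) : i%:R * d <= (1 + d) ^+ i - 1.
  elim: i => [|i IH]; first by rewrite mul0r expr0 subrr.
  rewrite exprS -natr1; have : 1 <= (1 + d) ^+ i by rewrite exprn_ege1// ltW.
  by move: IH d0; set u := (1 + d) ^+ i; clear; nra.
 by apply: (le_trans (b _)); rewrite gerBl.
have [iy imin] : C * M < (1 + d) ^+ (ex_minn qe) * m /\ forall j, C * M < (1 + d) ^+ j * m -> (ex_minn qe <= j)%N by case: ex_minnP.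
move: (ex_minn qe) iy imin => N iy imin.
case: N iy imin => [|N] iy imin.
 rewrite expr0 mul1r in iy; apply: (@le_trans _ _ m).
  by apply: le_trans (ltW iy); rewrite ler_peMl// ltW.
 by rewrite ler_peMl ?(ltW m0)//; have := ler_pM ler01 ler01 A1 be1; rewrite mul1r.
have {imin} Nlow : (1 + d) ^+ N * m <= C * M.
 by rewrite leNgt; apply/negP => /imin; rewrite ltnn.
set xx := ln M - ln m.
have NL : N%:R * (d / (1 + d)) <= ln C + xx.
 have : ln ((1 + d) ^+ N * m) <= ln (C * M) by apply: le_lnW => //; rewrite mulr_gt0// exprn_gt0.
 rewrite !lnM ?posrE ?exprn_gt0// lnXn// -mulr_natl.
 have := ln_ge q0; rewrite (_ : 1 - (1 + d)^-1 = d / (1 + d)); last by field; rewrite gt_eqF.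
 move=> h h2; have := ler_wpM2l (ler0n R N) h; rewrite /xx; move: h2; clear; lra.
pose t i := (1 + d) ^+ i * m.
have t0 i : 0 < t i by rewrite mulr_gt0// exprn_gt0.
have sw0 i : 0 <= shell_weight (1 + d) m N.+1 i by apply: shell_weight_ge0; exact: ltW.
have m4 : 0 < m ^+ 4 by rewrite exprn_gt0.
have pw w : sqr_at c r w -> 4 * lnq' (m ^+ 4) (sqdist f (f c) w) ^+ 2 * sqdist f (f c) w <=
  \sum_(i < N.+2) (if `|f w - f c| < t i then shell_weight (1 + d) m N.+1 i else 0).
 move=> /sqr_atP wr; apply: shells_cover => //; first exact: sqdist_bounds.
 by apply: le_lt_trans iy; apply: cd; rewrite yr.
have En := HE k f g ux uy vx vy (f c) c d r (lnq (m ^+ 4)) (lnq' (m ^+ 4)) N.+2 (shell_weight (1 + d) m N.+1) t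
 QP k01 d0 kd r0 (lnq'_cont m4) (lnq_der m4) sw0 t0 pw.
rewrite shell_sum// in En.
have G := grad2_comp (lnq'_cont m4) (lnq_der m4) (grad2_sqdist (f c) Q).
have lm4 (u : R) : 0 < u -> ln (u ^+ 4) = 4 * ln u by move=> u0; rewrite lnXn// mulr_natl.
have [W0|W0] := leP (xx - 2 * ln C - 1) 0.
 have : M = m * expR xx.
  by rewrite /xx expRD expRN !lnK ?posrE//; field; rewrite gt_eqF.
 move=> ->; rewrite [m * _]mulrC ler_pM2r//.
 apply: (@le_trans _ _ (A * 1)); last by rewrite ler_wpM2l// ltW// expR_gt0.
 by rewrite mulr1 ler_expR; move: W0 D0; clear; lra.
have := @flux_cauchy s c _ _ _ r (ln M - ln C) (1 + ln C + ln m) s0 G sr.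
case/(_ _)/wrap => [p pr|].
 have hp : M / C <= `|f p - f c| by rewrite ler_pdivrMr// mulrC; apply: cd; rewrite yr pr.
 have MC : 0 < M / C by rewrite divr_gt0.
 have /andP[F1 _] := sqdist_bounds f (f c) p.
 have h1 : (M / C) ^+ 2 <= sqdist f (f c) p by apply: le_trans F1; rewrite ler_sqr ?nnegrE// ltW.
 have h2 : (M / C) ^+ 4 <= m ^+ 4 + sqdist f (f c) p ^+ 2.
  apply: (@le_trans _ _ (sqdist f (f c) p ^+ 2)); last by rewrite lerDr ltW.
  rewrite (_ : _ ^+ 4 = ((M / C) ^+ 2) ^+ 2); last by rewrite -exprM.
  by rewrite ler_sqr ?nnegrE ?sqr_ge0// (le_trans (sqr_ge0 _) h1).
 have := le_lnW (exprn_gt0 4 MC) h2; rewrite lm4// lnM ?posrE ?invr_gt0// lnV ?posrE// /lnq; clear; lra.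
case/(_ _)/wrap => [p /sqr_atP ps|].
 have hp : `|f p - f c| <= C * m by exact: cd.
 have /andP[_ F2] := sqdist_bounds f (f c) p.
 have S0 : 0 <= sqdist f (f c) p by rewrite addr_ge0 ?sqr_ge0.
 have h1 : sqdist f (f c) p <= 2 * (C * m) ^+ 2.
  by apply: (le_trans F2); rewrite ler_pM2l// ler_sqr ?nnegrE// ?mulr_ge0// ltW.
 have h2 : m ^+ 4 + sqdist f (f c) p ^+ 2 <= 5 * (C * m) ^+ 4.
  have : sqdist f (f c) p ^+ 2 <= (2 * (C * m) ^+ 2) ^+ 2.
   by rewrite ler_sqr ?nnegrE//; exact: le_trans h1.
  have : m ^+ 4 <= (C * m) ^+ 4 by rewrite exprMn ler_peMl ?(ltW m4)// exprn_ege1.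
  by set u := C * m; clear; lra.
 have p0 : 0 < m ^+ 4 + sqdist f (f c) p ^+ 2 by rewrite ltr_wpDr ?sqr_ge0.
 have Cm : 0 < C * m by rewrite mulr_gt0.
 have := le_lnW p0 h2; rewrite lnM ?posrE ?exprn_gt0// lm4// lnM ?posrE// /lnq.
 have : ln (5 : R) <= 4.
  rewrite -[leRHS]expRK; apply: le_lnW => //; have := @expR_ge1Dx R 4; clear; lra.
 by clear; lra.
case/(_ _)/wrap => [|]; first by move: W0; rewrite /xx; clear; lra.
have -> : ln M - ln C - (1 + ln C + ln m) = xx - 2 * ln C - 1 by rewrite /xx; ring.
have -> : r / s = 2 ^+ n by rewrite /r mulfK// gt_eqF.
rewrite lnXn//; move: W0; set W := xx - 2 * ln C - 1 => W0.
have F0 := flux_low; move: F0 En; set F := 8 * _; set E := energy _ _ _ => F0 En.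
set l := ln 2 *+ n + 9 => h.
have l9 : 9 <= l by rewrite lerDr mulrn_wge0// ln_ge0// ler1n.
have EF : E <= (199 / 100 * (xx + ln C) + 126) * F.
 have e1 : N%:R * (d * (2 + d)) <= (1 + d) * (2 + d) * (ln C + xx).
  have := ler_wpM2l (_ : 0 <= (1 + d) * (2 + d)) NL; rewrite (_ : (1 + d) * (2 + d) * (N%:R * (d / (1 + d))) = N%:R * (d * (2 + d))); last by field; rewrite gt_eqF.
  by apply; rewrite mulr_ge0// ?addr_ge0 ?(ltW d0).
 have p0 : 0 <= ln C + xx by move: W0 lC0; rewrite /W; clear; lra.
 have e2 := ler_wpM2r p0 hd.
 move: En; rewrite -[N.+2%:R]natr1 -[N.+1%:R]natr1 => En.
 have e3 : d * (2 + d) <= 3 by move: d0 d1; clear; nra.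
 have e4 : N%:R * (d * (2 + d)) + 2 * (d * (2 + d)) + 1 <= (1 + d) * (2 + d) * (ln C + xx) + 7.
  by move: e1 e3; clear; lra.
 have e5 : 0 <= (1 + 2 * d) * 6 by move: d0; clear; lra.
 have e6 := ler_wpM2l e5 e4.
 have e7 : 0 <= 199 / 100 * (ln C + xx) by move: p0; clear; lra.
 have e8 := ler_wpM2l e7 F0.
 by move: En e6 e8 e2 d1 F0; clear; lra.
(* If this failed, then l <= W and l D < l (W - 1.99 l) <= W (W - 1.99 l), against the quadratic
   inequality. *)
have key : W <= 199 / 100 * l + D.
 rewrite leNgt; apply/negP => kW.
 have FF : 0 < F by apply: lt_le_trans F0; clear; lra.
 have l0 : 0 <= l by move: l9; clear; lra.
 have h1 := le_trans h (ler_wpM2l l0 EF).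
 rewrite [l * (_ * F)]mulrA ler_pM2r// in h1.
 have wl : l <= W by move: kW D0 l0; clear; lra.
 have wl2 : 0 <= W - 199 / 100 * l by move: kW D0; clear; lra.
 have h2 := ler_wpM2r wl2 wl.
 have h3 : l * D < l * (W - 199 / 100 * l) by rewrite ltr_pM2l; [move: kW; clear; lra|move: l9; clear; lra].
 have h4 : l * (199 / 100 * (xx + ln C) + 126) = 199 / 100 * l * W + l * D by rewrite /W /D; ring.
 by move: h1 h2 h3; rewrite h4; clear; lra.
have : M = m * expR xx.
 by rewrite /xx expRD expRN !lnK ?posrE//; field; rewrite gt_eqF.
move=> ->; rewrite [m * _]mulrC ler_pM2r// /A /be -expRM_natl -expRD ler_expR.
move: key; rewrite /W /l (_ : ln 2 *+ n = n%:R * ln 2); last by rewrite [RHS]mulr_natl.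
by set L := ln 2; set X := ln C; set Z := xx; set T := n%:R; clear; lra.
Qed.

End radial_fields.

(** * Representation of the second difference by a kernel *)

Section second_difference.
Variable R : realType.
Local Notation P := (R * R)%type.
Local Notation mu1 := (@lbm R).
Local Notation mu2 := (@lbm R \x @lbm R)%E.

(** In view of [field_norm], the field of one pole is at most 2 over the larger of the distance to
    the pole and the regularization radius. *)
Lemma field_le (a t : R) : 0 < a -> 0 <= t -> t * qf a t ^+ 2 * Num.max t a <= 4.
Proof.
move=> a0 t0; rewrite /qf; case: (leP t a) => h.
 rewrite (_ : a^-1 + (a - t) / a ^+ 2 = (2 * a - t) / a ^+ 2); last by field; rewrite gt_eqF.
 rewrite (_ : t * ((2 * a - t) / a ^+ 2) ^+ 2 * a = (t * (2 * a - t) ^+ 2) / a ^+ 3); last by field; rewrite gt_eqF.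
 rewrite ler_pdivrMr ?exprn_gt0//.
 have h1 : (2 * a - t) ^+ 2 <= (2 * a) ^+ 2 by rewrite ler_sqr ?nnegrE; move: h t0 a0; clear; lra.
 have h2 := ler_pM t0 (sqr_ge0 _) h h1; apply: (le_trans h2); clear; lra.
have t1 : 0 < t by exact: lt_trans h.
rewrite (_ : _ * t = 1); first by lra.
by field; rewrite !gt_eqF.
Qed.

Variables (a h : P) (s : R).
Hypothesis s0 : 0 < s.

Definition kerx (z : P) := fieldx (s ^+ 2) (a - h) z + fieldx (s ^+ 2) (a + h) z - 2 * fieldx (s ^+ 2) a z.
Definition kery (z : P) := fieldy (s ^+ 2) (a - h) z + fieldy (s ^+ 2) (a + h) z - 2 * fieldy (s ^+ 2) a z.

Lemma radius2_ge (c z : P) : `|z - c| ^+ 2 <= radius2 c z.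
Proof. by have /andP[] := sqdist_bounds id c z. Qed.

Lemma kernel_near (z : P) (t : R) : 0 < t ->
 (t <= s \/ [/\ t <= `|z - (a - h)|, t <= `|z - (a + h)| & t <= `|z - a|]) ->
 kerx z ^+ 2 + kery z ^+ 2 <= 64 / t ^+ 2.
Proof.
move=> t0 H; have s20 : 0 < s ^+ 2 by rewrite exprn_gt0.
have t20 : 0 < t ^+ 2 by rewrite exprn_gt0.
have B c : t <= s \/ t <= `|z - c| -> fieldx (s ^+ 2) c z ^+ 2 + fieldy (s ^+ 2) c z ^+ 2 <= 4 / t ^+ 2.
 move=> tc; rewrite field_norm ler_pdivlMr//; apply: le_trans (field_le s20 (radius2_ge0 c z)).
 rewrite ler_wpM2l ?mulr_ge0 ?sqr_ge0 ?radius2_ge0 ?qf_ge0//.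
 rewrite le_max; case: tc => tc; apply/orP; [right|left].
  by rewrite ler_sqr ?nnegrE ?(ltW t0) ?(ltW s0).
 by apply: le_trans (radius2_ge c z); rewrite ler_sqr ?nnegrE ?(ltW t0).
have h1 : t <= s \/ t <= `|z - (a - h)| by case: H => [|[]]; auto.
have h2 : t <= s \/ t <= `|z - (a + h)| by case: H => [|[]]; auto.
have h3 : t <= s \/ t <= `|z - a| by case: H => [|[]]; auto.
move: (B _ h1) (B _ h2) (B _ h3); rewrite /kerx /kery.
set x1 := fieldx _ _ _; set x2 := fieldx _ _ _; set x3 := fieldx _ _ _.
set y1 := fieldy _ _ _; set y2 := fieldy _ _ _; set y3 := fieldy _ _ _.
have E (u v w : R) : (u + v - 2 * w) ^+ 2 <= 4 * (u ^+ 2 + v ^+ 2 + 2 * w ^+ 2).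
 have := sqr_ge0 (u - v); have := sqr_ge0 (u + w); have := sqr_ge0 (v + w); clear; nra.
move=> b1 b2 b3; apply: (le_trans (lerD (E x1 x2 x3) (E y1 y2 y3))).
by rewrite (_ : 64 / t ^+ 2 = 16 * (4 / t ^+ 2)); [move: b1 b2 b3; clear; lra|ring].
Qed.

(** As complex numbers, with w = z - a, the three poles combine to 2 h^2 / (w (w^2 - h^2)): decay
    like |h|^2 / |w|^3 instead of 1 / |w|. *)
Lemma kernel_far (z : P) : s <= `|h| -> 4 * `|h| < `|z - a| ->
 kerx z ^+ 2 + kery z ^+ 2 <= 128 * `|h| ^+ 4 / `|z - a| ^+ 6.
Proof.
move=> sh hz; have h0 : 0 < `|h| by exact: lt_le_trans sh.
set w := `|z - a| in hz *.
have w0 : 0 < w by move: h0 hz; clear; lra.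
have far (c : P) : 3 / 4 * w <= `|z - c| -> (3 / 4 * w) ^+ 2 <= radius2 c z /\ s ^+ 2 <= radius2 c z.
 move=> wc; have e := radius2_ge c z.
 have h1 : (3 / 4 * w) ^+ 2 <= `|z - c| ^+ 2 by rewrite ler_sqr ?nnegrE//; move: w0; clear; lra.
 have h2 : s ^+ 2 <= `|z - c| ^+ 2.
  by rewrite ler_sqr ?nnegrE ?(ltW s0)//; move: sh hz wc w0; clear; lra.
 by split; exact: le_trans e.
have n1 : 3 / 4 * w <= `|z - (a - h)|.
 have := ler_normB (z - (a - h)) h; rewrite (_ : z - (a - h) - h = z - a); last by rewrite opprB addrA addrAC addrK.
 by rewrite -/w; move: hz; clear; lra.
have n2 : 3 / 4 * w <= `|z - (a + h)|.
 have := ler_normD (z - (a + h)) h; rewrite (_ : z - (a + h) + h = z - a); last by rewrite opprD addrA subrK.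
 by rewrite -/w; move: hz; clear; lra.
have n3 : 3 / 4 * w <= `|z - a| by rewrite -/w; move: w0; clear; lra.
have [A1 S1] := far _ n1; have [A2 S2] := far _ n2; have [A3 S3] := far _ n3.
have Hh : radius2 h 0 <= 2 * `|h| ^+ 2 by apply: radius2_le; rewrite sub0r normrN.
rewrite /kerx /kery /fieldx /fieldy /qf !max_l// !subrr !mul0r !addr0.
have q0 : 0 < (3 / 4 * w) ^+ 2 by rewrite exprn_gt0// mulr_gt0.
have p1 : 0 < radius2 (a - h) z by exact: lt_le_trans A1.
have p2 : 0 < radius2 (a + h) z by exact: lt_le_trans A2.
have p3 : 0 < radius2 a z by exact: lt_le_trans A3.
(* The squared modulus of that rational function, expanded in real coordinates. *)
have -> : ((z.1 - (a - h).1) / radius2 (a - h) z + (z.1 - (a + h).1) / radius2 (a + h) z - 2 * ((z.1 - a.1) / radius2 a z)) ^+ 2 +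
 ((z.2 - (a - h).2) / radius2 (a - h) z + (z.2 - (a + h).2) / radius2 (a + h) z - 2 * ((z.2 - a.2) / radius2 a z)) ^+ 2 =
 4 * radius2 h 0 ^+ 2 / (radius2 (a - h) z * radius2 (a + h) z * radius2 a z).
 move: p1 p2 p3 => /lt0r_neq0 + /lt0r_neq0 + /lt0r_neq0; rewrite /radius2 /=.
 rewrite (_ : z.1 - (a.1 - h.1) = (z.1 - a.1) + h.1); last by ring.
 rewrite (_ : z.2 - (a.2 - h.2) = (z.2 - a.2) + h.2); last by ring.
 rewrite (_ : z.1 - (a.1 + h.1) = (z.1 - a.1) - h.1); last by ring.
 rewrite (_ : z.2 - (a.2 + h.2) = (z.2 - a.2) - h.2); last by ring.
 set x := z.1 - a.1; set y := z.2 - a.2; set u := h.1; set v := h.2; clear => p1 p2 p3.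
 by field; rewrite p1 p2 p3.
rewrite ler_pdivrMr ?mulr_gt0//.
have hh4 : radius2 h 0 ^+ 2 <= 4 * `|h| ^+ 4.
 rewrite (_ : 4 * `|h| ^+ 4 = (2 * `|h| ^+ 2) ^+ 2); last by ring.
 by rewrite ler_sqr ?nnegrE ?radius2_ge0// mulr_ge0 ?sqr_ge0.
have prod : ((3 / 4 * w) ^+ 2) ^+ 3 <= radius2 (a - h) z * radius2 (a + h) z * radius2 a z.
 move: (ltW q0) A1 A2 A3; set Q := _ ^+ 2 => Q0 A1 A2 A3; rewrite (_ : Q ^+ 3 = Q * Q * Q); last by ring.
 by apply: ler_pM => //; [exact: mulr_ge0|apply: ler_pM].
have K0 : 0 <= 128 * `|h| ^+ 4 / w ^+ 6 by rewrite divr_ge0 ?mulr_ge0 ?exprn_ge0// ltW.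
apply: le_trans (ler_wpM2l K0 prod).
rewrite (_ : 128 * `|h| ^+ 4 / w ^+ 6 * ((3 / 4 * w) ^+ 2) ^+ 3 = 729 / 32 * `|h| ^+ 4); last by field; rewrite gt_eqF.
by move: hh4 (exprn_ge0 4 (ltW h0)); set X := `|h| ^+ 4; set Y := radius2 h 0 ^+ 2; lra.
Qed.

Lemma kernel_box_cont : continuous kerx /\ continuous kery.
Proof.
have s20 : 0 < s ^+ 2 by rewrite exprn_gt0.
have cX c := xac_cont (fieldx_x c s20); have cY c := xac_cont (fieldy_x c s20).
split => z; (apply: cvgB; [apply: cvgD|apply: cvgM; [exact: cvg_cst|]]); [exact: cX|exact: cX|exact: cX|exact: cY|exact: cY|exact: cY].
Qed.

(** For f = p + i q, [px - qy] and [qx + py] are the components of 2 f_zbar. The kernel is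
    curl-free, so the terms in q cancel, and its divergence consists of three sources. The
    divergence theorem leaves averages of [p] around the poles, with weights 1, 1, -2 and error eta,
    and four edge terms of size r M ka. *)
Lemma second_difference_formula (p px py q qx qy : P -> R) (r eta M ka : R) :
 grad2 p px py -> grad2 q qx qy -> s + `|h| <= r ->
 (forall c z, c = a - h \/ c = a + h \/ c = a -> `|z - c| <= s -> `|p z - p c| <= eta) -> 0 <= eta ->
 0 <= M -> 0 <= ka ->
 (forall z, `|z - a| = r -> `|p z| <= M /\ `|q z| <= M) ->
 (forall z, `|z - a| = r -> kerx z ^+ 2 + kery z ^+ 2 <= ka ^+ 2) ->
 8 * atan 1 * `|p (a + h) + p (a - h) - 2 * p a| <=
  `|\int[mu2]_(z in sqr_at a r) ((px z - qy z) * kerx z + (qx z + py z) * kery z)| +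
  32 * atan 1 * eta + 16 * r * M * ka.
Proof.
move=> Gp Gq shr pe eta0 M0 ka0 bd kb.
have h0 := normr_ge0 h.
have r0 : 0 < r by move: s0 shr h0; lra.
have s20 : 0 < s ^+ 2 by rewrite exprn_gt0.
have cp := xac_cont (grad2_x Gp); have cq := xac_cont (grad2_x Gq).
pose kxx z := fieldxx (s ^+ 2) (a - h) z + fieldxx (s ^+ 2) (a + h) z - 2 * fieldxx (s ^+ 2) a z.
pose kyy z := fieldyy (s ^+ 2) (a - h) z + fieldyy (s ^+ 2) (a + h) z - 2 * fieldyy (s ^+ 2) a z.
pose kxy z := fieldxy (s ^+ 2) (a - h) z + fieldxy (s ^+ 2) (a + h) z - 2 * fieldxy (s ^+ 2) a z.
have comb (f1 f2 f3 g1 g2 g3 : P -> R) : xac f1 g1 -> xac f2 g2 -> xac f3 g3 ->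
  xac (fun z => f1 z + f2 z - 2 * f3 z) (fun z => g1 z + g2 z - 2 * g3 z).
 move=> x1 x2 x3; have := xacD (xacD x1 x2) (xacZ (-2) x3).
 by congr xac; apply/funext => z; ring.
have kx_x : xac kerx kxx by apply: comb; exact: fieldx_x.
have ky_x : xac kery kxy by apply: comb; exact: fieldy_x.
have ky_y : yac kery kyy by apply: comb; exact: fieldy_y.
have kx_y : yac kerx kxy by apply: comb; exact: fieldx_y.
have Px := xacD (xacM (grad2_x Gp) kx_x) (xacM (grad2_x Gq) ky_x).
have Qy := xacD (yacM (grad2_y Gp) ky_y) (xacZ (-1) (yacM (grad2_y Gq) kx_y)).
have := gauss a r0 Px (Qy : yac (fun z => p z * kery z + -1 * (q z * kerx z)) (fun z => kery z * py z + p z * kyy z + -1 * (kerx z * qy z + q z * kxy z))).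
have l1 : a.1 - r <= a.1 + r by lra. have l2 : a.2 - r <= a.2 + r by lra.
have mQ := @msqr_at R a r.
pose so c z := p z * source (s ^+ 2) c z.
have sob c : mu2.-integrable (sqr_at a r) (EFin \o so c).
 by exact: (locintMc cp (locint_cont (@source_cont _ (s ^+ 2) c))).2 _ _ _ _ l1 l2.
set I := \int[mu2]_(z in sqr_at a r) ((px z - qy z) * _ + _).
have [ckx cky] := kernel_box_cont.
have Bi : locint (fun z => (px z - qy z) * kerx z + (qx z + py z) * kery z).
 have b1 := locintMc ckx (locintD (xac_box (grad2_x Gp)) (locintZ (-1) (yac_box (grad2_y Gq)))).
 have b2 := locintMc cky (locintD (xac_box (grad2_x Gq)) (yac_box (grad2_y Gp))).
 by have := locintD b1 b2; congr locint; apply/funext => z; ring.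
have -> : \int[mu2]_(z in sqr_at a r) (kerx z * px z + p z * kxx z + (kery z * qx z + q z * kxy z) +
   (kery z * py z + p z * kyy z + -1 * (kerx z * qy z + q z * kxy z))) =
  I + (\int[mu2]_(z in sqr_at a r) so (a - h) z + \int[mu2]_(z in sqr_at a r) so (a + h) z -
  2 * \int[mu2]_(z in sqr_at a r) so a z).
 rewrite -RintegralZl// -RintegralD// -RintegralB//; [|exact: RiD|exact: RiZ].
 rewrite -RintegralD//; [|exact: Bi.2|by apply: RiB => //; [exact: RiD|exact: RiZ]].
 by apply: eq_Rintegral => z _; rewrite /so -!field_div// /kxx /kyy; ring.
have Sm c : c = a - h \/ c = a + h \/ c = a ->
  `|\int[mu2]_(z in sqr_at a r) so c z - p c * (8 * atan 1)| <= eta * (8 * atan 1).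
 move=> ca; have sub : sqr_at c s `<=` sqr_at a r.
  move=> z /sqr_atP zc; apply/sqr_atP.
  have ca' : `|c - a| <= `|h|.
   by case: ca => [->|[->|->]]; rewrite 1?addrAC subrr ?add0r ?normrN ?normr0.
  have := ler_normD (z - c) (c - a); rewrite addrA subrK; move: zc ca' shr; lra.
 have pU z : sqr_at c s z -> p z <= p c + eta.
  by move=> /sqr_atP zc; have := pe c z ca zc; rewrite ler_distl => /andP[_].
 have pL z : sqr_at c s z -> -1 * p z <= - p c + eta.
  by move=> /sqr_atP zc; have := pe c z ca zc; rewrite ler_distl => /andP[+ _]; lra.
 have u1 := source_le s0 sub cp pU.
 have cp' : continuous (fun z => -1 * p z) by move=> z; apply: cvgM; [exact: cvg_cst|exact: cp].
 have u2 := source_le s0 sub cp' pL.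
 have e2 : \int[mu2]_(z in sqr_at a r) (-1 * p z * source (s ^+ 2) c z) = -1 * \int[mu2]_(z in sqr_at a r) so c z.
  by rewrite -RintegralZl//; apply: eq_Rintegral => z _; rewrite /so mulrA.
 rewrite e2 in u2; rewrite ler_norml; apply/andP; split; move: u1 u2; rewrite /so; set J := Rintegral _ _ _; lra.
have edge_le (F : P -> R) (e1 e2 : R -> P) (t0 : R) : continuous F -> continuous e1 -> continuous e2 ->
  (forall t : R, t0 - r <= t <= t0 + r -> `|F (e1 t)| <= 2 * M * ka /\ `|F (e2 t)| <= 2 * M * ka) ->
  `|\int[mu1]_(t in `[t0 - r, t0 + r]) (F (e1 t) - F (e2 t))| <= 8 * r * M * ka.
 move=> cF c1 c2 Fe; have lt : t0 - r <= t0 + r by lra.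
 have ce (e : R -> P) : continuous e -> continuous (fun t => F (e t)).
  by move=> ec t; apply: (@continuous_comp _ _ _ e F); [exact: ec|exact: cF].
 apply: (@le_trans _ _ (\int[mu1]_(t in `[t0 - r, t0 + r]) cst (4 * M * ka) t)).
  apply: Rint_le_norm => //.
  - by apply: RiB => //; apply: cont_int1 => //; exact: ce.
  - by apply: cont_int1 => // t; exact: cvg_cst.
  - move=> t; rewrite /= in_itv /= => /Fe[u1 u2]; apply: (le_trans (ler_normB _ _)); move: u1 u2; lra.
 rewrite Rintegral_cst// mu1_itvcc//; lra.
have bE z : `|z - a| = r -> `|p z * kerx z + q z * kery z| <= 2 * M * ka /\ `|p z * kery z + -1 * (q z * kerx z)| <= 2 * M * ka.
 move=> zr; have [pz qz] := bd z zr; have kz := kb z zr.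
 have k1 : `|kerx z| <= ka.
  rewrite -ler_sqr ?nnegrE// (real_normK (num_real _)); apply: le_trans kz; rewrite lerDl; exact: sqr_ge0.
 have k2 : `|kery z| <= ka.
  rewrite -ler_sqr ?nnegrE// (real_normK (num_real _)); apply: le_trans kz; rewrite lerDr; exact: sqr_ge0.
 have m (u v : R) : `|u| <= M -> `|v| <= ka -> `|u * v| <= M * ka by move=> u1 u2; rewrite normrM ler_pM.
 split; apply: (le_trans (ler_normD _ _)); rewrite 1?mulN1r ?normrN.
  by apply: (le_trans (lerD (m _ _ pz k1) (m _ _ qz k2))); rewrite -mulrA mulr_natl mulr2n.
 by apply: (le_trans (lerD (m _ _ pz k2) (m _ _ qz k1))); rewrite -mulrA mulr_natl mulr2n.
have edg (t0 x : R) : t0 - r <= x <= t0 + r -> `|x - t0| <= r by rewrite ler_distl.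
have nr : `|r| = r by rewrite ger0_norm// ltW.
have c1 : continuous (fun z => p z * kerx z + q z * kery z).
 by move=> z; apply: cvgD; apply: cvgM; [exact: cp|exact: ckx|exact: cq|exact: cky].
have c2 : continuous (fun z => p z * kery z + -1 * (q z * kerx z)).
 by move=> z; apply: cvgD; [apply: cvgM; [exact: cp|exact: cky]|apply: cvgM; [exact: cvg_cst|apply: cvgM; [exact: cq|exact: ckx]]].
have V := edge_le _ (fun y => (a.1 + r, y)) (fun y => (a.1 - r, y)) a.2 c1 (@vline_cont _ _) (@vline_cont _ _).
have H := edge_le _ (fun x => (x, a.2 + r)) (fun x => (x, a.2 - r)) a.1 c2 (@hline_cont _ _) (@hline_cont _ _).
move: V => /(_ _)/wrap[t /edg ht|V].
 split; [apply: (bE _ _).1|apply: (bE _ _).1]; apply: norm_edge; left.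
  by rewrite /= [a.1 + r]addrC addrK nr.
 by rewrite /= [a.1 - r]addrC addrK normrN nr.
move: H => /(_ _)/wrap[t /edg ht|H].
 split; [apply: (bE _ _).2|apply: (bE _ _).2]; apply: norm_edge; right.
  by rewrite /= [a.2 + r]addrC addrK nr.
 by rewrite /= [a.2 - r]addrC addrK normrN nr.
have Sa := Sm (a - h) (or_introl erefl); have Sb := Sm (a + h) (or_intror (or_introl erefl)).
have Sc := Sm a (or_intror (or_intror erefl)).
have A0 : 0 <= 8 * atan 1 :> R by apply: le_trans (flux_low R); rewrite divr_ge0 ?ler0n.
move: V H Sa Sb Sc; rewrite /=.
set B1 := Rintegral _ _ _; set B2 := Rintegral _ _ _; set J1 := Rintegral _ _ _; set J2 := Rintegral _ _ _; set J3 := Rintegral _ _ _.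
move=> V H Sa Sb Sc E.
rewrite -[8 * atan 1 in leLHS]ger0_norm// -normrM.
have -> : 8 * atan 1 * (p (a + h) + p (a - h) - 2 * p a) =
  - (J1 - p (a - h) * (8 * atan 1)) - (J2 - p (a + h) * (8 * atan 1)) + 2 * (J3 - p a * (8 * atan 1)) + (B1 + B2 - I).
 by move: E => /eqP; rewrite -subr_eq => /eqP <-; ring.
move: Sa Sb Sc V H; rewrite !ler_norml => /andP[m1 m2] /andP[m3 m4] /andP[m5 m6] /andP[m7 m8] /andP[m9 m10].
have := ler_norm I; have := ler_norm (- I); rewrite normrN => n1 n2.
by apply/andP; split; move: m1 m2 m3 m4 m5 m6 m7 m8 m9 m10 n1 n2; clear; lra.
Qed.

End second_difference.

(** * Covering squares adapted to the kernel *)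

Section quasiconformal_second_difference.
Variable R : realType.
Local Notation P := (R * R)%type.
Local Notation mu2 := (@lbm R \x @lbm R)%E.

Lemma pow4 n : (4 : R) ^+ n = (2 ^+ n) ^+ 2.
Proof. by rewrite exprAC; congr (_ ^+ _); ring. Qed.

Lemma pow64 n : (64 : R) ^+ n = (2 ^+ n) ^+ 6.
Proof. by rewrite exprAC; congr (_ ^+ _); ring. Qed.

Lemma sum_box (D : set P) (a b c d : R) (n : nat) (g : nat -> P -> R) (B : nat -> R) :
 D = cbox a b c d -> a <= b -> c <= d ->
 (forall i, (i < n)%N -> locint (g i) /\ \int[mu2]_(z in D) g i z <= B i) ->
 locint (fun z => \sum_(i < n) g i z) /\
 \int[mu2]_(z in D) (\sum_(i < n) g i z) <= \sum_(i < n) B i.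
Proof.
move=> De ab cd; have mD : measurable D by rewrite De; exact: mcbox.
elim: n => [_|n IH H].
 rewrite big_ord0; under eq_fun do rewrite big_ord0; split; first by apply: locint_cont => z; exact: cvg_cst.
 by rewrite Rintegral_cst// mul0r.
have [bn In] := IH (fun i h => H i (ltnW h)); have [bc Ic] := H n (ltnSn n).
under eq_fun do rewrite big_ord_recr /=; split; first exact: locintD.
rewrite RintegralD//; [|by rewrite De; exact: bn.2|by rewrite De; exact: bc.2].
by rewrite big_ord_recr /=; exact: lerD.
Qed.

(** Each square of the cover gets its own Cauchy weight b / e. The majorants of all the squares are
    nonnegative and simply added, so overlaps do no harm. *)
Lemma cover_bound (a : P) (r k : R) (N1 N2 : nat) (cen : nat -> nat -> P) (rr kap e b : nat -> nat -> R)
  (w1 w2 G K1 K2 : P -> R) : 0 < k -> 0 <= r ->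
 locint w1 -> locint w2 -> locint G -> (forall z, 0 <= G z) ->
 continuous K1 -> continuous K2 ->
 {ae mu2, forall z, w1 z ^+ 2 + w2 z ^+ 2 <= 4 * k ^+ 2 * G z} ->
 (forall z, sqr_at a r z -> exists i j, [/\ (i < N1)%N, (j < N2)%N, sqr_at (cen i j) (rr i j) z &
   K1 z ^+ 2 + K2 z ^+ 2 <= kap i j]) ->
 (forall i j, (i < N1)%N -> (j < N2)%N -> [/\ 0 <= rr i j, 0 < e i j, 0 < b i j, 0 <= kap i j &
  \int[mu2]_(z in sqr_at (cen i j) (rr i j)) G z <= e i j ^+ 2 /\ 4 * rr i j ^+ 2 * kap i j <= b i j ^+ 2]) ->
 `|\int[mu2]_(z in sqr_at a r) (w1 z * K1 z + w2 z * K2 z)| <=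
 \sum_(i < N1) \sum_(j < N2) 3 * k * (e i j * b i j).
Proof.
move=> k0 r0 bw1 bw2 bG G0 cK1 cK2 wG cov H.
have l1 : a.1 - r <= a.1 + r by lra. have l2 : a.2 - r <= a.2 + r by lra.
have mQ := msqr_at a r.
pose lam i j := b i j / e i j.
pose q i j z := k / 2 * (4 * lam i j * G z + (lam i j)^-1 * kap i j).
pose S i j := sqr_at (cen i j) (rr i j).
have mS i j : measurable (S i j) by exact: msqr_at.
have k20 : 0 <= k / 2 by rewrite divr_ge0// ltW.
have qP i j : (i < N1)%N -> (j < N2)%N -> [/\ locint (q i j \_ (S i j)), (forall z, 0 <= q i j z) &
  \int[mu2]_(z in sqr_at a r) (q i j \_ (S i j)) z <= 3 * k * (e i j * b i j)].
 move=> iN jN; have [rr0 e0 b0 ka0 [Ge kb]] := H i j iN jN.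
 have la0 : 0 < lam i j by rewrite divr_gt0.
 have q0 z : 0 <= q i j z.
  by rewrite mulr_ge0// addr_ge0// mulr_ge0 ?mulr_ge0 ?invr_ge0// ltW.
 have bc (t : R) : locint (cst t : P -> R) by apply: locint_cont => z; exact: cvg_cst.
 have bq : locint (q i j).
  have := locintZ (k / 2) (locintD (locintZ (4 * lam i j) bG) (bc ((lam i j)^-1 * kap i j))).
  by congr locint.
 have bqS : locint (q i j \_ (S i j)).
  apply: (locint_le _ _ bq).
   by apply/(measurable_restrictT _ _).1 => //; apply: measurable_funTS; exact: bq.1.
  by move=> z; rewrite patchE; case: ifP => _; rewrite ?normr0 ?q0// ger0_norm.
 split => //; rewrite -Rintegral_mkcondr.
 have m1 : (cen i j).1 - rr i j <= (cen i j).1 + rr i j by lra.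
 have m2 : (cen i j).2 - rr i j <= (cen i j).2 + rr i j by lra.
 apply: (@le_trans _ _ (\int[mu2]_(z in S i j) q i j z)).
  by apply: (box_mono m1 m2 bq q0); [exact: measurableI|move=> z []].
 have i1 := (locintZ (4 * lam i j) bG).2 _ _ _ _ m1 m2.
 have i2 := (bc ((lam i j)^-1 * kap i j)).2 _ _ _ _ m1 m2.
 rewrite /q RintegralZl//; last by apply: RiD.
 rewrite RintegralD// RintegralZl//; last exact: bG.2.
 rewrite Rintegral_cst//.
 have -> : fine (mu2 (S i j)) = 4 * rr i j ^+ 2 by rewrite mu_sqr_at.
 have h1 : lam i j * \int[mu2]_(z in S i j) G z <= lam i j * e i j ^+ 2 by rewrite ler_wpM2l// ltW.
 have h2 : (lam i j)^-1 * (4 * rr i j ^+ 2 * kap i j) <= (lam i j)^-1 * b i j ^+ 2.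
  by rewrite ler_wpM2l// invr_ge0 ltW.
 have e1 : lam i j * e i j ^+ 2 = e i j * b i j by rewrite /lam; field; rewrite gt_eqF.
 have e2 : (lam i j)^-1 * b i j ^+ 2 = e i j * b i j by rewrite /lam; field; rewrite !gt_eqF.
 have eb0 : 0 < e i j * b i j by rewrite mulr_gt0.
 rewrite e1 in h1; rewrite e2 in h2.
 have h3 : 4 * lam i j * \int[mu2]_(z in S i j) G z + (lam i j)^-1 * kap i j * (4 * rr i j ^+ 2) <= 5 * (e i j * b i j).
  by move: h1 h2; set X := Rintegral _ _ _; set Y := _^-1; set Z := lam i j; set W := e i j * _; clear; lra.
 have := ler_wpM2l k20 h3; move: eb0 k0; set W := e i j * _; set V := k / 2 * _; clear => W0 k0.
 by have := mulr_gt0 k0 W0; clear; lra.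
have inner i : (i < N1)%N -> locint (fun z => \sum_(j < N2) (q i j \_ (S i j)) z) /\
  \int[mu2]_(z in sqr_at a r) (\sum_(j < N2) (q i j \_ (S i j)) z) <= \sum_(j < N2) 3 * k * (e i j * b i j).
 move=> iN; apply: (@sum_box _ _ _ _ _ N2 (fun j => q i j \_ (S i j)) (fun j => 3 * k * (e i j * b i j)) erefl l1 l2).
 by move=> j jN; have [] := qP i j iN jN.
have [bS IS] := @sum_box _ _ _ _ _ N1 (fun i z => \sum_(j < N2) (q i j \_ (S i j)) z)
 (fun i => \sum_(j < N2) 3 * k * (e i j * b i j)) erefl l1 l2 inner.
apply: le_trans IS.
have Bw : locint (fun z => w1 z * K1 z + w2 z * K2 z).
 have := locintD (locintMc cK1 bw1) (locintMc cK2 bw2).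
 by congr locint; apply/funext => z; ring.
apply: (le_trans (le_normr_Rintegral _ (Bw.2 _ _ _ _ l1 l2))) => //.
apply: ae_le_Rint => //; [exact: (RiN (Bw.2 _ _ _ _ l1 l2))|exact: (bS.2 _ _ _ _ l1 l2)|].
apply: aeS wG => z wz zQ.
have [i [j [iN jN zS Kz]]] := cov z zQ.
have [rr0 e0 b0 ka0 _] := H i j iN jN.
have la0 : 0 < lam i j by rewrite divr_gt0.
have pos (i' : 'I_N1) : 0 <= \sum_(j < N2) (q i' j \_ (S i' j)) z.
 apply: sumr_ge0 => j' _; have [_ q0 _] := qP i' j' (ltn_ord i') (ltn_ord j').
 by rewrite patchE; case: ifP.
apply: (@le_trans _ _ (q i j z)).
 rewrite /q; have am (u v : R) (L : R) : 0 < L -> `|u * v| <= L / 2 * u ^+ 2 + L^-1 / 2 * v ^+ 2.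
  move=> L0; have s1 : 0 <= L^-1 / 2 * (L * u - v) ^+ 2 by rewrite mulr_ge0 ?sqr_ge0// divr_ge0 ?invr_ge0// ltW.
  have s2 : 0 <= L^-1 / 2 * (L * u + v) ^+ 2 by rewrite mulr_ge0 ?sqr_ge0// divr_ge0 ?invr_ge0// ltW.
  have e1 : L / 2 * u ^+ 2 + L^-1 / 2 * v ^+ 2 - u * v = L^-1 / 2 * (L * u - v) ^+ 2 by field; rewrite gt_eqF.
  have e2 : L / 2 * u ^+ 2 + L^-1 / 2 * v ^+ 2 + u * v = L^-1 / 2 * (L * u + v) ^+ 2 by field; rewrite gt_eqF.
  by rewrite ler_norml; apply/andP; split; move: s1 s2 e1 e2; clear; lra.
 have L0 : 0 < lam i j / k by rewrite divr_gt0.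
 have h1 := am (w1 z) (K1 z) _ L0; have h2 := am (w2 z) (K2 z) _ L0.
 apply: (le_trans (ler_normD _ _)); apply: (le_trans (lerD h1 h2)).
 have h3 := ler_wpM2l (ltW L0) wz.
 have L1 : 0 <= (lam i j / k)^-1 by rewrite invr_ge0 ltW.
 have h4 := ler_wpM2l L1 Kz.
 have e1 : lam i j / k * (4 * k ^+ 2 * G z) = k * (4 * lam i j * G z) by field; rewrite gt_eqF.
 have e2 : (lam i j / k)^-1 * kap i j = k * ((lam i j)^-1 * kap i j) by field; rewrite !gt_eqF.
 rewrite e1 in h3; rewrite e2 in h4; move: h3 h4.
 set A := lam i j / k; set B := A^-1; set C := 4 * _ * _; set D := _^-1 * kap i j; clear; lra.
rewrite (bigD1 (Ordinal iN))//= (bigD1 (Ordinal jN))//= patchE mem_set// -addrA lerDl addr_ge0//.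
 apply: sumr_ge0 => j' _; have [_ q0 _] := qP i j' iN (ltn_ord j').
 by rewrite patchE; case: ifP.
by apply: sumr_ge0 => i' _; exact: pos.
Qed.

Lemma geometric_le (t : R) n : 0 <= t < 1 -> \sum_(i < n) t ^+ i <= (1 - t)^-1.
Proof.
move=> /andP[t0 t1]; have p : 0 < 1 - t by rewrite subr_gt0.
suff E : (1 - t) * \sum_(i < n) t ^+ i = 1 - t ^+ n.
 by rewrite -[leRHS]mul1r ler_pdivlMr// mulrC E gerBl exprn_ge0.
elim: n => [|n IH]; first by rewrite big_ord0 mulr0 expr0 subrr.
by rewrite big_ord_recr /= mulrDr IH exprS; ring.
Qed.

Lemma geometric_small (t C e : R) : 0 <= t < 1 -> 0 < e -> exists N : nat, C * t ^+ N <= e.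
Proof.
move=> /andP[t0 t1] e0.
have : (fun n : nat => t ^+ n) @ \oo --> (0 : R) by apply: cvg_expr; rewrite ger0_norm.
have C0 : 0 < `|C| + 1 by rewrite ltr_wpDl.
move=> /cvgrPdist_le/(_ (e / (`|C| + 1)) (divr_gt0 e0 C0))[N _ /(_ N (leqnn N))] /=.
rewrite sub0r normrN ger0_norm ?exprn_ge0// => h; exists N.
apply: (@le_trans _ _ ((`|C| + 1) * t ^+ N)).
 by rewrite ler_wpM2r ?exprn_ge0// (le_trans (ler_norm _))// lerDl.
by rewrite mulrC -ler_pdivlMr.
Qed.

(** Indices 2 and 3 both name a: 2 serves the small squares about a, 3 the large ones that cover the
    far region. *)
Definition pole (a h : P) (i : nat) : P := if i == 0%N then a - h else if i == 1%N then a + h else a.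

(** Near the poles, the dyadic scale of the distance to the closest one is used with [kernel_near],
    down to the regularization radius; beyond distance 4 |h| the dyadic scale of |z - a| is used
    with [kernel_far]. *)
Lemma kernel_cover (a h z : P) (N : nat) : h != 0 -> `|z - a| <= 2 ^+ N.+2 * `|h| ->
 exists i j, [/\ (i < 4)%N, (j < N.+1)%N,
  `|z - pole a h i| <= (if (i < 3)%N then (2 ^+ j)^-1 else 2 ^+ j.+2) * `|h| &
  kerx a h ((2 ^+ N)^-1 * `|h|) z ^+ 2 + kery a h ((2 ^+ N)^-1 * `|h|) z ^+ 2 <=
   (if (i < 3)%N then 256 * 4 ^+ j else 128 / 64 ^+ j) / `|h| ^+ 2].
Proof.
move=> hn zR; have h0 : 0 < `|h| by rewrite normr_gt0.
set s := (2 ^+ N)^-1 * `|h|; have s0 : 0 < s by rewrite mulr_gt0// invr_gt0 exprn_gt0.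
have sh : s <= `|h| by rewrite /s ler_piMl ?(ltW h0)// invf_le1 ?exprn_gt0// exprn_ege1// ler1n.
have [za|za] := ltP (4 * `|h|) `|z - a|.
 have ne : exists n, `|z - a| <= 2 ^+ n.+2 * `|h| by exists N.
 have [n1 nm] : `|z - a| <= 2 ^+ (ex_minn ne).+2 * `|h| /\ forall j, `|z - a| <= 2 ^+ j.+2 * `|h| -> (ex_minn ne <= j)%N by case: ex_minnP.
 move: (ex_minn ne) n1 nm => n n1 nm.
 have nN : (n <= N)%N by exact: nm.
 case: n nN n1 nm => [|n] nN n1 nm.
  by move: za; rewrite ltNge (_ : 4 = 2 ^+ 2) ?n1//; ring.
 exists 3%N, n.+1; split => //.
 apply: (le_trans (kernel_far s0 sh za)); rewrite /=.
 have nz : 2 ^+ n.+2 * `|h| <= `|z - a|.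
  by rewrite leNgt; apply/negP => /ltW/nm; rewrite ltnn.
 have p0 : 0 < 2 ^+ n.+2 * `|h| by rewrite mulr_gt0// exprn_gt0.
 apply: (@le_trans _ _ (128 * `|h| ^+ 4 / (2 ^+ n.+2 * `|h|) ^+ 6)).
  rewrite ler_wpM2l ?mulr_ge0 ?exprn_ge0// lef_pV2 ?posrE ?exprn_gt0 ?(lt_le_trans p0 nz)//.
  by rewrite ler_pXn2r// ?nnegrE ltW// (lt_le_trans p0 nz).
 rewrite pow64 (exprS 2 n.+1); have : (2 : R) ^+ n.+1 != 0 by rewrite expf_neq0.
 set X := (2 : R) ^+ n.+1 => X0.
 rewrite (_ : 128 * `|h| ^+ 4 / (2 * X * `|h|) ^+ 6 = 2 * (X ^- 6 / `|h| ^+ 2)); last by field; rewrite X0 gt_eqF.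
 rewrite -mulrA ler_wpM2r//; first by rewrite divr_ge0 ?exprn_ge0// invr_ge0 /X -pow64 exprn_ge0.
 by rewrite ler_nat.
have [i i3 near] : exists2 i, (i < 3)%N & [/\ `|z - pole a h i| <= `|z - (a - h)|,
  `|z - pole a h i| <= `|z - (a + h)| & `|z - pole a h i| <= `|z - a|].
 case: (leP `|z - (a - h)| `|z - (a + h)|) => h1.
  by case: (leP `|z - (a - h)| `|z - a|) => h2; [exists 0%N|exists 2%N] => //; split; rewrite /pole /=; move: h1 h2; clear; lra.
 by case: (leP `|z - (a + h)| `|z - a|) => h2; [exists 1%N|exists 2%N] => //; split; rewrite /pole /=; move: h1 h2; clear; lra.
have [far|clo] := leP `|h| `|z - pole a h i|.
 exists 3%N, 0%N; split => //=.
  by rewrite /pole /= (_ : 2 ^+ 2 = 4)//; ring.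
 apply: (@le_trans _ _ (64 / `|h| ^+ 2)).
  by apply: kernel_near => //; right; case: near => n1 n2 n3; split; exact: le_trans far _.
 by rewrite expr0 divr1 ler_wpM2r ?invr_ge0 ?sqr_ge0// ler_nat.
have [pl|pl] := leP `|z - pole a h i| s.
 exists i, N; split => //; [exact: ltn_trans i3 _|by rewrite i3|rewrite i3].
 apply: (@le_trans _ _ (64 / s ^+ 2)); first by apply: kernel_near => //; left.
 rewrite pow4 /s; have : (2 : R) ^+ N != 0 by rewrite expf_neq0.
 set X := (2 : R) ^+ N => X0; rewrite (_ : 64 / (X^-1 * `|h|) ^+ 2 = 64 * (X ^+ 2 / `|h| ^+ 2)); last by field; rewrite X0 gt_eqF.
 by rewrite -mulrA ler_wpM2r ?divr_ge0 ?sqr_ge0// ler_nat.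
have ne : exists n, (2 ^+ n.+1)^-1 * `|h| < `|z - pole a h i|.
 exists N; apply: le_lt_trans pl; rewrite /s ler_wpM2r// lef_pV2 ?posrE ?exprn_gt0//.
 by rewrite ler_weXn2l// ler1n.
have [n1 nm] : (2 ^+ (ex_minn ne).+1)^-1 * `|h| < `|z - pole a h i| /\ forall j, (2 ^+ j.+1)^-1 * `|h| < `|z - pole a h i| -> (ex_minn ne <= j)%N by case: ex_minnP.
move: (ex_minn ne) n1 nm => n n1 nm.
have nN : (n < N.+1)%N.
 rewrite ltnS; apply: nm; apply: le_lt_trans pl; rewrite /s ler_wpM2r// lef_pV2 ?posrE ?exprn_gt0//.
 by rewrite ler_weXn2l// ler1n.
exists i, n; split => //; [exact: ltn_trans i3 _| |]; rewrite i3.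
 case: n {n1 nN} nm => [|n] nm; first by rewrite expr0 invr1 mul1r ltW.
 by rewrite leNgt; apply/negP => /nm; rewrite ltnn.
have t0 : 0 < (2 ^+ n.+1)^-1 * `|h| by rewrite mulr_gt0// invr_gt0 exprn_gt0.
apply: (@le_trans _ _ (64 / ((2 ^+ n.+1)^-1 * `|h|) ^+ 2)).
 by apply: kernel_near => //; right; case: near => m1 m2 m3; split; exact: le_trans (ltW n1) _.
rewrite pow4 (exprS 2 n); have : (2 : R) ^+ n != 0 by rewrite expf_neq0.
set X := (2 : R) ^+ n => X0; apply: le_of_eq; field; rewrite X0 gt_eqF//.
Qed.

End quasiconformal_second_difference.

(** * The second difference of a quasiconformal map *)

Section second_difference_bound.
Variable R : realType.
Local Notation P := (R * R)%type.
Local Notation mu2 := (@lbm R \x @lbm R)%E.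
(** Up to constants the energy of the square of scale j is (T^j rho)^2 near a pole, by hole filling,
    and ((4 T)^j rho)^2 far out, by growth. The kernel contributes the factors 1 and 4^-j
    respectively, so both sums are geometric with ratio T < 1. *)
Lemma second_difference_step : exists2 k0 : R, 0 < k0 & exists2 A : R, 0 < A & exists2 t : R, 0 <= t < 1 &
 forall k f g ux uy vx vy (a h : P) (N : nat) (p px py q qx qy : P -> R),
 qcpos k f g ux uy vx vy -> 0 < k <= k0 -> h != 0 -> (0 < N)%N ->
 grad2 p px py -> grad2 q qx qy ->
 (forall z z', `|p z - p z'| <= `|f z - f z'|) -> (forall z, `|q z| <= `|f z - f a|) -> p a = 0 ->
 {ae mu2, forall z, (px z - qy z) ^+ 2 + (qx z + py z) ^+ 2 <= 4 * k ^+ 2 * cf2 (ux z) (uy z) (vx z) (vy z)} ->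
 `|p (a + h) + p (a - h)| <= A * k * `|f (a + h) - f a| + A * `|f (a + h) - f a| * t ^+ N.
Proof.
have [k1 k10 [CE CE1 HE]] := square_energy R; have [k2 k20 [Cq Cq1 HC]] := weak_quasisymmetry R.
have [k3 k30 [Ch Ch1 [th /andP[th0 th1] HH]]] := hole_filling R.
have [k4 k40 [Cg Cg1 [be /andP[be1 be4] HG]]] := growth R.
have CE0 : 0 < CE by exact: lt_le_trans CE1.
have Cq0 : 0 < Cq by exact: lt_le_trans Cq1.
have Ch0 : 0 < Ch by exact: lt_le_trans Ch1.
have Cg0 : 0 < Cg by exact: lt_le_trans Cg1.
exists (Num.min (Num.min k1 k2) (Num.min k3 k4)); first by rewrite !lt_min k10 k20 k30 k40.
(* One ratio for both ends: sqrt th from hole filling at small scales, be / 4 from growth against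
   the decay of the kernel at large ones. *)
pose T := Num.max (Num.sqrt th) (be / 4).
have T0 : 0 < T by rewrite lt_max divr_gt0 ?orbT// (lt_le_trans ltr01).
have T1 : T < 1.
 rewrite gt_max -{1}sqrtr1 ltr_sqrt// th1 ltr_pdivrMr//= mul1r; exact: be4.
have thT n : th ^+ n <= (T ^+ n) ^+ 2.
 rewrite -exprM mulnC exprM; apply: lerXn2r; rewrite ?nnegrE ?exprn_ge0 ?(ltW T0) ?(ltW th0)//.
 rewrite -{1}(sqr_sqrtr (ltW th0)) ler_sqr ?nnegrE ?sqrtr_ge0 ?(ltW T0)//.
 by rewrite /T le_max lexx.
have beT n : be ^+ n <= (4 * T) ^+ n.
 apply: lerXn2r; rewrite ?nnegrE ?mulr_ge0 ?(ltW T0) ?(le_trans ler01 be1)//.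
 by rewrite mulrC -ler_pdivrMr// /T le_max lexx orbT.
clearbody T.
have T01 : 0 <= T < 1 by apply/andP; split; [exact: ltW|exact: T1].
pose B := CE * Ch * Cq * Cg * 16.
have B0 : 0 < B by rewrite !mulr_gt0.
have BE : B = CE * Ch * Cq * Cg * 16 := erefl B.
clearbody B.
pose A := 13 * 100 * CE * B / (1 - T) + 10 * 100 * B.
have p1T : 0 < 1 - T by rewrite subr_gt0.
have A0 : 0 < A by rewrite addr_gt0 ?divr_gt0 ?mulr_gt0.
have AE : A = 13 * 100 * CE * B / (1 - T) + 10 * 100 * B := erefl A.
clearbody A.
exists A; first exact: A0.
exists T; first exact: T01.
move=> k f g ux uy vx vy a h N p px py q qx qy QP /andP[k0]; rewrite !le_min => /andP[/andP[kk1 kk2] /andP[kk3 kk4]].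
move=> hn N0 Gp Gq pf qf0 pa wG.
have kk0 := ltW k0.
have Q := qp_map QP; have gu := qc_u Q; have gv := qc_v Q.
set rho := `|f (a + h) - f a|.
have h0 : 0 < `|h| by rewrite normr_gt0.
have fpos (x y : P) : x != y -> 0 < `|f x - f y|.
 by rewrite normr_gt0 subr_eq0; apply: contra => /eqP/(can_inj (qc_fK Q)) ->.
have rho0 : 0 < rho by apply: fpos; rewrite -subr_eq0 addrAC subrr add0r.
(* Regularization radius and outer radius, tied to the same N: the errors at the poles and on the
   outer boundary are then both of order T^N rho. *)
set s := (2 ^+ N)^-1 * `|h|; set r := 2 ^+ N.+2 * `|h|.
have s0 : 0 < s by rewrite mulr_gt0// invr_gt0 exprn_gt0.
have r0 : 0 < r by rewrite mulr_gt0// exprn_gt0.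
have shr : s + `|h| <= r.
 have X1 : 1 <= (2 : R) ^+ N by rewrite exprn_ege1// ler1n.
 have : s <= `|h| by rewrite /s ler_piMl ?(ltW h0)// invf_le1 ?exprn_gt0.
 have : 4 * `|h| <= r by rewrite /r !exprS mulrA ler_wpM2r ?(ltW h0)//; move: X1; clear; lra.
 by move: h0; clear; lra.
have k01 : 0 <= k <= k1 by rewrite kk0. have k02 : 0 <= k <= k2 by rewrite kk0.
have k03 : 0 <= k <= k3 by rewrite kk0. have k04 : 0 <= k <= k4 by rewrite kk0.
have pole_rho i : exists2 y, `|y - pole a h i| = `|h| & `|f y - f (pole a h i)| <= Cq * rho.
 have r1 : rho <= Cq * rho by rewrite ler_peMl// ltW.
 rewrite /pole; case: ifP => _; last case: ifP => _.
 - exists a; first by rewrite opprB addrCA subrr addr0.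
  rewrite distrC; apply: (HC _ _ _ _ _ _ _ (a - h) a (a + h) QP k02).
  by rewrite addrAC subrr add0r normrN addrAC subrr add0r.
 - by exists a; [rewrite opprD addrA subrr add0r normrN|rewrite distrC].
 - by exists (a + h); [rewrite addrAC subrr add0r|].
have small i j z : `|z - pole a h i| <= (2 ^+ j)^-1 * `|h| -> `|f z - f (pole a h i)| <= B * T ^+ j * rho.
 move=> zj; have [y yh yr] := pole_rho i.
 have := HH _ _ _ _ _ _ _ z y (pole a h i) j QP k03.
 rewrite yh -ler_pdivlMl ?exprn_gt0// => /(_ zj) h1.
 have p2 : 0 <= Cq * rho by rewrite mulr_ge0// ltW.
 have h2 : `|f y - f (pole a h i)| ^+ 2 <= (Cq * rho) ^+ 2 by rewrite ler_sqr ?nnegrE.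
 rewrite -ler_sqr ?nnegrE ?mulr_ge0 ?exprn_ge0 ?(ltW B0) ?(ltW T0) ?(ltW rho0)//.
 apply: (le_trans h1).
 apply: (@le_trans _ _ (Ch * (T ^+ j) ^+ 2 * (Cq * rho) ^+ 2)).
  by apply: ler_pM; [apply: mulr_ge0; [exact: ltW|exact: exprn_ge0 (ltW th0)]|exact: exprn_ge0|apply: ler_wpM2l; [exact: ltW|exact: thT]|exact: h2].
 have -> : Ch * (T ^+ j) ^+ 2 * (Cq * rho) ^+ 2 = (Ch * Cq ^+ 2) * (T ^+ j * rho) ^+ 2 by ring.
 rewrite -[B * _ * _]mulrA [in leRHS]exprMn ler_wpM2r ?sqr_ge0//.
 have e1 : 1 <= CE * Cg * 16 by rewrite (le_trans (_ : 1 <= 1 * 1 * 16))//; [rewrite !mul1r ler1n|apply: ler_pM => //; rewrite ?mulr_ge0//; exact: ler_pM].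
 have -> : B = Ch * Cq * (CE * Cg * 16) by rewrite BE; ring.
 rewrite [in leRHS]exprMn; apply: (@le_trans _ _ ((Ch * Cq) ^+ 2 * 1)).
  by rewrite mulr1 exprMn ler_wpM2r ?sqr_ge0// expr2 ler_peMl// ltW.
 by rewrite ler_wpM2l ?sqr_ge0// exprn_ege1.
have big j z : `|z - a| <= 2 ^+ j.+2 * `|h| -> `|f z - f a| <= Cg * 16 * (4 * T) ^+ j * rho.
 move=> zj; have := HG _ _ _ _ _ _ _ z (a + h) a j.+2 QP k04; rewrite addrAC subrr add0r => /(_ zj) h1.
 apply: (le_trans h1); rewrite ler_wpM2r ?(ltW rho0)// -mulrA ler_wpM2l ?(ltW Cg0)//.
 have be0 : 0 <= be by exact: le_trans be1.
 rewrite !exprSr -mulrA mulrC; apply: ler_pM; rewrite ?mulr_ge0 ?exprn_ge0//.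
 by have := ler_pM be0 be0 (ltW be4) (ltW be4); clear; lra.
pose rr i j := (if (i < 3)%N then (2 ^+ j)^-1 else 2 ^+ j.+2) * `|h|.
pose kap i j := (if (i < 3)%N then 256 * 4 ^+ j else 128 / 64 ^+ j) / `|h| ^+ 2.
pose e i j := CE * (B * (if (i < 3)%N then T ^+ j else (4 * T) ^+ j) * rho).
(* 4 rr^2 kap equals 32^2 near a pole, and 8192 / 16^j <= (100 / 4^j)^2 far out. *)
pose b (i j : nat) : R := if (i < 3)%N then 32 else 100 / 4 ^+ j.
have rq0 : 0 < `|h| ^+ 2 by rewrite exprn_gt0.
have CgB : Cg * 16 <= B.
 have e1 : 1 <= CE * Ch * Cq by rewrite !mulr_ege1.
 have cg0 : 0 <= Cg * 16 by rewrite mulr_ge0 ?ler0n// ltW.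
 by rewrite BE -[CE * Ch * Cq * Cg * 16]mulrA ler_peMl.
have w4 : 0 <= 4 * T by rewrite mulr_ge0 ?ler0n// ltW.
have T4 j : 0 < (4 * T) ^+ j by rewrite exprn_gt0// mulr_gt0.
have Tj j : 0 < T ^+ j by rewrite exprn_gt0.
have e0 i j : 0 < e i j by rewrite mulr_gt0// mulr_gt0// mulr_gt0//; case: ifP.
have b0 i j : 0 < b i j by rewrite /b; case: ifP => // _; rewrite divr_gt0// exprn_gt0.
have bG := qc_cf2_box Q.
have [ckx cky] := kernel_box_cont a h s0.
have bw1 : locint (fun z => px z - qy z).
 have := locintD (xac_box (grad2_x Gp)) (locintZ (-1) (yac_box (grad2_y Gq))).
 by congr locint; apply/funext => z; rewrite mulN1r.
have bw2 : locint (fun z => qx z + py z).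
 exact: locintD (xac_box (grad2_x Gq)) (yac_box (grad2_y Gp)).
have rr0 i j : 0 < rr i j.
 by rewrite mulr_gt0//; case: ifP => _; rewrite ?invr_gt0 exprn_gt0.
have cov z : sqr_at a r z -> exists i j, [/\ (i < 4)%N, (j < N.+1)%N, sqr_at (pole a h i) (rr i j) z &
   kerx a h s z ^+ 2 + kery a h s z ^+ 2 <= kap i j].
 move=> /sqr_atP zr; have [i [j [i4 j4 zi K]]] := kernel_cover hn zr.
 by exists i, j; split => //; apply/sqr_atP.
have Hij i j : (i < 4)%N -> (j < N.+1)%N -> [/\ 0 <= rr i j, 0 < e i j, 0 < b i j, 0 <= kap i j &
  \int[mu2]_(z in sqr_at (pole a h i) (rr i j)) cf2 (ux z) (uy z) (vx z) (vy z) <= e i j ^+ 2 /\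
  4 * rr i j ^+ 2 * kap i j <= b i j ^+ 2].
 move=> i4 _; split; [exact: ltW|exact: e0|exact: b0| |split].
 - rewrite /kap; apply: divr_ge0; last exact: sqr_ge0.
  by case: ifP => _; [apply: mulr_ge0|apply: divr_ge0]; rewrite ?exprn_ge0 ?ler0n.
 - set c := pole a h i; pose y : P := (c.1 + rr i j, c.2).
  have yr : `|y - c| = rr i j := norm_right_point c (rr0 i j).
  have [_] := HE _ _ _ _ _ _ _ c y QP k01; rewrite yr => h1; apply: (le_trans h1).
  pose X := B * (if (i < 3)%N then T ^+ j else (4 * T) ^+ j) * rho; have fX : `|f y - f c| <= X.
   rewrite /X; case: ifPn => i3.
    by apply: small; rewrite -/c yr /rr i3.
   have i0 : i != 0%N by apply: contraNneq i3 => ->.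
   have i1 : i != 1%N by apply: contraNneq i3 => ->.
   have ci : c = a by rewrite /c /pole (negbTE i0) (negbTE i1).
   have h2 : `|y - a| <= 2 ^+ j.+2 * `|h| by rewrite -ci yr /rr (negbTE i3).
   rewrite ci; apply: (le_trans (big j y h2)); rewrite ler_wpM2r ?(ltW rho0)// ler_wpM2r// ltW//.
  have X0 : 0 <= X by exact: le_trans fX.
  apply: (@le_trans _ _ (CE * X ^+ 2)); first by rewrite ler_wpM2l ?(ltW CE0)// ler_sqr ?nnegrE.
  by rewrite /e -/X [in leRHS]exprMn ler_wpM2r ?sqr_ge0// expr2 ler_peMl// ltW.
 - rewrite /rr /kap /b; case: ifP => _.
   rewrite pow4; have : (2 : R) ^+ j != 0 by rewrite expf_neq0.
   set X := (2 : R) ^+ j => X0; apply: le_of_eq; field; rewrite X0 gt_eqF//.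
  rewrite pow4 pow64 (exprS 2 j.+1) (exprS 2 j); have : (2 : R) ^+ j != 0 by rewrite expf_neq0.
  set X := (2 : R) ^+ j => X0.
  rewrite (_ : 4 * (2 * (2 * X) * `|h|) ^+ 2 * (128 / X ^+ 6 / `|h| ^+ 2) = 64 * 128 * X ^- 4); last by field; rewrite X0 gt_eqF.
  rewrite (_ : (100 / X ^+ 2) ^+ 2 = 100 * 100 * X ^- 4); last by field.
  have X4 : 0 <= X ^- 4 by rewrite invr_ge0 (_ : X ^+ 4 = (X ^+ 2) ^+ 2) ?sqr_ge0//; ring.
  by move: X4; set Y := X ^- 4; clear; lra.
have cf0 z : 0 <= cf2 (ux z) (uy z) (vx z) (vy z) := cf2_ge0 _ _ _ _.
have I1 := cover_bound k0 (ltW r0) bw1 bw2 bG cf0 ckx cky wG cov Hij.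
have I2 : \sum_(i < 4) \sum_(j < N.+1) 3 * k * (e i j * b i j) <= 12 * 100 * k * (CE * B * rho * (1 - T)^-1).
 have V0 : 0 <= CE * B * rho by rewrite !mulr_ge0// ltW.
 have k3p : 0 <= 3 * k by rewrite mulr_ge0 ?ler0n.
 apply: (@le_trans _ _ (\sum_(i < 4) 3 * k * (100 * (CE * B * rho) * (1 - T)^-1))); last first.
  rewrite sumr_const card_ord -mulr_natl; set Y := CE * B * rho; set Z := _^-1.
  by apply: le_of_eq; ring.
 apply: ler_sum => i _; rewrite -mulr_sumr ler_wpM2l//.
 apply: (@le_trans _ _ (\sum_(j < N.+1) 100 * (CE * B * rho) * T ^+ j)); last first.
  by rewrite -mulr_sumr ler_wpM2l ?geometric_le// mulr_ge0.
 apply: ler_sum => j _; rewrite /e /b; case: ifP => _.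
  have := mulr_ge0 V0 (ltW (Tj j)); rewrite (_ : CE * (B * T ^+ j * rho) * 32 = 32 * (CE * B * rho * T ^+ j)); last by ring.
  by rewrite -[100 * _ * _]mulrA; set Y := _ * T ^+ j; clear; lra.
 rewrite exprMn; apply: le_of_eq; have : (4 : R) ^+ j != 0 by rewrite expf_neq0.
 by set X := (4 : R) ^+ j => X0; field.
(* 12^2 exceeds the 128 of [kernel_far], applied on the outer boundary. *)
pose ka := 12 * `|h| ^+ 2 / r ^+ 3.
have ka0 : 0 <= ka by apply: divr_ge0; [apply: mulr_ge0; [exact: ler0n|exact: sqr_ge0]|apply: exprn_ge0; exact: ltW].
have cg0 := ltW Cg0; have B0' := ltW B0; have rh0 := ltW rho0; have ce0 := ltW CE0.
have Tj0 j := ltW (Tj j); have T40 j := ltW (T4 j); have p1T' := ltW p1T.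
pose eta := B * T ^+ N * rho; pose M := Cg * 16 * (4 * T) ^+ N * rho.
have eta0 : 0 <= eta by apply: mulr_ge0 => //; exact: mulr_ge0.
have M0 : 0 <= M by apply: mulr_ge0 => //; apply: mulr_ge0 => //; apply: mulr_ge0 => //; exact: ler0n.
have pe c z : c = a - h \/ c = a + h \/ c = a -> `|z - c| <= s -> `|p z - p c| <= eta.
 move=> cc zc; apply: (le_trans (pf z c)).
 have [i ci] : exists i, c = pole a h i.
  by case: cc => [->|[->|->]]; [exists 0%N|exists 1%N|exists 2%N].
 by rewrite ci; apply: small; rewrite -ci.
have bdr z : `|z - a| = r -> `|p z| <= M /\ `|q z| <= M.
 move=> zr; have h1 : `|f z - f a| <= M by apply: big; rewrite zr.
 split; last exact: le_trans h1.
 by have := pf z a; rewrite pa subr0 => h2; exact: le_trans h1.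
have kb z : `|z - a| = r -> kerx a h s z ^+ 2 + kery a h s z ^+ 2 <= ka ^+ 2.
 move=> zr; have sh : s <= `|h|.
  by rewrite /s ler_piMl ?(ltW h0)// invf_le1 ?exprn_gt0// exprn_ege1// ler1n.
 have hz : 4 * `|h| < `|z - a|.
  rewrite zr /r ltr_pM2r//; case: (N) N0 => // n _.
  have : 1 <= (2 : R) ^+ n by rewrite exprn_ege1// ler1n.
  by rewrite !exprS; clear; lra.
 apply: (le_trans (kernel_far s0 sh hz)); rewrite zr /ka.
 rewrite (_ : (12 * `|h| ^+ 2 / r ^+ 3) ^+ 2 = 12 * 12 * `|h| ^+ 4 / r ^+ 6); last by field; rewrite gt_eqF.
 rewrite ler_wpM2r ?invr_ge0 ?exprn_ge0 ?(ltW r0)// ler_wpM2r ?exprn_ge0//.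
 by clear; lra.
have := second_difference_formula s0 Gp Gq shr pe eta0 M0 ka0 bdr kb.
rewrite pa mulr0 subr0.
have -> : 16 * r * M * ka = 12 * (Cg * 16) * (T ^+ N * rho).
 rewrite /M /ka /r (exprS 2 N.+1) (exprS 2 N) [(4 * T) ^+ N]exprMn pow4; have : (2 : R) ^+ N != 0 by rewrite expf_neq0.
 by set X := (2 : R) ^+ N => X0; field; rewrite X0 gt_eqF.
have F1 : 1 <= 8 * atan 1 :> R by apply: le_trans (flux_low R); clear; lra.
have TR0 : 0 <= T ^+ N * rho by exact: mulr_ge0.
have h3 := ler_wpM2r TR0 CgB.
move: (le_trans I1 I2); set I := `|Rintegral _ _ _|; set D := `|p _ + _| => I3 S1.
have D0 : 0 <= D by exact: normr_ge0.
have S2 : D - 4 * eta <= I + 12 * (B * (T ^+ N * rho)).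
 have X0 : 0 <= I + 12 * (B * (T ^+ N * rho)).
  by apply: addr_ge0; [exact: normr_ge0|apply: mulr_ge0; [exact: ler0n|exact: mulr_ge0]].
 have [n|n] := leP (D - 4 * eta) 0; first exact: le_trans X0.
 apply: (@le_trans _ _ (8 * atan 1 * (D - 4 * eta))); first by rewrite ler_peMl// ltW.
 by move: S1 h3; set W := T ^+ N * rho; set Z := atan 1; clear; lra.
have k1r : 0 <= k * (CE * B * rho * (1 - T)^-1).
 apply: mulr_ge0 => //; apply: mulr_ge0; last by rewrite invr_ge0.
 by apply: mulr_ge0 => //; exact: mulr_ge0.
have k2r : 0 <= B * k * rho by apply: mulr_ge0 => //; exact: mulr_ge0.
have k3r : 0 <= CE * B / (1 - T) * (T ^+ N * rho).
 by apply: mulr_ge0 => //; apply: divr_ge0 => //; exact: mulr_ge0.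
have k4r : 0 <= B * (T ^+ N * rho) by exact: mulr_ge0.
have -> : A * k * rho + A * rho * T ^+ N = 13 * 100 * (k * (CE * B * rho * (1 - T)^-1)) + 10 * 100 * (B * k * rho) +
  13 * 100 * (CE * B / (1 - T) * (T ^+ N * rho)) + 10 * 100 * (B * (T ^+ N * rho)) by rewrite AE; ring.
have etE : eta = B * (T ^+ N * rho) by rewrite /eta mulrA.
move: S2 I3 k1r k2r k3r k4r; rewrite etE -[12 * 100 * k * _]mulrA.
set V1 := k * _; set V2 := B * k * rho; set V3 := CE * B / _ * _; set V4 := B * _; clear; lra.
Qed.

Lemma grad2Dc (p px py : P -> R) (m : R) : grad2 p px py -> grad2 (fun z => p z + m) px py.
Proof. by move=> [gx gy gxx gyy]; split => //; [exact: xacDc|exact: (xacDc m gy)]. Qed.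

Lemma grad2Z (p px py : P -> R) (m : R) : grad2 p px py ->
 grad2 (fun z => m * p z) (fun z => m * px z) (fun z => m * py z).
Proof.
move=> [gx gy gxx gyy].
have cm : continuous (cst m : P -> R) by move=> z; exact: cvg_cst.
by split; [exact: xacZ|exact: (xacZ m gy)|exact: locint_sqM cm gxx|exact: locint_sqM cm gyy].
Qed.

(** Coordinate by coordinate: the pairs (u, v) and (v, -u) have the same Cauchy-Riemann defect, of
    squared length 4 ac2. Letting N tend to infinity removes the term in t^N. *)
Lemma second_difference : exists2 k0 : R, 0 < k0 & exists2 A : R, 0 < A &
 forall k f g ux uy vx vy (a h : P), qcpos k f g ux uy vx vy -> 0 < k <= k0 ->
 `|f (a + h) + f (a - h) - 2 *: f a| <= A * k * `|f (a + h) - f a|.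
Proof.
have [k0 k00 [A A0 [t t01 H]]] := second_difference_step.
exists k0 => //; exists A => // k f g ux uy vx vy a h QP k01.
have [->|hn] := eqVneq h 0.
 rewrite !addr0 subr0 subrr normr0 mulr0 (_ : f a + f a - 2 *: f a = 0) ?normr0//.
 by rewrite scaler_nat mulr2n subrr.
have Q := qp_map QP.
set rho := `|f (a + h) - f a|.
have lim (x : R) : (forall N, (0 < N)%N -> x <= A * k * rho + A * rho * t ^+ N) -> x <= A * k * rho.
 move=> le; apply/ler_addgt0Pr => e e0.
 have [N Ne] := geometric_small (A * rho) t01 e0.
 apply: (le_trans (le N.+1 (ltn0Sn N))); rewrite lerD2l; apply: le_trans Ne.
 have /andP[t0 t1] := t01.
 apply: ler_wpM2l; first by apply: mulr_ge0; [exact: ltW|exact: normr_ge0].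
 by rewrite exprS ler_piMl ?exprn_ge0// ltW.
have ae := qp_ae QP.
have Gu := grad2Dc (- (f a).1) (qc_u Q); have Gv := grad2Dc (- (f a).2) (qc_v Q).
rewrite norm_le2 /=; apply/andP; split; apply: lim => N N0.
 rewrite (_ : _ - _ = ((f (a + h)).1 - (f a).1) + ((f (a - h)).1 - (f a).1)); last by rewrite /GRing.scale /=; ring.
 apply: (H k f g ux uy vx vy a h N _ _ _ _ _ _ QP k01 hn N0 Gu Gv).
 - by move=> z z' /=; rewrite opprB addrA subrK; exact: norm1_le (f z - f z').
 - by move=> z /=; exact: norm2_le (f z - f a).
 - by rewrite /= subrr.
 - apply: aeS ae => z; rewrite /ac2; set G := cf2 _ _ _ _ => h1.
  by move: h1; set x := ux z; set y := uy z; set u := vx z; set v := vy z; clear; lra.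
rewrite (_ : _ - _ = ((f (a + h)).2 - (f a).2) + ((f (a - h)).2 - (f a).2)); last by rewrite /GRing.scale /=; ring.
apply: (H k f g ux uy vx vy a h N _ _ _ _ _ _ QP k01 hn N0 Gv (grad2Z (-1) Gu)).
- by move=> z z' /=; rewrite opprB addrA subrK; exact: norm2_le (f z - f z').
- by move=> z /=; rewrite mulN1r normrN; exact: norm1_le (f z - f a).
- by rewrite /= subrr.
- apply: aeS ae => z; rewrite /ac2; set G := cf2 _ _ _ _ => h1.
 by move: h1; set x := ux z; set y := uy z; set u := vx z; set v := vy z; clear; lra.
Qed.

End second_difference_bound.

(** * Masses on the binary tree *)

Section dyadic_mass.
Variable R : realType.

(** Write al = S (1 + x) / 2 and be = S (1 + y) / 2. The first order terms add up to - t (x + y),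
    nonpositive because S <= al + be. The second order terms cost at most a factor exp(10 eta^2),
    which 2^(1 + t - 2 s) pays for. *)
Lemma power_sum_le (S al be eta s t l : R) : 0 < S -> 0 < l -> 0 < t <= 1 -> 0 <= eta <= 1 / 4 ->
 `|2 * al - S| <= eta * S -> `|2 * be - S| <= eta * S -> S <= al + be ->
 (1 + t - 2 * s) * ln 2 + 10 * eta ^+ 2 <= 0 ->
 al `^ (- t) * (l / 2) `^ (2 * s) + be `^ (- t) * (l / 2) `^ (2 * s) <= S `^ (- t) * l `^ (2 * s).
Proof.
move=> S0 l0 /andP[t0 t1] /andP[e0 e1] Ha Hb Hab ex.
have pE (x y : R) : 0 < x -> x `^ y = expR (y * ln x) by move=> x0; rewrite /powR gt_eqF.
have one (a : R) : `|2 * a - S| <= eta * S -> 0 < a /\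
  a `^ (- t) <= expR (- t * ln S + t * ln 2) * (1 - t * ((2 * a - S) / S) + 10 * eta ^+ 2).
 move=> Ha'; pose x := (2 * a - S) / S.
 have xe : `|x| <= eta by rewrite normrM normfV (gtr0_norm S0) ler_pdivrMr.
 have [x1 x2] : - (1 / 4) <= x /\ x <= 1 / 4.
  by move: xe; rewrite ler_norml => /andP[h1 h2]; split; move: h1 h2 e1; clear; lra.
 have aE : a = S / 2 * (1 + x) by rewrite /x; field; rewrite gt_eqF.
 have y0 : 0 < 1 + x by move: x1; clear; lra.
 have a0 : 0 < a by rewrite aE mulr_gt0// divr_gt0.
 split=> //; rewrite pE// -/x.
 have x2e : x ^+ 2 <= eta ^+ 2 by rewrite -(real_normK (num_real x)) ler_sqr ?nnegrE.
 have lx : x - 2 * x ^+ 2 <= ln (1 + x).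
  apply: le_trans (ln_ge y0); rewrite -subr_ge0.
  rewrite (_ : _ - _ = x ^+ 2 * (1 + 2 * x) / (1 + x)); last by field; rewrite gt_eqF.
  by apply: divr_ge0; [apply: mulr_ge0; [exact: sqr_ge0|move: x1; clear; lra]|exact: ltW].
 pose u := - t * (x - 2 * x ^+ 2).
 have ux : `|u| <= 2 * `|x|.
  rewrite /u normrM normrN (gtr0_norm t0).
  have h : `|x - 2 * x ^+ 2| <= 2 * `|x|.
   rewrite (_ : x - 2 * x ^+ 2 = x * (1 - 2 * x)); last by ring.
   by rewrite normrM mulrC ler_wpM2r// ler_norml; apply/andP; split; move: x1 x2; clear; lra.
  by apply: (le_trans _ h); rewrite ler_piMl.
 have u1 : u <= 1 / 2 by apply: (le_trans (ler_norm _)); apply: (le_trans ux); move: xe e1; clear; lra.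
 have eu : expR u <= 1 + u + 2 * u ^+ 2.
  have q0 : 0 < 1 - u by move: u1; clear; lra.
  have h1 : 1 - u <= expR (- u) by exact: expR_ge1Dx.
  have h2 : (1 + u + 2 * u ^+ 2) * (1 - u) >= 1.
   rewrite -subr_ge0 (_ : _ - 1 = u ^+ 2 * (1 - 2 * u)); last by ring.
   by rewrite mulr_ge0 ?sqr_ge0//; move: u1; clear; lra.
  have h3 : 0 < 1 + u + 2 * u ^+ 2.
   by rewrite -(pmulr_lgt0 _ q0); apply: lt_le_trans h2.
  rewrite -[u in leLHS]opprK expRN invf_ple ?posrE ?expR_gt0//.
  apply: le_trans h1; rewrite invf_ple ?posrE//.
  by rewrite -[leLHS]mul1r ler_pdivrMr.
 have u2 : u ^+ 2 <= 4 * eta ^+ 2.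
  rewrite -(real_normK (num_real u)); apply: (@le_trans _ _ ((2 * `|x|) ^+ 2)); first by rewrite ler_sqr ?nnegrE ?mulr_ge0.
  by rewrite exprMn (real_normK (num_real x)); move: x2e; clear; lra.
 have fin : expR u <= 1 - t * x + 10 * eta ^+ 2.
  apply: (le_trans eu); rewrite {1}/u; have tx : t * x ^+ 2 <= eta ^+ 2.
   by apply: le_trans x2e; rewrite ler_piMl ?sqr_ge0.
  by move: tx u2; set y := x ^+ 2; clear; lra.
 rewrite aE lnM ?posrE ?divr_gt0// lnM ?posrE ?invr_gt0// lnV ?posrE//.
 apply: le_trans (ler_wpM2l (expR_ge0 _) fin); rewrite -expRD ler_expR /u.
 have := ler_wpM2l (ltW t0) lx; clear; lra.
have [al0 h1] := one al Ha; have [be0 h2] := one be Hb.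
set L := (l / 2) `^ (2 * s); have L0 : 0 <= L by exact: powR_ge0.
rewrite -mulrDl; apply: (@le_trans _ _ (expR (- t * ln S + t * ln 2) * (2 * expR (10 * eta ^+ 2)) * L)).
 rewrite ler_wpM2r//; apply: (le_trans (lerD h1 h2)); rewrite -mulrDr ler_wpM2l ?expR_ge0//.
 have x12 : 0 <= (2 * al - S) / S + (2 * be - S) / S.
  by rewrite -mulrDl divr_ge0 ?(ltW S0)//; move: Hab; clear; lra.
 have := expR_ge1Dx (10 * eta ^+ 2); have := mulr_ge0 (ltW t0) x12; clear; lra.
rewrite /L !pE ?divr_gt0// lnM ?posrE ?invr_gt0// lnV ?posrE//.
have -> : (2 : R) * expR (10 * eta ^+ 2) = expR (ln 2 + 10 * eta ^+ 2) by rewrite expRD lnK ?posrE.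
by rewrite -!expRD ler_expR; move: ex; clear; lra.
Qed.

Variables (G : nat -> Prop) (m0 : nat).
Hypothesis m0_gt0 : (0 < m0)%N.

(** With the numbering of a heap, i %/ 2^k is the k-th ancestor of i, so this looks for a member of
    G among i and its ancestors down to the number m0. *)
Definition hit (i : nat) := exists k, (m0 <= i %/ 2 ^ k)%N /\ G (i %/ 2 ^ k).
Definition top_node (i : nat) := [/\ (m0 <= i)%N, G i & ~ hit i./2].

Lemma hitE i : hit i <-> ((m0 <= i)%N /\ G i) \/ hit i./2.
Proof.
split=> [[[|k]]|[|[k]]].
- by rewrite divn1; left.
- by rewrite expnS divnMA divn2; right; exists k.
- by exists 0%N; rewrite divn1.
- by exists k.+1; rewrite expnS divnMA divn2.
Qed.

Lemma hit_top i : hit i -> exists k, top_node (i %/ 2 ^ k).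
Proof.
elim/ltn_ind: i => i IH hi; have [h|nh] := pselect (hit i./2).
 have i0 : (0 < i)%N.
  by case: h => k [mk _]; case: i mk {IH hi} => // ; rewrite div0n leqNgt m0_gt0.
 have [|k tk] := IH i./2 _ h; first by rewrite -divn2 ltn_Pdiv.
 by exists k.+1; rewrite expnS divnMA divn2.
by exists 0%N; rewrite divn1; move: hi => /hitE[[mi gi]|//]; split.
Qed.

(** The frontier from q to 2 q - 1 gives up its first node q and receives the two children of q. *)
Lemma frontier_step (F : nat -> R) (q : nat) :
 \sum_(q <= i < q.*2) F i + F q.*2 + F q.*2.+1 = F q + \sum_(q.+1 <= i < q.+1.*2) F i.
Proof.
have l1 : (q <= q.*2)%N by lia. have l2 : (q <= q.*2.+1)%N by lia.
have l3 : (q < q.*2.+2)%N by lia.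
by rewrite doubleS -(big_ltn l3) big_nat_recr// big_nat_recr.
Qed.

(** The frontier advances one node at a time. The mass of the top nodes already passed, plus that of
    the frontier nodes with no hit strictly above them, never increases, as a node passes on at most
    its own mass. *)
Lemma top_mass (Phi : nat -> R) (m : nat) : (forall i, 0 <= Phi i) ->
 (forall i, (m0 <= i)%N -> Phi i.*2 + Phi i.*2.+1 <= Phi i) ->
 \sum_(i < m) (if `[< top_node i >] then Phi i else 0) <= \sum_(m0 <= i < m0.*2) Phi i.
Proof.
move=> P0 Ps; set K := leRHS.
have main n : \sum_(m0 <= i < m0 + n) (if `[< top_node i >] then Phi i else 0) +
  \sum_(m0 + n <= i < (m0 + n).*2) (if `[< hit i./2 >] then 0 else Phi i) <= K.
 elim: n => [|n IH].
  rewrite addn0 big_geq// add0r; apply: le_of_eq.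
  apply: eq_big_nat => i /andP[i1 i2]; case: asboolP => // -[k [mk _]]; exfalso.
  move: mk; rewrite leqNgt (leq_ltn_trans (leq_div _ _))//.
  by rewrite -divn2 ltn_divLR// muln2.
 apply: le_trans IH; rewrite addnS big_nat_recr ?leq_addr//=.
 set q := (m0 + n)%N; rewrite -addrA lerD2l.
 have q0 : (0 < q)%N by rewrite addn_gt0 m0_gt0.
 have fs := frontier_step (fun i => if `[< hit i./2 >] then 0 else Phi i) q; rewrite /= in fs.
 rewrite uphalf_double doubleK in fs.
 suff : (if `[< top_node q >] then Phi q else 0) + (if `[< hit q >] then 0 else Phi q.*2) + (if `[< hit q >] then 0 else Phi q.*2.+1) <= (if `[< hit q./2 >] then 0 else Phi q).
  move: fs; set W := \sum_(q.+1 <= i < _) _; set V := \sum_(q <= i < _) _.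
  set c1 := (if _ then Phi q else 0); set c2 := (if _ then 0 else Phi q.*2); set c3 := (if _ then 0 else Phi q.*2.+1).
  by set c4 := (if _ then 0 else Phi q); clear; lra.
 have := hitE q => hq; case: (asboolP (top_node q)) => [[mq gq nh]|nt].
  have hq' : hit q by apply/hitE; left.
  by rewrite (asboolT hq') (asboolF nh) !addr0.
 case: (asboolP (hit q./2)) => [h|nh].
  have hq' : hit q by apply/hitE; right.
  by rewrite (asboolT hq') !addr0.
 have nq : ~ hit q by move=> /hitE[[mq gq]|//]; apply: nt; split.
 by rewrite (asboolF nq) add0r; apply: Ps; rewrite leq_addr.
have Z n : 0 <= \sum_(m0 + n <= i < (m0 + n).*2) (if `[< hit i./2 >] then 0 else Phi i).
 by apply: sumr_ge0 => i _; case: ifP.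
have [mm|mm] := leqP m m0.
 rewrite big1; first by apply: sumr_ge0.
 move=> i _; case: asboolP => // -[mi _ _]; exfalso.
 by move: mi; rewrite leqNgt (leq_trans (ltn_ord i)).
rewrite -(big_mkord xpredT (fun i => if `[< top_node i >] then Phi i else 0)).
rewrite (big_cat_nat (n := m0))//=; last exact: ltnW.
rewrite big_nat big1 ?add0r; last first.
 by move=> i /andP[_ im]; case: asboolP => // -[mi _ _]; exfalso; move: mi; rewrite leqNgt im.
apply: le_trans (main (m - m0)%N); rewrite subnKC ?(ltnW mm)// lerDl.
by have := Z (m - m0)%N; rewrite subnKC ?(ltnW mm).
Qed.

End dyadic_mass.

(** * Parametrization of the circle *)

Section half_circle.
Variable R : realType.
Local Notation P := (R * R)%type.

(* The rational parametrization of a half circle by [0, 1), with y = 2 x - 1. *)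
Definition half_arc (b x : R) : P :=
 (b * ((1 - (2 * x - 1) ^+ 2) / (1 + (2 * x - 1) ^+ 2)), b * (2 * (2 * x - 1) / (1 + (2 * x - 1) ^+ 2))).

(** The sign selects the half circle: 1 the right one, -1 its antipodal image. *)
Definition arc_side (b : R) := b = 1 \/ b = -1.

Lemma sup_sq (z : P) : `|z| ^+ 2 <= z.1 ^+ 2 + z.2 ^+ 2 <= 2 * `|z| ^+ 2.
Proof. by have := sqdist_bounds id 0 z; rewrite /sqdist /= !subr0. Qed.

(** Stereographic projection: the squared chord is 4 (y - y')^2 / ((1 + y^2) (1 + y'^2)), with |y|
    and |y'| at most 1. *)
Lemma arc_chord b x x' : arc_side b -> 0 <= x <= 1 -> 0 <= x' <= 1 ->
 `|x - x'| <= `|half_arc b x - half_arc b x'| <= 4 * `|x - x'|.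
Proof.
move=> bb /andP[x0 x1] /andP[y0 y1].
have b2 : b ^+ 2 = 1 by case: bb => ->; rewrite ?sqrrN expr1n.
have pos (t : R) : 0 <= t -> t <= 1 -> 1 <= 1 + (2 * t - 1) ^+ 2 <= 2.
 by move=> t0 t1; have := sqr_ge0 (2 * t - 1); move: t0 t1; clear; nra.
have /andP[p1 p2] := pos x x0 x1; have /andP[q1 q2] := pos x' y0 y1.
have E : (half_arc b x - half_arc b x').1 ^+ 2 + (half_arc b x - half_arc b x').2 ^+ 2 =
  16 * (x - x') ^+ 2 / ((1 + (2 * x - 1) ^+ 2) * (1 + (2 * x' - 1) ^+ 2)).
 rewrite /half_arc /= -!mulrBr !exprMn b2 !mul1r.
 have d1 : 1 + (2 * x - 1) ^+ 2 != 0 by rewrite gt_eqF// (lt_le_trans ltr01).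
 have d2 : 1 + (2 * x' - 1) ^+ 2 != 0 by rewrite gt_eqF// (lt_le_trans ltr01).
 by field; rewrite d1 d2.
have pq0 : 0 < (1 + (2 * x - 1) ^+ 2) * (1 + (2 * x' - 1) ^+ 2) by apply: mulr_gt0; apply: lt_le_trans ltr01 _.
have pq1 : 1 <= (1 + (2 * x - 1) ^+ 2) * (1 + (2 * x' - 1) ^+ 2) by exact: mulr_ege1.
have pq4 : (1 + (2 * x - 1) ^+ 2) * (1 + (2 * x' - 1) ^+ 2) <= 4.
 by rewrite (_ : 4 = 2 * 2); [apply: ler_pM => //; exact: le_trans ler01 _|ring].
have /andP[s1 s2] := sup_sq (half_arc b x - half_arc b x'); rewrite E in s1 s2.
have X0 := sqr_ge0 (x - x').
have lo : 4 * (x - x') ^+ 2 <= 16 * (x - x') ^+ 2 / ((1 + (2 * x - 1) ^+ 2) * (1 + (2 * x' - 1) ^+ 2)).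
 rewrite ler_pdivlMr//; have := ler_wpM2l X0 pq4; clear; lra.
have hi : 16 * (x - x') ^+ 2 / ((1 + (2 * x - 1) ^+ 2) * (1 + (2 * x' - 1) ^+ 2)) <= 16 * (x - x') ^+ 2.
 rewrite ler_pdivrMr//; have := ler_wpM2l X0 pq1; clear; lra.
apply/andP; split.
 rewrite -ler_sqr ?nnegrE// (real_normK (num_real _)); move: lo s2 X0; clear; lra.
rewrite -ler_sqr ?nnegrE ?mulr_ge0// exprMn (real_normK (num_real (x - x'))); move: hi s1; clear; lra.
Qed.

(** The curvature of the circle moves the midpoint of an arc off that of its chord by the square of
    the length only, which is negligible against the chord at small scales. *)
Lemma arc_midpoint b x k : arc_side b -> 0 <= x - k -> x + k <= 1 -> 0 <= k ->
 `|half_arc b (x + k) + half_arc b (x - k) - 2 *: half_arc b x| <= 64 * k ^+ 2.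
Proof.
move=> bb; set y := 2 * x - 1; set h := 2 * k => x0 x1 k0.
have e1 : 2 * (x + k) - 1 = y + h by rewrite /y /h; ring.
have e2 : 2 * (x - k) - 1 = y - h by rewrite /y /h; ring.
have -> : 64 * k ^+ 2 = 16 * h ^+ 2 by rewrite /h; ring.
have y1 : -1 <= y /\ y <= 1 by rewrite /y; split; move: x0 x1 k0; clear; lra.
have h1 : 0 <= h /\ h <= 1 by rewrite /h; split; move: x0 x1 k0; clear; lra.
have nb (t : R) : `|b * t| = `|t| by rewrite normrM; case: bb => ->; rewrite ?normrN1 ?normr1 mul1r.
move: y1 h1 => [y1 y2] [h0 h1].
have A0 (t : R) : 1 <= 1 + t ^+ 2 by rewrite lerDl sqr_ge0.
have An (t : R) : 1 + t ^+ 2 != 0 by rewrite gt_eqF// (lt_le_trans ltr01).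
have D1 : 1 <= (1 + (y + h) ^+ 2) * (1 + (y - h) ^+ 2) * (1 + y ^+ 2) by rewrite !mulr_ege1.
have D0 : 0 < (1 + (y + h) ^+ 2) * (1 + (y - h) ^+ 2) * (1 + y ^+ 2) by exact: lt_le_trans D1.
have bnd (n : R) : `|n| <= 16 -> `|h ^+ 2 * n / ((1 + (y + h) ^+ 2) * (1 + (y - h) ^+ 2) * (1 + y ^+ 2))| <= 16 * h ^+ 2.
 move=> n16; rewrite normrM normfV (gtr0_norm D0) ler_pdivrMr// normrM (ger0_norm (sqr_ge0 h)).
 rewrite [h ^+ 2 * _]mulrC; apply: (@le_trans _ _ (16 * h ^+ 2 * 1)).
  by rewrite mulr1 ler_wpM2r ?sqr_ge0.
 by rewrite ler_wpM2l// mulr_ge0 ?sqr_ge0.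
have y2' : 0 <= y ^+ 2 /\ y ^+ 2 <= 1 by split; [exact: sqr_ge0|rewrite -(expr1n R 2) -(real_normK (num_real y)) ler_sqr ?nnegrE// ler_norml y1].
have h2' : 0 <= h ^+ 2 /\ h ^+ 2 <= 1 by split; [exact: sqr_ge0|rewrite -(expr1n R 2) ler_sqr ?nnegrE].
move: y2' h2' => [ya yb] [ha hb].
rewrite norm_le2 /half_arc /= e1 e2 -/y /GRing.scale /=; apply/andP; split.
 rewrite (_ : _ - _ = b * (h ^+ 2 * (4 * (3 * y ^+ 2 - 1 - h ^+ 2)) / ((1 + (y + h) ^+ 2) * (1 + (y - h) ^+ 2) * (1 + y ^+ 2)))); last first.
  by field; rewrite !An.
 by rewrite nb; apply: bnd; rewrite ler_norml; apply/andP; split; move: ya yb ha hb; clear; lra.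
rewrite (_ : _ - _ = b * (h ^+ 2 * (4 * y * (y ^+ 2 - 3 - h ^+ 2)) / ((1 + (y + h) ^+ 2) * (1 + (y - h) ^+ 2) * (1 + y ^+ 2)))); last first.
 by field; rewrite !An.
rewrite nb; apply: bnd; rewrite -mulrA normrM (_ : 16 = 4 * 4 :> R); last by ring.
rewrite ger0_norm// ler_wpM2l// normrM (_ : 4 = 1 * 4 :> R); last by ring.
apply: ler_pM => //; first by rewrite ler_norml y1.
by rewrite ler_norml; apply/andP; split; move: ya yb ha hb; clear; lra.
Qed.

(** The inverse parameter is y = q2 / (1 + q1) on the right half, taken to contain (0, -1) but not
    (0, 1); the remaining points are antipodal to this half. *)
Lemma arc_cover (p : P) : p.1 ^+ 2 + p.2 ^+ 2 = 1 ->
 exists b x, [/\ arc_side b, 0 <= x < 1 & p = half_arc b x].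
Proof.
suff H (q : P) : q.1 ^+ 2 + q.2 ^+ 2 = 1 -> 0 <= q.1 -> q.2 < 1 -> exists2 x, 0 <= x < 1 & q = half_arc 1 x.
 move=> e; have [[p1 p2]|n] := pselect (0 <= p.1 /\ p.2 < 1).
  by have [x x01 ->] := H p e p1 p2; exists 1, x; split => //; left.
 have e' : (- p).1 ^+ 2 + (- p).2 ^+ 2 = 1 by rewrite /= !sqrrN.
 have [||x x01 px] := H (- p) e'.
 - rewrite /= oppr_ge0 leNgt; apply/negP => p1; apply: n; split; first exact: ltW.
  by rewrite ltNge; apply/negP => p2; move: e p1 p2; clear; nra.
 - rewrite /= ltrNl ltNge; apply/negP => p2; apply: n.
  have q1 : p.1 ^+ 2 = 0 by have := sqr_ge0 p.1; move: e p2; clear; nra.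
  by split; [move/eqP: q1; rewrite sqrf_eq0 => /eqP ->|move: p2; clear; lra].
 exists (-1), x; split => //; first by right.
 by rewrite -[p]opprK px /half_arc; apply: pair_ext => /=; ring.
move=> e q1 q2; pose y := q.2 / (1 + q.1).
have d0 : 0 < 1 + q.1 by rewrite ltr_wpDr.
have y2 : y < 1 by rewrite ltr_pdivrMr// mul1r; move: q1 q2; clear; lra.
have y1 : -1 <= y.
 by rewrite ler_pdivlMr// mulN1r; have := sqr_ge0 q.1; move: e q1; clear; nra.
exists ((y + 1) / 2); first by apply/andP; split; move: y1 y2; clear; lra.
have y2e : 1 + y ^+ 2 = 2 / (1 + q.1).
 rewrite /y; have q22 : q.2 ^+ 2 = (1 - q.1) * (1 + q.1) by move: e; clear; lra.
 by rewrite expr_div_n q22; field; rewrite gt_eqF.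
have yE : 2 * ((y + 1) / 2) - 1 = y by field.
rewrite /half_arc yE y2e (_ : 1 - y ^+ 2 = 2 - (1 + y ^+ 2)); last by ring.
rewrite y2e /y [LHS]surjective_pairing; apply: pair_ext => /=; field; rewrite gt_eqF//.
Qed.

End half_circle.

(** * Image chords of dyadic arcs and the transfer of covers *)

Section dyadic_arcs.
Variable R : realType.
Local Notation P := (R * R)%type.

(* Dyadic subintervals of [0, 1) are numbered as the nodes of a binary heap with root 1. *)
Definition len (i : nat) : R := (2 ^+ trunc_log 2 i)^-1.
Definition lft (i : nat) : R := i%:R * len i - 1.

Lemma len_gt0 i : 0 < len i.
Proof. by rewrite invr_gt0 exprn_gt0. Qed.

Lemma len_half i : (1 < i)%N -> len i = len i./2 / 2.
Proof. by move=> i1; rewrite /len trunc_log2S// exprSr invfM. Qed.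

Lemma children i : (0 < i)%N ->
 [/\ len i.*2 = len i / 2, len i.*2.+1 = len i / 2, lft i.*2 = lft i & lft i.*2.+1 = lft i + len i / 2].
Proof.
move=> i0; have e1 : len i.*2 = len i / 2 by rewrite len_half ?doubleK//; lia.
have e2 : len i.*2.+1 = len i / 2 by rewrite len_half /= ?uphalf_double//; lia.
by split => //; rewrite /lft ?e1 ?e2 -?natr1 -muln2 natrM; field.
Qed.

Lemma lft_range i : (0 < i)%N -> 0 <= lft i /\ lft i + len i <= 1.
Proof.
move=> i0; have /andP[h1 h2] := trunc_log_bounds (isT : 1 < 2)%N i0.
have p0 : 0 < (2 : R) ^+ trunc_log 2 i by rewrite exprn_gt0.
rewrite /lft /len; split; first by rewrite subr_ge0 ler_pdivlMr// mul1r -natrX ler_nat.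
have h3 : i%:R + 1 <= 2 * 2 ^+ trunc_log 2 i :> R by rewrite natr1 -natrX -natrM ler_nat -expnS.
rewrite (_ : _ + _ = (i%:R + 1) / 2 ^+ trunc_log 2 i - 1); last by field; rewrite gt_eqF.
by rewrite lerBlDr ler_pdivrMr//; move: h3; lra.
Qed.

Fixpoint node_at (x : R) (n : nat) : nat :=
 if n is n'.+1 then let i := node_at x n' in
  if x < lft i + len i / 2 then i.*2 else i.*2.+1
 else 1%N.

Lemma node_atP x n : 0 <= x < 1 -> [/\ (2 ^ n <= node_at x n < 2 ^ n.+1)%N, len (node_at x n) = (2 ^+ n)^-1,
 lft (node_at x n) <= x & x < lft (node_at x n) + len (node_at x n)].
Proof.
move=> /andP[x0 x1]; elim: n => [|n [/andP[i1 i2] il l1 l2]] /=.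
 by split => //; rewrite /lft /len /trunc_log /= ?expr0 invr1; lra.
have i0 : (0 < node_at x n)%N by rewrite (leq_trans _ i1)// expn_gt0.
have [c1 c2 c3 c4] := children i0.
have e : (2 ^+ n)^-1 / 2 = (2 ^+ n.+1)^-1 :> R by rewrite exprSr invfM.
case: ltP => h; rewrite ?c1 ?c2 ?c3 ?c4 il e; split => //.
- by rewrite !expnS in i2 *; lia.
- by rewrite -e -il.
- by rewrite !expnS in i2 *; lia.
- by rewrite -e -il.
- by move: l2; rewrite il -e; lra.
Qed.

Lemma node_at_half x n : (node_at x n.+1)./2 = node_at x n.
Proof. by rewrite /=; case: ifP => _; rewrite /= ?doubleK ?uphalf_double. Qed.

Lemma eighth_lt (x y : R) : x <= y / 8 -> 0 < y -> 4 * x < y.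
Proof. by lra. Qed.

Lemma positive_minimum (g : nat -> R) m : (forall i, (0 < i)%N -> 0 < g i) ->
 exists2 q, 0 < q & forall i, (0 < i < m)%N -> q <= g i.
Proof.
move=> g0; elim: m => [|m [q q0 H]]; first by exists 1 => // i; rewrite ltn0 andbF.
case: m H => [|m] H; first by exists 1 => // i /andP[]; case: i.
exists (Num.min q (g m.+1)); first by rewrite lt_min q0 g0.
move=> i /andP[i0]; rewrite ltnS leq_eqVlt => /orP[/eqP ->|im]; first by rewrite ge_min lexx orbT.
by rewrite ge_min H// i0.
Qed.

Let slack_dist (u v y y' : R) : u - 4 * v <= y <= u + 5 * v -> u - 4 * v <= y' <= u + 5 * v -> `|y - y'| <= 9 * v.
Proof. by rewrite ler_norml => /andP[a b] /andP[c d]; apply/andP; split; lra. Qed.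

Variables (f : P -> P) (C Ch th de eta s t b : R).
Hypotheses (fi : injective f) (cf : continuous f) (C1 : 1 <= C) (th01 : 0 < th < 1) (de0 : 0 < de).
Hypotheses (Hqs : forall x y z : P, `|x - y| <= `|z - y| -> `|f x - f y| <= C * `|f z - f y|).
Hypotheses (Hho : forall (x z c : P) (n : nat), 2 ^+ n * `|x - c| <= `|z - c| -> `|f x - f c| ^+ 2 <= Ch * th ^+ n * `|f z - f c| ^+ 2).
Hypotheses (Hsd : forall a h : P, `|f (a + h) + f (a - h) - 2 *: f a| <= de * `|f (a + h) - f a|).
Hypotheses (etaE : eta = 3 * de * C) (eta4 : eta <= 1 / 4) (bb : arc_side b).
Hypotheses (t01 : 0 < t <= 1) (s0 : 0 < s) (st : (1 + t - 2 * s) * ln 2 + 10 * eta ^+ 2 <= 0).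

Let F (x : R) := f (half_arc b x).
Let g (i : nat) := `|F (lft i + len i) - F (lft i)|.

Lemma node_gt0 i : (0 < i)%N -> 0 < g i.
Proof.
move=> i0; have [l0 l1] := lft_range i0; have p := len_gt0 i.
rewrite normr_gt0 subr_eq0; apply/negP => /eqP/fi e.
have r1 : 0 <= lft i + len i <= 1 by apply/andP; split; move: l0 l1 p; lra.
have r2 : 0 <= lft i <= 1 by apply/andP; split; move: l0 l1 p; lra.
have /andP[+ _] := arc_chord bb r1 r2; rewrite e (subrr (half_arc b (lft i))) normr0 addrAC subrr add0r gtr0_norm//.
by rewrite leNgt p.
Qed.

Let splits_below (l0 : R) := forall i, (0 < i)%N -> len i <= l0 ->
 [/\ `|2 * g i.*2 - g i| <= eta * g i, `|2 * g i.*2.+1 - g i| <= eta * g i & g i <= g i.*2 + g i.*2.+1].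

(** [Hsd] controls the image of the chord midpoint c, not that of the arc midpoint m. Since |m - c|
    is quadratic in [len], hole filling makes |f m - f c| at most [de] times |f Q - f c| for short
    arcs. Quasisymmetry turns this into a multiple of the whole image chord, at the cost of C. *)
Lemma node_split : exists2 l0 : R, 0 < l0 & splits_below l0.
Proof.
have th1 : 0 <= th < 1 by have /andP[h1 h2] := th01; rewrite (ltW h1).
have [N HN] := @geometric_small _ th Ch (de ^+ 2) th1 (exprn_gt0 2 de0).
have p2 : 0 < (2 : R) ^+ N by rewrite exprn_gt0.
(* For shorter arcs 2^N * 8 len^2 <= len / 2, which leaves room for N doublings between m and the
   ends of the chord. *)
exists (16 * 2 ^+ N)^-1; first by rewrite invr_gt0 mulr_gt0.
move=> i i0 il; have [l0 l1] := lft_range i0; have p := len_gt0 i.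
have [c1 c2 c3 c4] := children i0.
set l := lft i; set r := l + len i; set m := l + len i / 2.
have g1 : g i.*2 = `|F m - F l| by rewrite /g c1 c3.
have g2 : g i.*2.+1 = `|F r - F m|.
 by rewrite /g c2 c4 /r /m /l; congr (`|F _ - _|); field.
have gi : g i = `|F r - F l| by [].
have key : `|2 *: F m - F l - F r| <= eta * g i.
 pose Q := half_arc b r; pose Pp := half_arc b l; pose c := 2^-1 *: (Pp + Q).
 have cQ : c + (Q - c) = Q by rewrite addrC subrK.
 have cP : c - (Q - c) = Pp.
  by rewrite opprB addrA -scalerDl (_ : 2^-1 + 2^-1 = 1) ?scale1r ?addrK//; field.
 have k0 : 0 <= len i / 2 by move: p; lra.
 have am := @arc_midpoint _ b m (len i / 2) bb.
 have mr : m + len i / 2 = r by rewrite /m /r; field.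
 have ml : m - len i / 2 = l by rewrite /m addrK.
 have r1 : r <= 1 by exact: l1. have l0' : 0 <= l by exact: l0.
 rewrite mr ml in am; have {}am := am l0' r1 k0.
 have mc : `|half_arc b m - c| <= 8 * len i ^+ 2.
  have -> : half_arc b m - c = - (2^-1 *: (half_arc b r + half_arc b l - 2 *: half_arc b m)).
   rewrite scalerBr scalerA mulVf// scale1r opprB /c; congr (_ - _ *: _); exact: addrC.
  rewrite normrN normrZ gtr0_norm ?invr_gt0//; move: am; rewrite exprMn.
  by set X := `|_|; set Y := len i ^+ 2; rewrite exprVn; lra.
 have rl : `|r - l| = len i by rewrite /r addrAC subrr add0r gtr0_norm.
 have chord := @arc_chord _ b r l bb.
 have lr : l <= r by rewrite lerDl ltW.
 have r01 : 0 <= r <= 1 by apply/andP; split; [exact: le_trans lr|].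
 have l01 : 0 <= l <= 1 by apply/andP; split; [|exact: le_trans r1].
 have /andP[ch1 _] := chord r01 l01; rewrite rl -/Q -/Pp in ch1.
 have Qc : `|Q - c| = `|Q - Pp| / 2.
  have -> : Q - c = 2^-1 *: (Q - Pp).
   rewrite /c scalerDr scalerBr opprD addrA addrAC -[X in X - _ - _]scale1r -scalerBl.
   by rewrite (_ : 1 - 2^-1 = 2^-1)//; field.
  by rewrite normrZ gtr0_norm ?invr_gt0// mulrC.
 have far : 2 ^+ N * `|half_arc b m - c| <= `|Q - c|.
  apply: (@le_trans _ _ (2 ^+ N * (8 * len i ^+ 2))); first by rewrite ler_pM2l.
  rewrite Qc; apply: (@le_trans _ _ (len i / 2)); last by move: ch1; lra.
  have : len i * (16 * 2 ^+ N) <= 1 by rewrite -ler_pdivlMr ?mulr_gt0// mul1r.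
  by move=> h; have := ler_wpM2l (ltW p) h; set X := 2 ^+ N; lra.
 have fQc : `|f Q - f c| <= C * g i.
  have h : `|c - Q| <= `|Pp - Q|.
   by rewrite (distrC c) (distrC Pp) Qc ler_pdivrMr// ler_peMr// ler1n.
  by have := Hqs h; rewrite (distrC (f c)) (distrC (f Pp)).
 have fmc : `|F m - f c| <= de * `|f Q - f c|.
  rewrite -ler_sqr ?nnegrE ?mulr_ge0 ?(ltW de0)// exprMn; apply: (le_trans (Hho far)).
  by rewrite ler_wpM2r ?sqr_ge0.
 have sd := Hsd c (Q - c); rewrite cQ cP in sd.
 have -> : 2 *: F m - F l - F r = 2 *: (F m - f c) - (f Q + f Pp - 2 *: f c).
  have -> : F l = f Pp by []. have -> : F r = f Q by [].
  by apply: pair_ext => /=; rewrite /GRing.scale /=; ring.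
 apply: (le_trans (ler_normB _ _)); rewrite normrZ ger0_norm// etaE.
 have := ler_wpM2l (ltW de0) fQc; move: fmc sd; set X := `|f Q - f c|; lra.
rewrite g1 g2 gi; split.
- apply: le_trans key; rewrite (_ : 2 * `|F m - F l| = `|2 *: (F m - F l)|); last by rewrite normrZ ger0_norm.
 apply: (le_trans (ler_dist_dist _ _)); apply: le_of_eq; congr (`|_|).
 by apply: pair_ext => /=; rewrite /GRing.scale /=; ring.
- apply: le_trans key; rewrite (_ : 2 * `|F r - F m| = `|2 *: (F r - F m)|); last by rewrite normrZ ger0_norm.
 rewrite -[leRHS]normrN; apply: (le_trans (ler_dist_dist _ _)); apply: le_of_eq; congr (`|_|).
 by apply: pair_ext => /=; rewrite /GRing.scale /=; ring.
- by rewrite [leRHS]addrC; exact: ler_distD.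
Qed.

Let Phi (i : nat) := g i `^ (- t) * len i `^ (2 * s).

Lemma node_mass l0 i : splits_below l0 ->
 (0 < i)%N -> len i <= l0 -> Phi i.*2 + Phi i.*2.+1 <= Phi i.
Proof.
move=> H i0 il; have [h1 h2 h3] := H i i0 il; have [c1 c2 _ _] := children i0.
rewrite /Phi c1 c2; apply: (@power_sum_le _ (g i) _ _ eta) => //; [exact: node_gt0|exact: len_gt0|].
by rewrite eta4 etaE !mulr_ge0 ?(ltW de0)// (le_trans ler01 C1).
Qed.

(** The interval of the node enlarged by four lengths on both sides, the range that [node_choice]
    can guarantee; these enlargements are nested along the tree. *)
Definition near_node (i : nat) (y : R) := lft i - 4 * len i <= y <= lft i + 5 * len i.

Lemma near_half i y : (1 < i)%N -> near_node i y -> near_node i./2 y.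
Proof.
move=> i1 /andP[y1 y2]; have h0 : (0 < i./2)%N by rewrite half_gt0.
have [c1 c2 c3 c4] := children h0; have p := len_gt0 i./2.
have [e|e] : i = i./2.*2 \/ i = i./2.*2.+1.
 by have := odd_double_half i; case: (odd i) => h; [right|left]; rewrite -[LHS]h.
- by move: y1 y2; rewrite {1 2 3 4}e c1 c3 => y1 y2; apply/andP; split; move: y1 y2 p; lra.
- by move: y1 y2; rewrite {1 2 3 4}e c2 c4 => y1 y2; apply/andP; split; move: y1 y2 p; lra.
Qed.

Lemma near_ancestor i y k : (0 < i %/ 2 ^ k)%N -> near_node i y -> near_node (i %/ 2 ^ k) y.
Proof.
elim: k => [|k IH]; first by rewrite divn1.
rewrite expnSr divnMA divn2 => h0 /IH H.
have h1 : (1 < i %/ 2 ^ k)%N by move: h0; case: (i %/ 2 ^ k)%N => [|[]].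
by apply: near_half => //; apply: H; exact: ltn_trans h1.
Qed.

(** Past level n0, take the node just before the branch of x first drops below 3 C D. Image chords
    almost halve at each step, whence the bound 9 C D. A point y farther than 4 lengths from x
    would, by quasisymmetry, force the image chord of the node down to 2 C D. *)
Lemma node_choice l0 n0 (x D : R) : splits_below l0 ->
 (2 ^+ n0)^-1 <= l0 -> 0 <= x < 1 -> 0 < D ->
 (forall i, (0 < i < 2 ^ n0.+1)%N -> 3 * C * D <= g i) ->
 exists i, [/\ (2 ^ n0 <= i)%N, g i <= 9 * C * D &
  forall y, 0 <= y < 1 -> `|F y - F x| <= D -> near_node i y].
Proof.
move=> HS hn0 x01 D0 gD; have C0 : 0 < C by exact: lt_le_trans C1.
have CD0 : 0 < C * D by rewrite mulr_gt0.
have /andP[x0 x1] := x01.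
have ends n : [/\ (0 < node_at x n)%N, 0 <= lft (node_at x n) <= 1, 0 <= lft (node_at x n) + len (node_at x n) <= 1 &
  `|lft (node_at x n) - x| <= len (node_at x n) /\ `|lft (node_at x n) + len (node_at x n) - x| <= len (node_at x n)].
 have [/andP[i1 _] il l1 l2] := node_atP n x01; set i := node_at x n in i1 il l1 l2 *.
 have i0 : (0 < i)%N by rewrite (leq_trans _ i1)// expn_gt0.
 have [r1 r2] := lft_range i0; have p := len_gt0 i.
 split => //; [by apply/andP; split; move: r1 r2 p; lra|by apply/andP; split; move: r1 r2 p; lra|].
 by split; rewrite ler_norml; apply/andP; split; move: l1 l2 p; lra.
have xx : 0 <= x <= 1 by rewrite x0 ltW.
(* Continuity at the point of parameter x makes the image chords along its branch arbitrarily
   small. *)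
have ne : exists n, g (node_at x (n0 + n).+1) < 3 * C * D.
 have /cvgrPdist_lt/(_ (C * D) CD0) := @cf (half_arc b x).
 move=> /nbhs_ballP[rho rho0 Hr]; have {}rho0 : 0 < rho by [].
 have h12 : 0 <= (1 / 2 : R) < 1 by lra.
 have [N HN] := @geometric_small _ (1 / 2) 1 (rho / 8) h12 (divr_gt0 rho0 (ltr0n R 8)).
 have HN1 : (1 / 2) ^+ N <= rho / 8.
  by rewrite -[leLHS]mul1r.
 exists N; move: (ends (n0 + N).+1) (node_atP (n0 + N).+1 x01).
 move: (node_at x (n0 + N).+1) => i [i0 l01 r01 [lx rx]] [_ il _ _].
 have ir : 4 * len i < rho.
  have : len i <= (1 / 2) ^+ N.
   rewrite il expr_div_n expr1n mul1r lef_pV2 ?posrE ?exprn_gt0//.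
   by rewrite ler_weXn2l ?ler1n//; apply: leqW; exact: leq_addl.
  move=> h.
  have h2 : len i <= rho / 8.
   exact: le_trans h HN1.
  move: rho0.
  exact: eighth_lt h2.
 have cl (y : R) : 0 <= y <= 1 -> `|y - x| <= len i -> `|F x - F y| < C * D.
  move=> y01 yx; apply: Hr; rewrite -ball_normE /= distrC; apply: le_lt_trans ir.
  by have /andP[_ h] := arc_chord bb y01 xx; apply: (le_trans h); rewrite ler_pM2l.
 have := cl _ l01 lx; have := cl _ r01 rx => h1 h2.
 have := ler_distD (F x) (F (lft i + len i)) (F (lft i)); rewrite -/(g i).
 by move: h1 h2; rewrite (distrC (F x) (F (lft i + len i))); move: CD0; lra.
have [n1 nm] : g (node_at x (n0 + ex_minn ne).+1) < 3 * C * D /\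
  forall j, g (node_at x (n0 + j).+1) < 3 * C * D -> (ex_minn ne <= j)%N by case: ex_minnP.
move: (ex_minn ne) n1 nm => n n1 nm.
have [i0 l01 r01 [lx rx]] := ends (n0 + n)%N.
have [/andP[i1 i2] il l1 l2] := node_atP (n0 + n)%N x01.
have hf := node_at_half x (n0 + n).
set i := node_at x (n0 + n) in i0 l01 r01 lx rx i1 i2 il l1 l2 hf *.
have ii : (2 ^ n0 <= i)%N by apply: leq_trans i1; rewrite leq_exp2l// leq_addr.
have il0 : len i <= l0.
 by apply: le_trans hn0; rewrite il lef_pV2 ?posrE ?exprn_gt0// ler_weXn2l ?ler1n// leq_addr.
have gi : 3 * C * D <= g i.
 case: n {n1} nm @i i0 l01 r01 lx rx i1 i2 il l1 l2 hf ii il0 => [|n] nm i i0 l01 r01 lx rx i1 i2 il l1 l2 hf ii il0.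
  by apply: gD; rewrite i0 /=; rewrite addn0 in i2.
 by rewrite leNgt; apply/negP; rewrite /i addnS => /nm; rewrite ltnn.
exists i; split => //.
- have [h1 h2 _] := HS i i0 il0; have g0 := node_gt0 i0.
 have e14 : eta * g i <= 1 / 4 * g i by rewrite ler_pM2r.
 have : node_at x (n0 + n).+1 = i.*2 \/ node_at x (n0 + n).+1 = i.*2.+1.
  by rewrite /= -/i; case: ifP => _; [left|right].
 case=> e; move: n1; rewrite e; move: h1 h2; rewrite !ler_norml => /andP[a1 a2] /andP[a3 a4] a5;
  by move: a1 a3 a5 e14 CD0; rewrite -!mulrA; lra.
- move=> y y01 yD; have yy : 0 <= y <= 1 by case/andP: y01 => -> /ltW ->.
 have nx : `|y - x| <= 4 * len i.
  rewrite leNgt; apply/negP => far.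
  have /andP[ch _] := arc_chord bb yy xx.
  have cl (z : R) : 0 <= z <= 1 -> `|z - x| <= len i -> `|F z - F x| <= C * D.
   move=> z01 zx; apply: (@le_trans _ _ (C * `|F y - F x|)); last by rewrite ler_pM2l.
   apply: Hqs; have /andP[_ h] := arc_chord bb z01 xx; apply: (le_trans h); apply: le_trans ch.
   by apply: le_trans (ltW far); rewrite ler_pM2l.
  have := cl _ l01 lx; have := cl _ r01 rx => h1 h2.
  have := ler_distD (F x) (F (lft i + len i)) (F (lft i)); rewrite -/(g i).
  by move: h1 h2 gi; rewrite (distrC (F x) (F (lft i))); move: CD0; rewrite -!mulrA; lra.
 by move: nx; rewrite ler_norml => /andP[n2 n3]; apply/andP; split; move: n2 n3 l1 l2; lra.
Qed.

Lemma edist_bounds (p q : P) : `|p - q| <= Defs.edist p q <= 2 * `|p - q|.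
Proof.
have /andP[h1 h2] := sup_sq (p - q).
rewrite /Defs.edist; apply/andP; split.
 by rewrite [leLHS](_ : _ = Num.sqrt (`|p - q| ^+ 2)) ?ler_wsqrtr// sqrtr_sqr normr_id.
rewrite -[leRHS]ger0_norm ?mulr_ge0// -sqrtr_sqr ler_wsqrtr//; apply: (le_trans h2).
by rewrite exprMn; have := sqr_ge0 `|p - q|; lra.
Qed.

Lemma ediam_ge (U : set P) r p q : (ediam U <= r%:E)%E -> U p -> U q -> `|p - q| <= r.
Proof.
move=> Ur Up Uq; have /andP[h _] := edist_bounds p q; apply: (le_trans h).
rewrite -lee_fin; apply: le_trans Ur; apply: ereal_sup_ubound; right.
by exists p => //; exists q.
Qed.

Lemma ediam_ge0 (U : set P) : (0 <= ediam U)%E.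
Proof. by apply: ereal_sup_ubound; left. Qed.

Lemma ediam_le (U : set P) r : 0 <= r -> (forall p q, U p -> U q -> `|p - q| <= r) -> (ediam U <= (2 * r)%:E)%E.
Proof.
move=> r0 H; apply: ub_ereal_sup => _ [->|[p Up [q Uq <-]]]; first by rewrite lee_fin mulr_ge0.
by have /andP[_ h] := edist_bounds p q; rewrite lee_fin (le_trans h)// ler_pM2l// H.
Qed.

Lemma diam_pow_le (U : set P) (r q : R) : 0 <= q -> 0 <= r -> (ediam U <= r%:E)%E -> (diam_pow q U <= (r `^ q)%:E)%E.
Proof.
move=> q0 r0; have := ediam_ge0 U; rewrite /diam_pow; case: (ediam U) => [x| |] //; rewrite !lee_fin => x0 xr.
by apply: ge0_ler_powR.
Qed.

Lemma sum_indicator_le (m j : nat) (v : R) : 0 <= v -> \sum_(i < m) (if j == i :> nat then v else 0) <= v.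
Proof.
move=> v0; have [jm|jm] := ltnP j m.
 rewrite (bigD1 (Ordinal jm))//= eqxx big1 ?addr0// => i ij.
 by rewrite ifF//; apply/negbTE; apply: contra ij => /eqP h; apply/eqP/val_inj.
rewrite big1// => i _; rewrite ifF//; apply/negbTE; apply: contraTneq (ltn_ord i) => <-.
by rewrite -leqNgt.
Qed.

(** The arithmetic-geometric mean inequality, as the square of len^s is the product of g^t and
    [Phi]; the weight lam balances the two sums later. *)
Lemma powR_mean (i : nat) (lam : R) : (0 < i)%N -> 0 < lam ->
 len i `^ s <= (lam * g i `^ t + Phi i / lam) / 2.
Proof.
move=> i0 l0; have gi := node_gt0 i0; have p := len_gt0 i.
have e : (len i `^ s) ^+ 2 = g i `^ t * Phi i.
 rewrite /Phi mulrA -powRD; last by rewrite (lt0r_neq0 gi) implybT.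
 rewrite subrr powRr0 mul1r expr2 -powRD; last by rewrite (lt0r_neq0 p) implybT.
 by congr (_ `^ _); ring.
have y0 : 0 <= g i `^ t by exact: powR_ge0.
have z0 : 0 <= Phi i by rewrite mulr_ge0 ?powR_ge0.
rewrite -ler_sqr ?nnegrE ?powR_ge0//; last first.
 by apply: divr_ge0; [apply: addr_ge0; [apply: mulr_ge0 => //; exact: ltW|apply: divr_ge0 => //; exact: ltW]|exact: ler0n].
rewrite e -subr_ge0 (_ : _ - _ = ((lam * g i `^ t - Phi i / lam) / 2) ^+ 2) ?sqr_ge0//.
by field; rewrite gt_eqF.
Qed.

(** A partial sum involves finitely many nodes, so finitely many covering sets account for them and
    the double sum can be exchanged. *)
Lemma finite_reach (A : nat -> nat -> Prop) (m : nat) : exists N : nat,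
 forall i, (i < m)%N -> (exists k, A k i) -> exists2 k, (k < N)%N & A k i.
Proof.
elim: m => [|m [N HN]]; first by exists 0%N.
have [[k Ak]|n] := pselect (exists k, A k m).
 exists (maxn N k.+1) => i; rewrite ltnS leq_eqVlt => /orP[/eqP -> _|im /(HN _ im)[k' k'N]].
  by exists k => //; rewrite leq_max ltnSn orbT.
 by exists k' => //; rewrite leq_max k'N.
by exists N => i; rewrite ltnS leq_eqVlt => /orP[/eqP -> //|im]; exact: HN.
Qed.

(** Each relevant set of the cover of the image is assigned a node, and the new cover consists of
    the enlarged arcs of the maximal assigned nodes. Over these the sum of g^t is controlled by the
    given cover, the sum of [Phi] by [top_mass], and [powR_mean] combines the two. *)
Lemma half_cover (E : set P) (d e : R) : (forall z, E z -> exists2 x, 0 <= x < 1 & z = half_arc b x) ->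
 hausdorff_measure t (f @` E) = 0%E -> 0 < d -> 0 < e ->
 exists W : nat -> set P, [/\ E `<=` \bigcup_i W i, forall i, (ediam (W i) <= d%:E)%E &
  forall m, (\sum_(0 <= i < m) diam_pow s (W i) <= e%:E)%E].
Proof.
move=> EA H0 d0 e0; have [l0 l00 HS] := node_split.
have /andP[t0 t1] := t01; have C0 : 0 < C by exact: lt_le_trans C1.
have h12 : 0 <= (1 / 2 : R) < 1 by lra.
have mn0 : 0 < Num.min l0 (d / 72) by rewrite lt_min l00 divr_gt0.
have [n0] := @geometric_small _ (1 / 2) 1 _ h12 mn0.
rewrite mul1r expr_div_n expr1n mul1r le_min => /andP[n0l n0d].
pose m0 := (2 ^ n0)%N; have m00 : (0 < m0)%N by rewrite expn_gt0.
have lenm i : (m0 <= i)%N -> len i <= (2 ^+ n0)^-1.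
 move=> mi; rewrite lef_pV2 ?posrE ?exprn_gt0// ler_weXn2l ?ler1n//.
 by rewrite -(trunc_expnK n0 (isT : 1 < 2)%N) leq_trunc_log.
have Phi0 i : 0 <= Phi i by rewrite mulr_ge0 ?powR_ge0.
have PhiS i : (m0 <= i)%N -> Phi i.*2 + Phi i.*2.+1 <= Phi i.
 by move=> mi; apply: (node_mass HS); [exact: leq_trans mi|exact: le_trans (lenm i mi) n0l].
set K := \sum_(m0 <= i < m0.*2) Phi i.
have K0 : 0 <= K by exact: sumr_ge0.
have [q q0 Hq] := positive_minimum (2 ^ n0.+1) node_gt0.
(* 72 = 2 * 4 * 9: an enlarged interval has length 9 len, [arc_chord] costs 4 and the passage to
   Euclidean diameters costs 2. *)
pose T := (72 : R) `^ s; have T0 : 0 < T by exact: powR_gt0.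
(* lam makes the part coming from [Phi] at most e / 2; om is the bound on the sum of g^t that makes
   the other part e / 2. *)
pose lam := T * (K + 1) / e; have lam0 : 0 < lam by rewrite divr_gt0// mulr_gt0// ltr_wpDl.
pose om := e / (T * lam); have om0 : 0 < om by rewrite divr_gt0// mulr_gt0.
(* Sets of diameter at most dU have 3 C D below the image chord of every node up to level n0, so the
   chosen nodes lie at level n0 or deeper. *)
pose dU := q / (3 * C); have dU0 : 0 < dU by rewrite divr_gt0// mulr_gt0.
pose Q := (9 * C) `^ t; have Q0 : 0 < Q by rewrite powR_gt0// mulr_gt0.
pose e1 := Num.min (om / (2 * Q)) (dU `^ t).
have e10 : 0 < e1 by rewrite lt_min divr_gt0 ?powR_gt0// mulr_gt0.
have e1Q : Q * (2 * e1) <= om.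
 have : e1 <= om / (2 * Q) by rewrite ge_min lexx.
 by rewrite ler_pdivlMr ?mulr_gt0//; lra.
have pre : (hausdorff_pre t dU (f @` E) < e1%:E)%E.
 apply: (@le_lt_trans _ _ 0%E); last by rewrite lte_fin.
 by rewrite -H0; apply: ereal_sup_ubound; exists dU.
have [_ [U [Uc Ud] <-] Us] := ereal_inf_lt pre.
pose r k := fine (ediam (U k)).
have rE k : ediam (U k) = (r k)%:E.
 rewrite /r fineK// ge0_fin_numE ?ediam_ge0//; apply: le_lt_trans (Ud k) _; exact: ltry.
have r0 k : 0 <= r k by rewrite -lee_fin -rE ediam_ge0.
(* A covering set may have diameter zero. It is treated as having at least this positive size, whose
   t-th powers sum to at most e1. *)
pose ek k := (e1 / 2 ^+ k.+1) `^ t^-1.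
have ek0 k : 0 < ek k by rewrite powR_gt0// divr_gt0// exprn_gt0.
have ekt k : ek k `^ t = e1 / 2 ^+ k.+1.
 by rewrite /ek -powRrM mulVf ?gt_eqF// powRr1// divr_ge0 ?exprn_ge0// ltW.
pose D k := Num.max (r k) (ek k).
have D0 k : 0 < D k by rewrite lt_max ek0 orbT.
have DdU k : D k <= dU.
 rewrite ge_max -lee_fin -rE Ud /=.
 rewrite leNgt; apply/negP => lt; have : dU `^ t < ek k `^ t by apply: gt0_ltr_powR; rewrite ?nnegrE ?ltW.
 rewrite ekt ltNge => /negP; apply; apply: (@le_trans _ _ e1); last by rewrite ge_min lexx orbT.
 by rewrite ler_pdivrMr ?exprn_gt0// ler_peMr ?(ltW e10)// exprn_ege1// ler1n.
have Dt k : D k `^ t <= r k `^ t + e1 / 2 ^+ k.+1.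
 rewrite -ekt /D; case: (leP (r k) (ek k)) => _; [rewrite lerDr|rewrite lerDl]; exact: powR_ge0.
pose good k := exists x, [/\ 0 <= x < 1, E (half_arc b x) & U k (F x)].
have nodeP k : exists i, good k -> [/\ (m0 <= i)%N, g i <= 9 * C * D k &
  forall y, 0 <= y < 1 -> U k (F y) -> near_node i y].
 have [[x [x01 Ex Ux]]|n] := pselect (good k); last by exists 0%N.
 have gD i : (0 < i < 2 ^ n0.+1)%N -> 3 * C * D k <= g i.
  move=> /Hq h; apply: le_trans h; have := DdU k; rewrite /dU ler_pdivlMr ?mulr_gt0//.
  by rewrite mulrC.
 have [i [h1 h2 h3]] := node_choice HS n0l x01 (D0 k) gD.
 exists i => _; split => // y y01 Uy; apply: h3 => //.
 apply: (@le_trans _ _ (r k)); last by rewrite le_max lexx.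
 by apply: (@ediam_ge (U k)) => //; rewrite rE.
have [nd Hnd] := choice nodeP.
pose G i := exists2 k, good k & nd k = i.
(* Indexed by nodes and not by covering sets, so that a node chosen several times counts once; the
   sets at other indices are empty. *)
pose W i := [set z | top_node G m0 i /\ exists y, [/\ 0 <= y < 1, near_node i y & z = half_arc b y]].
have Wd i : (ediam (W i) <= (72 * len i)%:E)%E.
 rewrite (_ : 72 * len i = 2 * (36 * len i)); last by ring.
 apply: ediam_le; first by rewrite mulr_ge0// ltW// len_gt0.
 move=> _ _ [_ [y [y01 yn ->]]] [_ [y' [y01' yn' ->]]].
 have c1 : 0 <= y <= 1 by case/andP: y01 => -> /ltW.
 have c2 : 0 <= y' <= 1 by case/andP: y01' => -> /ltW.
 have /andP[_ h] := arc_chord bb c1 c2; apply: (le_trans h).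
 have : `|y - y'| <= 9 * len i.
  by exact: slack_dist yn yn'.
 by lra.
have W0 i : ~ top_node G m0 i -> W i = set0 by move=> n; apply/seteqP; split => z // [/n].
have top_pos i : top_node G m0 i -> (0 < i)%N by case=> mi _ _; exact: leq_trans mi.
exists W; split.
- move=> z Ez; have [x x01 zx] := EA z Ez.
 have [k _ Uk] := Uc (f z) (ex_intro2 _ _ z Ez erefl).
 have gk : good k by exists x; rewrite -zx; split => //; rewrite /F -zx.
 have [mi _ near] := Hnd k gk.
 have hi : hit G m0 (nd k) by exists 0%N; rewrite divn1; split => //; exists k.
 have [j tj] := hit_top m00 hi.
 exists (nd k %/ 2 ^ j)%N => //; split => //; exists x; split => //.
 apply: near_ancestor; first exact: top_pos tj.
 by apply: near => //; rewrite /F -zx.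
- move=> i; have [ti|ni] := pselect (top_node G m0 i); last first.
  by rewrite W0// (_ : d = 2 * (d / 2)); [apply: ediam_le => //; rewrite divr_ge0// ltW|field].
 apply: (le_trans (Wd i)); rewrite lee_fin; have [mi _ _] := ti.
 have := lenm i mi; move: n0d; rewrite ler_pdivlMr//; lra.
move=> m; pose w (i : nat) := if `[< top_node G m0 i >] then T * len i `^ s else 0.
apply: (@le_trans _ _ (\sum_(0 <= i < m) (w i)%:E)%E).
 apply: lee_sum => i _; rewrite /w; case: asboolP => [ti|ni].
  rewrite /T -powRM//; last exact: ltW (len_gt0 i).
  by apply: diam_pow_le; [exact: ltW|rewrite mulr_ge0// ltW// len_gt0|exact: Wd].
 (* An empty piece has diameter 0, and 0 to the power s is 0 since s differs from 0. *)
 rewrite -(powR0 (lt0r_neq0 s0)); apply: diam_pow_le => //; first exact: ltW.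
 by rewrite W0// -(mulr0 2); apply: ediam_le.
rewrite sumEFin lee_fin big_mkord.
pose top_g (i : nat) := if `[< top_node G m0 i >] then g i `^ t else 0.
pose top_Phi (i : nat) := if `[< top_node G m0 i >] then Phi i else 0.
have sPhi : \sum_(i < m) top_Phi i <= K by exact: top_mass.
have [N HN] := finite_reach (fun k i => good k /\ nd k = i) m.
have sg : \sum_(i < m) top_g i <= om.
 apply: (@le_trans _ _ (\sum_(i < m) \sum_(k < N) (if nd k == i :> nat then (9 * C * D k) `^ t else 0))).
  apply: ler_sum => i _; rewrite /top_g; case: asboolP => [[_ [k' gk' nk'] _]|_]; last first.
   by apply: sumr_ge0 => k _; case: ifP => // _; exact: powR_ge0.
  have [|k kN [gk nk]] := HN i (ltn_ord i); first by exists k'.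
  rewrite (bigD1 (Ordinal kN))//= nk eqxx.
  have [_ gi _] := Hnd k gk; rewrite nk in gi.
  rewrite -[leLHS]addr0; apply: lerD.
   by apply: (ge0_ler_powR (ltW t0)); rewrite ?nnegrE; [exact: normr_ge0|exact: le_trans (normr_ge0 _) gi|exact: gi].
  by apply: sumr_ge0 => j _; case: ifP => // _; exact: powR_ge0.
 rewrite exchange_big /=; apply: (@le_trans _ _ (\sum_(k < N) Q * (r k `^ t + e1 / 2 ^+ k.+1))).
  apply: ler_sum => k _; apply: (le_trans (sum_indicator_le _ _ (powR_ge0 _ _))).
  by rewrite powRM ?mulr_ge0 ?(ltW C0) ?(ltW (D0 k))// ler_wpM2l ?(ltW Q0).
 rewrite -mulr_sumr; apply: le_trans e1Q; rewrite ler_pM2l// mulr2n mulrDl !mul1r big_split /=; apply: lerD.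
  have : (\sum_(0 <= k < N) (r k `^ t)%:E <= e1%:E)%E.
   apply: le_trans (ltW Us).
   rewrite (eq_bigr (fun k => diam_pow t (U k))); last by move=> k _; rewrite /diam_pow rE.
   apply: (nneseries_lim_ge (u_ := fun k => diam_pow t (U k))) => k _ _.
   by rewrite /diam_pow rE lee_fin powR_ge0.
  by rewrite sumEFin lee_fin big_mkord.
 rewrite -mulr_sumr ler_piMr ?(ltW e10)//.
 apply: (@le_trans _ _ (1 / 2 * \sum_(k < N) (1 / 2) ^+ k)).
  rewrite mulr_sumr; apply: ler_sum => k _; rewrite expr_div_n expr1n exprS.
  by apply: le_of_eq; field; rewrite expf_neq0.
 have := @geometric_le _ (1 / 2) N h12; rewrite (_ : (1 - 1 / 2)^-1 = 2 :> R); last by field.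
 by lra.
apply: (@le_trans _ _ (\sum_(i < m) T / 2 * (lam * top_g i + top_Phi i / lam))).
 apply: ler_sum => i _; rewrite /w /top_g /top_Phi; case: asboolP => [ti|_]; last by rewrite mulr0 mul0r addr0 mulr0.
 have h := ler_wpM2l (ltW T0) (powR_mean (top_pos i ti) lam0); apply: (le_trans h).
 by apply: le_of_eq; ring.
rewrite -mulr_sumr big_split /= -mulr_sumr -mulr_suml.
have a1 : lam * \sum_(i < m) top_g i <= lam * om by rewrite ler_pM2l.
have a2 : (\sum_(i < m) top_Phi i) / lam <= K / lam by rewrite ler_pM2r ?invr_gt0.
have T20 : 0 < T / 2 by rewrite divr_gt0.
apply: (@le_trans _ _ (T / 2 * (lam * om + K / lam))); first by rewrite ler_pM2l// lerD.
have -> : T / 2 * (lam * om + K / lam) = e / 2 + e / 2 * (K / (K + 1)).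
 by rewrite /om /lam; field; rewrite !gt_eqF// ?ltr_wpDl// ?mulr_gt0 ?ltr_wpDl.
have : K / (K + 1) <= 1 by rewrite ler_pdivrMr ?ltr_wpDl// mul1r lerDl.
by move=> h; have := ler_wpM2l (ltW (divr_gt0 e0 (ltr0n R 2))) h; lra.
Qed.

End dyadic_arcs.

(** * From the definitions of the statement to the working notions *)

Section translation.
Variable R : realType.
Local Notation P := (R * R)%type.
Local Notation mu2 := (@lbm R \x @lbm R)%E.

Lemma L2loc_box (g : P -> R) : L2loc g -> locint g /\ locint (fun z => g z ^+ 2).
Proof.
move=> Lg; have mg := Lg.1; split; split => //.
- by move=> *; exact: L2loc_integrable.
- exact: measurable_funX.
- by move=> *; exact: L2loc_sq_integrable.
Qed.

Lemma W12loc_grad2 (f fx fy : P -> R) : continuous f -> W12loc_with f fx fy -> grad2 f fx fy.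
Proof.
move=> cf [_ [Lx [Ly [wx wy]]]].
have [bx bxx] := L2loc_box Lx; have [by' byy] := L2loc_box Ly.
split => //; first by apply: xac_weak => //; exact: weak_pd_x bx.1 wx.
apply: xac_weak; last exact: weak_pd_y by'.1 wy.
 by move=> z; apply: (@continuous_comp _ _ _ (@swap R) f); [exact: (cvg_pair cvg_snd cvg_fst)|exact: cf].
exact: locint_swap.
Qed.

Lemma leb2_ae (A : P -> Prop) : {ae @leb2 R, forall z, A z} -> {ae mu2, forall z, A z}.
Proof. by move=> [B [mB B0 AB]]; exists B; split => //; rewrite -leb2E. Qed.

(** With E, F, G the first fundamental form, 16 cf2 ac2 = (E - G)^2 + (2 F)^2. The directions 0 and
    pi/2 control E - G, the directions pi/4 and -pi/4 control F. So the product is at most (9/2)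
    eps^2 (cf2 + ac2)^2, and the smaller part is at most 18 eps^2 times the larger one. *)
Lemma dilatation_le (eps a b c d : R) : 0 < eps < 1 ->
 (forall x y, Num.sqrt ((cos x * a + sin x * b) ^+ 2 + (cos x * c + sin x * d) ^+ 2) <=
   (1 + eps) * Num.sqrt ((cos y * a + sin y * b) ^+ 2 + (cos y * c + sin y * d) ^+ 2)) ->
 ac2 a b c d <= (5 * eps) ^+ 2 * cf2 a b c d \/ cf2 a b c d <= (5 * eps) ^+ 2 * ac2 a b c d.
Proof.
move=> /andP[e0 e1] H; pose S x := (cos x * a + sin x * b) ^+ 2 + (cos x * c + sin x * d) ^+ 2.
have S0 x : 0 <= S x by rewrite addr_ge0 ?sqr_ge0.
have K0 : 0 <= 1 + eps by lra.
have HS x y : S x <= (1 + eps) ^+ 2 * S y.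
 have := H x y; rewrite -/(S x) -/(S y) -ler_sqr ?nnegrE ?mulr_ge0 ?sqrtr_ge0//.
 by rewrite exprMn !sqr_sqrtr.
pose E := a ^+ 2 + c ^+ 2; pose G := b ^+ 2 + d ^+ 2; pose F := a * b + c * d.
have SE : S 0 = E by rewrite /S cos0 sin0 /E; ring.
have SG : S (pi / 2) = G by rewrite /S cos_pihalf sin_pihalf /G; ring.
have [co [si [c1 c2 Sp Sm]]] : exists co si : R, [/\ co ^+ 2 + si ^+ 2 = 1, 2 * (co * si) = 1,
  S (pi / 4) = co ^+ 2 * E + si ^+ 2 * G + 2 * (co * si) * F &
  S (- (pi / 4)) = co ^+ 2 * E + si ^+ 2 * G - 2 * (co * si) * F].
 exists (cos (pi / 4)), (sin (pi / 4)); split; first exact: cos2Dsin2.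
 - have := sin_pihalf R; rewrite (_ : pi / 2 = pi / 4 + pi / 4); last by field.
  by rewrite sinD => h; rewrite -[RHS]h; ring.
 - by rewrite /S /E /G /F; ring.
 - by rewrite /S cosN sinN /E /G /F; ring.
have h1 := HS 0 (pi / 2); have h2 := HS (pi / 2) 0; have h3 := HS (pi / 4) (- (pi / 4)); have h4 := HS (- (pi / 4)) (pi / 4).
rewrite SE SG in h1 h2; rewrite Sp Sm c2 in h3 h4.
have E0 : 0 <= E by rewrite addr_ge0 ?sqr_ge0.
have G0 : 0 <= G by rewrite addr_ge0 ?sqr_ge0.
have KK : (1 + eps) ^+ 2 <= 1 + 3 * eps /\ 1 <= (1 + eps) ^+ 2 by split; move: e0 e1; clear; nra.
move: KK h1 h2 h3 h4; set q := (1 + eps) ^+ 2 => -[q1 q2] h1 h2 h3 h4.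
have W0 : 0 <= co ^+ 2 * E + si ^+ 2 * G by rewrite addr_ge0// mulr_ge0 ?sqr_ge0.
have W1 : co ^+ 2 * E + si ^+ 2 * G <= E + G.
 have p1 := mulr_ge0 (sqr_ge0 si) E0; have p2 := mulr_ge0 (sqr_ge0 co) G0.
 have -> : E + G = (co ^+ 2 + si ^+ 2) * (E + G) by rewrite c1 mul1r.
 by move: p1 p2; set x := co ^+ 2; set y := si ^+ 2; clear; lra.
have lin (x y : R) : 0 <= x -> 0 <= y -> x <= q * y -> x - y <= 3 * eps * y.
 by move=> x0 y0 h; have := ler_wpM2r y0 q1; move: h; clear; lra.
have d1 := lin _ _ E0 G0 h1; have d2 := lin _ _ G0 E0 h2.
have [Fp Fm] : 0 <= co ^+ 2 * E + si ^+ 2 * G + 1 * F /\ 0 <= co ^+ 2 * E + si ^+ 2 * G - 1 * F.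
 by have := S0 (pi / 4); have := S0 (- (pi / 4)); rewrite Sp Sm c2.
have d3 := lin _ _ Fp Fm h3; have d4 := lin _ _ Fm Fp h4.
have T0 : 0 <= E + G by rewrite addr_ge0.
have m1 := mulr_ge0 (ltW e0) E0; have m2 := mulr_ge0 (ltW e0) G0.
have EG : (E - G) ^+ 2 <= (3 * eps * (E + G)) ^+ 2.
 rewrite -(real_normK (num_real (E - G))) ler_sqr ?nnegrE//; last by rewrite !mulr_ge0// ltW.
 by rewrite ler_norml; apply/andP; split; move: d1 d2 m1 m2; clear; lra.
have FF : (2 * F) ^+ 2 <= (3 * eps * (E + G)) ^+ 2.
 have w := ler_wpM2l (ltW e0) W1; have m3 := mulr_ge0 (ltW e0) Fp; have m4 := mulr_ge0 (ltW e0) Fm.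
 rewrite -(real_normK (num_real (2 * F))) ler_sqr ?nnegrE//; last by rewrite !mulr_ge0// ltW.
 move: d3 d4 w W0; rewrite !mul1r; set W := _ + si ^+ 2 * G => d3 d4 w W0.
 have w0 := mulr_ge0 (ltW e0) W0.
 rewrite ler_norml; have [F0|/ltW F0] := leP 0 F; [have := mulr_ge0 (ltW e0) F0|have := mulr_ge0_le0 (ltW e0) F0].
  by move=> eF; apply/andP; split; move: d3 d4 w w0 eF F0; clear; lra.
 by move=> eF; apply/andP; split; move: d3 d4 w w0 eF F0; clear; lra.
have id : 16 * (cf2 a b c d * ac2 a b c d) = (E - G) ^+ 2 + (2 * F) ^+ 2.
 by rewrite /cf2 /ac2 /E /G /F; field.
have sm : E + G = 2 * (cf2 a b c d + ac2 a b c d) by rewrite cf2_ac2_sum /E /G; ring.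
have := cf2_ge0 a b c d; have := ac2_ge0 a b c d; move: id sm EG FF.
move: (cf2 a b c d) (ac2 a b c d) => X Y id sm EG FF Y0 X0.
have key : X * Y <= 9 / 2 * eps ^+ 2 * (X + Y) ^+ 2.
 by move: id EG FF; rewrite sm; set u := (E - G) ^+ 2; set v := (2 * F) ^+ 2; rewrite !exprMn; clear; lra.
have fin (x y : R) : 0 <= y -> y <= x -> x * y <= 9 / 2 * eps ^+ 2 * (x + y) ^+ 2 -> y <= (5 * eps) ^+ 2 * x.
 move=> y0 yx h; have [x0|x0] := ltP 0 x; last first.
  have y00 : y = 0 by apply/eqP; rewrite eq_le y0 (le_trans yx).
  by rewrite y00 mulr_ge0 ?sqr_ge0// (le_trans y0 yx).
 rewrite -(ler_pM2l x0); apply: (le_trans h).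
 have xy : (x + y) ^+ 2 <= (2 * x) ^+ 2 by rewrite ler_sqr ?nnegrE ?addr_ge0 ?mulr_ge0 ?(ltW x0)//; move: yx; clear; lra.
 have e2 := sqr_ge0 eps; have := ler_wpM2l e2 xy; have := mulr_ge0 e2 (sqr_ge0 x).
 by clear; lra.
have [XY|YX] := leP Y X; [left|right]; first exact: fin.
by apply: fin => //; [exact: ltW|rewrite mulrC addrC].
Qed.

Lemma quasiconformal_qcmap (eps : R) (f : P -> P) : 0 < eps < 1 -> quasiconformal (1 + eps) f ->
 exists g ux uy vx vy, qcmap (5 * eps) f g ux uy vx vy.
Proof.
move=> e01 [[g [fK [gK [cf cg]]]] [ux [uy [vx [vy [Wu [Wv ae]]]]]]].
exists g, ux, uy, vx, vy; split => //.
- by apply: W12loc_grad2 => // z; apply: (@continuous_comp _ _ _ f fst); [exact: cf|exact: cvg_fst].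
- by apply: W12loc_grad2 => // z; apply: (@continuous_comp _ _ _ f snd); [exact: cf|exact: cvg_snd].
- by apply: leb2_ae; apply: aeS ae => z Hz; apply: dilatation_le => // x y; exact: Hz.
Qed.

Lemma diam_pow_ge0 (s : R) (U : set P) : (0 <= diam_pow s U)%E.
Proof. by rewrite /diam_pow; case: (ediam U) => // x; rewrite lee_fin powR_ge0. Qed.

Lemma hausdorff_measure_ge0 (s : R) (E : set P) : (0 <= hausdorff_measure s E)%E.
Proof.
apply: (@le_trans _ _ (hausdorff_pre s 1 E)); last by apply: ereal_sup_ubound; exists 1 => //=.
by apply: le_ereal_inf_tmp => _ [U _ <-]; apply: nneseries_ge0 => i _ _; exact: diam_pow_ge0.
Qed.

Lemma hausdorff_measure0_sub (s : R) (A B : set P) : A `<=` B -> hausdorff_measure s B = 0%E -> hausdorff_measure s A = 0%E.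
Proof.
move=> AB B0; apply/eqP; rewrite eq_le; apply/andP; split.
 apply: ub_ereal_sup => _ [d d0 <-].
 apply: (@le_trans _ _ (hausdorff_pre s d B)); last by rewrite -B0; apply: ereal_sup_ubound; exists d.
 by apply: le_ereal_inf_tmp => _ [U [BU Ud] <-]; apply: ereal_inf_lbound; exists U => //; split => // z /AB/BU.
exact: hausdorff_measure_ge0.
Qed.

(** Bounding all partial sums keeps the estimate among finite sums, which makes two covers easy to
    interleave. *)
Definition null_covered (s : R) (A : set P) := forall d e, 0 < d -> 0 < e ->
 exists W : nat -> set P, [/\ A `<=` \bigcup_i W i,
  forall i, (ediam (W i) <= d%:E)%E & forall m, (\sum_(0 <= i < m) diam_pow s (W i) <= e%:E)%E].

(** Even indices carry the cover of A and odd ones that of B, with half of the error each. *)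
Lemma hausdorff_measure0_halves (s : R) (E : set P) (A B : set P) : E `<=` A `|` B ->
 null_covered s A -> null_covered s B ->
 hausdorff_measure s E = 0%E.
Proof.
move=> EAB HA HB; apply/eqP; rewrite eq_le; apply/andP; split; last exact: hausdorff_measure_ge0.
apply: ub_ereal_sup => _ [d /= d0 <-]; apply/lee_addgt0Pr => e e0; rewrite add0e.
have e20 : 0 < e / 2 by rewrite divr_gt0.
have [V [VA Vd Vs]] := HA d (e / 2) d0 e20; have [W [WB Wd Ws]] := HB d (e / 2) d0 e20.
pose U i := if odd i then W i./2 else V i./2.
apply: (@le_trans _ _ (\sum_(0 <= i <oo) diam_pow s (U i))%E).
 apply: ereal_inf_lbound; exists U => //; split; last by move=> i; rewrite /U; case: ifP.
 move=> z /EAB[/VA[i _ iz]|/WB[i _ iz]].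
  by exists i.*2 => //; rewrite /U odd_double doubleK.
 by exists i.*2.+1 => //; rewrite /U /= odd_double uphalf_double.
have U0 i : (0 <= diam_pow s (U i))%E by exact: diam_pow_ge0.
apply: lime_le; first by apply: is_cvg_nneseries => i _ _.
apply: nearW => m; apply: (@le_trans _ _ (\sum_(0 <= i < m.*2) diam_pow s (U i))%E).
 rewrite [leRHS](big_cat_nat (n := m)) ?leq0n//=; last by rewrite -addnn leq_addr.
 by rewrite leeDl//; apply: sume_ge0.
have ES n : (\sum_(0 <= i < n.*2) diam_pow s (U i) = \sum_(0 <= i < n) diam_pow s (V i) + \sum_(0 <= i < n) diam_pow s (W i))%E.
 elim: n => [|n IH]; first by rewrite !big_geq// adde0.
 by rewrite doubleS !big_nat_recr//= IH /U /= odd_double uphalf_double doubleK; rewrite -!addeA; congr (_ + _)%E; rewrite addeCA.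
by rewrite ES (_ : e%:E = (e / 2)%:E + (e / 2)%:E)%E; [exact: leeD|rewrite -EFinD; congr (_%:E); field].
Qed.

End translation.

Theorem mainTheorem10 (R : realType) :
 exists c0 c1 eps0 : R, 0 < c0 /\ 0 < c1 /\ 0 < eps0 /\
  forall eps : R, 0 < eps -> eps < eps0 ->
  forall phi : R * R -> R * R, quasiconformal (1 + eps) phi ->
  forall E : set (R * R), E `<=` @unit_circle R ->
   ((1 - c0 * eps ^+ 2)%:E <= hausdorff_dim E)%E ->
   ((1 - c1 * eps ^+ 2)%:E <= hausdorff_dim (phi @` E))%E.
Proof.
have [k1 k10 H1] := constant_orientation R; have [k2 k20 [C C1 HC]] := weak_quasisymmetry R.
have [k3 k30 [Ch Ch1 [th th01 HH]]] := hole_filling R; have [k4 k40 [A A0 HA]] := second_difference R.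
have C0 : 0 < C by exact: lt_le_trans C1.
(* 15 = 3 * 5: [eta = 3 * de * C], where [de] is A times the dilatation bound 5 eps of
   [quasiconformal_qcmap]. *)
pose B := 15 * A * C; have B0 : 0 < B by rewrite !mulr_gt0.
pose k0 := Num.min (Num.min k1 k2) (Num.min k3 k4).
have k00 : 0 < k0 by rewrite !lt_min k10 k20 k30 k40.
(* With s = 1 - eps^2 / 4, a dimension of E at most s contradicts c0 = 1/8. With t < 1 - c1 eps^2
   one gets 1 + t - 2 s < - 20 B^2 eps^2, and ln 2 >= 1/2 lets this absorb 10 (B eps)^2. The bounds
   on eps keep 5 eps below every threshold and B eps below 1/4. *)
exists (1 / 8), (1 / 2 + 20 * B ^+ 2), (Num.min (1 / 2) (Num.min (k0 / 5) (1 / 4 / B))).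
split; first by lra.
split; first by rewrite ltr_pwDl ?mulr_ge0 ?sqr_ge0//; lra.
split; first by rewrite !lt_min !divr_gt0//; lra.
move=> eps e0; rewrite !lt_min => /andP[e12 /andP[ek eB]] f Qf E EC dE.
have e01 : 0 < eps < 1 by rewrite e0; lra.
have k50 : 0 < 5 * eps by rewrite mulr_gt0.
have [g [ux [uy [vx [vy Q]]]]] := quasiconformal_qcmap e01 Qf.
have kk0 : 5 * eps <= k0 by move: ek; rewrite ltr_pdivlMr//; lra.
move: kk0; rewrite !le_min => /andP[/andP[l1 l2] /andP[l3 l4]].
have k51 : 0 <= 5 * eps <= k1 by rewrite ltW.
have k52 : 0 <= 5 * eps <= k2 by rewrite ltW.
have k53 : 0 <= 5 * eps <= k3 by rewrite ltW.
have k54 : 0 < 5 * eps <= k4 by rewrite k50.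
(* The three properties involve only norms of combinations of values, so a sense-reversing map
   inherits them from its reflection. *)
have [Hqs Hho Hsd] : [/\ forall x y z : R * R, `|x - y| <= `|z - y| -> `|f x - f y| <= C * `|f z - f y|,
  forall (x z c : R * R) n, 2 ^+ n * `|x - c| <= `|z - c| -> `|f x - f c| ^+ 2 <= Ch * th ^+ n * `|f z - f c| ^+ 2 &
  forall a h : R * R, `|f (a + h) + f (a - h) - 2 *: f a| <= A * (5 * eps) * `|f (a + h) - f a|].
 have [QP|QP] := H1 _ _ _ _ _ _ _ Q k51.
  split => [x y z h|x z c n h|a h].
  - exact: HC QP k52 h.
  - exact: HH QP k53 h.
  - exact: HA QP k54.
 have N (z w : R * R) : w = (z.1, - z.2) -> `|w| = `|z|.
  have le (r : R) (p : R * R) : (`|(p.1, - p.2)| <= r) = (`|p| <= r) by rewrite !norm_le2 /= normrN.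
  by move=> ->; apply/eqP; rewrite eq_le le lexx -(le _ z) lexx.
 have Nd x y : `|f x - f y| = `|((f x).1, - (f x).2) - ((f y).1, - (f y).2)|.
  by symmetry; apply: N; apply: pair_ext => /=; ring.
 split => [x y z h|x z c n h|a h]; rewrite !Nd.
 - exact: HC QP k52 h.
 - exact: HH QP k53 h.
 - apply: le_trans (HA _ _ _ _ _ _ _ a h QP k54); apply: le_of_eq; symmetry; apply: N.
  by apply: pair_ext => /=; rewrite /GRing.scale /=; ring.
(* If the conclusion fails, the t-dimensional measure of the image vanishes for some t below 1 - c1
   eps^2; the covers are then pulled back to E at exponent s. *)
rewrite leNgt; apply/negP => /ereal_inf_lt[_ [t [t0 Ht] <-]]; rewrite lte_fin => tl.
pose s := 1 - eps ^+ 2 / 4.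
have e2 : 0 < eps ^+ 2 by rewrite exprn_gt0.
have e21 : eps ^+ 2 <= 1 by rewrite -(expr1n _ 2) ler_sqr ?nnegrE ?(ltW e0)//; move: e12; clear; lra.
have s0 : 0 < s by rewrite /s; move: e2 e21; clear; lra.
have t01 : 0 < t <= 1.
 rewrite t0 /=; apply: (le_trans (ltW tl)); rewrite gerBl; apply: mulr_ge0 (ltW e2).
 by apply: addr_ge0; [exact: divr_ge0|apply: mulr_ge0; [exact: ler0n|exact: sqr_ge0]].
have de0 : 0 < A * (5 * eps) by rewrite mulr_gt0.
have etaE : B * eps = 3 * (A * (5 * eps)) * C by rewrite /B; ring.
have eta4 : B * eps <= 1 / 4 by move: eB; rewrite ltr_pdivlMr// mulrC => /ltW.
have st : (1 + t - 2 * s) * ln 2 + 10 * (B * eps) ^+ 2 <= 0.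
 have ln2 : 1 / 2 <= ln (2 : R) by apply: le_trans (ln_ge _) => //; clear; lra.
 have h1 : 1 + t - 2 * s <= - (20 * B ^+ 2 * eps ^+ 2).
  by rewrite /s; move: tl; set X := B ^+ 2; set Y := eps ^+ 2; clear; lra.
 have X0 : 0 <= 20 * B ^+ 2 * eps ^+ 2 by apply: mulr_ge0; [apply: mulr_ge0; [exact: ler0n|exact: sqr_ge0]|exact: sqr_ge0].
 have h2 : (1 + t - 2 * s) * ln 2 <= - (20 * B ^+ 2 * eps ^+ 2) * ln 2 by rewrite ler_wpM2r// (le_trans _ ln2).
 have h3 := ler_wpM2l X0 ln2.
 by rewrite exprMn; move: h2 h3; set X := B ^+ 2; set Y := eps ^+ 2; clear; lra.
have fi : injective f := can_inj (qc_fK Q); have cf := qc_cf Q.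
pose half b := [set z | E z /\ exists2 x, 0 <= x < 1 & z = half_arc b x].
have cover b : arc_side b -> null_covered s (half b).
 move=> bb d e d0 e0'; apply: (half_cover fi cf C1 th01 de0 Hqs Hho Hsd etaE eta4 bb t01 s0 st _ _ d0 e0').
  by move=> z [].
 by apply: hausdorff_measure0_sub Ht => _ [z [Ez _] <-]; exists z.
have Es : hausdorff_measure s E = 0%E.
 apply: (@hausdorff_measure0_halves _ s E (half 1) (half (-1))); [|by apply: cover; left|by apply: cover; right].
 move=> z Ez; have [b [x [bb x01 zx]]] := arc_cover (EC z Ez).
 by case: bb zx => -> zx; [left|right]; split => //; exists x.
have : (hausdorff_dim E <= s%:E)%E by apply: ereal_inf_lbound; exists s.
by move=> /(le_trans dE); rewrite lee_fin /s; move: e2; clear; lra.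
Qed.
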